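(* Let $\mathcal{W}_0=\mathbf{R}^d$, $\mathcal{W}=\mathcal{W}_0^{\mathbf{Z}_-}$ with $\mathbf{Z}_-=\{\dots,-1,0\}$. Let $\Phi\in\mathcal{C}^2(\mathbf{R}^n\times\mathbf{R}^d;\mathbf{R}^n)$ be such that the derivatives $D_w\Phi$, $D_wD_x\Phi$ and $D_w^2\Phi$ all belong to $\mathcal{C}^{0,\Gamma}(\mathbf{R}^n\times\mathbf{R}^d)$, the matrix $M^\Phi(x,w)$ is invertible for Lebesgue-almost every $(x,w)$, and $(\det M^\Phi)^{-1}$ belongs to $\mathcal{C}^{0,\Gamma}(\mathbf{R}^n\times\mathbf{R}^d)$. Let $\mathbf{P}$ be a centred Gaussian probability measure on $\mathcal{W}$ such that there exist finite Borel measures $\mu_1,\dots,\mu_d$ on $[-\pi,\pi]$, without atoms, with $$\int_{\mathcal{W}}w_m^j\,w_{m+k}^l\,\mathbf{P}(dw)=\frac{\delta_{jl}}{2\pi}\int_{-\pi}^{\pi}e^{ikx}\mu_j(dx)$$ for all $j,l\in\{1,\dots,d\}$ and all $m,k$ with $m,m+k\in\mathbf{Z}_-$. Suppose that for each $j$ the density $f_j$ of the absolutely continuous part of $\mu_j$ (with respect to Lebesgue measure) is almost everywhere positive and satisfies $\int_{-\pi}^{\pi}\frac{1}{f_j(x)}\,dx<\infty$. Then the skew-product $(\mathcal{W},\mathbf{P},\mathcal{P},\mathbf{R}^n,\Phi)$ has the strong Feller property (in the sense defined in the context).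
   Context: **Function spaces.** $L^\Gamma(\mathbf{R}^d)$ is the Fréchet space of measurable $f:\mathbf{R}^d\to\mathbf{R}$ such that $\|f\|_{\gamma,p}^p=\int|f(w)|^pe^{-\gamma|w|^2}\,dw<\infty$ for all $\gamma>0$ and $p\ge1$, with the topology generated by these norms. A function $g:\mathbf{R}^n\times\mathbf{R}^d\to\mathbf{R}^m$ belongs to $\mathcal{C}^{0,\Gamma}(\mathbf{R}^n\times\mathbf{R}^d)$ if for every $i\in\{1,\dots,m\}$ the map $x\mapsto g_i(x,\cdot)$ is continuous from $\mathbf{R}^n$ to $L^\Gamma(\mathbf{R}^d)$. Elements of $\mathbf{R}^n$ are denoted $x$, those of $\mathbf{R}^d$ are denoted $w$, and $M^\Phi$ is the $n\times n$ matrix $M^\Phi_{ij}(x,w)=\sum_{k=1}^d\partial_{w^k}\Phi_i(x,w)\,\partial_{w^k}\Phi_j(x,w)$. **Skew-product.** $\mathcal{W}$ carries the product topology. For $w\in\mathcal{W}$, $w'\in\mathcal{W}_0$, define $w\sqcup w'\in\mathcal{W}$ by $(w\sqcup w')_0=w'$ and $(w\sqcup w')_k=w_{k+1}$ for $k<0$. Let $\bar{\mathcal{P}}(w,\cdot)$ be the regular conditional probability under $\mathbf{P}$ of the last coordinate (in $\mathcal{W}_0$) given all the previous ones, with respect to the splitting $\mathcal{W}\approx\mathcal{W}\times\mathcal{W}_0$, and let $\mathcal{P}(w,\cdot)$ be the push-forward of $\bar{\mathcal{P}}(w,\cdot)$ under $w'\mapsto w\sqcup w'$ (defined up to a $\mathbf{P}$-negligible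 set of $w$). The evolution map on $\mathbf{R}^n\times\mathcal{W}$ is $(x,w)\mapsto\Phi(x,w_0)$. Let $\mathcal{Q}$ be the Markov operator on $\mathbf{R}^n\times\mathcal{W}$ given by $(\mathcal{Q}\phi)(x,w)=\int_{\mathcal{W}}\phi(\Phi(x,w'_0),w')\,\mathcal{P}(w,dw')$. For $(x,w)\in\mathbf{R}^n\times\mathcal{W}$, let $\mathcal{S}(x,w)$ be the law of the solution process $(X_k)_{k\ge0}$, a probability measure on $(\mathbf{R}^n)^{\mathbf{N}}$, where $(X_k,W_k)_{k\ge0}$ is the Markov process with transition probabilities $\mathcal{Q}$ started at $(X_0,W_0)=(x,w)$. **Strong Feller.** The skew-product has the strong Feller property if there is a measurable map $\ell:\mathcal{W}\times(\mathbf{R}^n)^2\to[0,1]$ such that: for $\mathbf{P}$-almost every $w$ one has $\ell(w,x,x)=0$ for every $x$; $\|\mathcal{S}(x,w)-\mathcal{S}(y,w)\|_{\mathrm{TV}}\le\ell(w,x,y)$ for every $w\in\mathcal{W}$ and every $x,y\in\mathbf{R}^n$, where $\|\cdot\|_{\mathrm{TV}}$ denotes the total variation distance; and for $\mathbf{P}$-almost every $w$ the map $(w',x,y)\mapsto\ell(w\sqcup w',x,y)$, with $w'\in\mathcal{W}_0$, is jointly continuous.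
   Formalization: S(x,w) is taken as the law of (X_1,X_2,…): with X_0=x kept, laws from x≠y are mutually singular and strong Feller fails for n≥1 (e.g. Φ=x+w, iid noise). As P(w,·) is fixed only up to null sets and the bound is for every w, the claim is for some version of P(w,·). *)

(* Defs.v *)
From HB Require Import structures.
From mathcomp Require Import all_boot all_order all_algebra.
From mathcomp Require Import all_classical all_reals all_analysis.
From mathcomp Require Import complex.

Set Implicit Arguments.
Unset Strict Implicit.
Unset Printing Implicit Defensive.
Import Order.TTheory GRing.Theory Num.Theory.
Import numFieldNormedType.Exports.

Local Open Scope classical_set_scope.
Local Open Scope ring_scope.

(* Matrices and sequences carry the product sigma-algebra; as all the spaces
   below are countable products of separable metric spaces, this is the Borel
   sigma-algebra of the product topology. *)

Definition mx_display (d : measure_display) : measure_display.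
Proof. exact d. Qed.

Section measurable_matrix.
Context (R : realType) (m n : nat).

Definition mx_cylinders : set (set 'M[R]_(m, n)) :=
  \bigcup_(ij in [set: 'I_m * 'I_n])
    preimage_set_system setT (fun M : 'M[R]_(m, n) => M ij.1 ij.2) measurable.

HB.instance Definition _ :=
  @isMeasurable.Build (mx_display default_measure_display) 'M[R]_(m, n)
    <<s mx_cylinders >>
    (@sigma_algebra0 _ _ _) (@sigma_algebraC _ _) (@sigma_algebra_bigcup _ _ _).

End measurable_matrix.

Definition seqs_display (d : measure_display) : measure_display.
Proof. exact d. Qed.

Definition seqs (T : Type) : Type := nat -> T.

Section measurable_seqs.
Context d (T : measurableType d).

HB.instance Definition _ := Pointed.copy (seqs T) (nat -> T).

Definition seqs_cylinders : set (set (seqs T)) :=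
  \bigcup_(k in [set: nat])
    preimage_set_system setT (fun u : seqs T => u k) measurable.

HB.instance Definition _ :=
  @isMeasurable.Build (seqs_display d) (seqs T) <<s seqs_cylinders >>
    (@sigma_algebra0 _ _ _) (@sigma_algebraC _ _) (@sigma_algebra_bigcup _ _ _).

End measurable_seqs.

(* Lebesgue measure on R^d, as the d-fold product of the Lebesgue measure on R. *)
Fixpoint lebesgue_rV (R : realType) (d : nat) : set 'rV[R]_d -> \bar R :=
  match d with
  | 0 => dirac (0 : 'rV[R]_0)
  | d'.+1 => pushforward
      (@lebesgue_measure R \x lebesgue_rV (R := R) (d := d'))%E
      (fun p : R * 'rV[R]_d' => row_mx (p.1)%:M p.2 : 'rV[R]_(1 + d'))
  end.
Arguments lebesgue_rV : clear implicits.

Section function_spaces.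
Context (R : realType).

(* The norm of matrices in the library is the sup norm, hence this definition
   of the square of the Euclidean norm. *)
Definition sqnorm2 d (w : 'rV[R]_d) : R := \sum_j (w 0 j) ^+ 2.

Definition LGamma_norm d (gamma p : R) (f : 'rV[R]_d -> R) : \bar R :=
  ((\int[lebesgue_rV R d]_w
     (`|f w| `^ p * expR (- gamma * sqnorm2 w))%:E) `^ p^-1)%E.

Definition LGamma d (f : 'rV[R]_d -> R) : Prop :=
  measurable_fun setT f /\
  forall gamma p : R, 0 < gamma -> 1 <= p -> (LGamma_norm gamma p f < +oo)%E.

(* Scalar case; a vector-valued function belongs to C^{0,Gamma} when all its
   components do. *)
Definition C0Gamma n d (g : 'rV[R]_n -> 'rV[R]_d -> R) : Prop :=
  (forall x, LGamma (g x)) /\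
  forall (gamma p : R), 0 < gamma -> 1 <= p -> forall x,
    (fun y => LGamma_norm gamma p (fun w => g y w - g x w)) @ x --> 0%E.

(* In finite dimension, continuity of z |-> 'd F z for the operator norm is the
   same as continuity of z |-> 'd F z v for every v. *)
Definition C1 (V W : normedModType R) (F : V -> W) : Prop :=
  (forall z, differentiable F z) /\ forall v, continuous (fun z => 'd F z v).

Definition C2 (V W : normedModType R) (F : V -> W) : Prop :=
  C1 F /\ forall v, C1 (fun z => 'd F z v : W).

Definition pdx n d (l : 'I_n) (g : 'rV[R]_n -> 'rV[R]_d -> R) :
  'rV[R]_n -> 'rV[R]_d -> R :=
  fun x w => 'D_(delta_mx 0 l) (fun y => g y w) x.

Definition pdw n d (k : 'I_d) (g : 'rV[R]_n -> 'rV[R]_d -> R) :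
  'rV[R]_n -> 'rV[R]_d -> R :=
  fun x w => 'D_(delta_mx 0 k) (g x) w.

Definition component n d (Phi : 'rV[R]_n -> 'rV[R]_d -> 'rV[R]_n) (i : 'I_n) :
  'rV[R]_n -> 'rV[R]_d -> R :=
  fun x w => Phi x w 0 i.

Definition malliavin_mx n d (Phi : 'rV[R]_n -> 'rV[R]_d -> 'rV[R]_n)
    (x : 'rV[R]_n) (w : 'rV[R]_d) : 'M[R]_n :=
  \matrix_(i, j) \sum_k pdw k (component Phi i) x w
                      * pdw k (component Phi j) x w.

End function_spaces.

Section gaussian_noise.
Context (R : realType).

(* [normal_prob 0 0] is not the Dirac mass in the library. *)
Definition centred_normal (s : R) : set R -> \bar R :=
  if s == 0 then dirac (0 : R) else normal_prob 0 s.

(* The continuous linear functionals on (R^d)^{Z_-} are the finite linear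
   combinations of coordinates. *)
Definition centred_gaussian d (P : probability (seqs 'rV[R]_d) R) : Prop :=
  forall (N : nat) (c : 'I_N -> 'rV[R]_d), exists s : R,
    forall A : set R, measurable A ->
      pushforward P
        (fun w : seqs 'rV[R]_d => \sum_(k < N) \sum_j c k 0 j * w k 0 j) A
      = centred_normal s A.

Definition expi (x : R) : R[i] := Complex (cos x) (sin x).

Definition cintegral (mu : {finite_measure set R -> \bar R}) (D : set R) (f : R -> R[i]) : R[i] :=
  Complex (\int[mu]_(x in D) complex.Re (f x)) (\int[mu]_(x in D) complex.Im (f x)).

(* A coordinate w_m with m <= 0 is represented by [w a] with m = - a; hence
   (m, m + k) is represented by (a, b) with k = a - b. *)
Definition has_spectral_measures d (P : probability (seqs 'rV[R]_d) R)
    (mu : 'I_d -> {finite_measure set R -> \bar R}) : Prop :=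
  forall (j l : 'I_d) (a b : nat),
    Complex (\int[P]_w (w a 0 j * w b 0 l)) 0
    = Complex ((j == l)%:R / (2 * pi)) 0
      * cintegral (mu j) `[- pi, pi] (fun x => expi ((a%:Z - b%:Z)%:~R * x)).

Definition mutually_singular (mu nu : set R -> \bar R) : Prop :=
  exists N : set R, [/\ measurable N, mu N = 0%E & nu (~` N) = 0%E].

Definition ac_density (mu : set R -> \bar R) (f : R -> R) : Prop :=
  [/\ measurable_fun setT f, forall x, 0 <= f x &
    exists nu : {finite_measure set R -> \bar R},
      mutually_singular (@lebesgue_measure R) nu /\
      forall A : set R, measurable A ->
        mu A = (\int[@lebesgue_measure R]_(x in A) (f x)%:E + nu A)%E].

End gaussian_noise.

Section skew_products.
Context (R : realType) (n d : nat).
Local Notation X := 'rV[R]_n.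
Local Notation W0 := 'rV[R]_d.
(* W = W0^{Z_-}: the entry of index k : nat is the coordinate at time - k. *)
Local Notation W := (seqs 'rV[R]_d).

Definition past (w : W) : W := fun k => w k.+1.

Definition append (w : W) (w' : W0) : W :=
  fun k => if k is k'.+1 then w k' else w'.

Definition is_conditional_law (P : probability W R) (Pbar : R.-pker W ~> W0) :
    Prop :=
  forall (A : set W) (B : set W0), measurable A -> measurable B ->
    P [set w | A (past w) /\ B (w 0%N)]
    = (\int[P]_(w in past @^-1` A) Pbar (past w) B)%E.

Definition skew_kernel (Pbar : R.-pker W ~> W0) (w : W) : set W -> \bar R :=
  pushforward (Pbar w) (append w).

Definition skew_operator (PP : W -> set W -> \bar R) (Phi : X -> W0 -> X)
    (phi : X * W -> \bar R) (z : X * W) : \bar R :=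
  (\int[PP z.2]_w' phi (Phi z.1 (w' 0%N), w'))%E.

Definition markov_law (Q : (X * W -> \bar R) -> X * W -> \bar R) (z : X * W)
    (m : probability (seqs (X * W)%type) R) : Prop :=
  (forall A : set (X * W), measurable A -> m [set u | A (u 0%N)] = dirac z A) /\
  forall (k : nat) (A : nat -> set (X * W)) (B : set (X * W)),
    (forall i, measurable (A i)) -> measurable B ->
    let past_in := [set u : seqs (X * W)%type | forall i, (i <= k)%N -> A i (u i)] in
    m (past_in `&` [set u | B (u k.+1)])
    = (\int[m]_(u in past_in) Q (fun z => (\1_B z)%:E) (u k))%E.

(* Law of (X_1, X_2, ...).  The deterministic initial value X_0 = x is left out:
   otherwise the laws started from x != y would be mutually singular. *)
Definition solution_law (PP : W -> set W -> \bar R) (Phi : X -> W0 -> X)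
    (x : X) (w : W) (S : probability (seqs X) R) : Prop :=
  exists2 m : probability (seqs (X * W)%type) R,
    markov_law (skew_operator PP Phi) (x, w) m &
    forall A : set (seqs X), measurable A ->
      S A = m [set u | A (fun k => (u k.+1).1)].

(* Normalised so that it takes its values in [0, 1]. *)
Definition total_variation dd (T : measurableType dd) (mu nu : probability T R) :
    \bar R :=
  ereal_sup [set `|mu A - nu A|%E | A in measurable].

(* The bound on the total variation distance is required for every w, whereas
   the conditional law PP is determined by P only up to a null set of w: this is
   a property of a given version of PP. *)
Definition strong_feller (P : probability W R) (PP : W -> set W -> \bar R)
    (Phi : X -> W0 -> X) : Prop :=
  exists2 S : X -> W -> probability (seqs X) R,
    forall x w, solution_law PP Phi x w (S x w) &
  exists l : W * (X * X) -> R,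
    [/\ measurable_fun setT l /\ (forall z, 0 <= l z <= 1),
        {ae P, forall w, forall x, l (w, (x, x)) = 0},
        forall w x y, (total_variation (S x w) (S y w) <= (l (w, (x, y)))%:E)%E &
        {ae P, forall w,
          continuous (fun z : W0 * (X * X) => l (append w z.1, z.2))}].

End skew_products.

(* Main.v *)
Require Import Defs.
From HB Require Import structures.
From mathcomp Require Import all_boot all_order all_algebra.
From mathcomp Require Import all_classical all_reals all_analysis.
From mathcomp Require Import measurable_realfun lebesgue_integral_under normal_distribution.
From mathcomp Require Import ring lra.
Set Implicit Arguments.
Unset Strict Implicit.
Unset Printing Implicit Defensive.
Import Order.TTheory GRing.Theory Num.Theory.
Import numFieldNormedType.Exports.
Local Open Scope classical_set_scope.
Local Open Scope ring_scope.

(* Each component of the noise is a stationary Gaussian sequence whose spectral density f has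
   an integrable inverse.  By Cauchy-Schwarz, the coefficients of a linear combination of
   coordinates are then bounded by its L^2 norm.  Hence the optimal one-step prediction
   m(w) = sum_k c_k w_k has well defined coefficients c_k, the innovations
   eps_i = w_i - m(past) are i.i.d. Gaussian variables of positive variance, and the sequence
   b = (1, - c_0, - c_1, ...) is square summable.  The latter makes
   Z = (sum_i b_i eps_i) / (sum_i b_i^2) a nondegenerate Gaussian variable which is independent
   of eps - b Z.  Used as a perturbation of the noise, b Z changes the next coordinate by Z and
   no later one, since the changes of the later predictions are compensated.  Given eps - b Z,
   the path is therefore a function of X_1 = Phi(x, mu + Z), so the distance in total variation
   between two solutions is at most the mean distance between the laws of Phi(x, mu + Z) and
   Phi(y, mu + Z), where mu depends only on the past and on eps - b Z.

   The law of Phi(x, mu + Z) depends continuously on (x, mu) in total variation: multiplied by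
   the determinant of the Malliavin matrix, which is almost everywhere nonzero, a derivative of
   h(Phi(x, mu + z)) along (x, mu) is a C^1 combination of derivatives along z, which an
   integration by parts moves to the Gaussian density. *)

(** * Gaussian densities on the line *)

(** Predictors are limits that exist only almost surely, whereas [strong_feller] bounds the distance
    for every [w]. Pointwise statements are therefore made on a set [G] of full measure, stable
    under [append], and [ell] is 1 off [G]. The conditional law is given for every [w], as the law
    of [m w] plus an innovation.

    The sequence b is square summable because the variable sum_(i <= n) b_(n-i) eps_i contains w_n
    with coefficient sum_(i <= n) b_i^2 and has a variance proportional to the same sum: the
    spectral bound compares the square of this sum with the sum itself.

    The inverse determinant is continuous in x only in mean and cannot be differentiated. Its
    continuity turns invertibility at almost every position into invertibility at every position.
    The determinant that weights the integration by parts is then removed by approximating the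
    Gaussian density in L^1 by [D * chi], with [D] the determinant and [chi] of class C^1 and
    compactly supported.

    Independence and equality of laws are read off covariances: all variables lie in the mean-square
    closure of the linear functionals of the noise, and characteristic functions determine laws. *)

Section normal_law.
Context (R : realType).
Local Notation leb := (@lebesgue_measure R).

Lemma cvg_itv_nat (x : R) :
  \forall n \near \oo, x \in `[- n%:R, n%:R].
Proof.
near=> n; rewrite in_itv/= -ler_norml.
near: n; exact: nbhs_infty_ger.
Unshelve. all: end_near. Qed.

(** The fundamental theorem of calculus on [-n, n], then dominated convergence. This is the form of
    integration by parts behind the Gaussian moments and, through [integral_partial_eq0], behind the
    one along the noise. *)
Lemma integral_derivative_eq0 (F f : R -> R) :
  (forall x : R, is_derive x 1 F (f x)) -> continuous f ->
  leb.-integrable setT (EFin \o f) ->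
  (fun n => F n%:R) @ \oo --> 0 -> (fun n => F (- n%:R)) @ \oo --> 0 ->
  \int[leb]_x f x = 0.
Proof.
move=> dF cf intf Fp Fn.
pose I (n : nat) : set R := `[- n%:R, n%:R]%classic.
have FTC n : (\int[leb]_(x in I n.+1) (f x)%:E)%E
    = (F n.+1%:R - F (- n.+1%:R))%:E.
  rewrite (@continuous_FTC2 _ _ F) ?EFinB//.
  - by rewrite gtrN// ltr0n.
  - exact: continuous_subspaceT.
  - have cF x : {for x, continuous F}.
      by apply: differentiable_continuous; apply/derivable1_diffP; case: (dF x).
    split; first by move=> x _; case: (dF x).
      exact: cvg_at_right_filter (cF _).
    exact: cvg_at_left_filter (cF _).
  - by move=> x _; rewrite derive1E; apply: derive_val.
pose g n x := (f x * \1_(I n) x)%:E.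
have gint n : (\int[leb]_(x in I n) (f x)%:E = \int[leb]_x g n x)%E.
  rewrite integral_mkcond; apply: eq_integral => x _.
  rewrite patchE /g indicE; case: ifPn; rewrite ?mulr1 ?mulr0//.
have mf : measurable_fun setT f by exact: continuous_measurable_fun.
have [|||||_ _ H] := @dominated_convergence _ _ _ leb setT measurableT g
    (EFin \o f) (fun x => `|f x|%:E).
- move=> n; rewrite /g; apply/measurable_EFinP; apply: measurable_funM => //.
  by apply: measurable_indic; exact: measurable_itv.
- exact/measurable_EFinP.
- apply/aeW => x _; apply: cvg_near_cst; near=> n.
  rewrite /g indicE mem_set ?mulr1//=; near: n; exact: cvg_itv_nat.
- exact: (integrable_norm intf).
- apply/aeW => x n _; rewrite lee_fin normrM ler_piMr// indicE.
  by case: (_ \in _); rewrite ?normr1 ?normr0.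
have H2 : (fun n => (F n%:R - F (- n%:R))%:E) @ \oo --> 0%E.
  apply: cvg_EFin; first exact: nearW.
  have := cvgB Fp Fn; rewrite subr0; exact.
suff -> : (\int[leb]_x f x) = 0 by [].
rewrite /Rintegral; suff -> : (\int[leb]_x (f x)%:E = 0)%E by [].
apply: cvg_unique H _ => //.
apply: cvg_trans H2; apply: near_eq_cvg; near=> n.
have : (0 < n)%N by near: n; exact: nbhs_infty_gt.
by move=> /prednK <-; rewrite /= -gint FTC.
Unshelve. all: end_near. Qed.

(** Half of the exponent pays for the polynomial: with y = x^2 / (4 s^2), the bound 1 + y <= exp y
    gives (1 + 4 s^2 y) exp(-y) <= 1 + 4 s^2. The remaining half is a Gaussian of standard deviation
    sqrt 2 * s. *)
Lemma normal_tail_bound (s x : R) : s != 0 ->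
  (1 + x ^+ 2) * normal_fun 0 s x
  <= (1 + s ^+ 2 *+ 4) * normal_fun 0 (Num.sqrt 2 * s) x.
Proof.
move=> s0; rewrite /normal_fun subr0.
have s2 : 0 < s ^+ 2 by rewrite exprn_even_gt0.
set y := x ^+ 2 / (s ^+ 2 *+ 4).
have -> : - x ^+ 2 / (s ^+ 2 *+ 2) = - y + - y.
  by rewrite /y; field; rewrite s0.
have -> : - x ^+ 2 / ((Num.sqrt 2 * s) ^+ 2 *+ 2) = - y.
  by rewrite exprMn sqr_sqrtr// /y; field; rewrite s0.
rewrite expRD mulrA ler_wpM2r ?expR_ge0//.
rewrite expRN ler_pdivrMr ?expR_gt0//.
have -> : x ^+ 2 = (s ^+ 2 *+ 4) * y by rewrite /y; field; rewrite s0.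
have y0 : 0 <= y by rewrite /y divr_ge0 ?sqr_ge0// mulrn_wge0// ltW.
have /= := expR_ge1Dx y; have := ltW s2; nra.
Qed.

Lemma normal_fun_cvg (s : R) : s != 0 ->
  (fun n => normal_fun 0 s n%:R) @ \oo --> 0.
Proof.
move=> s0.
have s2 : 0 < s ^+ 2 by rewrite exprn_even_gt0.
have h : (fun n : nat => (s ^+ 2 *+ 2) * n%:R^-1 : R) @ \oo --> 0.
  rewrite -[X in _ --> X](mulr0 (s ^+ 2 *+ 2)); apply: cvgMr.
  apply/gtr0_cvgV0.
    by near=> n; rewrite ltr0n; near: n; exact: nbhs_infty_gt.
  exact: cvgr_idn.
apply: (@squeeze_cvgr _ _ _ _ (cst 0) _ _ _ _ _ h) => //; last exact: cvg_cst.
near=> n; rewrite normal_fun_ge0/= /normal_fun subr0.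
have n0 : (0 < n)%N by near: n; exact: nbhs_infty_gt.
have n1 : (1 : R) <= n%:R by rewrite ler1n.
rewrite mulNr expRN -[leRHS]invrK lef_pV2 ?posrE ?expR_gt0//; last first.
  by rewrite invr_gt0 mulr_gt0 ?invr_gt0 ?ltr0n// mulrn_wgt0.
apply: le_trans (expR_ge1Dx _).
rewrite invfM invrK -[leLHS]add0r lerD//.
rewrite mulrC ler_wpM2r ?invr_ge0 ?mulrn_wge0 ?sqr_ge0//.
by rewrite expr2; nra.
Unshelve. all: end_near. Qed.

Lemma normal_funN (s x : R) : normal_fun 0 s (- x) = normal_fun 0 s x.
Proof. by rewrite /normal_fun !subr0 sqrrN. Qed.

Lemma normal_moment_cvg (s : R) : s != 0 ->
  (fun n => (1 + n%:R ^+ 2) * normal_fun 0 s n%:R) @ \oo --> 0.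
Proof.
move=> s0.
have s20 : Num.sqrt 2 * s != 0 by rewrite mulf_neq0 ?sqrtr_eq0 -?ltNge.
have := normal_fun_cvg s20.
move/(cvgM (cvg_cst (1 + s ^+ 2 *+ 4))); rewrite mulr0 => h.
apply: (@squeeze_cvgr _ _ _ _ (cst 0) _ _ _ _ _ h) => //; last exact: cvg_cst.
near=> n; rewrite normal_tail_bound// andbT.
by rewrite mulr_ge0 ?normal_fun_ge0 ?addr_ge0 ?sqr_ge0.
Unshelve. all: end_near. Qed.

Lemma integrable_normal_fun (s : R) : s != 0 ->
  leb.-integrable setT (EFin \o normal_fun 0 s).
Proof.
move=> s0.
have := @integrable_normal_pdf R 0 s.
move/(integrableZl measurableT (normal_peak s)^-1); apply: eq_integrable => //.
move=> x _ /=; rewrite normal_pdfE// -EFinM mulrA mulVf ?mul1r//.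
by rewrite gt_eqF// normal_peak_gt0.
Qed.

Lemma integrable_normal_moment (s : R) : s != 0 ->
  leb.-integrable setT (fun x => ((1 + x ^+ 2) * normal_pdf 0 s x)%:E).
Proof.
move=> s0.
have s20 : Num.sqrt 2 * s != 0 by rewrite mulf_neq0 ?sqrtr_eq0 -?ltNge.
have := integrable_normal_fun s20.
move/(integrableZl measurableT (normal_peak s * (1 + s ^+ 2 *+ 4))).
apply: le_integrable => //.
  apply/measurable_EFinP; apply: measurable_funM.
    by apply: measurable_funD => //.
  exact: measurable_normal_pdf.
move=> x _; rewrite lee_fin !ger0_norm; last 2 first.
- rewrite mulr_ge0 ?normal_fun_ge0 ?mulr_ge0 ?normal_peak_ge0//.
  by rewrite addr_ge0 ?mulrn_wge0 ?sqr_ge0.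
- by rewrite mulr_ge0 ?normal_pdf_ge0 ?addr_ge0 ?sqr_ge0.
rewrite normal_pdfE// -[leRHS]mulrA mulrCA ler_wpM2l ?normal_peak_ge0//.
exact: normal_tail_bound.
Qed.

Lemma is_derive_normal_pdf (s x : R) : s != 0 ->
  is_derive x 1 (normal_pdf 0 s) (- (x / s ^+ 2) * normal_pdf 0 s x).
Proof.
move=> s0; rewrite normal_pdfE// /normal_fun.
have e : (fun x0 : R => normal_peak s * expR (- (x0 - 0) ^+ 2 / (s ^+ 2 *+ 2)))
   = (fun x0 => normal_peak s * expR (- (s ^+ 2 *+ 2)^-1 * (x0 ^+ 2))).
  by apply/funext => y; rewrite subr0; congr (_ * expR _); ring.
rewrite e; apply: is_derive_eq.
have -> : - (x - 0) ^+ 2 / (s ^+ 2 *+ 2) = - (s ^+ 2 *+ 2)^-1 * x ^+ 2.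
  by rewrite subr0; ring.
by rewrite /GRing.scale/=; field.
Qed.

End normal_law.

Section normal_law2.
Context (R : realType).
Local Notation leb := (@lebesgue_measure R).
Variable s : R.
Hypothesis s0 : s != 0.
Local Notation p := (normal_pdf 0 s).

Lemma integrable_le_normal_moment (h : R -> R) : measurable_fun setT h ->
  (forall x, `|h x| <= 1 + x ^+ 2) ->
  leb.-integrable setT (fun x => (h x * p x)%:E).
Proof.
move=> mh hle; apply: le_integrable (integrable_normal_moment s0) => //.
  by apply/measurable_EFinP; apply: measurable_funM => //;
    exact: measurable_normal_pdf.
move=> x _ /=; rewrite lee_fin !normrM ler_wpM2r// (le_trans (hle x))//.
exact: ler_norm.
Qed.

Lemma continuous_pdf : continuous p.
Proof. exact: continuous_normal_pdf. Qed.

Lemma bound_cvg0 (h : R -> R) :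
  (forall x, `|h x| <= (1 + x ^+ 2)) ->
  (fun n => h n%:R * p n%:R) @ \oo --> 0 /\
  (fun n => h (- n%:R) * p (- n%:R)) @ \oo --> 0.
Proof.
move=> hb.
have H : (fun n : nat => normal_peak s * ((1 + n%:R ^+ 2) * normal_fun 0 s n%:R))
    @ \oo --> 0.
  rewrite -[X in _ --> X](mulr0 (normal_peak s)); apply: cvgM.
    exact: cvg_cst.
  exact: normal_moment_cvg.
split; apply: norm_cvg0; apply: (@squeeze_cvgr _ _ _ _ (cst 0) _ _ _ _ _ H);
  try exact: cvg_cst.
- near=> n; rewrite normr_ge0/= normrM normal_pdfE//= [leRHS]mulrCA.
  rewrite normrM !(ger0_norm (normal_peak_ge0 _), ger0_norm (normal_fun_ge0 _ _ _)).
  by rewrite ler_wpM2r ?mulr_ge0 ?normal_peak_ge0 ?normal_fun_ge0.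
- near=> n; rewrite normr_ge0/= normrM normal_pdfE//= [leRHS]mulrCA normal_funN.
  rewrite normrM !(ger0_norm (normal_peak_ge0 _), ger0_norm (normal_fun_ge0 _ _ _)).
  rewrite ler_wpM2r ?mulr_ge0 ?normal_peak_ge0 ?normal_fun_ge0//.
  by rewrite -[n%:R in leRHS]opprK sqrrN.
Unshelve. all: end_near. Qed.

(** The derivative of x p(x) is p(x) - x^2 p(x) / s^2, and its integral over the line vanishes. *)
Lemma normal_variance_pdf : \int[leb]_x (x ^+ 2 * p x) = s ^+ 2.
Proof.
have i1 : leb.-integrable setT (fun x => (x ^+ 2 * p x)%:E).
  apply: integrable_le_normal_moment => // x.
  by rewrite ger0_norm ?sqr_ge0// lerDr.
have := @integral_derivative_eq0 R (fun x => x * p x)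
  (fun x => p x - (s ^+ 2)^-1 * (x ^+ 2 * p x)).
have /[swap]/[apply] : forall x : R,
    is_derive x 1 (fun x => x * p x) (p x - (s ^+ 2)^-1 * (x ^+ 2 * p x)).
  move=> x; have d := is_derive_normal_pdf x s0.
  by apply: is_derive_eq; rewrite /GRing.scale/=; field.
have cp := continuous_pdf.
have /[swap]/[apply] : continuous (fun x => p x - (s ^+ 2)^-1 * (x ^+ 2 * p x)).
  move=> x; apply: cvgB; first exact: cp.
  apply: cvgM; first exact: cvg_cst.
  by apply: cvgM; [exact: exprn_continuous | exact: cp].
have i2 : leb.-integrable setT (fun x => ((s ^+ 2)^-1 * (x ^+ 2 * p x))%:E).
  by have := integrableZl measurableT (s ^+ 2)^-1 i1; apply: eq_integrable.
have i0 := @integrable_normal_pdf R 0 s.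
have /[swap]/[apply] : leb.-integrable setT
   (EFin \o (fun x => p x - (s ^+ 2)^-1 * (x ^+ 2 * p x))).
  by have := integrableB measurableT i0 i2; apply: eq_integrable.
have [|c1 c2] := @bound_cvg0 id.
  by move=> x /=; rewrite ler_norml; nra.
move=> /(_ c1 c2); rewrite RintegralB// RintegralZl//.
rewrite {1}/Rintegral integral_normal_pdf/= => /eqP; rewrite subr_eq0 => /eqP e.
by apply: (mulfI (x := (s ^+ 2)^-1)); rewrite ?invr_eq0 ?sqrf_eq0// -e mulVf ?sqrf_eq0.
Qed.

Definition normal_cos (t : R) := \int[leb]_x (cos (t * x) * p x).

Lemma integrable_bounded_normal (h : R -> R) : measurable_fun setT h ->
  (forall x, `|h x| <= 1) -> leb.-integrable setT (fun x => (h x * p x)%:E).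
Proof.
move=> mh hle; apply: integrable_le_normal_moment => // x.
by rewrite (le_trans (hle x))// lerDl sqr_ge0.
Qed.

Lemma norm_cos_le1 (x : R) : `|cos x| <= 1.
Proof. by rewrite ler_norml cos_geN1 cos_le1. Qed.

Lemma norm_sin_le1 (x : R) : `|sin x| <= 1.
Proof. by rewrite ler_norml sin_geN1 sin_le1. Qed.

Lemma continuous_sin_lin (t : R) : continuous (fun x => sin (t * x)).
Proof.
move=> x; apply: continuous_comp; first exact: mulrl_continuous.
exact: continuous_sin.
Qed.

Lemma continuous_cos_lin (t : R) : continuous (fun x => cos (t * x)).
Proof.
move=> x; apply: continuous_comp; first exact: mulrl_continuous.
exact: continuous_cos.
Qed.

Lemma normal_sin_eq0 (t : R) : \int[leb]_x (sin (t * x) * p x) = 0.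
Proof.
have i1 : leb.-integrable setT (fun x => (sin (t * x) * p x)%:E).
  apply: integrable_bounded_normal => [|x]; last exact: norm_sin_le1.
  by apply: continuous_measurable_fun; exact: continuous_sin_lin.
suff : \int[leb]_x (sin (t * x) * p x) = - \int[leb]_x (sin (t * x) * p x) by lra.
rewrite [LHS]/Rintegral.
rewrite (eq_measure_integral (pushforward leb (-%R : _ -> measurableTypeR R)));
  last by move=> A mA _; exact/esym/lebesgue_measureN.
rewrite integral_pushforward//=.
- rewrite -mulN1r -RintegralZl// /Rintegral; congr fine; apply: eq_integral => x _ /=.
  rewrite mulrN sinN mulN1r mulNr; congr (- (_ * _))%:E.
  by rewrite !normal_pdfE// normal_funN.
- exact: (measurable_int _ i1).
- rewrite preimage_setT; have := integrableZl measurableT (-1) i1.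
  apply: eq_integrable => // x _ /=.
  rewrite mulrN sinN mulNr -EFinM mulN1r; congr (- (_ * _))%:E.
  by rewrite !normal_pdfE// normal_funN.
Qed.

(** From the derivative of sin(t x) p(x). The left-hand side is, up to sign, the derivative in t of
    [normal_cos], which thus satisfies a linear differential equation. *)
Lemma normal_sin_moment (t : R) :
  \int[leb]_x (x * sin (t * x) * p x) = s ^+ 2 * t * normal_cos t.
Proof.
have i1 : leb.-integrable setT (fun x => (x * sin (t * x) * p x)%:E).
  apply: integrable_le_normal_moment => [|x].
    apply: measurable_funM => //.
    by apply: continuous_measurable_fun; exact: continuous_sin_lin.
  rewrite normrM (le_trans (ler_wpM2l _ (norm_sin_le1 _)))// mulr1.
  by rewrite ler_norml; nra.
have i2 : leb.-integrable setT (fun x => (cos (t * x) * p x)%:E).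
  apply: integrable_bounded_normal => [|x]; last exact: norm_cos_le1.
  by apply: continuous_measurable_fun; exact: continuous_cos_lin.
pose f x := t * (cos (t * x) * p x) - (s ^+ 2)^-1 * (x * sin (t * x) * p x).
have := @integral_derivative_eq0 R (fun x => sin (t * x) * p x) f.
have /[swap]/[apply] : forall x : R, is_derive x 1 (fun x => sin (t * x) * p x) (f x).
  move=> x; have d := is_derive_normal_pdf x s0.
  by apply: is_derive_eq; rewrite /f /GRing.scale/=; field.
have cp := continuous_pdf.
have /[swap]/[apply] : continuous f.
  move=> x; apply: cvgB; apply: cvgM; try exact: cvg_cst.
    by apply: cvgM; [exact: continuous_cos_lin | exact: cp].
  by apply: cvgM; [apply: cvgM; [exact: cvg_id|exact: continuous_sin_lin] | exact: cp].
have j1 : leb.-integrable setT (fun x => ((s ^+ 2)^-1 * (x * sin (t * x) * p x))%:E).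
  by have := integrableZl measurableT (s ^+ 2)^-1 i1; apply: eq_integrable.
have j2 : leb.-integrable setT (fun x => (t * (cos (t * x) * p x))%:E).
  by have := integrableZl measurableT t i2; apply: eq_integrable.
have /[swap]/[apply] : leb.-integrable setT (EFin \o f).
  by have := integrableB measurableT j2 j1; apply: eq_integrable.
have [|c1 c2] := @bound_cvg0 (fun x => sin (t * x)).
  by move=> x /=; rewrite (le_trans (norm_sin_le1 _))// lerDl sqr_ge0.
move=> /(_ c1 c2); rewrite RintegralB// !RintegralZl// => /eqP.
rewrite subr_eq0 => /eqP e; rewrite -mulrA e mulrA mulfV ?mul1r//.
by rewrite sqrf_eq0.
Qed.

Lemma is_derive_normal_cos (t : R) :
  is_derive t 1 normal_cos (- (s ^+ 2 * t * normal_cos t)).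
Proof.
pose f (t x : R) := cos (t * x) * p x.
have df (y x : R) : is_derive y 1 (f ^~ x) (- (x * sin (y * x) * p x)).
  by rewrite /f; apply: is_derive_eq; rewrite /GRing.scale/=; ring.
have intf y : leb.-integrable setT (EFin \o f y).
  apply: integrable_bounded_normal => [|x]; last exact: norm_cos_le1.
  by apply: continuous_measurable_fun; exact: continuous_cos_lin.
pose G x := (1 + x ^+ 2) * p x.
have Ia : `]t - 1, t + 1[%classic t by rewrite /= in_itv/=; lra.
have d1 y x : partial1of2 f y x = - (x * sin (y * x) * p x).
  by rewrite partial1of2E; apply: derive_val.
have G0 x : 0 <= G x by rewrite mulr_ge0 ?normal_pdf_ge0 ?addr_ge0 ?sqr_ge0.
have Gub y x : `|partial1of2 f y x| <= G x.
  rewrite d1 normrN /G normrM (ger0_norm (normal_pdf_ge0 _ _ _)).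
  rewrite ler_wpM2r ?normal_pdf_ge0//.
  rewrite normrM (le_trans (ler_wpM2l _ (norm_sin_le1 _)))// mulr1.
  by rewrite ler_norml; nra.
have H1 := @derivable_under_integral R _ _ leb f setT measurableT t (t - 1) (t + 1)
  Ia (fun x _ => intf x) (fun x y _ _ => @ex_derive _ _ _ _ _ _ _ (df x y)) G G0
  (integrable_normal_moment s0) (fun x y _ _ => Gub x y).
have H2 := @differentiation_under_integral R _ _ leb f setT measurableT t (t - 1) (t + 1)
  Ia (fun x _ => intf x) (fun x y _ _ => @ex_derive _ _ _ _ _ _ _ (df x y)) G G0
  (integrable_normal_moment s0) (fun x y _ _ => Gub x y).
apply: DeriveDef => //; rewrite -derive1E H2 -normal_sin_moment.
rewrite -mulN1r -RintegralZl//; last first.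
  apply: integrable_le_normal_moment => [|x].
    apply: measurable_funM => //.
    by apply: continuous_measurable_fun; exact: continuous_sin_lin.
  rewrite normrM (le_trans (ler_wpM2l _ (norm_sin_le1 _)))// mulr1.
  by rewrite ler_norml; nra.
by apply: eq_Rintegral => x _; rewrite d1 mulN1r.
Qed.

(** The equation y' = - s^2 t y makes [normal_cos t * expR (s ^+ 2 / 2 * t ^+ 2)] constant, and its
    value at 0 is the total mass. *)
Lemma normal_cosE (t : R) : normal_cos t = expR (- (s ^+ 2 * t ^+ 2) / 2).
Proof.
pose h (t : R) := normal_cos t * expR (s ^+ 2 / 2 * t ^+ 2).
have dh (x : R) : is_derive x 1 h 0.
  have d := is_derive_normal_cos x.
  rewrite /h; apply: is_derive_eq; rewrite /GRing.scale/=.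
  by field.
have := @is_derive_0_is_cst _ h t 0 dh.
rewrite /h expr0n/= mulr0 expR0 mulr1.
have -> : normal_cos 0 = 1.
  rewrite /normal_cos; under eq_Rintegral do rewrite mul0r cos0 mul1r.
  by rewrite /Rintegral integral_normal_pdf.
move=> e; have -> : - (s ^+ 2 * t ^+ 2) / 2 = - (s ^+ 2 / 2 * t ^+ 2) by ring.
rewrite expRN; apply: (mulIf (lt0r_neq0 (expR_gt0 (s ^+ 2 / 2 * t ^+ 2)))).
by rewrite e mulVf ?lt0r_neq0 ?expR_gt0.
Qed.

End normal_law2.

(** * Weighted laws are determined by their Fourier transforms *)

Section density.
Local Open Scope ereal_scope.
Context d (T : measurableType d) (R : realType).
Variables (mu nu rho : {measure set T -> \bar R}) (g : T -> R).
Hypotheses (mg : measurable_fun setT g) (g0 : forall x, (0 <= g x)%R).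
Hypothesis nuE : forall A, measurable A ->
  nu A = \int[mu]_(x in A) (g x)%:E + rho A.

Import HBNNSimple.

(** Simple functions and monotone convergence. The extra term [rho] is zero for normal laws, and is
    the singular part for spectral measures. *)
Lemma ge0_integral_density (f : T -> \bar R) :
  measurable_fun setT f -> (forall x, 0 <= f x) ->
  \int[nu]_x f x = \int[mu]_x (f x * (g x)%:E) + \int[rho]_x f x.
Proof.
move=> mf f0.
pose f_ := nnsfun_approx measurableT mf.
have f_ge0 n x : 0 <= (f_ n x)%:E by rewrite lee_fin.
have mf_ n : measurable_fun setT (EFin \o f_ n) by exact/measurable_EFinP.
have ndf x : {homo (fun n => (f_ n x)%:E) : m n / (m <= n)%N >-> m <= n}.
  by move=> m n mn; rewrite lee_fin; exact/lefP/nd_nnsfun_approx.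
have limf x : (fun n => (f_ n x)%:E) @ \oo --> f x.
  by apply: cvg_nnsfun_approx => // *; exact: f0.
have E n : \int[nu]_x (f_ n x)%:E
    = \int[mu]_x ((f_ n x)%:E * (g x)%:E) + \int[rho]_x (f_ n x)%:E.
  under eq_integral do rewrite fimfunE -fsumEFin//.
  have E1 (m : {measure set T -> \bar R}) :
      \int[m]_x (\sum_(k \in range (f_ n)) (k * \1_(f_ n @^-1` [set k]) x)%:E)
      = \sum_(k \in range (f_ n)) k%:E * m (f_ n @^-1` [set k]).
    rewrite ge0_integral_fsum//; last 2 first.
    - by move=> y; exact/measurable_EFinP/measurable_funM.
    - by move=> y x _; rewrite nnfun_muleindic_ge0.
    by apply: eq_fsbigr => r _; rewrite integralZl_indic_nnsfun// integral_indic// setIT.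
  rewrite E1.
  under [X in _ = _ + X]eq_integral do rewrite fimfunE -fsumEFin//.
  rewrite E1.
  have -> : \int[mu]_x ((f_ n x)%:E * (g x)%:E)
      = \sum_(k \in range (f_ n)) k%:E * \int[mu]_(x in f_ n @^-1` [set k]) (g x)%:E.
    transitivity (\int[mu]_x (\sum_(k \in range (f_ n))
        (k * \1_(f_ n @^-1` [set k]) x)%:E * (g x)%:E)).
      apply: eq_integral => x _.
      rewrite -ge0_mule_fsuml; last by move=> k; rewrite nnfun_muleindic_ge0.
      by rewrite fsumEFin// -fimfunE.
    rewrite ge0_integral_fsum//; last 2 first.
    - move=> y; apply: emeasurable_funM; apply/measurable_EFinP => //.
      exact: measurable_funM.
    - by move=> y x _; rewrite mule_ge0 ?nnfun_muleindic_ge0// lee_fin.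
    apply: eq_fsbigr => r /set_mem [x0 _ <-].
    have mr : measurable_fun setT
        ((fun x : T => (g x)%:E) \_ (f_ n @^-1` [set f_ n x0])).
      apply/(measurable_restrictT _ _).1 => //.
      by apply: measurable_funTS; exact/measurable_EFinP.
    have gr0 x : 0 <= ((fun x : T => (g x)%:E) \_ (f_ n @^-1` [set f_ n x0])) x.
      by apply: erestrict_ge0 => y _; rewrite lee_fin.
    have r0 : 0 <= (f_ n x0)%:E by [].
    rewrite [in RHS]integral_mkcond -ge0_integralZl//.
    apply: eq_integral => x _; rewrite patchE indicE.
    by case: ifP => _; rewrite ?mulr1 ?mulr0 ?mul0e ?mule0.
  rewrite -fsbig_split//=; apply: eq_fsbigr => r /set_mem [x0 _ <-].
  rewrite nuE// ge0_muleDr//.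
  by apply: integral_ge0 => x _; rewrite lee_fin.
have LC (m : {measure set T -> \bar R}) :
    (fun n => \int[m]_x (f_ n x)%:E) @ \oo --> \int[m]_x f x.
  rewrite (eq_integral (fun x => limn (fun n => (f_ n x)%:E))).
    exact: cvg_monotone_convergence.
  by move=> x _; exact/esym/cvg_lim.
have LG : (fun n => \int[mu]_x ((f_ n x)%:E * (g x)%:E)) @ \oo
    --> \int[mu]_x (f x * (g x)%:E).
  rewrite (eq_integral (fun x => limn (fun n => (f_ n x)%:E * (g x)%:E))); last first.
    move=> x _; apply/esym/cvg_lim => //.
    by apply: cvgeZr.
  apply: cvg_monotone_convergence => //.
  - by move=> n; apply: emeasurable_funM => //; exact/measurable_EFinP.
  - by move=> n x _; rewrite mule_ge0// lee_fin.
  - by move=> x _ m n mn; rewrite lee_wpmul2r ?lee_fin//; exact: ndf.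
rewrite -(cvg_lim (@ereal_hausdorff R) (LC nu)); apply/cvg_lim => //.
under eq_fun do rewrite E.
apply: cvgeD => //.
by rewrite ge0_adde_def// inE; apply: integral_ge0 => x _; rewrite ?mule_ge0// lee_fin.
Qed.

End density.

Section shift.
Context (R : realType).
Local Notation leb := (@lebesgue_measure R).

Lemma lebesgue_measure_shift (m : R) (A : set R) : measurable A ->
  pushforward leb ((fun x : measurableTypeR R => x + m) : _ -> measurableTypeR R) A = leb A.
Proof.
move=> mA; apply/esym/lebesgue_measure_unique => //=.
  by apply: measurable_funD => //; exact: measurable_cst.
move=> mm _ [[a b]] _ <-.
rewrite /pushforward.
have -> : (fun x : R => x + m) @^-1` `]a, b]%classic = `]a - m, b - m]%classic.
  by apply/seteqP; split => x /=; rewrite !in_itv/= ltrBlDr lerBrDr.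
rewrite !lebesgue_measure_itv/= !lte_fin ltrD2r.
by case: ifP => // _; rewrite -!EFinB; congr EFin; ring.
Qed.

Lemma ge0_integral_shift (m : R) (f : R -> \bar R) : measurable_fun setT f ->
  (forall x, 0 <= f x)%E -> (\int[leb]_x f (x + m)%R = \int[leb]_x f x)%E.
Proof.
move=> mf f0.
have mm : measurable_fun setT ((fun x : measurableTypeR R => x + m) : _ -> measurableTypeR R).
  by apply: measurable_funD.
rewrite [RHS](eq_measure_integral
  (pushforward leb ((fun x : measurableTypeR R => x + m) : _ -> measurableTypeR R))).
  by rewrite ge0_integral_pushforward.
by move=> A mA _; apply/esym; exact: lebesgue_measure_shift.
Qed.

End shift.

Section integrableR.
Context d (T : measurableType d) (R : realType) (mu : {measure set T -> \bar R}).
Implicit Types f g : T -> R.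

Lemma integrableRD f g : mu.-integrable setT (EFin \o f) ->
  mu.-integrable setT (EFin \o g) ->
  mu.-integrable setT (EFin \o (fun x => f x + g x)).
Proof. by move=> /(integrableD measurableT)/[apply]; apply: eq_integrable. Qed.

Lemma integrableRB f g : mu.-integrable setT (EFin \o f) ->
  mu.-integrable setT (EFin \o g) ->
  mu.-integrable setT (EFin \o (fun x => f x - g x)).
Proof. by move=> /(integrableB measurableT)/[apply]; apply: eq_integrable. Qed.

Lemma integrableRZ (k : R) f : mu.-integrable setT (EFin \o f) ->
  mu.-integrable setT (EFin \o (fun x => k * f x)).
Proof. by move=> /(integrableZl measurableT k); apply: eq_integrable. Qed.

End integrableR.

Section smoothing.
Context (R : realType).
Local Notation leb := (@lebesgue_measure R).

Lemma integrable_le_cst d (T : measurableType d) (P : {finite_measure set T -> \bar R})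
    (f : T -> R) (M : R) :
  measurable_fun setT f -> (forall x, `|f x| <= M) ->
  P.-integrable setT (EFin \o f).
Proof.
move=> mf fM; apply: measurable_bounded_integrable => //.
  by rewrite ltey_eq fin_num_measure.
by exists M; split; [exact: num_real | move=> y My x _ /=; apply: le_trans (fM x) (ltW My)].
Qed.

Lemma normal_pdf_shift (s m x : R) : s != 0 ->
  normal_pdf m s x = normal_pdf 0 s (x - m).
Proof. by move=> s0; rewrite !normal_pdfE// /normal_fun subr0. Qed.

Lemma ge0_integral_normal_shift (s m : R) (h : R -> R) :
  s != 0 -> measurable_fun setT h -> (forall x, 0 <= h x) ->
  (\int[normal_prob m s]_x (h x)%:E = \int[leb]_x (h (x + m) * normal_pdf 0 s x)%:E)%E.
Proof.
move=> s0 mh h0.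
rewrite (@ge0_integral_density _ _ _ leb (normal_prob m s) mzero (normal_pdf m s))//;
  last 4 first.
- exact: measurable_normal_pdf.
- by move=> x; exact: normal_pdf_ge0.
- by move=> A mA; rewrite adde0.
- exact/measurable_EFinP.
rewrite integral_measure_zero adde0.
rewrite -[LHS](@ge0_integral_shift _ m).
- by apply: eq_integral => x _; rewrite -EFinM normal_pdf_shift// addrK.
- apply: emeasurable_funM; apply/measurable_EFinP => //.
  exact: measurable_normal_pdf.
- by move=> x; rewrite mule_ge0 ?lee_fin ?normal_pdf_ge0.
Qed.

(** Chebyshev's inequality, from the second moment. *)
Lemma normal_prob_far (s m r : R) (A : set R) : s != 0 -> 0 < r -> measurable A ->
  (forall x, A x -> r <= `|x - m|) -> (normal_prob m s A <= (s ^+ 2 / r ^+ 2)%:E)%E.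
Proof.
move=> s0 r0 mA Ar.
rewrite -[A]setIT -integral_indic//.
rewrite ge0_integral_normal_shift//.
have i := @integrable_le_normal_moment R s s0 (fun x => x ^+ 2).
have -> : ((s ^+ 2 / r ^+ 2)%:E
    = \int[leb]_x (r ^- 2 * (x ^+ 2 * normal_pdf 0 s x))%:E)%E.
  rewrite -[in LHS](normal_variance_pdf s0) mulrC EFinM /Rintegral fineK.
    under [RHS]eq_integral do rewrite EFinM.
    rewrite ge0_integralZl//.
    - apply/measurable_EFinP; apply: measurable_funM => //.
      exact: measurable_normal_pdf.
    - by move=> x _; rewrite lee_fin mulr_ge0 ?sqr_ge0 ?normal_pdf_ge0.
    - by rewrite lee_fin invr_ge0 exprn_ge0 ?ltW.
  apply: integrable_fin_num => //; apply: i => // x.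
  by rewrite ger0_norm ?sqr_ge0// lerDr.
apply: ge0_le_integral => //.
- by move=> x _; rewrite lee_fin mulr_ge0 ?normal_pdf_ge0.
- apply/measurable_EFinP; apply: measurable_funM; last exact: measurable_normal_pdf.
  by apply: measurableT_comp; [exact: measurable_indic | exact: measurable_funD].
- apply/measurable_EFinP; apply: measurable_funM => //.
  by apply: measurable_funM => //; exact: measurable_normal_pdf.
move=> x _; rewrite lee_fin mulrA ler_wpM2r ?normal_pdf_ge0//.
rewrite indicE; have [|_] := boolP (_ \in _); last first.
  by rewrite mulr_ge0 ?sqr_ge0// invr_ge0 exprn_ge0 ?ltW.
rewrite inE => /Ar; rewrite addrK => rx.
rewrite -(real_normK (num_real x)) mulrC ler_pdivlMr ?exprn_gt0// mul1r.
by rewrite lerXn2r ?nnegrE// ltW.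
Qed.

End smoothing.


Section Rintegral_fubini.
Context d1 d2 (T : measurableType d1) (S : measurableType d2) (R : realType).

Lemma Rintegral_fubini (m1 : {sigma_finite_measure set T -> \bar R})
    (m2 : {sigma_finite_measure set S -> \bar R}) (f : T * S -> R) :
  (m1 \x m2)%E.-integrable setT (EFin \o f) ->
  \int[m1]_x \int[m2]_y f (x, y) = \int[m2]_y \int[m1]_x f (x, y).
Proof.
move=> intf; rewrite {1 3}/Rintegral; congr fine.
rewrite -[RHS](_ : \int[m2]_y fubini_G m1 (EFin \o f) y = _)%E; last first.
  apply: ae_eq_integral => //.
  - exact: (measurable_fubini_G intf).
  - apply/measurable_EFinP; apply: measurableT_comp => //.
    exact: (measurable_fubini_G intf).
  - apply: filterS (ae_integrable2 intf) => y iy _ /=.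
    by rewrite /Rintegral fineK//; exact: (integrable_fin_num _ iy).
rewrite -[LHS](_ : \int[m1]_x fubini_F m2 (EFin \o f) x = _)%E; last first.
  apply: ae_eq_integral => //.
  - exact: (measurable_fubini_F intf).
  - apply/measurable_EFinP; apply: measurableT_comp => //.
    exact: (measurable_fubini_F intf).
  - apply: filterS (ae_integrable1 intf) => y iy _ /=.
    by rewrite /Rintegral fineK//; exact: (integrable_fin_num _ iy).
exact: Fubini intf.
Qed.

Lemma Rintegral_fubini_bounded (P : probability T R)
    (m2 : {sigma_finite_measure set S -> \bar R}) (f : T * S -> R) (M : R) :
  measurable_fun setT f ->
  (forall w, (\int[m2]_y `|f (w, y)|%:E <= M%:E)%E) ->
  \int[P]_x \int[m2]_y f (x, y) = \int[m2]_y \int[P]_x f (x, y).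
Proof.
move=> mf fM; apply: Rintegral_fubini.
have mf' : measurable_fun setT (EFin \o f) by exact/measurable_EFinP.
apply/integrable12ltyP => //.
apply: (@le_lt_trans _ _ (\int[P]_w (cst M%:E w))%E).
  apply: ge0_le_integral => //.
  - by move=> w _; apply: integral_ge0 => t _.
  - apply: (measurable_fun_fubini_tonelli_F (abse \o (EFin \o f))) => //=.
    exact: measurableT_comp.
  - by move=> x _; exact: fM.
by apply: integrable_lty => //; exact: finite_measure_integrable_cst.
Qed.

End Rintegral_fubini.

(** * Weighted laws on the line: Gaussian kernels, then rays, then Borel sets *)

Section one_dim_uniqueness.
Context (R : realType).
Local Notation leb := (@lebesgue_measure R).

Lemma measurable_cos : measurable_fun setT (@cos R).
Proof. by apply: continuous_measurable_fun; exact: continuous_cos. Qed.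

Lemma measurable_sin : measurable_fun setT (@sin R).
Proof. by apply: continuous_measurable_fun; exact: continuous_sin. Qed.

Section one_space.
Context d (T : measurableType d) (P : probability T R).
Variables (U X : T -> R) (M : R).
Hypotheses (mU : measurable_fun setT U) (UM : forall w, `|U w| <= M)
  (mX : measurable_fun setT X).

Lemma integrable_weight (h : R -> R) (N : R) : measurable_fun setT h ->
  (forall x, `|h x| <= N) -> P.-integrable setT (fun w => (U w * h (X w))%:E).
Proof.
move=> mh hN.
apply: (@integrable_le_cst _ _ _ _ (fun w => U w * h (X w)) (M * N)).
  by apply: measurable_funM => //; exact: measurableT_comp.
by move=> w; rewrite normrM ler_pM.
Qed.

(* [normal_pdf 0 s^-1 (x - a)] is a mixture of the functions
   [x |-> cos (t * (x - a))]. *)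
Lemma weight_normal_pdf (s a : R) : s != 0 ->
  \int[P]_w (U w * normal_pdf 0 s^-1 (X w - a)) =
  normal_peak s^-1 * \int[leb]_t
     (normal_pdf 0 s t * (cos (t * a) * \int[P]_w (U w * cos (t * X w))
      + sin (t * a) * \int[P]_w (U w * sin (t * X w)))).
Proof.
move=> s0.
have s1 : s^-1 != 0 by rewrite invr_eq0.
have M0 : 0 <= M by apply: (le_trans _ (UM point)).
pose F (z : T * R) := U z.1 * (cos (z.2 * (X z.1 - a)) * normal_pdf 0 s z.2).
have mF : measurable_fun setT F.
  apply: measurable_funM; first exact: measurableT_comp.
  apply: measurable_funM.
    apply: (measurableT_comp measurable_cos); apply: measurable_funM => //.
    by apply: measurable_funB => //; exact: measurableT_comp.
  by apply: measurableT_comp => //; exact: measurable_normal_pdf.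
have Fle w t : `|F (w, t)| <= M * normal_pdf 0 s t.
  rewrite /F/= normrM ler_pM// normrM (ger0_norm (normal_pdf_ge0 _ _ _)).
  by rewrite ler_piMl ?normal_pdf_ge0// norm_cos_le1.
have iM : (\int[leb]_t (M * normal_pdf 0 s t)%:E = M%:E)%E.
  under eq_integral do rewrite EFinM.
  rewrite ge0_integralZl ?lee_fin// ?integral_normal_pdf ?mule1//.
    by apply/measurable_EFinP; exact: measurable_normal_pdf.
  by move=> t _; rewrite lee_fin normal_pdf_ge0.
have FE w : \int[leb]_t F (w, t) = U w * expR (- (s ^+ 2 * (X w - a) ^+ 2) / 2).
  rewrite -(normal_cosE s0) /normal_cos -RintegralZl//.
    by apply: eq_Rintegral => t _; rewrite /F/= [t * _]mulrC.
  apply: integrable_bounded_normal => // [|x]; last exact: norm_cos_le1.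
  by apply: continuous_measurable_fun; exact: continuous_cos_lin.
transitivity (normal_peak s^-1 * \int[P]_w \int[leb]_t F (w, t)).
  under [in RHS]eq_Rintegral do rewrite FE.
  rewrite -RintegralZl//; last first.
    apply: (@integrable_weight (fun x => expR (- (s ^+ 2 * (x - a) ^+ 2) / 2)) 1).
      apply: measurableT_comp => //; apply: measurable_funM => //.
      apply: measurableT_comp => //; apply: measurable_funM => //.
      by apply: measurable_funX; exact: measurable_funB.
    move=> x; rewrite ger0_norm ?expR_ge0// -[leRHS]expR0 ler_expR.
    by rewrite mulNr oppr_le0 divr_ge0// mulr_ge0// sqr_ge0.
  apply: eq_Rintegral => w _; rewrite normal_pdfE// /normal_fun subr0 mulrCA.
  by congr (_ * (_ * expR _)); field.
rewrite (@Rintegral_fubini_bounded _ _ _ _ _ P leb F M)//; last first.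
  move=> w; rewrite -iM; apply: ge0_le_integral => //.
  - apply/measurable_EFinP; apply: measurableT_comp => //.
    by apply: (measurableT_comp mF); exact: pair1_measurable.
  - apply/measurable_EFinP; apply: measurable_funM => //.
    exact: measurable_normal_pdf.
  - by move=> t _; rewrite lee_fin; exact: Fle.
congr (_ * _); apply: eq_Rintegral => t _.
rewrite /F/=.
have ic := @integrable_weight (fun x => cos (t * x)) 1.
have isn := @integrable_weight (fun x => sin (t * x)) 1.
have {}ic : P.-integrable setT (EFin \o (fun w => U w * cos (t * X w))).
  apply: ic => [|x]; last exact: norm_cos_le1.
  by apply: continuous_measurable_fun; exact: continuous_cos_lin.
have {}isn : P.-integrable setT (EFin \o (fun w => U w * sin (t * X w))).
  apply: isn => [|x]; last exact: norm_sin_le1.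
  by apply: continuous_measurable_fun; exact: continuous_sin_lin.
rewrite -!RintegralZl// -RintegralD//; last 2 first.
- by have := integrableZl measurableT (cos (t * a)) ic; apply: eq_integrable.
- by have := integrableZl measurableT (sin (t * a)) isn; apply: eq_integrable.
rewrite -RintegralZl//; last first.
  by apply: integrableRD; exact: integrableRZ.
apply: eq_Rintegral => w _; rewrite mulrBr cosB; ring.
Qed.


(** The smoothed indicator of a ray is a mixture, over the centres a > c, of the kernels of
    [weight_normal_pdf]; it is therefore determined by cosine and sine integrals too. *)
Lemma weight_normal_prob (s c : R) : s != 0 ->
  \int[P]_w (U w * fine (normal_prob (X w) s `]c, +oo[%classic)) =
  \int[leb]_a (\1_(`]c, +oo[%classic : set R) a * \int[P]_w (U w * normal_pdf 0 s (X w - a))).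
Proof.
move=> s0.
pose F (z : T * R) := U z.1 * (\1_(`]c, +oo[%classic : set R) z.2 * normal_pdf 0 s (X z.1 - z.2)).
have pdfE w a : normal_pdf 0 s (X w - a) = normal_pdf (X w) s a.
  rewrite [RHS]normal_pdf_shift// !normal_pdfE// -normal_funN; congr (_ * normal_fun _ _ _).
  by rewrite opprB.
have mF : measurable_fun setT F.
  apply: measurable_funM; first exact: measurableT_comp.
  apply: measurable_funM; first by apply: measurableT_comp.
  apply: (measurableT_comp (measurable_normal_pdf _ _)).
  by apply: measurable_funB => //; exact: measurableT_comp.
have M0 : 0 <= M by apply: (le_trans _ (UM point)).
transitivity (\int[P]_w \int[leb]_a F (w, a)).
  apply: eq_Rintegral => w _; rewrite /F/= RintegralZl//; last first.
    apply: (@le_integrable _ _ _ leb _ measurableT _ (fun a => (normal_pdf (X w) s a)%:E));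
      last exact: integrable_normal_pdf.
      apply/measurable_EFinP; apply: measurable_funM => //.
      apply: (measurableT_comp (measurable_normal_pdf _ _)).
      exact: measurable_funB.
    move=> a _; rewrite lee_fin pdfE normrM ler_piMl//.
    by rewrite indicE; case: (_ \in _); rewrite ?normr1 ?normr0.
  congr (_ * fine _); rewrite /normal_prob [LHS]integral_mkcond.
  apply: eq_integral => a _; rewrite patchE pdfE indicE.
  by case: ifP; rewrite ?mul1r ?mul0r.
rewrite (@Rintegral_fubini_bounded _ _ _ _ _ P leb F M)//; last first.
  move=> w; apply: (@le_trans _ _ (\int[leb]_a (M * normal_pdf (X w) s a)%:E)%E).
    apply: ge0_le_integral => //.
    - apply/measurable_EFinP; apply: measurableT_comp => //.
      by apply: (measurableT_comp mF); exact: pair1_measurable.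
    - apply/measurable_EFinP; apply: measurable_funM => //.
      exact: measurable_normal_pdf.
    - move=> a _; rewrite lee_fin /F/= normrM ler_pM// pdfE normrM.
      rewrite (ger0_norm (normal_pdf_ge0 _ _ _)) ler_piMl ?normal_pdf_ge0//.
      by rewrite indicE; case: (_ \in _); rewrite ?normr1 ?normr0.
  under eq_integral do rewrite EFinM.
  rewrite ge0_integralZl ?lee_fin// ?integral_normal_pdf ?mule1//.
    by apply/measurable_EFinP; exact: measurable_normal_pdf.
  by move=> t _; rewrite lee_fin normal_pdf_ge0.
apply: eq_Rintegral => a _; rewrite /F/= -RintegralZl//.
  by apply: eq_Rintegral => w _; rewrite mulrCA.
apply: (@integrable_weight (fun x => normal_pdf 0 s (x - a)) (normal_peak s)).
  apply: (measurableT_comp (measurable_normal_pdf _ _)).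
  exact: measurable_funB.
by move=> x; rewrite ger0_norm ?normal_pdf_ge0// normal_pdf_ub.
Qed.

End one_space.

Lemma Rintegral_dominated_cvg d (T : measurableType d) (mu : {measure set T -> \bar R})
    (f_ : nat -> T -> R) (f g : T -> R) :
  (forall n, measurable_fun setT (f_ n)) ->
  (forall x, (fun n => f_ n x) @ \oo --> f x) ->
  mu.-integrable setT (EFin \o g) -> (forall n x, `|f_ n x| <= g x) ->
  mu.-integrable setT (EFin \o f) /\
  (fun n => \int[mu]_x f_ n x) @ \oo --> \int[mu]_x f x.
Proof.
move=> mf_ f_f ig fg.
have mf : measurable_fun setT f.
  by apply: (measurable_fun_cvg mf_) => x _; exact: f_f.
have [|||||if_ _ H] := @dominated_convergence _ _ _ mu setT measurableT
    (fun n x => (f_ n x)%:E) (EFin \o f) (EFin \o g).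
- by move=> n; exact/measurable_EFinP.
- exact/measurable_EFinP.
- by apply/aeW => x _; apply: cvg_EFin; [exact: nearW | exact: f_f].
- exact: ig.
- by apply/aeW => x n _; rewrite lee_fin.
split => //; apply: fine_cvg; rewrite fineK//.
exact: integrable_fin_num.
Qed.

(** The standard deviation 1/(n+1)^2 is negligible against the offset 1/(n+1) of the ray. Without
    the offset the limit at x = c would be 1/2 instead of the value 0 of the indicator of the open
    ray. *)
Lemma normal_prob_gt_cvg (c x : R) :
  (fun n => fine (normal_prob x (n.+1%:R ^-2) `]c + n.+1%:R^-1, +oo[%classic))
  @ \oo --> (\1_(`]c, +oo[%classic : set R) x : R).
Proof.
pose r n : R := n.+1%:R^-1.
have r0 n : 0 < r n by rewrite invr_gt0.
have sE n : n.+1%:R ^-2 = r n ^+ 2 by rewrite /r exprVn.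
have s0 n : n.+1%:R ^-2 != 0 :> R by rewrite sE gt_eqF// exprn_gt0.
have rc : r @ \oo --> 0 by exact: cvg_harmonic.
rewrite indicE; have [|] := boolP (x \in _).
  rewrite inE/= in_itv/= andbT => cx /=.
  have H : (fun n => 1 - 4 / (x - c) ^+ 2 * r n ^+ 4) @ \oo --> (1 : R).
    have : (fun n => 1 - 4 / (x - c) ^+ 2 * r n ^+ 4) @ \oo
        --> 1 - 4 / (x - c) ^+ 2 * 0 ^+ 4.
      apply: cvgB; first exact: cvg_cst.
      apply: cvgM; first exact: cvg_cst.
      by apply: (continuous_cvg _ (@exprn_continuous _ 4 0)).
    by rewrite expr0n/= mulr0 subr0.
  apply: (@squeeze_cvgr _ _ _ _ _ (cst 1) _ _ _ H); last exact: cvg_cst.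
  have h0 : 0 < (x - c) / 2 by lra.
  near=> n.
  have rn : r n <= (x - c) / 2.
    by near: n; exact: (cvgr_le _ rc).
  apply/andP; split; last first.
    rewrite -lee_fin fineK ?probability_le1//.
    by rewrite fin_num_measure.
  rewrite lerBlDr -lerBlDl -lee_fin.
  have -> : (1 - fine (normal_prob x (n.+1%:R ^-2) `]c + n.+1%:R^-1, +oo[%classic))%:E
      = normal_prob x (n.+1%:R ^-2) (~` `]c + n.+1%:R^-1, +oo[%classic).
    by rewrite probability_setC// EFinB fineK// fin_num_measure.
  apply: (le_trans (normal_prob_far (m := x) (s0 n) h0 _ _)) => //.
  - exact: measurableC.
  - move=> y /=; rewrite in_itv/= andbT => /negP; rewrite -leNgt => yc.
    rewrite ler0_norm; last by rewrite -/(r n) in yc; lra.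
    by rewrite -/(r n) in yc; lra.
  - rewrite lee_fin sE -exprM le_eqVlt; apply/orP; left; apply/eqP.
    by field; lra.
rewrite notin_setE/= in_itv/= andbT => /negP; rewrite -leNgt => xc.
have H : (fun n => r n ^+ 2) @ \oo --> (0 : R).
  have : (fun n => r n ^+ 2) @ \oo --> (0 ^+ 2 : R).
    by apply: (continuous_cvg _ (@exprn_continuous _ 2 0)).
  by rewrite expr0n.
apply: (@squeeze_cvgr _ _ _ _ (cst 0) _ _ _ _ _ H); last exact: cvg_cst.
near=> n; apply/andP; split; first by rewrite fine_ge0.
rewrite -lee_fin fineK ?fin_num_measure//.
apply: (le_trans (normal_prob_far (m := x) (s0 n) (r0 n) _ _)) => //.
  move=> y /=; rewrite in_itv/= andbT -/(r n) => yc.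
  by have rn0 := r0 n; rewrite ler_normr; apply/orP; left; lra.
rewrite lee_fin sE le_eqVlt; apply/orP; left; apply/eqP.
by field; rewrite gt_eqF.
Unshelve. all: end_near. Qed.

Lemma measurable_normal_prob (s : R) (A : set R) : measurable A ->
  measurable_fun setT (fun x => normal_prob x s A).
Proof.
move=> mA; have [->|s0] := eqVneq s 0.
  (* For [s = 0] the density [normal_pdf] takes a default value that does not depend on the mean. *)
  rewrite [X in measurable_fun _ X](_ : _ = cst (normal_prob 0 0 A)) //.
  by apply/funext => x; rewrite /normal_prob /normal_pdf eqxx.
pose F (z : R * R) := (\1_A z.2 * normal_pdf 0 s (z.2 - z.1))%:E.
rewrite [X in measurable_fun _ X](_ : _ = fubini_F leb F).
  apply: measurable_fun_fubini_tonelli_F => [|z].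
    apply/measurable_EFinP; apply: measurable_funM.
      by apply: measurableT_comp.
    apply: (measurableT_comp (measurable_normal_pdf _ _)).
    exact: measurable_funB.
  by rewrite lee_fin mulr_ge0 ?normal_pdf_ge0.
apply/funext => x; rewrite /normal_prob /fubini_F [LHS]integral_mkcond.
apply: eq_integral => a _; rewrite patchE /F/= -normal_pdf_shift// indicE.
by case: ifP; rewrite ?mul1r ?mul0r.
Qed.

Section two_spaces.
Context d (T : measurableType d) (P : probability T R) (U X : T -> R).
Context d' (T' : measurableType d') (P' : probability T' R) (U' X' : T' -> R).
Variable M : R.
Hypotheses (mU : measurable_fun setT U) (UM : forall w, `|U w| <= M)
  (mX : measurable_fun setT X).
Hypotheses (mU' : measurable_fun setT U') (UM' : forall w, `|U' w| <= M)
  (mX' : measurable_fun setT X').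
Hypothesis Hcos : forall t,
  \int[P]_w (U w * cos (t * X w)) = \int[P']_w (U' w * cos (t * X' w)).
Hypothesis Hsin : forall t,
  \int[P]_w (U w * sin (t * X w)) = \int[P']_w (U' w * sin (t * X' w)).

Let ray (c : R) : set R := `]c, +oo[%classic.

Let eq_ray (c : R) :
  \int[P]_w (U w * \1_(ray c) (X w)) = \int[P']_w (U' w * \1_(ray c) (X' w)).
Proof.
pose phi n x : R := fine (normal_prob x (n.+1%:R ^-2) (ray (c + n.+1%:R^-1))).
have s0 n : n.+1%:R ^-2 != 0 :> R by rewrite invr_eq0 expf_neq0.
have phi1 n x : `|phi n x| <= 1.
  rewrite ger0_norm ?fine_ge0// -lee_fin fineK ?probability_le1//;
    try exact: measurable_itv.
  by rewrite fin_num_measure//; exact: measurable_itv.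
have cvg_phi e (S : measurableType e) (Q : probability S R) (V Y : S -> R) :
    measurable_fun setT V -> (forall w, `|V w| <= M) -> measurable_fun setT Y ->
    (fun n => \int[Q]_w (V w * phi n (Y w))) @ \oo -->
    \int[Q]_w (V w * \1_(ray c) (Y w)).
  move=> mV VM mY.
  apply: (@Rintegral_dominated_cvg _ _ _ (fun n w => V w * phi n (Y w)) _ (cst M) _ _ _ _).2.
  - move=> n; apply: measurable_funM => //; apply: measurableT_comp => //.
    apply: measurableT_comp => //; apply: measurable_normal_prob => //.
    exact: measurable_itv.
  - move=> w; apply: cvgM; first exact: cvg_cst.
    exact: normal_prob_gt_cvg.
  - exact: finite_measure_integrable_cst.
  - by move=> n w; rewrite normrM -[M]mulr1 ler_pM.
have H1 := cvg_phi _ _ P U X mU UM mX.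
have H2 := cvg_phi _ _ P' U' X' mU' UM' mX'.
rewrite -(cvg_lim (@Rhausdorff R) H1) -(cvg_lim (@Rhausdorff R) H2).
congr (limn _); apply/funext => n.
rewrite /phi (weight_normal_prob P mU UM mX) ?(weight_normal_prob P' mU' UM' mX')//.
apply: eq_Rintegral => a _; congr (_ * _).
have s1 : n.+1%:R ^+ 2 != 0 :> R by rewrite expf_neq0.
rewrite -[n.+1%:R ^-2]/((n.+1%:R ^+ 2)^-1).
rewrite (weight_normal_pdf P mU UM mX)// (weight_normal_pdf P' mU' UM' mX')//.
congr (_ * _); apply: eq_Rintegral => t _.
by rewrite Hcos Hsin.
Qed.

(** Rays are stable under intersection and generate the Borel sets, and the sets on which both sides
    agree form a Dynkin system; complements use the total weight, which is [Hcos] at 0. The weight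
    may change sign, which allows trigonometric weights in [eq_cylinder_trig]. *)
Lemma eq_weighted_law (A : set R) : measurable A ->
  \int[P]_w (U w * \1_A (X w)) = \int[P']_w (U' w * \1_A (X' w)).
Proof.
have H0 : \int[P]_w U w = \int[P']_w U' w.
  have := Hcos 0; under eq_Rintegral do rewrite mul0r cos0 mulr1.
  by under [RHS]eq_Rintegral do rewrite mul0r cos0 mulr1.
have iU (B : set R) : measurable B ->
    P.-integrable setT (EFin \o (fun w => U w * \1_B (X w))).
  move=> mB; apply: (@integrable_weight _ _ _ _ _ M mU UM mX _ 1) => //.
  by move=> x; rewrite indicE; case: (_ \in _); rewrite ?normr1 ?normr0.
have iU' (B : set R) : measurable B ->
    P'.-integrable setT (EFin \o (fun w => U' w * \1_B (X' w))).
  move=> mB; apply: (@integrable_weight _ _ _ _ _ M mU' UM' mX' _ 1) => //.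
  by move=> x; rewrite indicE; case: (_ \in _); rewrite ?normr1 ?normr0.
pose G : set (set R) := [set B | exists c, B = ray c].
pose E (B : set R) :=
  \int[P]_w (U w * \1_B (X w)) = \int[P']_w (U' w * \1_B (X' w)).
move=> mA.
have mE : @measurable _ (measurableTypeR R) = <<s G >> by exact: RGenOInfty.measurableE.
apply: (@dynkin_induction _ (measurableTypeR R) G E) => //; last by rewrite -mE.
- move=> _ _ [a ->] [b ->]; exists (Num.max a b).
  apply/seteqP; split => x; rewrite /ray /= !in_itv/= !andbT gt_max.
    by case=> -> ->.
  by move/andP.
- by rewrite /E; under eq_Rintegral do rewrite indicT mulr1;
    under [RHS]eq_Rintegral do rewrite indicT mulr1.
- by move=> _ [c ->]; exact: eq_ray.
- move=> S mS ES; rewrite /E.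
  have mSC : measurable (~` S) by exact: measurableC.
  have iC x : \1_(~` S) x = 1 - \1_S x :> R.
    by rewrite indicC indicE; case: (_ \in _); rewrite ?subrr ?subr0.
  under eq_Rintegral do rewrite iC mulrBr mulr1.
  under [RHS]eq_Rintegral do rewrite iC mulrBr mulr1.
  have iU0 : P.-integrable setT (EFin \o U).
    by have := iU _ measurableT; apply: eq_integrable => // w _ /=; rewrite indicT mulr1.
  have iU0' : P'.-integrable setT (EFin \o U').
    by have := iU' _ measurableT; apply: eq_integrable => // w _ /=; rewrite indicT mulr1.
  by rewrite !RintegralB ?H0 ?ES//; [exact: iU'|exact: iU].
- move=> F mF tF EF; rewrite /E.
  have cvg_F e (S : measurableType e) (Q : probability S R) (V Y : S -> R) :
      measurable_fun setT V -> (forall w, `|V w| <= M) -> measurable_fun setT Y ->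
      (fun n => \sum_(k < n) \int[Q]_w (V w * \1_(F k) (Y w))) @ \oo -->
      \int[Q]_w (V w * \1_(\bigcup_k F k) (Y w)).
    move=> mV VM mY.
    have iV (B : set R) : measurable B ->
      Q.-integrable setT (EFin \o (fun w => V w * \1_B (Y w))).
      move=> mB; apply: (@integrable_weight _ _ _ _ _ M mV VM mY _ 1) => //.
      by move=> x; rewrite indicE; case: (_ \in _); rewrite ?normr1 ?normr0.
    have mFn n : measurable (\big[setU/set0]_(k < n) F k) by exact: bigsetU_measurable.
    have -> : (fun n => \sum_(k < n) \int[Q]_w (V w * \1_(F k) (Y w)))
        = (fun n => \int[Q]_w (V w * \1_(\big[setU/set0]_(k < n) F k) (Y w))).
      apply/funext; elim=> [|n IH].
        rewrite !big_ord0; under eq_Rintegral do rewrite indic0 mulr0.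
        by rewrite Rintegral_cst// mul0r.
      rewrite big_ord_recr/= IH -RintegralD//; last 2 first.
      - exact: (iV _ (mFn n)).
      - exact: (iV _ (mF n)).
      apply: eq_Rintegral => w _; rewrite big_ord_recr/= -mulrDr; congr (_ * _).
      rewrite !indicE in_setU; have [Fn|] := boolP (Y w \in F n); last first.
        by rewrite orbF addr0.
      rewrite orbT; have [|_] := boolP (Y w \in \big[setU/set0]_(k < n) F k);
        last by rewrite add0r.
      rewrite -bigcup_mkord inE => -[k /= kn Fk].
      have := tF k n I I (ex_intro _ (Y w) (conj Fk (set_mem Fn))).
      by move=> kE; rewrite kE ltnn in kn.
    apply: (@Rintegral_dominated_cvg _ _ _
      (fun n w => V w * \1_(\big[setU/set0]_(k < n) F k) (Y w)) _ (cst M) _ _ _ _).2.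
    + move=> n; apply: measurable_funM => //; apply: measurableT_comp => //.
      by apply: measurable_indic; exact: mFn.
    + move=> w; apply: cvgM; first exact: cvg_cst.
      apply: cvg_near_cst; rewrite !indicE; have [|yF] := boolP (Y w \in \bigcup_k F k).
        rewrite inE => -[k _ Fk]; near=> n.
        rewrite indicE mem_set// -bigcup_mkord; exists k => //=.
        by near: n; exact: nbhs_infty_gt.
      near=> n; rewrite indicE memNset// -bigcup_mkord => -[k _ Fk].
      by move/negP: yF; apply; rewrite inE; exists k.
    + exact: finite_measure_integrable_cst.
    + move=> n w; rewrite normrM -[M]mulr1 ler_pM//.
      by rewrite indicE; case: (_ \in _); rewrite ?normr1 ?normr0.
  have H1 := cvg_F _ _ P U X mU UM mX.
  have H2 := cvg_F _ _ P' U' X' mU' UM' mX'.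
  rewrite -(cvg_lim (@Rhausdorff R) H1) -(cvg_lim (@Rhausdorff R) H2).
  by congr (limn _); apply/funext => n; apply: eq_bigr => k _; exact: EF.
Unshelve. all: end_near. Qed.

End two_spaces.
End one_dim_uniqueness.

(** * Uniqueness of laws with given characteristic functions *)

Section law_uniqueness.
Context d (T : measurableType d) (R : realType) (I : Type) (X : I -> T -> R).

(** Abstract coordinates: the real line, row vectors, sequences and products are all handled through
    such a family, so that one uniqueness theorem serves them all. *)
Definition generating : Prop :=
  (forall i, measurable_fun setT (X i)) /\
  @measurable _ T `<=` <<s \bigcup_(i in [set: I])
     preimage_set_system setT (X i) measurable >>.

Definition combo (l : seq (I * R)) (x : T) : R := \sum_(p <- l) p.2 * X p.1 x.

Fixpoint cylinder (l : seq (I * set R)) : set T :=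
  if l is p :: l' then X p.1 @^-1` p.2 `&` cylinder l' else setT.

Fixpoint all_measurable (l : seq (I * set R)) : Prop :=
  if l is p :: l' then measurable p.2 /\ all_measurable l' else True.

Hypothesis genX : generating.

Lemma measurable_combo l : measurable_fun setT (combo l).
Proof.
by apply: measurable_sum => p; apply: measurable_funM => //; exact: genX.1.
Qed.

Lemma measurable_cylinder l : all_measurable l -> measurable (cylinder l).
Proof.
elim: l => [_|p l IH /= [mp ml]]; first exact: measurableT.
apply: measurableI; last exact: IH.
by rewrite -[_ @^-1` _]setTI; exact: genX.1.
Qed.

Lemma cylinder_cat l1 l2 : cylinder (l1 ++ l2) = cylinder l1 `&` cylinder l2.
Proof. by elim: l1 => [|p l1 IH] /=; rewrite ?setTI// IH setIA. Qed.

Lemma all_measurable_cat l1 l2 :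
  all_measurable l1 -> all_measurable l2 -> all_measurable (l1 ++ l2).
Proof. by elim: l1 => [//|p l1 IH] /= [? /IH h] /h. Qed.

Section two_laws.
Variables P P' : probability T R.
Hypothesis eq_cos : forall l, \int[P]_x cos (combo l x) = \int[P']_x cos (combo l x).
Hypothesis eq_sin : forall l, \int[P]_x sin (combo l x) = \int[P']_x sin (combo l x).

Let trig (b : bool) : R -> R := if b then @cos R else @sin R.

Let measurable_trig b : measurable_fun setT (trig b).
Proof. by case: b; [exact: measurable_cos | exact: measurable_sin]. Qed.

Let trig_le1 b x : `|trig b x| <= 1.
Proof. by case: b; [exact: norm_cos_le1 | exact: norm_sin_le1]. Qed.

Let integrable_cyl (Q : probability T R) b l l' : all_measurable l ->
  Q.-integrable setT (EFin \o (fun x => \1_(cylinder l) x * trig b (combo l' x))).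
Proof.
move=> ml; apply: (@integrable_le_cst _ _ _ _ _ 1).
  apply: measurable_funM; first exact/measurable_indic/measurable_cylinder.
  by apply: measurableT_comp => //; exact: measurable_combo.
move=> x; rewrite normrM -[leRHS]mulr1 ler_pM// ?trig_le1//.
by rewrite indicE; case: (_ \in _); rewrite ?normr1 ?normr0.
Qed.

(** Induction on the number of coordinates constrained by the cylinder. With the remaining factors
    as a weight [U], the integrals of [U] times a cosine or sine of one more coordinate are, by
    product-to-sum formulas, integrals with a longer [combo] over a shorter cylinder. The induction
    hypothesis applies to these, and [eq_weighted_law] then restores the missing constraint. *)
Lemma eq_cylinder_trig l l' (b : bool) : all_measurable l ->
  \int[P]_x (\1_(cylinder l) x * trig b (combo l' x)) =
  \int[P']_x (\1_(cylinder l) x * trig b (combo l' x)).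
Proof.
elim: l l' b => [|[i A] l IH] l' b /=.
  move=> _; under eq_Rintegral do rewrite indicT mul1r.
  under [RHS]eq_Rintegral do rewrite indicT mul1r.
  by case: b; [exact: eq_cos | exact: eq_sin].
move=> [mA ml].
pose U x : R := \1_(cylinder l) x * trig b (combo l' x).
have UE x : \1_(X i @^-1` A `&` cylinder l) x * trig b (combo l' x)
    = U x * \1_A (X i x).
  rewrite /U mulrAC; congr (_ * _); rewrite !indicE in_setI.
  have -> : (x \in X i @^-1` A) = (X i x \in A) by apply/idP/idP; rewrite !inE.
  by rewrite andbC -mulnb natrM.
under eq_Rintegral do rewrite UE; under [RHS]eq_Rintegral do rewrite UE.
have mU : measurable_fun setT U.
  apply: measurable_funM; first exact/measurable_indic/measurable_cylinder.
  by apply: measurableT_comp => //; exact: measurable_combo.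
have U1 x : `|U x| <= 1.
  rewrite normrM -[leRHS]mulr1 ler_pM// ?trig_le1//.
  by rewrite indicE; case: (_ \in _); rewrite ?normr1 ?normr0.
have cE t x : combo ((i, t) :: l') x = t * X i x + combo l' x.
  by rewrite /combo big_cons.
pose K (Q : probability T R) c t : R :=
  \int[Q]_x (\1_(cylinder l) x * trig c (combo ((i, t) :: l') x)).
have KD (Q : probability T R) c t (k : R) : k * K Q c t + K Q c (- t) =
   \int[Q]_x (\1_(cylinder l) x * (k * trig c (combo ((i, t) :: l') x) +
               trig c (combo ((i, - t) :: l') x))).
  rewrite -RintegralZl//; last exact: integrable_cyl.
  rewrite -RintegralD//; [|exact/integrableRZ/integrable_cyl|exact: integrable_cyl].
  by apply: eq_Rintegral => x _; rewrite mulrDr mulrCA.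
have half (Q : probability T R) (h : T -> R) (k : R) : Q.-integrable setT (EFin \o h) ->
  \int[Q]_x (k * h x) = k * \int[Q]_x h x by move=> ih; rewrite RintegralZl.
(* Product-to-sum formulas, with the frequencies t and -t. A sine factor exchanges cosine and sine
   in the rest, which is why the induction runs over both values of [b]. *)
have tc t : forall Q : probability T R, \int[Q]_x (U x * cos (t * X i x))
    = 2^-1 * (1 * K Q b t + K Q b (- t)).
  move=> Q; rewrite KD -half; last first.
    have h1 := @integrable_cyl Q b l ((i, t) :: l') ml.
    have h2 := @integrable_cyl Q b l ((i, - t) :: l') ml.
    have := integrableRD h1 h2; apply: eq_integrable => // x _ /=.
    by rewrite mul1r mulrDr.
  apply: eq_Rintegral => x _; rewrite /U !cE; case: (b) => /=.
    by rewrite mulNr !cosD cosN sinN; field.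
  by rewrite mulNr !sinD cosN sinN; field.
have ts t : forall Q : probability T R, \int[Q]_x (U x * sin (t * X i x))
    = (if b then - 2^-1 else 2^-1) * (-1 * K Q (~~ b) t + K Q (~~ b) (- t)).
  move=> Q; rewrite KD -half; last first.
    have h1 := integrableRZ (-1) (@integrable_cyl Q (~~ b) l ((i, t) :: l') ml).
    have h2 := @integrable_cyl Q (~~ b) l ((i, - t) :: l') ml.
    have := integrableRD h1 h2; apply: eq_integrable => // x _ /=.
    by rewrite mulrDr mulrCA.
  apply: eq_Rintegral => x _; rewrite /U !cE; case: (b) => /=.
    by rewrite (mulNr t) !sinD cosN sinN; field.
  by rewrite (mulNr t) !cosD cosN sinN; field.
apply: (@eq_weighted_law _ _ _ P U (X i) _ _ P' U (X i) 1) => //; try exact: genX.1.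
- by move=> t; rewrite !tc /K !IH.
- by move=> t; rewrite !ts /K !IH.
Qed.

(** Characteristic functions of all finite linear combinations determine a law: with an empty
    combination, [eq_cylinder_trig] gives equality on cylinders, which are stable under intersection
    and generate the sigma-algebra. *)
Theorem eq_law (A : set T) : measurable A -> P A = P' A.
Proof.
pose G : set (set T) := [set B | exists2 l, all_measurable l & B = cylinder l].
have mG : @measurable _ T = <<s G >>.
  apply/seteqP; split => [B /genX.2|].
    apply: smallest_sub; first exact: smallest_sigma_algebra.
    move=> _ [i _ [C mC <-]]; apply: sub_sigma_algebra; exists [:: (i, C)] => //=.
    by rewrite setIT setTI.
  apply: smallest_sub; first exact: sigma_algebra_measurable.
  by move=> _ [l ml ->]; exact: measurable_cylinder.
apply: (measure_unique G (fun=> setT)) => //.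
- move=> _ _ [l1 m1 ->] [l2 m2 ->]; exists (l1 ++ l2); last by rewrite cylinder_cat.
  exact: all_measurable_cat.
- by move=> _; exists [::].
- by rewrite bigcup_const.
- move=> _ [l ml ->].
  have := @eq_cylinder_trig l [::] true ml.
  have e (Q : probability T R) :
      \int[Q]_x (\1_(cylinder l) x * trig true (combo [::] x)) = fine (Q (cylinder l)).
    rewrite /Rintegral; congr fine.
    rewrite -[in RHS](setIT (cylinder l)) -integral_indic//; last exact: measurable_cylinder.
    by apply: eq_integral => x _; rewrite /combo big_nil /trig cos0 mulr1.
  have fm (Q : probability T R) : Q (cylinder l) \is a fin_num.
    by apply: fin_num_measure; exact: measurable_cylinder.
  rewrite !e => h; have hP := fineK (fm P); have hP' := fineK (fm P').
  by rewrite -[LHS]hP h hP'.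
- by move=> _; rewrite ltey_eq fin_num_measure.
Qed.

End two_laws.
End law_uniqueness.

(** * Generating coordinates of vectors, sequences and products *)

Section generating_families.
Context (R : realType).

(** The sigma-algebra on the source is an arbitrary class [A] of sets rather than a canonical
    structure, so that it may be one generated in the middle of a proof. *)
Lemma generating_preimage d (T : measurableType d) I (X : I -> T -> R)
    (S : Type) (f : S -> T) (A : set (set S)) : generating X ->
  sigma_algebra setT A ->
  (forall i C, measurable C -> A (f @^-1` (X i @^-1` C))) ->
  forall B, measurable B -> A (f @^-1` B).
Proof.
move=> [_ gX] [A0 AC AU] AX B /gX.
suff : <<s \bigcup_(i in [set: I]) preimage_set_system setT (X i) measurable >>
    `<=` [set C | A (f @^-1` C)] by apply.
apply: smallest_sub.
  split => [/=|C /= AfC|F /= AF].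
  - by rewrite preimage_set0.
  - by rewrite setTD preimage_setC -setTD; exact: AC.
  - by rewrite preimage_bigcup; exact: AU.
by move=> _ [i _ [C mC <-]] /=; rewrite setTI; exact: AX.
Qed.

Lemma generating_measurable d (T : measurableType d) I (X : I -> T -> R)
    e (S : measurableType e) (f : S -> T) : generating X ->
  (forall i, measurable_fun setT (fun s => X i (f s))) -> measurable_fun setT f.
Proof.
move=> gX mf _ B mB; rewrite setTI.
apply: (generating_preimage gX (sigma_algebra_measurable S)) mB => i C mC.
by rewrite -[_ @^-1` _]setTI; exact: mf.
Qed.

Lemma generating_id : generating (fun (_ : unit) (x : R) => x).
Proof.
split=> [_|B mB]; first exact: measurable_id.
by apply: sub_sigma_algebra; exists tt => //; exists B => //; rewrite setTI.
Qed.

Lemma generating_mx m n :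
  generating (fun (ij : 'I_m * 'I_n) (M : 'M[R]_(m, n)) => M ij.1 ij.2).
Proof.
split => [ij _ B mB|//].
by apply: sub_sigma_algebra; exists ij => //; exists B.
Qed.

Lemma generating_rV n : generating (fun (j : 'I_n) (w : 'rV[R]_n) => w 0 j).
Proof.
split => [j|]; first exact: ((generating_mx 1 n).1 (0, j)).
move=> B /(generating_mx 1 n).2; apply: sub_smallest2r => //.
move=> _ [[i j] _ [C mC <-]]; exists j => //.
by exists C => //; rewrite (ord1 i).
Qed.

Lemma measurable_coord n (j : 'I_n) :
  measurable_fun setT (fun w : 'rV[R]_n => w 0 j).
Proof. exact: (generating_rV n).1. Qed.

Lemma measurable_rV n e (S : measurableType e) (f : S -> 'rV[R]_n) :
  (forall j, measurable_fun setT (fun s => f s 0 j)) -> measurable_fun setT f.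
Proof. exact: (generating_measurable (generating_rV n)). Qed.

Lemma measurable_proj d (T : measurableType d) (k : nat) :
  measurable_fun setT (fun u : seqs T => u k).
Proof.
move=> _ B mB.
by apply: sub_sigma_algebra; exists k => //; exists B.
Qed.

Lemma measurable_seqs d (T : measurableType d) e (S : measurableType e)
    (f : S -> seqs T) :
  (forall k, measurable_fun setT (fun s => f s k)) -> measurable_fun setT f.
Proof.
move=> mf _ B mB; rewrite setTI.
suff : <<s @seqs_cylinders _ T >> `<=` [set C | measurable (f @^-1` C)] by apply.
apply: smallest_sub.
  split => [/=|C /= AfC|F /= AF].
  - by rewrite preimage_set0.
  - by rewrite setTD preimage_setC; exact: measurableC.
  - by rewrite preimage_bigcup; exact: bigcupT_measurable.
move=> _ [k _ [C mC <-]] /=; rewrite setTI.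
by rewrite -[_ @^-1` _]setTI; exact: mf.
Qed.

Lemma generating_seqs d (T : measurableType d) I (X : I -> T -> R) :
  generating X -> generating (fun (p : nat * I) (u : seqs T) => X p.2 (u p.1)).
Proof.
move=> gX; split => [[k i] /=|].
  by apply: (measurableT_comp (gX.1 i)); exact: measurable_proj.
apply: smallest_sub; first exact: smallest_sigma_algebra.
move=> _ [k _ [C mC <-]]; rewrite setTI.
apply: (generating_preimage gX (f := fun u : seqs T => u k)) mC.
  exact: smallest_sigma_algebra.
move=> i D mD; apply: sub_sigma_algebra; exists (k, i) => //.
by exists D => //; rewrite setTI.
Qed.

Lemma generating_prod d1 d2 (T1 : measurableType d1) (T2 : measurableType d2)
    I1 I2 (X1 : I1 -> T1 -> R) (X2 : I2 -> T2 -> R) :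
  generating X1 -> generating X2 ->
  generating (fun (i : I1 + I2) (z : T1 * T2) =>
    match i with inl i1 => X1 i1 z.1 | inr i2 => X2 i2 z.2 end).
Proof.
move=> g1 g2; split => [[i|i]|].
- exact: (measurableT_comp (g1.1 i)).
- exact: (measurableT_comp (g2.1 i)).
rewrite measurable_prod_measurableType.
apply: smallest_sub; first exact: smallest_sigma_algebra.
set A := <<s _ >>.
have sA : sigma_algebra setT A by exact: smallest_sigma_algebra.
move=> _ [B1 mB1] [B2 mB2] <-.
have -> : B1 `*` B2 = (fst @^-1` B1) `&` (snd @^-1` B2) :> set (T1 * T2) by [].
have h1 : A (fst @^-1` B1).
  apply: (generating_preimage g1 (f := @fst T1 T2) sA) mB1 => i C mC.
  by apply: sub_sigma_algebra; exists (inl i) => //; exists C => //; rewrite setTI.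
have h2 : A (snd @^-1` B2).
  apply: (generating_preimage g2 (f := @snd T1 T2) sA) mB2 => i C mC.
  by apply: sub_sigma_algebra; exists (inr i) => //; exists C => //; rewrite setTI.
pose S := g_sigma_algebraType (\bigcup_(i in [set: I1 + I2]) preimage_set_system [set: T1 * T2]
     (fun z => match i with inl i1 => X1 i1 z.1 | inr i2 => X2 i2 z.2 end) measurable).
exact: (@measurableI _ S _ _ h1 h2).
Qed.

End generating_families.

(** * Continuously differentiable functions *)

Section C1_calculus.
Context (R : realType) (V : normedModType R).
Implicit Types f g : V -> R.

Lemma C1_continuous (W : normedModType R) (f : V -> W) : C1 f -> continuous f.
Proof. by move=> [df _] z; exact: differentiable_continuous. Qed.

Lemma C1_intro f (df : V -> V -> R) : (forall z, differentiable f z) ->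
  (forall z v, 'd f z v = df z v) -> (forall v, continuous (df ^~ v)) -> C1 f.
Proof.
move=> hd dE hc; split=> // v.
by have -> : (fun z => 'd f z v) = df ^~ v by apply/funext => z; exact: dE.
Qed.

Lemma C1_cst (a : R) : C1 (fun _ : V => a : R).
Proof.
apply: (@C1_intro _ (fun _ _ => 0)) => [z|z v|v z].
- exact: differentiable_cst.
- by have -> : 'd (fun _ : V => a : R) z = 0 :> (V -> R) by exact: diff_cst.
- exact: cvg_cst.
Qed.

Lemma diff_add f g z v : C1 f -> C1 g ->
  'd (fun z => f z + g z : R) z v = 'd f z v + 'd g z v.
Proof. by move=> [df _] [dg _]; rewrite (diffD (df z) (dg z)). Qed.

Lemma C1_add f g : C1 f -> C1 g -> C1 (fun z => f z + g z : R).
Proof.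
move=> cf cg; apply: (@C1_intro _ (fun z v => 'd f z v + 'd g z v)) => [z|z v|v z].
- exact: (differentiableD (cf.1 z) (cg.1 z)).
- exact: diff_add.
- by apply: cvgD; [exact: cf.2|exact: cg.2].
Qed.

Lemma diff_mul f g z v : C1 f -> C1 g ->
  'd (fun z => f z * g z : R) z v = f z * 'd g z v + g z * 'd f z v.
Proof. by move=> [df _] [dg _]; rewrite (diffM (df z) (dg z)). Qed.

Lemma C1_mul f g : C1 f -> C1 g -> C1 (fun z => f z * g z : R).
Proof.
move=> cf cg; apply: (@C1_intro _ (fun z v => f z * 'd g z v + g z * 'd f z v))
  => [z|z v|v z].
- exact: (differentiableM (cf.1 z) (cg.1 z)).
- exact: diff_mul.
- have cf' : {for z, continuous f} by exact: C1_continuous.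
  have cg' : {for z, continuous g} by exact: C1_continuous.
  exact: cvgD (cvgM cf' (cg.2 v z)) (cvgM cg' (cf.2 v z)).
Qed.

Lemma C1_sum (I : Type) (s : seq I) (F : I -> V -> R) :
  (forall i, C1 (F i)) -> C1 (fun z => \sum_(i <- s) F i z : R).
Proof.
move=> cF; elim: s => [|i s IH].
  have -> : (fun z => \sum_(i <- [::]) F i z : R) = fun _ => 0.
    by apply/funext => z; rewrite big_nil.
  exact: C1_cst.
have -> : (fun z => \sum_(j <- i :: s) F j z : R) = fun z => F i z + \sum_(i <- s) F i z.
  by apply/funext => z; rewrite big_cons.
exact: (C1_add (cF i) IH).
Qed.

Lemma C1_prod (I : Type) (s : seq I) (F : I -> V -> R) :
  (forall i, C1 (F i)) -> C1 (fun z => \prod_(i <- s) F i z : R).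
Proof.
move=> cF; elim: s => [|i s IH].
  have -> : (fun z => \prod_(i <- [::]) F i z : R) = fun _ => 1.
    by apply/funext => z; rewrite big_nil.
  exact: C1_cst.
have -> : (fun z => \prod_(j <- i :: s) F j z : R) = fun z => F i z * \prod_(i <- s) F i z.
  by apply/funext => z; rewrite big_cons.
exact: (C1_mul (cF i) IH).
Qed.

Lemma C1_det n (M : V -> 'M[R]_n) :
  (forall i j, C1 (fun z => M z i j : R)) -> C1 (fun z => \det (M z) : R).
Proof.
move=> cM; rewrite /determinant; apply: C1_sum => s.
by apply: C1_mul; [exact: C1_cst | exact: C1_prod].
Qed.

Lemma C1_adj n (M : V -> 'M[R]_n) :
  (forall i j, C1 (fun z => M z i j : R)) ->
  forall i j, C1 (fun z => (\adj (M z)) i j : R).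
Proof.
move=> cM i j.
have -> : (fun z => (\adj (M z)) i j : R) = fun z =>
    (-1) ^+ (j + i) * \det (\matrix_(k, l) (M z) (lift j k) (lift i l)).
  apply/funext => z; rewrite mxE /cofactor; congr (_ * \det _).
  by apply/matrixP => k l; rewrite !mxE.
apply: C1_mul; first exact: C1_cst.
apply: C1_det => k l.
have -> : (fun z => (\matrix_(k, l) (M z) (lift j k) (lift i l)) k l : R)
    = fun z => M z (lift j k) (lift i l) by apply/funext => z; rewrite mxE.
exact: cM.
Qed.

Lemma diff_comp_real (h h' : R -> R) f z v : (forall x : R, is_derive x 1 h (h' x)) ->
  C1 f -> 'd (fun z => h (f z) : R) z v = h' (f z) * 'd f z v.
Proof.
move=> dh cf.
have dh' : differentiable h (f z) by apply/derivable1_diffP; case: (dh (f z)).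
have -> : (fun z => h (f z) : R) = h \o f by [].
rewrite (diff_comp (cf.1 z) dh')/= deriv1E; last by case: (dh (f z)).
by rewrite derive1E (@derive_val _ _ _ _ _ _ _ (dh (f z))) mulrC.
Qed.

Lemma C1_comp_real (h h' : R -> R) f : (forall x : R, is_derive x 1 h (h' x)) ->
  continuous h' -> C1 f -> C1 (fun z => h (f z) : R).
Proof.
move=> dh ch cf; apply: (@C1_intro _ (fun z v => h' (f z) * 'd f z v)) => [z|z v|v z].
- apply: (@differentiable_comp _ _ _ _ f h); first exact: cf.1.
  by apply/derivable1_diffP; case: (dh (f z)).
- exact: diff_comp_real.
- have cf' : {for z, continuous f} by exact: C1_continuous.
  exact: cvgM (continuous_comp cf' (ch _)) (cf.2 v z).
Qed.

Lemma diff_coord n (F : V -> 'rV[R]_n) i z v : differentiable F z ->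
  'd (fun z => F z 0 i : R) z v = ('d F z v) 0 i.
Proof.
move=> dF.
have -> : (fun z => F z 0 i : R) = (fun N : 'rV[R]_n => N 0 i) \o F by [].
rewrite (diff_comp dF (differentiable_coord _ _ _))/=.
have @l : {linear 'rV[R]_n -> R}.
  by exists (fun N : 'rV[R]_n => N 0 i); do 2![eexists]; do ?[constructor];
     rewrite ?mxE// => ? *; rewrite ?mxE//; move=> ?; rewrite !mxE.
have -> : (fun N : 'rV[R]_n => N 0 i) = l by [].
by rewrite diff_lin//; exact: coord_continuous.
Qed.

Lemma C1_coord n (F : V -> 'rV[R]_n) i : C1 F -> C1 (fun z => F z 0 i : R).
Proof.
move=> cF; apply: (@C1_intro _ (fun z v => ('d F z v) 0 i)) => [z|z v|v z].
- apply: (@differentiable_comp _ _ _ _ F (fun N : 'rV[R]_n => N 0 i)); first exact: cF.1.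
  exact: differentiable_coord.
- by apply: diff_coord; exact: cF.1.
- apply: (@continuous_comp _ _ _ (fun z => 'd F z v) (fun N : 'rV[R]_n => N 0 i)).
    exact: cF.2.
  exact: coord_continuous.
Qed.

Lemma rV_basis n (x : 'rV[R]_n) : x = \sum_i x 0 i *: delta_mx 0 i.
Proof. by rewrite {1}[x]row_sum_delta. Qed.

Lemma diff_comp_rV n (F : V -> 'rV[R]_n) (phi : 'rV[R]_n -> R) z v :
  C1 F -> C1 phi ->
  'd (fun z => phi (F z) : R) z v
  = \sum_i 'd phi (F z) (delta_mx 0 i) * 'd (fun z => F z 0 i : R) z v.
Proof.
move=> cF cphi.
have -> : (fun z => phi (F z) : R) = phi \o F by [].
rewrite (diff_comp (cF.1 z) (cphi.1 _))/=.
rewrite [in LHS](rV_basis ('d F z v)) linear_sum/=; apply: eq_bigr => i _.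
by rewrite linearZ/= (diff_coord i v (cF.1 z)) [RHS]mulrC.
Qed.

Lemma continuous_at_sum (I : Type) (s : seq I) (F : I -> V -> R) z :
  (forall i, {for z, continuous (F i)}) ->
  {for z, continuous (fun z => \sum_(i <- s) F i z)}.
Proof.
move=> cF; elim: s => [|i s IH].
  have -> : (fun z => \sum_(i <- [::]) F i z : R) = fun _ => 0.
    by apply/funext => y; rewrite big_nil.
  exact: cvg_cst.
have -> : (fun z => \sum_(j <- i :: s) F j z : R) = fun z => F i z + \sum_(i <- s) F i z.
  by apply/funext => y; rewrite big_cons.
exact: cvgD (cF i) IH.
Qed.

Lemma C1_comp_rV n (F : V -> 'rV[R]_n) (phi : 'rV[R]_n -> R) :
  C1 F -> C1 phi -> C1 (fun z => phi (F z) : R).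
Proof.
move=> cF cphi; apply: (@C1_intro _ (fun z v =>
   \sum_i 'd phi (F z) (delta_mx 0 i) * 'd (fun z => F z 0 i : R) z v)) => [z|z v|v z].
- exact: (@differentiable_comp _ _ _ _ F phi _ (cF.1 z) (cphi.1 _)).
- exact: diff_comp_rV.
- apply: continuous_at_sum => i.
  have h1 : {for z, continuous (fun z => 'd phi (F z) (delta_mx 0 i))}.
    apply: (@continuous_comp _ _ _ F (fun y => 'd phi y (delta_mx 0 i))).
      exact: C1_continuous.
    exact: cphi.2.
  exact: cvgM h1 ((C1_coord i cF).2 v z).
Qed.

Lemma is_derive_path f (z v : V) (t : R) : C1 f ->
  is_derive t 1 (fun t : R => f (z + t *: v)) ('d f (z + t *: v) v).
Proof.
move=> cf.
pose p : R -> V := cst z + ( *:%R^~ v).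
have dp : is_diff (t : R) p (0 + ( *:%R^~ v)) by exact: is_diffD.
have dpt : differentiable p t by exact: (@ex_diff _ _ _ _ _ _ _ dp).
have dft : differentiable f (p t) by exact: cf.1.
apply: (@DeriveDef _ _ _ t 1 (f \o p)).
  by apply: diff_derivable; exact: differentiable_comp.
rewrite deriveE; last exact: differentiable_comp.
rewrite (diff_comp dpt dft)/= (@diff_val _ _ _ _ _ _ _ dp).
by rewrite add0r scale1r.
Qed.

End C1_calculus.

(** * Continuous functions are measurable *)

Section borel.
Context (R : realType).

(** The link between a topology and a sigma-algebra generated by coordinates: a set that is a
    neighbourhood of each of its points is a countable union of the [B i]. The notion passes to
    products, where the sigma-algebra is the product one. *)
Definition countable_network d (T : measurableType d) (nb : T -> set (set T)) : Prop :=
  exists (I : countType) (B : I -> set T),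
    (forall i, measurable (B i)) /\
    forall x U, nb x U -> exists i, B i x /\ B i `<=` U.

Lemma network_measurable d (T : measurableType d) (nb : T -> set (set T)) (U : set T) :
  countable_network nb -> (forall x, U x -> nb x U) -> measurable U.
Proof.
move=> [I [B [mB nbB]]] hU.
have -> : U = \bigcup_i (if `[< B i `<=` U >] then B i else set0).
  apply/seteqP; split => [x Ux|x [i _]]; last by case: asboolP => // BU /BU.
  have [i [Bx BU]] := nbB x U (hU x Ux).
  by exists i => //; case: asboolP.
apply: countable_bigcupT_measurable => // i.
by case: asboolP => _; [exact: mB | exact: measurable0].
Qed.

Lemma network_continuous d (T : measurableType d) (nb : T -> set (set T)) (f : T -> R) :
  countable_network nb ->
  (forall x (V : set R), open V -> V (f x) -> nb x (f @^-1` V)) ->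
  measurable_fun setT f.
Proof.
move=> nT cf; apply: (measurability (@RGenOpens.G R)).
  exact: RGenOpens.measurableE.
move=> _ [_ [x [y ->]] <-]; rewrite setTI.
by apply: (network_measurable nT) => z fz; apply: cf.
Qed.

Lemma network_prod d1 d2 (T1 : measurableType d1) (T2 : measurableType d2) nb1 nb2 :
  @countable_network _ T1 nb1 -> @countable_network _ T2 nb2 ->
  @countable_network _ (T1 * T2)%type (fun x => filter_prod (nb1 x.1) (nb2 x.2)).
Proof.
move=> [I1 [B1 [mB1 h1]]] [I2 [B2 [mB2 h2]]].
exists (I1 * I2)%type, (fun i => B1 i.1 `*` B2 i.2); split.
  by move=> i; exact: measurableX.
move=> [x1 x2] U [[U1 U2] /= [/h1[i1 [Bx1 BU1]] /h2[i2 [Bx2 BU2]]] UU].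
exists (i1, i2); split => // -[y1 y2] [/= /BU1 ? /BU2 ?]; exact: UU.
Qed.

Lemma network_rV n : @countable_network _ 'rV[R]_n (fun x => nbhs x).
Proof.
exists ('rV[rat]_n * rat)%type, (fun i : 'rV[rat]_n * rat => [set y : 'rV[R]_n |
  forall j, `|y 0 j - ratr (i.1 0 j)| < ratr i.2]); split.
  move=> [q r]/=.
  have -> : [set y : 'rV[R]_n | forall j, `|y 0 j - ratr (q 0 j)| < ratr r] =
    \bigcap_(j in [set: 'I_n]) ((fun y : 'rV[R]_n => y 0 j) @^-1`
       [set t | `|t - ratr (q 0 j)| < ratr r]).
    by apply/seteqP; split => [y yr j _|y yr j]; exact: yr.
  apply: fin_bigcap_measurable => [|j _]; first exact: finite_finset.
  rewrite -[_ @^-1` _]setTI; apply: measurable_coord => //.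
  have -> : [set t : R | `|t - ratr (q 0 j)| < ratr r]
      = `]ratr (q 0 j) - ratr r, ratr (q 0 j) + ratr r[%classic.
    apply/seteqP; split => t /=; rewrite in_itv/= ltr_norml => /andP[h1 h2];
      apply/andP; split; lra.
  exact: measurable_itv.
move=> x U /nbhs_ballP[e /= e0 eU].
have e2 : 0 < e / 2 by rewrite divr_gt0.
have [r] := rat_in_itvoo e2; rewrite in_itv/= => /andP[r0 re].
have /choice[q qP] : forall j, exists q : rat, `|x 0 j - ratr q| < ratr r.
  move=> j; have h : x 0 j - ratr r < x 0 j + ratr r by lra.
  have [q] := rat_in_itvoo h; rewrite in_itv/= => /andP[h1 h2].
  by exists q; rewrite ltr_norml; apply/andP; split; lra.
exists (\row_j q j, r) => /=; split=> [j|y yr]; first by rewrite mxE.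
apply: eU; split => // i j; rewrite (ord1 i).
have := qP j; have := yr j; rewrite mxE -ball_normE /= => h1 h2.
rewrite (_ : x 0 j - y 0 j = (x 0 j - ratr (q j)) - (y 0 j - ratr (q j))); last by ring.
by apply: le_lt_trans (ler_normB _ _) _; lra.
Qed.

Lemma measurable_continuous_rV n (f : 'rV[R]_n -> R) : continuous f ->
  measurable_fun setT f.
Proof.
move=> cf; apply: (network_continuous (network_rV n)) => x V oV Vfx.
by apply: cf; exact: open_nbhs_nbhs.
Qed.

Lemma measurable_continuous_prod n m (f : 'rV[R]_n * 'rV[R]_m -> R) : continuous f ->
  measurable_fun setT f.
Proof.
move=> cf; apply: (network_continuous (network_prod (network_rV n) (network_rV m)))
  => x V oV Vfx.
have := cf x V; apply; exact: open_nbhs_nbhs.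
Qed.

Lemma measurable_continuous_prod3 n m p (f : 'rV[R]_n * ('rV[R]_m * 'rV[R]_p) -> R) :
  continuous f -> measurable_fun setT f.
Proof.
move=> cf; apply: (network_continuous (network_prod (network_rV n)
  (network_prod (network_rV m) (network_rV p)))) => x V oV Vfx.
have := cf x V; apply; exact: open_nbhs_nbhs.
Qed.

End borel.

(** * Lebesgue measure on row vectors *)

Lemma sigma_finite_product d1 d2 (T1 : measurableType d1) (T2 : measurableType d2)
    (R : realType) (m1 : {sigma_finite_measure set T1 -> \bar R})
    (m2 : {sigma_finite_measure set T2 -> \bar R}) : sigma_finite setT (m1 \x m2)%E.
Proof.
have /sigma_finiteP[F [TF ndF Foo]] := sigma_finiteT m1.
have /sigma_finiteP[G [TG ndG Goo]] := sigma_finiteT m2.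
exists (fun n => F n `*` G n) => [|k].
  apply/esym/seteqP; split => // -[x y] _.
  have [i _ Fx] : (\bigcup_k F k) x by rewrite -TF.
  have [j _ Gy] : (\bigcup_k G k) y by rewrite -TG.
  exists (maxn i j) => //; split.
    by apply: (subsetPset _ _ (ndF _ _ (leq_maxl i j))).
  by apply: (subsetPset _ _ (ndG _ _ (leq_maxr i j))).
have [mF Fk] := Foo k; have [mG Gk] := Goo k; split; first exact: measurableX.
by rewrite product_measure1E// lte_mul_pinfty// ge0_fin_numE.
Qed.

Section sigma_finite_pack.
Context d (T : measurableType d) (R : realType) (mu : {measure set T -> \bar R}).

(** A copy of [mu] that carries the proof of sigma-finiteness as an argument, so that the structure
    can be attached to it. *)
Definition sigma_finite_pack (_ : sigma_finite setT mu) : set T -> \bar R := mu.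

Variable smu : sigma_finite setT mu.

HB.instance Definition _ := isMeasure.Build _ _ _ (sigma_finite_pack smu)
  (@measure0 _ _ _ mu) (@measure_ge0 _ _ _ mu) (@measure_semi_sigma_additive _ _ _ mu).

HB.instance Definition _ := Measure_isSigmaFinite.Build _ _ _
  (sigma_finite_pack smu) smu.

End sigma_finite_pack.

Section lebesgue_row_vectors.
Context (R : realType).
Local Notation leb := (@lebesgue_measure R).

Definition consr d (p : R * 'rV[R]_d) : 'rV[R]_d.+1 :=
  row_mx (p.1)%:M p.2 : 'rV[R]_(1 + d).

Lemma consr0 d (p : R * 'rV[R]_d) : consr p 0 ord0 = p.1.
Proof.
have -> : ord0 = lshift d (ord0 : 'I_1) by apply/val_inj.
transitivity ((p.1%:M : 'M[R]_1) 0 ord0); last by rewrite mxE eqxx mulr1n.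
exact: (@row_mxEl _ _ 1 d).
Qed.

Lemma consrS d (p : R * 'rV[R]_d) j : consr p 0 (lift ord0 j) = p.2 0 j.
Proof.
have -> : lift ord0 j = rshift 1 j by apply/val_inj.
exact: (@row_mxEr _ _ 1 d).
Qed.

Definition tailr d (w : 'rV[R]_d.+1) : 'rV[R]_d := \row_j w 0 (lift ord0 j).

Lemma consrK d (p : R * 'rV[R]_d) : (consr p 0 ord0, tailr (consr p)) = p.
Proof.
case: p => a z; rewrite consr0; congr (_, _).
by apply/rowP => j; rewrite mxE consrS.
Qed.

Lemma tailrK d (w : 'rV[R]_d.+1) : consr (w 0 ord0, tailr w) = w.
Proof.
apply/rowP => j; case: (unliftP ord0 j) => [k ->|->]; last by rewrite consr0.
by rewrite consrS mxE.
Qed.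

Lemma measurable_consr d : measurable_fun setT (@consr d).
Proof.
apply: measurable_rV => j; case: (unliftP ord0 j) => [k ->|->].
  have -> : (fun s : R * 'rV[R]_d => consr s 0 (lift ord0 k)) = fun s => s.2 0 k.
    by apply/funext => p; rewrite consrS.
  exact: (measurableT_comp (@measurable_coord R d k) measurable_snd).
have -> : (fun s : R * 'rV[R]_d => consr s 0 ord0) = fst.
  by apply/funext => p; rewrite consr0.
exact: measurable_fst.
Qed.

Lemma measurable_tailr d : measurable_fun setT (fun w : 'rV[R]_d.+1 => (w 0 ord0, tailr w)).
Proof.
apply/measurable_fun_pairP; split; first exact: measurable_coord.
apply: measurable_rV => j.
have -> : (fun w : 'rV[R]_d.+1 => tailr w 0 j) = fun w => w 0 (lift ord0 j).
  by apply/funext => w; rewrite /= mxE.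
exact: measurable_coord.
Qed.

(** The structure has to be built along the recursion on d, since each product needs the previous
    factor to be a sigma-finite measure. The equality of set functions then transports it to
    [lebesgue_rV] itself. *)
Lemma lebesgue_rV_measure d : exists m : {sigma_finite_measure set 'rV[R]_d -> \bar R},
  (m : set 'rV[R]_d -> \bar R) = lebesgue_rV R d.
Proof.
elim: d => [|d [m mE]].
  by exists [the {sigma_finite_measure set _ -> \bar R} of dirac (0 : 'rV[R]_0)].
have [mu muE] : exists mu : {measure set 'rV[R]_d.+1 -> \bar R},
    (mu : set _ -> \bar R) = pushforward (leb \x m)%E (@consr d).
  by exists (measure_function_pushforward__canonical__measure_function_Measure
   (leb \x m)%E (@measurable_consr d)).
have smu : sigma_finite setT mu.
  have [F TF Ffin] : sigma_finite setT (leb \x m)%E.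
    exact: sigma_finite_product.
  exists (fun n => (fun w : 'rV[R]_d.+1 => (w 0 ord0, tailr w)) @^-1` F n).
    by rewrite -preimage_bigcup -TF preimage_setT.
  move=> n; have [mF Fn] := Ffin n; split.
    by rewrite -[X in measurable X]setTI; exact: measurable_tailr.
  rewrite muE /pushforward.
  have -> : @consr d @^-1` ((fun w : 'rV[R]_d.+1 => (w 0 ord0, tailr w)) @^-1` F n) = F n.
    by apply/funext => p; rewrite /preimage/= consrK.
  exact: Fn.
exists [the {sigma_finite_measure set _ -> \bar R} of sigma_finite_pack smu].
by rewrite /= /sigma_finite_pack muE -mE.
Qed.

Let leb0 d : lebesgue_rV R d set0 = 0%E.
Proof. by have [m <-] := lebesgue_rV_measure d; exact: measure0. Qed.

Let leb_ge0 d A : (0 <= lebesgue_rV R d A)%E.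
Proof. by have [m <-] := lebesgue_rV_measure d; exact: measure_ge0. Qed.

Let leb_sigma_additive d : semi_sigma_additive (lebesgue_rV R d).
Proof.
by have [m <-] := lebesgue_rV_measure d; exact: measure_semi_sigma_additive.
Qed.

Let leb_sigma_finite d : sigma_finite setT (lebesgue_rV R d).
Proof. by have [m <-] := lebesgue_rV_measure d; exact: sigma_finiteT. Qed.

HB.instance Definition _ d := isMeasure.Build _ _ _ (lebesgue_rV R d)
  (leb0 d) (@leb_ge0 d) (@leb_sigma_additive d).

HB.instance Definition _ d := Measure_isSigmaFinite.Build _ _ _
  (lebesgue_rV R d) (leb_sigma_finite d).

Lemma ge0_integral_lebesgue_rVS d (f : 'rV[R]_d.+1 -> \bar R) :
  measurable_fun setT f -> (forall w, 0 <= f w)%E ->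
  (\int[lebesgue_rV R d.+1]_w f w =
   \int[(leb \x lebesgue_rV R d)]_p f (consr p))%E.
Proof.
move=> mf f0.
transitivity (\int[pushforward (leb \x lebesgue_rV R d) (@consr d)]_w f w)%E => //.
by rewrite ge0_integral_pushforward//; exact: measurable_consr.
Qed.

Lemma integrable_lebesgue_rVS d (f : 'rV[R]_d.+1 -> R) :
  (lebesgue_rV R d.+1).-integrable setT (EFin \o f) ->
  (leb \x lebesgue_rV R d)%E.-integrable setT (EFin \o (fun p => f (consr p))).
Proof.
move=> /integrableP[mf iF]; apply/integrableP; split.
  by apply: (measurableT_comp mf); exact: measurable_consr.
have m1 : measurable_fun setT (abse \o (EFin \o f)) by exact: measurableT_comp.
by have <- := ge0_integral_lebesgue_rVS m1 (fun w => abse_ge0 _).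
Qed.

Lemma Rintegral_lebesgue_rVS d (f : 'rV[R]_d.+1 -> R) :
  (lebesgue_rV R d.+1).-integrable setT (EFin \o f) ->
  \int[lebesgue_rV R d.+1]_w f w =
  \int[(leb \x lebesgue_rV R d)%E]_p f (consr p).
Proof.
move=> iF; rewrite /Rintegral; congr fine.
transitivity (\int[pushforward (leb \x lebesgue_rV R d) (@consr d)]_w (f w)%:E)%E => //.
rewrite integral_pushforward//.
- exact: measurable_consr.
- exact: (measurable_int _ iF).
- exact: integrable_lebesgue_rVS.
Qed.

Definition box d (B : R) : set 'rV[R]_d := [set w | forall j, `|w 0 j| <= B].

Lemma measurable_box d B : measurable (@box d B).
Proof.
have -> : @box d B = \bigcap_(j in [set: 'I_d])
    ((fun y : 'rV[R]_d => y 0 j) @^-1` `[- B, B]%classic).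
  apply/seteqP; split => [y yr j _|y yr j]; first by rewrite /= in_itv/= -ler_norml.
  by have := yr j I; rewrite /= in_itv/= -ler_norml.
apply: fin_bigcap_measurable => [|j _]; first exact: finite_finset.
rewrite -[_ @^-1` _]setTI; apply: measurable_coord => //; exact: measurable_itv.
Qed.

Lemma lebesgue_rV_box d B : (lebesgue_rV R d (@box d B) < +oo)%E.
Proof.
elim: d => [|d IH]; first by rewrite /= diracE ltry.
rewrite /= /pushforward.
have -> : (fun p : R * 'rV[R]_d => row_mx (p.1)%:M p.2 : 'rV[R]_(1 + d)) @^-1` @box d.+1 B
   = `[- B, B]%classic `*` @box d B.
  apply/seteqP; split => [p h|p [h1 h2] j].
    split; first by have := h ord0; rewrite [X in `|X|]consr0 /= in_itv/= -ler_norml.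
    by move=> j; have := h (lift ord0 j); rewrite [X in `|X|]consrS.
  case: (unliftP ord0 j) => [k ->|->]; first by rewrite [X in `|X|]consrS; exact: h2.
  by move: h1; rewrite [X in `|X|]consr0 /= in_itv/= -ler_norml.
rewrite product_measure1E//; [|exact: measurable_box].
have fin : leb `[- B, B]%classic \is a fin_num.
  by rewrite lebesgue_measure_itv/=; case: ifP.
exact: lte_mul_pinfty.
Qed.

Lemma compact_box d B : compact (@box d B).
Proof.
have -> : @box d B = [set v : 'rV[R]_d | forall i, `[- B, B]%classic (v 0 i)].
  by apply/seteqP; split => v h j; have := h j; rewrite /= in_itv/= -ler_norml.
exact: (@rV_compact R d (fun _ => `[- B, B]%classic) (fun _ => @segment_compact R (- B) B)).
Qed.

Lemma bounded_box d (f : 'rV[R]_d -> R) B : continuous f ->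
  (forall w, ~ box B w -> f w = 0) -> exists M, forall w, `|f w| <= M.
Proof.
move=> cf f0.
have [[w0 Bw0]|nB] := pselect (exists w, @box d B w); last first.
  exists 0 => w; rewrite f0 ?normr0// => Bw; apply: nB; by exists w.
have [||c _ cM] := @compact_EVT_max _ R (fun w => `|f w|) (@box d B) _ (@compact_box d B).
- by exists w0.
- apply: continuous_subspaceT => w; apply: continuous_comp; first exact: cf.
  exact: norm_continuous.
exists `|f c| => w; have [Bw|/f0 ->] := pselect (box B w); last by rewrite normr0.
by apply: cM; rewrite inE.
Qed.

Lemma integrable_box d (f : 'rV[R]_d -> R) B (M : R) : measurable_fun setT f ->
  (forall w, `|f w| <= M) ->
  (forall w, ~ box B w -> f w = 0) ->
  (lebesgue_rV R d).-integrable setT (EFin \o f).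
Proof.
move=> mf fM f0; apply/integrableP; split; first exact/measurable_EFinP.
have M0 : 0 <= M by apply: (le_trans _ (fM 0)).
apply: (@le_lt_trans _ _ (\int[lebesgue_rV R d]_w (M%:E * (\1_(box B) w)%:E))%E).
  apply: ge0_le_integral => //.
  - by apply/measurable_EFinP; apply: measurableT_comp.
  - apply: emeasurable_funM => //; apply/measurable_EFinP.
    by apply: measurable_indic; exact: measurable_box.
  - move=> w _ /=; rewrite -EFinM lee_fin indicE.
    have [|nB] := boolP (w \in box B); first by rewrite mulr1.
    by rewrite mulr0 f0 ?normr0//; rewrite notin_setE in nB.
rewrite ge0_integralZl//.
- by rewrite integral_indic ?setIT//; [exact: lte_mul_pinfty (lebesgue_rV_box d B)|exact: measurable_box].
- by apply/measurable_EFinP; apply: measurable_indic; exact: measurable_box.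
Qed.

(** A directional derivative sees only the values on a line. Partial derivatives of a function of a
    vector thus become derivatives of its restriction to one coordinate or to a block of
    coordinates. *)
Lemma is_derive_transfer (V V' W : normedModType R) (f : V -> W) (g : V' -> W)
    (x v : V) (y w : V') (l : W) :
  (forall h : R, f (h *: v + x) = g (h *: w + y)) ->
  is_derive x v f l -> is_derive y w g l.
Proof.
move=> fg [df vf].
have e : (fun h : R => h^-1 *: (f (h *: v + x) - f x))
    = (fun h : R => h^-1 *: (g (h *: w + y) - g y)).
  apply/funext => h; rewrite fg; congr (_ *: (_ - _)).
  by have := fg 0; rewrite !scale0r !add0r.
apply: DeriveDef.
  by move: df; rewrite /derivable e.
by rewrite -vf /derive e.
Qed.

Lemma continuous_consr d : continuous (@consr d).
Proof.
move=> p; apply/cvg_ballP => e e0.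
exists (ball p.1 e, ball p.2 e); first by split; exact: nbhsx_ballx.
move=> q [b1 b2]; split => // i j; rewrite (ord1 i).
case: (unliftP ord0 j) => [k ->|->]; last by rewrite !consr0.
by rewrite !consrS; exact: b2.2.
Qed.

Lemma continuous_consr_l d (z : 'rV[R]_d) : continuous (fun a => consr (a, z)).
Proof.
move=> a; apply/cvg_ballP => e e0.
have := @nbhsx_ballx _ _ a e e0; apply: filterS => b ab.
split => // i j; rewrite (ord1 i).
case: (unliftP ord0 j) => [k ->|->]; last by rewrite !consr0.
by rewrite !consrS; exact: ballxx.
Qed.

Lemma continuous_consr_r d (a : R) : continuous (fun z : 'rV[R]_d => consr (a, z)).
Proof.
move=> z U /(@continuous_consr d (a, z)) [[A C] [/= nA nC] AC].
apply: filterS nC => y Cy; apply: (AC (a, y)); split => //=.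
exact: nbhs_singleton nA.
Qed.

Lemma consr_shift_l d (a h : R) (z : 'rV[R]_d) :
  consr (h *: 1 + a, z) = h *: delta_mx 0 ord0 + consr (a, z).
Proof.
apply/rowP => j; rewrite [RHS]mxE [in RHS]mxE [in RHS]mxE.
case: (unliftP ord0 j) => [k ->|->]; last by rewrite !consr0/=; congr (_ * _ + _).
by rewrite !consrS/= mulr0 add0r.
Qed.

Lemma consr_shift_r d (a h : R) (z : 'rV[R]_d) j :
  consr (a, h *: delta_mx 0 j + z) = h *: delta_mx 0 (lift ord0 j) + consr (a, z).
Proof.
apply/rowP => l; rewrite [RHS]mxE [in RHS]mxE [in RHS]mxE.
case: (unliftP ord0 l) => [k ->|->]; last by rewrite !consr0/= mulr0 add0r.
by rewrite !consrS/= !mxE (inj_eq lift_inj).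
Qed.

Lemma open_not_box d B : open (~` @box d B).
Proof. by apply: closed_openC; apply: compact_closed; [exact: norm_hausdorff|exact: compact_box]. Qed.

(** Induction on the dimension by Fubini's theorem. The direction is either the first coordinate,
    where the fundamental theorem of calculus applies on each line, or one of the others, where the
    induction hypothesis applies to each slice. *)
Lemma integral_partial_eq0 d (u u' : 'rV[R]_d -> R) (k : 'I_d) B :
  continuous u -> continuous u' ->
  (forall z, is_derive z (delta_mx 0 k) u (u' z)) ->
  (forall w, ~ box B w -> u w = 0) ->
  \int[lebesgue_rV R d]_w u' w = 0.
Proof.
elim: d u u' k => [|d IH] u u' k cu cu' du u0; first by case: k du.
(* The complement of the box is open, so [u] vanishes near [w] and not only at [w]. *)
have u'0 w : ~ box B w -> u' w = 0.
  move=> nB.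
  have d0 : is_derive w (delta_mx 0 k) (cst 0 : 'rV[R]_d.+1 -> R) (u' w).
    apply: (near_eq_is_derive _ (du w)).
    have /open_nbhs_nbhs := conj (@open_not_box d.+1 B) nB.
    by apply: filterS => z nz; rewrite u0.
  have := @derive_val _ _ _ _ _ _ _ d0; rewrite derive_cst => <- //.
have [M uM] := bounded_box cu' u'0.
have mu' := measurable_continuous_rV cu'.
have iu' := integrable_box mu' uM u'0.
have ip := integrable_lebesgue_rVS iu'.
rewrite Rintegral_lebesgue_rVS//.
have boxE a z : box B (consr (a, z)) -> `|a| <= B /\ @box d B z.
  move=> h; split; first by have := h ord0; rewrite consr0.
  by move=> j; have := h (lift ord0 j); rewrite consrS.
case: (unliftP ord0 k) => [j kE|kE].
  rewrite /Rintegral -(integral12_prod_meas1 ip) integral0_eq// => a _.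
  have ca : continuous (fun z => u' (consr (a, z))).
    move=> z; apply: (@continuous_comp _ _ _ (fun z => consr (a, z)) u').
      exact: continuous_consr_r.
    exact: cu'.
  have ia := @integrable_box d (fun z => u' (consr (a, z))) B M
    (measurable_continuous_rV ca) (fun z => uM _) (fun z nz => u'0 _ (fun h => nz (boxE _ _ h).2)).
  have fa := integrable_fin_num measurableT ia.
  rewrite /fubini_F -[LHS](fineK fa); congr EFin.
  apply: (IH (fun z => u (consr (a, z))) (fun z => u' (consr (a, z))) j) => //.
  - move=> z; apply: (@continuous_comp _ _ _ (fun z => consr (a, z)) u).
      exact: continuous_consr_r.
    exact: cu.
  - move=> z; apply: is_derive_transfer (du (consr (a, z))) => h.
    by rewrite consr_shift_r kE.
  - by move=> z nz; apply: u0 => /boxE[].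
rewrite /Rintegral -(integral21_prod_meas1 ip) integral0_eq// => z _.
have cz : continuous (fun a => u' (consr (a, z))).
  move=> a; apply: (@continuous_comp _ _ _ (fun a => consr (a, z)) u').
    exact: continuous_consr_l.
  exact: cu'.
have iz : leb.-integrable setT (EFin \o (fun a => u' (consr (a, z)))).
  have i1 := @integrable_indic_itv R (- B) B true false.
  have := integrableZl measurableT M i1.
  apply: le_integrable => //.
    by apply/measurable_EFinP; exact: continuous_measurable_fun.
  move=> a _ /=; rewrite lee_fin indicE.
  have [|nB] := boolP (a \in _).
    by rewrite mulr1 => _; rewrite (le_trans (uM _))// ler_norm.
  rewrite mulr0 normr0 u'0 ?normr0// => /boxE[aB _]; move: nB.
  by rewrite notin_setE/= in_itv/= -ler_norml aB.
have fz := integrable_fin_num measurableT iz.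
rewrite /fubini_G -[LHS](fineK fz); congr EFin.
have u00 : forall a : R, B < `|a| -> u (consr (a, z)) = 0.
  by move=> a aB; apply: u0 => /boxE[]; rewrite leNgt aB.
apply: (@integral_derivative_eq0 _ (fun a => u (consr (a, z)))) => //.
- move=> a; apply: is_derive_transfer (du (consr (a, z))) => h.
  by rewrite consr_shift_l kE.
- apply: cvg_near_cst; near=> n; apply: u00; rewrite ger0_norm//.
  by near: n; exact: nbhs_infty_gtr.
- apply: cvg_near_cst; near=> n; apply: u00; rewrite normrN ger0_norm//.
  by near: n; exact: nbhs_infty_gtr.
Unshelve. all: end_near. Qed.

End lebesgue_row_vectors.

(** * Integration by parts along the noise *)

Section adjugate_identity.
Context (R : realType) (n d : nat).
Local Notation B := ('rV[R]_n * 'rV[R]_d)%type.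
Variable F : B -> 'rV[R]_n.
Hypothesis hF : C2 F.

Definition noise_dir (k : 'I_d) : B := (0, delta_mx 0 k).

Definition pdF (v : B) (i : 'I_n) (y : B) : R := ('d F y v) 0 i.

Lemma C1_pdF v i : C1 (pdF v i).
Proof. exact: (C1_coord i (hF.2 v)). Qed.

Lemma diff_F_coord v i y : 'd (fun z => F z 0 i : R) y v = pdF v i y.
Proof. by apply: diff_coord; exact: hF.1.1. Qed.

Definition mallM (y : B) : 'M[R]_n :=
  \matrix_(i, j) \sum_k pdF (noise_dir k) i y * pdF (noise_dir k) j y.

Lemma C1_mallM i j : C1 (fun y => mallM y i j : R).
Proof.
have -> : (fun y => mallM y i j : R)
    = fun y => \sum_k pdF (noise_dir k) i y * pdF (noise_dir k) j y.
  by apply/funext => y; rewrite mxE.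
by apply: C1_sum => k; apply: C1_mul; exact: C1_pdF.
Qed.

Definition mdet (y : B) : R := \det (mallM y).

Lemma C1_mdet : C1 mdet.
Proof. by apply: C1_det => i j; exact: C1_mallM. Qed.

(** In matrix form, (D_w F)^T adj(M) D_v F. As M adj(M) = det(M), moving the noise along this vector
    displaces [F] as the direction [v] does, multiplied by [mdet]: this is the vector field of
    Malliavin calculus with the inverse matrix cleared of its denominator. *)
Definition hvec (v : B) (k : 'I_d) (y : B) : R :=
  \sum_i \sum_j pdF (noise_dir k) i y * (\adj (mallM y) i j * pdF v j y).

Lemma C1_hvec v k : C1 (hvec v k).
Proof.
apply: C1_sum => i; apply: C1_sum => j; apply: C1_mul; first exact: C1_pdF.
apply: C1_mul; last exact: C1_pdF.
by apply: C1_adj => i' j'; exact: C1_mallM.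
Qed.

Lemma pdF_linear v w (a : R) i y : pdF (a *: v + w) i y = a * pdF v i y + pdF w i y.
Proof. by rewrite /pdF linearP !mxE. Qed.

Lemma hvec_linear v w (a : R) k y : hvec (a *: v + w) k y = a * hvec v k y + hvec w k y.
Proof.
rewrite /hvec mulr_sumr -big_split; apply: eq_bigr => i _.
rewrite /= mulr_sumr -big_split; apply: eq_bigr => j _ /=.
by rewrite pdF_linear; ring.
Qed.

Lemma sum_pdF_hvec v i y :
  \sum_k pdF (noise_dir k) i y * hvec v k y = mdet y * pdF v i y.
Proof.
transitivity (\sum_j (mallM y *m \adj (mallM y)) i j * pdF v j y).
  under eq_bigr do rewrite /hvec mulr_sumr.
  rewrite exchange_big/=.
  under eq_bigr do under eq_bigr do rewrite mulr_sumr.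
  under eq_bigr do rewrite exchange_big/=.
  rewrite exchange_big/=; apply: eq_bigr => j _.
  rewrite mxE mulr_suml; apply: eq_bigr => i' _.
  rewrite [mallM y i i']mxE !mulr_suml; apply: eq_bigr => k _; ring.
rewrite mul_mx_adj (bigD1 i)//= mxE eqxx mulr1n big1 ?addr0// => j ji.
by rewrite mxE eq_sym (negbTE ji) mulr0n mul0r.
Qed.

(* The factor [mdet] makes the direction [v] a combination of the noise
   directions with C1 coefficients, without dividing by the determinant. *)
Lemma diff_comp_mdet (phi : 'rV[R]_n -> R) v y : C1 phi ->
  'd (fun z => phi (F z) : R) y v * mdet y
  = \sum_k 'd (fun z => phi (F z) : R) y (noise_dir k) * hvec v k y.
Proof.
move=> cphi.
rewrite (diff_comp_rV _ _ hF.1 cphi) mulr_suml.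
under [RHS]eq_bigr do rewrite (diff_comp_rV _ _ hF.1 cphi) mulr_suml.
rewrite exchange_big/=; apply: eq_bigr => i _.
under [RHS]eq_bigr do rewrite diff_F_coord -mulrA.
by rewrite -mulr_sumr sum_pdF_hvec diff_F_coord; ring.
Qed.

End adjugate_identity.
Arguments noise_dir {R n d}.

Section slices.
Context (R : realType) (n d : nat).
Local Notation B := ('rV[R]_n * 'rV[R]_d)%type.

Definition noise_inj (z : 'rV[R]_d) : B := (0, z).

Lemma noise_injD (h : R) (z e : 'rV[R]_d) (b : B) :
  b + noise_inj (h *: e + z) = h *: noise_inj e + (b + noise_inj z).
Proof.
by rewrite /noise_inj; apply/eqP; rewrite xpair_eqE/=; apply/andP; split; apply/eqP;
  rewrite ?scaler0 ?addr0 ?add0r// addrCA.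
Qed.

Lemma is_derive_slice (u : B -> R) (b : B) (z : 'rV[R]_d) k : C1 u ->
  is_derive z (delta_mx 0 k) (fun z => u (b + noise_inj z))
    ('d u (b + noise_inj z) (noise_dir k)).
Proof.
move=> cu.
have du : is_derive (b + noise_inj z) (noise_dir k) u
    ('d u (b + noise_inj z) (noise_dir k)).
  apply: DeriveDef; first by apply: diff_derivable; exact: cu.1.
  by rewrite deriveE//; exact: cu.1.
by apply: is_derive_transfer du => h; rewrite noise_injD.
Qed.

Lemma continuous_slice (u : B -> R) (b : B) : continuous u ->
  continuous (fun z => u (b + noise_inj z)).
Proof.
move=> cu z; apply: (@continuous_comp _ _ _ (fun z => b + noise_inj z) u); last exact: cu.
have cz : {for z, continuous (fun z : 'rV[R]_d => noise_inj z)}.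
  move=> U [[A C] [/= nA nC] AC].
  apply: filterS nC => y Cy; apply: (AC (0, y)); split => //=.
  exact: nbhs_singleton nA.
have cb : {for z, continuous (fun _ : 'rV[R]_d => b)} by exact: cst_continuous.
exact: (continuousD cb cz).
Qed.

Definition dirder (u : B -> R) (v y : B) : R := 'd u y v.

Lemma is_derive_diff (V : normedModType R) (u : V -> R) (z v : V) : C1 u ->
  is_derive z v u ('d u z v).
Proof.
move=> cu; apply: DeriveDef; first by apply: diff_derivable; exact: cu.1.
by rewrite deriveE//; exact: cu.1.
Qed.

Lemma is_derive_mul3 (V : normedModType R) (f1 f2 f3 : V -> R) (z v : V) (d1 d2 d3 : R) :
  is_derive z v f1 d1 -> is_derive z v f2 d2 -> is_derive z v f3 d3 ->
  is_derive z v (fun z => f1 z * f2 z * f3 z)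
    (d1 * f2 z * f3 z + f1 z * (d2 * f3 z + f2 z * d3)).
Proof.
move=> h1 h2 h3; have h := is_deriveM (is_deriveM h1 h2) h3.
apply: (is_derive_eq h); rewrite /GRing.scale/=.
by rewrite -!mulrA !mulrDr; ring.
Qed.

End slices.
Arguments noise_inj {R n d}.

Section integration_by_parts.
Context (R : realType) (n d : nat).
Local Notation B := ('rV[R]_n * 'rV[R]_d)%type.
Local Notation leb := (lebesgue_rV R d).
Variable F : B -> 'rV[R]_n.
Hypothesis hF : C2 F.
Variables (chi : 'rV[R]_d -> R) (r : R).
Hypotheses (cchi : C1 chi) (chi0 : forall z, ~ box r z -> chi z = 0).

Lemma dchi0 z v : ~ box r z -> 'd chi z v = 0.
Proof.
move=> nB.
have d0 : is_derive z v (cst 0 : 'rV[R]_d -> R) ('d chi z v).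
  apply: (near_eq_is_derive _ (is_derive_diff z v cchi)).
  have /open_nbhs_nbhs := conj (@open_not_box R d r) nB.
  by apply: filterS => y ny; rewrite chi0.
by have := @derive_val _ _ _ _ _ _ _ d0; rewrite derive_cst => <-.
Qed.

Lemma continuous_mul (f g : 'rV[R]_d -> R) : continuous f -> continuous g ->
  continuous (fun z => f z * g z).
Proof. by move=> cf cg z; exact: (cvgM (cf z) (cg z)). Qed.

Lemma continuous_add (f g : 'rV[R]_d -> R) : continuous f -> continuous g ->
  continuous (fun z => f z + g z).
Proof. by move=> cf cg z; exact: (cvgD (cf z) (cg z)). Qed.

Lemma integrable_continuous_box (f : 'rV[R]_d -> R) : continuous f ->
  (forall z, ~ box r z -> f z = 0) -> leb.-integrable setT (EFin \o f).
Proof.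
move=> cf f0; have [M fM] := bounded_box cf f0.
exact: integrable_box (measurable_continuous_rV cf) fM f0.
Qed.

(** The derivative of [mdet F] along [v] times [chi], minus the divergence along the noise of
    [hvec F v] times [chi]: the weight that remains once no derivative falls on the test
    function. *)
Definition remainder (v y : B) (z : 'rV[R]_d) : R :=
  dirder (mdet F) v y * chi z
  - \sum_k (dirder (hvec F v k) (noise_dir k) y * chi z
            + hvec F v k y * 'd chi z (delta_mx 0 k)).

Let sl (b : B) (u : B -> R) z := u (b + noise_inj z).

Let csl b u : continuous u -> continuous (sl b u).
Proof. exact: continuous_slice. Qed.

Let cdiff (u : B -> R) v : C1 u -> continuous (fun y => 'd u y v).
Proof. by move=> [_ h]; exact: h. Qed.

(** By [diff_comp_mdet] the derivative of [phi] along [v], weighted by the determinant, is a sum of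
    derivatives along the noise, and each of them is integrated by parts against [hvec] times [chi].
    The right-hand side contains [phi] but not its derivative, hence bounds that depend only on the
    sup norm of [phi]. *)
Lemma integral_diff_mdet (phi : 'rV[R]_n -> R) (b v : B) : C1 phi ->
  \int[leb]_z ('d (fun y => phi (F y) * mdet F y : R) (b + noise_inj z) v * chi z)
  = \int[leb]_z (phi (F (b + noise_inj z)) * remainder v (b + noise_inj z) z).
Proof.
move=> cphi.
pose A y : R := phi (F y).
have cA : C1 A by exact: (C1_comp_rV hF.1 cphi).
have cAc := C1_continuous cA.
have cD := C1_mdet hF; have cDc := C1_continuous cD.
have cchic := C1_continuous cchi.
have ch k := C1_hvec hF v k.
have chc k := C1_continuous (ch k).
pose T k z := sl b (fun y => 'd A y (noise_dir k)) z * sl b (hvec F v k) z * chi z.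
pose Q k z := sl b A z * (sl b (fun y => 'd (hvec F v k) y (noise_dir k)) z * chi z
            + sl b (hvec F v k) z * 'd chi z (delta_mx 0 k)).
have cT k : continuous (T k) :=
  continuous_mul (continuous_mul (csl (b := b) (cdiff (v := noise_dir k) cA)) (csl (b := b) (chc k))) cchic.
have cQ k : continuous (Q k) :=
  continuous_mul (csl (b := b) cAc)
    (continuous_add (continuous_mul (csl (b := b) (cdiff (v := noise_dir k) (ch k))) cchic)
       (continuous_mul (csl (b := b) (chc k)) (cchi.2 (delta_mx 0 k)))).
have T0 k z : ~ box r z -> T k z = 0 by move=> nB; rewrite /T chi0// mulr0.
have Q0 k z : ~ box r z -> Q k z = 0.
  by move=> nB; rewrite /Q chi0// dchi0// !mulr0 addr0 mulr0.
have iT k := integrable_continuous_box (cT k) (T0 k).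
have iQ k := integrable_continuous_box (cQ k) (Q0 k).
have IBP k : \int[leb]_z T k z = - \int[leb]_z Q k z.
  apply/eqP; rewrite -addr_eq0 -RintegralD//; apply/eqP.
  apply: (@integral_partial_eq0 R d
    (fun z => sl b A z * sl b (hvec F v k) z * chi z) _ k r) => //.
  - exact: continuous_mul (continuous_mul (csl (b := b) cAc) (csl (b := b) (chc k))) cchic.
  - exact: (continuous_add (cT k) (cQ k)).
  - move=> z.
    have h1 := is_derive_slice b z k cA.
    have h2 := is_derive_slice b z k (ch k).
    have h3 := is_derive_diff z (delta_mx 0 k) cchi.
    exact: is_derive_mul3 h1 h2 h3.
  - by move=> z nB; rewrite chi0// mulr0.
have iTs : forall s : seq 'I_d,
    leb.-integrable setT (EFin \o (fun z => \sum_(k <- s) T k z)) /\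
    \int[leb]_z (\sum_(k <- s) T k z) = \sum_(k <- s) \int[leb]_z T k z.
  elim=> [|k s [IH1 IH2]].
    have e : (fun z => \sum_(k <- [::]) T k z) = cst 0.
      by apply/funext => z; rewrite big_nil.
    rewrite e big_nil; split; first exact: integrable0.
    by rewrite /Rintegral integral0.
  have e : (fun z => \sum_(k <- k :: s) T k z) = fun z => T k z + \sum_(k <- s) T k z.
    by apply/funext => z; rewrite big_cons.
  rewrite e big_cons -IH2; split; first exact: integrableRD.
  exact: RintegralD.
have iQs : forall s : seq 'I_d,
    leb.-integrable setT (EFin \o (fun z => \sum_(k <- s) Q k z)) /\
    \int[leb]_z (\sum_(k <- s) Q k z) = \sum_(k <- s) \int[leb]_z Q k z.
  elim=> [|k s [IH1 IH2]].
    have e : (fun z => \sum_(k <- [::]) Q k z) = cst 0.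
      by apply/funext => z; rewrite big_nil.
    rewrite e big_nil; split; first exact: integrable0.
    by rewrite /Rintegral integral0.
  have e : (fun z => \sum_(k <- k :: s) Q k z) = fun z => Q k z + \sum_(k <- s) Q k z.
    by apply/funext => z; rewrite big_cons.
  rewrite e big_cons -IH2; split; first exact: integrableRD.
  exact: RintegralD.
pose E z := sl b A z * (sl b (fun y => 'd (mdet F) y v) z * chi z).
have iE : leb.-integrable setT (EFin \o E).
  apply: integrable_continuous_box.
    exact: continuous_mul (csl (b := b) cAc) (continuous_mul (csl (b := b) (cdiff (v := v) cD)) cchic).
  by move=> z nB; rewrite /E chi0// !mulr0.
transitivity (\int[leb]_z (\sum_k T k z + E z)).
  apply: eq_Rintegral => z _.
  rewrite (diff_mul _ _ cA cD) /E /T /sl mulrDl addrC; congr (_ + _).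
    by rewrite [mdet _ _ * _]mulrC (diff_comp_mdet hF)// mulr_suml.
  by rewrite mulrA.
transitivity (\int[leb]_z (E z - \sum_k Q k z)); last first.
  apply: eq_Rintegral => z _; rewrite /E /Q /remainder -mulr_sumr -mulrBr.
  by [].
rewrite RintegralD//; last exact: (iTs _).1.
rewrite RintegralB//; last exact: (iQs _).1.
rewrite (iTs _).2 (iQs _).2 addrC; congr (_ + _).
by rewrite -sumrN; apply: eq_bigr => k _.
Qed.

End integration_by_parts.

Section bounded_functions.
Context (R : realType).

Definition bounded_fun_on (T : Type) (D : set T) (h : T -> R) : Prop :=
  exists M, forall t, D t -> `|h t| <= M.

Lemma bounded_fun_onD T (D : set T) (h1 h2 : T -> R) :
  bounded_fun_on D h1 -> bounded_fun_on D h2 -> bounded_fun_on D (fun t => h1 t + h2 t).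
Proof.
move=> [M1 h1M] [M2 h2M]; exists (M1 + M2) => t Dt.
by rewrite (le_trans (ler_normD _ _))// lerD ?h1M ?h2M.
Qed.

Lemma bounded_fun_onN T (D : set T) (h : T -> R) :
  bounded_fun_on D h -> bounded_fun_on D (fun t => - h t).
Proof. by move=> [M hM]; exists M => t Dt; rewrite normrN hM. Qed.

Lemma bounded_fun_onM T (D : set T) (h1 h2 : T -> R) :
  bounded_fun_on D h1 -> bounded_fun_on D h2 -> bounded_fun_on D (fun t => h1 t * h2 t).
Proof.
move=> [M1 h1M] [M2 h2M]; exists (M1 * M2) => t Dt.
by rewrite normrM ler_pM ?h1M ?h2M.
Qed.

Lemma bounded_fun_on_sum T (D : set T) (I : Type) (s : seq I) (h : I -> T -> R) :
  (forall i, bounded_fun_on D (h i)) -> bounded_fun_on D (fun t => \sum_(i <- s) h i t).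
Proof.
move=> bh; elim: s => [|i s IH].
  by exists 0 => t _; rewrite big_nil normr0.
have [M hM] := bounded_fun_onD (bh i) IH.
by exists M => t Dt; rewrite big_cons hM.
Qed.

Lemma compact_bounded_fun (T : topologicalType) (K : set T) (f : T -> R) :
  compact K -> continuous f -> bounded_fun_on K f.
Proof.
move=> cK cf.
have [[w0 Bw0]|nB] := pselect (exists w, K w); last first.
  by exists 0 => w Kw; case: nB; exists w.
have [||c _ cM] := @compact_EVT_max _ R (fun w => `|f w|) K _ cK.
- by exists w0.
- apply: continuous_subspaceT => w; apply: continuous_comp; first exact: cf.
  exact: norm_continuous.
by exists `|f c| => w Bw; apply: cM; rewrite inE.
Qed.

Lemma rV_coord_le m (x : 'rV[R]_m) i : `|x 0 i| <= `|x|.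
Proof.
have h : (`|x 0 i|%:nng <= \big[Num.max/0%:nng]_(ij : 'I_1 * 'I_m) `|x ij.1 ij.2|%:nng)%R.
  exact: (le_bigmax _ (fun ij : 'I_1 * 'I_m => `|x ij.1 ij.2|%:nng) (0, i)).
have -> : `|x| = mx_norm x by [].
by move: h; rewrite mx_normE -num_le.
Qed.

End bounded_functions.

Lemma diff_comb (R : realType) (V : normedModType R) (u1 u2 : V -> R) (a : R) (v y : V) :
  C1 u1 -> C1 u2 ->
  'd (fun y => a * u1 y + u2 y : R) y v = a * 'd u1 y v + 'd u2 y v.
Proof.
move=> c1 c2; rewrite (diff_add _ _ (C1_mul (C1_cst V a) c1) c2).
rewrite (diff_mul _ _ (C1_cst V a) c1).
have -> : 'd (fun _ : V => a : R) y = 0 :> (V -> R) by exact: diff_cst.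
by rewrite mulr0 addr0.
Qed.

(** * Uniform bounds near a base point *)

Section tube.
Context (R : realType) (n d : nat).
Local Notation B := ('rV[R]_n * 'rV[R]_d)%type.

Definition state_dir (i : 'I_n) : B := (delta_mx 0 i, 0).

Lemma pair_basis (v : B) : v = \sum_i v.1 0 i *: state_dir i + \sum_k v.2 0 k *: noise_dir k.
Proof.
have h1 (s : seq 'I_n) (c : 'I_n -> R) :
    \sum_(i <- s) c i *: state_dir i = (\sum_(i <- s) c i *: delta_mx 0 i, 0).
  elim: s => [|i s IH]; first by rewrite !big_nil.
  by rewrite !big_cons IH; apply/eqP; rewrite xpair_eqE/= scaler0 addr0 !eqxx.
have h2 (s : seq 'I_d) (c : 'I_d -> R) :
    \sum_(i <- s) c i *: noise_dir i = ((0, \sum_(i <- s) c i *: delta_mx 0 i) : B).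
  elim: s => [|i s IH]; first by rewrite !big_nil.
  by rewrite !big_cons IH; apply/eqP; rewrite xpair_eqE/= scaler0 addr0 !eqxx.
rewrite h1 h2 -!rV_basis; apply/eqP.
by rewrite {1}(surjective_pairing v) xpair_eqE/= addr0 add0r !eqxx.
Qed.

Lemma pair_coord_le1 (v : B) i : `|v.1 0 i| <= `|v|.
Proof. by rewrite (le_trans (rV_coord_le _ _))// prod_normE le_max lexx. Qed.

Lemma pair_coord_le2 (v : B) i : `|v.2 0 i| <= `|v|.
Proof. by rewrite (le_trans (rV_coord_le _ _))// prod_normE le_max lexx orbT. Qed.

(** Expansion of [v] on the finite basis of state and noise directions: boundedness on [D] for each
    basis vector yields one constant for all [v]. *)
Lemma bounded_linear_on (T : Type) (D : set T) (L : B -> T -> R) :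
  (forall a v w t, L (a *: v + w) t = a * L v t + L w t) ->
  (forall v, bounded_fun_on D (L v)) ->
  exists2 M, 0 <= M & forall v t, D t -> `|L v t| <= M * `|v|.
Proof.
move=> lL bL.
have L0 t : L 0 t = 0.
  by have := lL 1 0 0 t; rewrite scaler0 addr0 mul1r => /eqP; rewrite -subr_eq subrr eq_sym => /eqP.
have Ls (I : Type) (s : seq I) (c : I -> R) (e : I -> B) w t :
    L (\sum_(i <- s) c i *: e i + w) t = \sum_(i <- s) c i * L (e i) t + L w t.
  elim: s => [|i s IH]; first by rewrite !big_nil !add0r.
  by rewrite !big_cons -!addrA lL IH.
have [M1 /= bM1] : bounded_fun_on D
    (fun t => \sum_i `|L (state_dir i) t| + \sum_k `|L (noise_dir k) t|).
  apply: bounded_fun_onD; apply: bounded_fun_on_sum => i.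
    by have [M hM] := bL (state_dir i); exists M => t /hM; rewrite normr_id.
  by have [M hM] := bL (noise_dir i); exists M => t /hM; rewrite normr_id.
exists `|M1| => // v t Dt; rewrite [v in L v](pair_basis v).
rewrite -[X in L X](addr0) -addrA Ls Ls L0 addr0.
apply: (@le_trans _ _ ((\sum_i `|L (state_dir i) t| + \sum_k `|L (noise_dir k) t|) * `|v|)).
  rewrite mulrDl (le_trans (ler_normD _ _))// lerD// mulr_suml
    (le_trans (ler_norm_sum _ _ _))// ler_sum// => i _; rewrite normrM mulrC ler_wpM2l//.
    exact: pair_coord_le1.
  exact: pair_coord_le2.
rewrite ler_wpM2r// (le_trans (ler_norm _))// (le_trans (bM1 _ Dt))//.
exact: ler_norm.
Qed.

(** The radius 2 leaves room around the segments t * eta with |eta| <= 1 and 0 <= t <= 1, so that t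
    may range over an open interval containing [0, 1] when an integral is differentiated in t. The
    noise [z] is kept as a second component because the cutoff is evaluated there, and not at the
    displaced point. *)
Definition tube (b0 : B) (r : R) : set (B * 'rV[R]_d) :=
  [set p | box r p.2 /\ exists2 eta : B, `|eta| <= 2 & p.1 = b0 + eta + noise_inj p.2].

Lemma bounded_tube1 b0 r (u : B -> R) : continuous u ->
  bounded_fun_on (tube b0 r) (fun p => u p.1).
Proof.
move=> cu.
have cub : continuous (fun y : B => u (b0 + y)).
  move=> y; apply: (@continuous_comp _ _ _ (fun y => b0 + y) u); last exact: cu.
  have cb : {for y, continuous (fun _ : B => b0)} by exact: cst_continuous.
  have ci : {for y, continuous (fun y : B => y)} by move=> A.
  exact: (continuousD cb ci).
have [M hM] := compact_bounded_fun
  (compact_setX (@compact_box R n 2) (@compact_box R d (2 + r))) cub.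
exists M => -[y z] [/= bz [eta e2 ->]]; rewrite -addrA; apply: hM; split => j /=.
  by rewrite addr0 (le_trans (pair_coord_le1 _ _)).
by rewrite mxE (le_trans (ler_normD _ _))// lerD ?bz// (le_trans (pair_coord_le2 _ _)).
Qed.

Lemma bounded_tube2 b0 r (u : 'rV[R]_d -> R) : continuous u ->
  bounded_fun_on (tube b0 r) (fun p => u p.2).
Proof.
move=> cu; have [M hM] := compact_bounded_fun (@compact_box R d r) cu.
by exists M => p [bz _]; exact: hM.
Qed.

Lemma dirder_linear (u : B -> R) (a : R) (v w y : B) :
  dirder u (a *: v + w) y = a * dirder u v y + dirder u w y.
Proof. by rewrite /dirder linearP. Qed.

Lemma dirder_comb (u1 u2 : B -> R) (a : R) (v y : B) : C1 u1 -> C1 u2 ->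
  dirder (fun y => a * u1 y + u2 y) v y = a * dirder u1 v y + dirder u2 v y.
Proof. exact: diff_comb. Qed.

Lemma diff_tube b0 r (u : B -> R) : C1 u ->
  exists2 M : R, 0 <= M & forall (v : B) (p : B * 'rV[R]_d), tube b0 r p -> `|dirder u v p.1| <= M * `|v|.
Proof.
move=> cu; apply: (@bounded_linear_on _ _ (fun (v : B) (p : B * 'rV[R]_d) => dirder u v p.1)).
  by move=> a v w t; exact: dirder_linear.
by move=> v; apply: bounded_tube1; exact: (cu.2 v).
Qed.

Lemma path_in_tube b0 r z (eta : B) (t : R) : box r z -> `|eta| <= 1 -> `|t| <= 2 ->
  tube b0 r (b0 + t *: eta + noise_inj z, z).
Proof.
move=> bz e1 t2; split => //; exists (t *: eta) => //=.
by rewrite normrZ -[leRHS]mulr1 ler_pM.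
Qed.

Lemma is_derive_tube (u : B -> R) b0 (eta : B) z (t : R) : C1 u ->
  is_derive t 1 (fun t : R => u (b0 + t *: eta + noise_inj z))
    ('d u (b0 + t *: eta + noise_inj z) eta).
Proof.
move=> cu; have := is_derive_path (b0 + noise_inj z) eta t cu.
have e s : b0 + noise_inj z + s *: eta = b0 + s *: eta + noise_inj z by rewrite addrAC.
have -> : (fun t : R => u (b0 + noise_inj z + t *: eta))
    = (fun t : R => u (b0 + t *: eta + noise_inj z)).
  by apply/funext => s; rewrite e.
by rewrite e.
Qed.

Lemma lipschitz_tube b0 r (u : B -> R) : C1 u ->
  exists2 M, 0 <= M & forall (eta : B) z, box r z -> `|eta| <= 1 ->
    `|u (b0 + eta + noise_inj z) - u (b0 + noise_inj z)| <= M * `|eta|.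
Proof.
move=> cu; have [M M0 hM] := diff_tube b0 r cu; exists M => // eta z bz e1.
have [||c] := @MVT_segment R (fun t : R => u (b0 + t *: eta + noise_inj z))
    (fun t => 'd u (b0 + t *: eta + noise_inj z) eta) 0 1 ler01.
- by move=> t _; exact: is_derive_tube.
- apply: derivable_within_continuous => t _.
  by case: (is_derive_tube b0 eta z t cu).
rewrite in_itv/= => /andP[c0 c1]; rewrite scale1r scale0r addr0 subr0 mulr1 => ->.
apply: (hM eta (_, z)); apply: path_in_tube => //.
by rewrite ger0_norm// (le_trans c1)// ler1n.
Qed.

End tube.
Arguments state_dir {R n d}.

Section smooth_variation.
Context (R : realType) (n d : nat).
Local Notation B := ('rV[R]_n * 'rV[R]_d)%type.
Local Notation leb := (lebesgue_rV R d).
Variable F : B -> 'rV[R]_n.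
Hypothesis hF : C2 F.
Variables (chi : 'rV[R]_d -> R) (r : R).
Hypotheses (cchi : C1 chi) (chi0 : forall z, ~ box r z -> chi z = 0).

Lemma remainder_linear (a : R) v w y z :
  remainder F chi (a *: v + w) y z = a * remainder F chi v y z + remainder F chi w y z.
Proof.
have alg (I : Type) (s : seq I) (e p q p' q' : I -> R) (x x' c : R) :
    (a * x + x') * c - \sum_(k <- s) ((a * p k + p' k) * c + (a * q k + q' k) * e k)
    = a * (x * c - \sum_(k <- s) (p k * c + q k * e k))
      + (x' * c - \sum_(k <- s) (p' k * c + q' k * e k)).
  have -> : \sum_(k <- s) ((a * p k + p' k) * c + (a * q k + q' k) * e k)
      = a * \sum_(k <- s) (p k * c + q k * e k) + \sum_(k <- s) (p' k * c + q' k * e k).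
    by rewrite mulr_sumr -big_split; apply: eq_bigr => k _ /=; ring.
  by ring.
have dl k : dirder (hvec F (a *: v + w) k) (noise_dir k) y
    = a * dirder (hvec F v k) (noise_dir k) y + dirder (hvec F w k) (noise_dir k) y.
  rewrite -dirder_comb; [|exact: C1_hvec|exact: C1_hvec].
  congr (dirder _ _ _); apply/funext => y'; exact: hvec_linear.
rewrite /remainder -alg dirder_linear; congr (_ - _).
by apply: eq_bigr => k _; rewrite dl hvec_linear.
Qed.

Lemma remainder_tube (b0 : B) : exists2 M : R, 0 <= M &
  forall (v : B) (p : B * 'rV[R]_d), tube b0 r p -> `|remainder F chi v p.1 p.2| <= M * `|v|.
Proof.
apply: (@bounded_linear_on _ _ _ _ _ (fun v p => remainder F chi v p.1 p.2)).
  by move=> a v w t; exact: remainder_linear.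
move=> v; rewrite /remainder.
have bchi : bounded_fun_on (tube b0 r) (fun p => chi p.2).
  exact: bounded_tube2 (C1_continuous cchi).
apply: bounded_fun_onD.
  apply: bounded_fun_onM => //.
  exact: (@bounded_tube1 _ _ _ b0 r _ ((C1_mdet hF).2 v)).
apply: bounded_fun_onN; apply: bounded_fun_on_sum => k; apply: bounded_fun_onD.
  apply: bounded_fun_onM => //.
  exact: (@bounded_tube1 _ _ _ b0 r _ ((C1_hvec hF v k).2 (noise_dir k))).
apply: bounded_fun_onM.
  exact: (@bounded_tube1 _ _ _ b0 r _ (C1_continuous (C1_hvec hF v k))).
exact: (@bounded_tube2 _ _ _ b0 r _ (cchi.2 (delta_mx 0 k))).
Qed.

Lemma remainder_off_box v y z : ~ box r z -> remainder F chi v y z = 0.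
Proof.
move=> nB; rewrite /remainder chi0// mulr0 big1 ?subr0// => k _.
by rewrite mulr0 (dchi0 cchi chi0)// !mulr0 addr0.
Qed.

(** The integral is differentiated along the segment from [b0] to [b0 + eta]; by
    [integral_diff_mdet] its derivative involves [phi] only through its values, so that the mean
    value theorem gives a constant [C] chosen before [phi]. This uniformity permits the passage to
    indicators. *)
Lemma smooth_variation (b0 : B) : exists2 C : R, 0 <= C & forall eta : B, `|eta| <= 1 ->
  forall phi : 'rV[R]_n -> R, C1 phi -> (forall x, `|phi x| <= 1) ->
  `| \int[leb]_z (phi (F (b0 + eta + noise_inj z)) * mdet F (b0 + eta + noise_inj z) * chi z)
   - \int[leb]_z (phi (F (b0 + noise_inj z)) * mdet F (b0 + noise_inj z) * chi z) |
  <= C * `|eta|.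
Proof.
have [M M0 hM] := remainder_tube b0.
exists (M * fine (leb (box r))); first by rewrite mulr_ge0// fine_ge0.
move=> eta e1 phi cphi phi1.
pose g (y : B) : R := phi (F y) * mdet F y.
have cA : C1 (fun y => phi (F y) : R) by exact: (C1_comp_rV hF.1 cphi).
have cg : C1 g := C1_mul cA (C1_mdet hF).
pose h (t : R) z := g (b0 + t *: eta + noise_inj z) * chi z.
have cchic := C1_continuous cchi.
have ch (t : R) : continuous (h t) :=
  continuous_mul (continuous_slice (b := b0 + t *: eta) (C1_continuous cg)) cchic.
have h0 t z : ~ box r z -> h t z = 0 by move=> nB; rewrite /h chi0// mulr0.
have ih t := integrable_continuous_box (ch t) (h0 t).
have dh (t : R) z : is_derive t 1 (h ^~ z) ('d g (b0 + t *: eta + noise_inj z) eta * chi z).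
  have d1 := is_derive_tube b0 eta z t cg.
  have d2 : is_derive t 1 (fun _ : R => chi z) 0 by exact: is_derive_cst.
  have d3 := is_deriveM d1 d2.
  by apply: (is_derive_eq d3); rewrite /GRing.scale/= mulr0 add0r mulrC.
pose J (t : R) := \int[leb]_z h t z.
have [M1 M10 hM1] := diff_tube b0 r cg.
(* Differentiation under the integral sign; the dominating function comes from the uniform bound on
   the tube and depends on neither t nor [eta]. *)
have dJ (t : R) : t \in `]-2, 2[%R -> derivable J t 1 /\
    derive1 J t = \int[leb]_z ('d g (b0 + t *: eta + noise_inj z) eta * chi z).
  move=> tI.
  have hG z : 0 <= M1 * `|chi z| by rewrite mulr_ge0.
  have iG : leb.-integrable setT (EFin \o (fun z => M1 * `|chi z|)).
    apply: (integrable_continuous_box (r := r)).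
      apply: continuous_mul; first exact: cst_continuous.
      move=> z; apply: (@continuous_comp _ _ _ chi Num.norm); first exact: cchic.
      exact: norm_continuous.
    by move=> z nB; rewrite chi0// normr0 mulr0.
  have G_ub (x : R) z : `]-2, 2[%classic x -> [set: 'rV[R]_d] z ->
      `|partial1of2 h x z| <= M1 * `|chi z|.
    rewrite /= in_itv/= => /andP[x1 x2] _.
    rewrite partial1of2E (@derive_val _ _ _ _ _ _ _ (dh x z)) normrM.
    have [Bz|/chi0 ->] := pselect (box r z); last by rewrite normr0 !mulr0.
    rewrite ler_wpM2r//; apply: (le_trans (hM1 eta (_, z) _)).
      by apply: path_in_tube => //; rewrite ler_norml !ltW.
    by rewrite -[leRHS]mulr1 ler_wpM2l.
  have ihI (x : R) : `]-2, 2[%classic x -> leb.-integrable setT (EFin \o h x) by move=> _.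
  have derf (x : R) z : `]-2, 2[%classic x -> [set: 'rV[R]_d] z -> derivable (h ^~ z) x 1.
    by move=> _ _; case: (dh x z).
  split; first exact: (derivable_under_integral measurableT tI ihI derf hG iG G_ub).
  rewrite (differentiation_under_integral measurableT tI ihI derf hG iG G_ub).
  apply: eq_Rintegral => z _; rewrite partial1of2E.
  exact: (@derive_val _ _ _ _ _ _ _ (dh t z)).
have J'le t : t \in `]-2, 2[%R -> `|derive1 J t| <= M * fine (leb (box r)) * `|eta|.
  move=> tI; have [_ ->] := dJ _ tI.
  rewrite (integral_diff_mdet hF cchi chi0)//.
  pose q z := phi (F (b0 + t *: eta + noise_inj z))
    * remainder F chi eta (b0 + t *: eta + noise_inj z) z.
  have qle z : `|q z| <= M * `|eta| * \1_(box r) z.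
    rewrite /q normrM indicE.
    have [Bz|nB] := pselect (box r z); last first.
      by rewrite remainder_off_box// normr0 mulr0 memNset// mulr0.
    rewrite mem_set// mulr1 -[leRHS]mul1r ler_pM//.
    apply: (hM eta (_, z)); apply: path_in_tube => //.
    by move: tI; rewrite in_itv/= ler_norml => /andP[? ?]; rewrite !ltW.
  have q0 z : ~ box r z -> q z = 0 by move=> nB; rewrite /q remainder_off_box// mulr0.
  have cq : continuous q.
    have cs (u : B -> R) : continuous u -> continuous (fun z => u (b0 + t *: eta + noise_inj z)).
      exact: continuous_slice.
    have cN (f : 'rV[R]_d -> R) : continuous f -> continuous (fun z => - f z).
      by move=> cf z; exact: (cvgN (cf z)).
    have ck k := continuous_add
      (continuous_mul (cs _ ((C1_hvec hF eta k).2 (noise_dir k))) cchic)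
      (continuous_mul (cs _ (C1_continuous (C1_hvec hF eta k))) (cchi.2 (delta_mx 0 k))).
    have cS : continuous (fun z => \sum_k
        (dirder (hvec F eta k) (noise_dir k) (b0 + t *: eta + noise_inj z) * chi z
         + hvec F eta k (b0 + t *: eta + noise_inj z) * 'd chi z (delta_mx 0 k))).
      move=> z; apply: continuous_at_sum => k.
      exact: (ck k z).
    exact: (continuous_mul (cs _ (C1_continuous cA)) (continuous_add
      (continuous_mul (cs _ ((C1_mdet hF).2 eta)) cchic) (cN _ cS))).
  have iq := integrable_continuous_box cq q0.
  have mB := @measurable_box R d r.
  have iI : leb.-integrable setT (EFin \o (fun z => M * `|eta| * \1_(box r) z)).
    apply: (@integrable_box _ _ _ r (M * `|eta|)).
    - by apply: measurable_funM => //; exact: measurable_indic.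
    - move=> z; rewrite indicE; case: (_ \in _); rewrite ?mulr1 ?mulr0 ?normr0 ?mulr_ge0//.
      by rewrite ger0_norm// mulr_ge0.
    - by move=> z nB; rewrite indicE memNset// mulr0.
  apply: (le_trans (le_normr_Rintegral measurableT iq)).
  have -> : M * fine (leb (box r)) * `|eta| = \int[leb]_z (M * `|eta| * \1_(box r) z).
    rewrite RintegralZl//; last first.
      apply: (@integrable_box _ _ _ r 1).
      - exact: measurable_indic.
      - by move=> z; rewrite indicE; case: (_ \in _); rewrite ?normr1 ?normr0.
      - by move=> z nB; rewrite indicE memNset.
    by rewrite /Rintegral integral_indic// setIT mulrAC.
  apply: le_Rintegral => //; exact: integrable_norm iq.
have [||c] := @MVT_segment R J (derive1 J) 0 1 ler01.
- move=> t; rewrite in_itv/= => /andP[t0 t1].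
  have tI : t \in `]-2, 2[%R by rewrite in_itv/=; apply/andP; split; lra.
  by rewrite derive1E; apply: DeriveDef => //; case: (dJ _ tI).
- apply: derivable_within_continuous => t; rewrite in_itv/= => /andP[t0 t1].
  have tI : t \in `]-2, 2[%R by rewrite in_itv/=; apply/andP; split; lra.
  by case: (dJ _ tI).
rewrite in_itv/= => /andP[c0 c1]; rewrite subr0 mulr1 /J /h /g scale1r scale0r addr0 => ->.
by apply: J'le; rewrite in_itv/=; apply/andP; split; lra.
Qed.

End smooth_variation.

(** * Smooth approximation of indicator functions *)

Section convergence_criteria.
Context (R : realType).

Lemma cvg_le_harmonic (u : nat -> R) (l : R) N :
  (forall k, (N <= k)%N -> `|u k - l| <= k.+1%:R^-1) -> u @ \oo --> l.
Proof.
move=> h; apply/cvgrPdist_le => e e0.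
have /cvgrPdist_le /(_ e e0) := @cvg_harmonic R.
apply: filterS2 (nbhs_infty_ge N) => k Nk.
rewrite sub0r normrN ger0_norm ?invr_ge0// => kE.
by rewrite distrC (le_trans (h k Nk)).
Qed.

Lemma expRN_le_harmonic (s : R) k : k%:R <= s -> expR (- s) <= k.+1%:R^-1.
Proof.
move=> ks; rewrite expRN lef_pV2 ?posrE ?expR_gt0//.
by rewrite (le_trans _ (expR_ge1Dx s))// -natr1 addrC lerD2l.
Qed.

(** A smooth increasing step from 0 to 1. The double exponential is convenient because 1 + x <= exp
    x bounds both of its tails by 1/(k+1). *)
Definition gompertz (s : R) : R := expR (- expR (- s)).

Lemma gompertz_itv s : 0 <= gompertz s <= 1.
Proof. by rewrite /gompertz expR_ge0/= -expR0 ler_expR oppr_le0 expR_ge0. Qed.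

Lemma is_derive_gompertz (s : R) : is_derive s 1 gompertz (gompertz s * expR (- s)).
Proof.
rewrite /gompertz; apply: is_derive_eq.
by rewrite /GRing.scale/=; ring.
Qed.

Lemma continuous_gompertz' : continuous (fun s => gompertz s * expR (- s)).
Proof.
move=> s; have d (f : R -> R) l : is_derive s 1 f l -> {for s, continuous f}.
  by move=> df; apply: differentiable_continuous; apply/derivable1_diffP; case: df.
have c1 := d _ _ (is_derive_gompertz s).
have c2 : {for s, continuous (fun s : R => expR (- s))}.
  by apply: (d _ (- expR (- s))); apply: is_derive_eq; rewrite /GRing.scale/=; ring.
exact: (cvgM c1 c2).
Qed.

Lemma gompertz_le s k : s <= - k%:R -> gompertz s <= k.+1%:R^-1.
Proof.
move=> sk; apply: expRN_le_harmonic.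
rewrite (le_trans _ (expR_ge1Dx _))// (@le_trans _ _ (- s))//; last by rewrite lerDr.
by rewrite lerNr.
Qed.

Lemma gompertz_ge s k : k%:R <= s -> 1 - k.+1%:R^-1 <= gompertz s.
Proof.
move=> ks; rewrite /gompertz (le_trans _ (expR_ge1Dx _))// lerD2l lerN2.
exact: expRN_le_harmonic.
Qed.

(** The shift by -k forces the limit 0 for x <= 0, including x = 0, and the factor k^2 makes this
    shift negligible for x > 0. *)
Lemma gompertz_cvg (x : R) :
  (fun k => gompertz (k%:R ^+ 2 * x - k%:R)) @ \oo --> ((0 < x)%R%:R : R).
Proof.
have [x0|x0] := ltP 0 x; last first.
  apply: (@cvg_le_harmonic _ _ 0) => k _ /=.
  rewrite subr0 ger0_norm; last by case/andP: (gompertz_itv (k%:R ^+ 2 * x - k%:R)).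
  apply: gompertz_le; rewrite gerDr// mulr_ge0_le0// exprn_ge0//.
(* From k >= 2/x on, k^2 x >= 2 k, so the argument is at least k. *)
apply: (@cvg_le_harmonic _ _ (Num.truncn (2 / x)).+1) => k kN /=.
have h : k%:R <= k%:R ^+ 2 * x - k%:R :> R.
  have : 2 / x <= k%:R by rewrite (le_trans (ltW (truncnS_gt _)))// ler_nat.
  rewrite ler_pdivrMr// => h2; have k0 : 0 <= k%:R :> R by [].
  by nra.
have := gompertz_ge h; have /andP[_] := gompertz_itv (k%:R ^+ 2 * x - k%:R).
move: (gompertz _) => g; have : 0 <= k.+1%:R^-1 :> R by rewrite invr_ge0.
by move: (k.+1%:R^-1) => c c0 g1 gc; rewrite ler_norml; apply/andP; split; lra.
Qed.

End convergence_criteria.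

Lemma C1_coordinate (R : realType) m (j : 'I_m) : C1 (fun x : 'rV[R]_m => x 0 j : R).
Proof.
have id1 : C1 (fun x : 'rV[R]_m => x).
  split=> [z|v z]; first exact: (@ex_diff _ _ _ _ _ _ _ (is_diff_id z)).
  have -> : (fun z : 'rV[R]_m => 'd (fun x : 'rV[R]_m => x) z v) = fun _ => v.
    by apply/funext => y; rewrite (@diff_val _ _ _ _ _ _ _ (is_diff_id y)).
  exact: cst_continuous.
exact: (C1_coord j id1).
Qed.

Section smooth_approximation.
Context (R : realType) dT (T : measurableType dT) (mu : {measure set T -> \bar R}) (m : nat).
Variables (G0 G1 : T -> 'rV[R]_m) (r0 r1 : T -> R).
Hypotheses (mG0 : measurable_fun setT G0) (mG1 : measurable_fun setT G1).
Hypotheses (ir0 : mu.-integrable setT (EFin \o r0)) (ir1 : mu.-integrable setT (EFin \o r1)).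
Hypotheses (r00 : forall z, 0 <= r0 z) (r10 : forall z, 0 <= r1 z).

(** Two maps with two weights at once: the same smooth function has to approximate the indicator
    both at the base point and at the displaced point. *)
Definition gap (f g : 'rV[R]_m -> R) (z : T) : R :=
  r0 z * `|f (G0 z) - g (G0 z)| + r1 z * `|f (G1 z) - g (G1 z)|.

Definition unit_valued (f : 'rV[R]_m -> R) : Prop :=
  measurable_fun setT f /\ forall x, 0 <= f x <= 1.

Lemma unit_valued_indic A : measurable A -> unit_valued (\1_A).
Proof.
move=> mA; split; first exact: measurable_indic.
by move=> x; rewrite indicE; case: (_ \in _); rewrite ?ler01 ?lexx.
Qed.

Lemma unit_valued_C1 (f : 'rV[R]_m -> R) : C1 f -> (forall x, 0 <= f x <= 1) -> unit_valued f.
Proof. by move=> cf f01; split => //; exact: measurable_continuous_rV (C1_continuous cf). Qed.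

Lemma gap_ge0 f g z : 0 <= gap f g z.
Proof. by rewrite addr_ge0// mulr_ge0. Qed.

Lemma gap_le f g z : unit_valued f -> unit_valued g -> gap f g z <= r0 z + r1 z.
Proof.
move=> [_ f01] [_ g01].
have h x : `|f x - g x| <= 1.
  by have := f01 x; have := g01 x; rewrite ler_norml => /andP[? ?] /andP[? ?]; lra.
by rewrite lerD// ler_piMr.
Qed.

Lemma measurable_gap f g : unit_valued f -> unit_valued g -> measurable_fun setT (gap f g).
Proof.
move=> [mf _] [mg _].
have h (r : T -> R) (G : T -> 'rV[R]_m) : mu.-integrable setT (EFin \o r) ->
    measurable_fun setT G -> measurable_fun setT (fun z => r z * `|f (G z) - g (G z)|).
  move=> /measurable_int/measurable_EFinP mr mG; apply: measurable_funM => //.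
  apply: measurableT_comp => //; apply: measurable_funB.
    exact: (measurableT_comp mf mG).
  exact: (measurableT_comp mg mG).
by apply: measurable_funD; exact: h.
Qed.

Lemma integrable_gap f g : unit_valued f -> unit_valued g ->
  mu.-integrable setT (EFin \o gap f g).
Proof.
move=> uf ug; apply: (le_integrable measurableT _ _ (integrableRD ir0 ir1)).
  by apply/measurable_EFinP; exact: measurable_gap.
move=> z _ /=; rewrite lee_fin ger0_norm ?gap_ge0// (le_trans (gap_le z uf ug))//.
exact: ler_norm.
Qed.

Definition mean_gap f g : R := \int[mu]_z gap f g z.

Lemma mean_gap_le f g h k h' k' : unit_valued f -> unit_valued g -> unit_valued h ->
  unit_valued k -> unit_valued h' -> unit_valued k' ->
  (forall x, `|f x - g x| <= `|h x - k x| + `|h' x - k' x|) ->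
  mean_gap f g <= mean_gap h k + mean_gap h' k'.
Proof.
move=> uf ug uh uk uh' uk' H.
have i1 := integrable_gap uh uk; have i2 := integrable_gap uh' uk'.
rewrite /mean_gap -RintegralD//.
apply: le_Rintegral => //; [exact: integrable_gap|exact: integrableRD|].
move=> z _; rewrite /gap addrACA -!mulrDr lerD// ler_wpM2l//.
Qed.

Lemma mean_gap_refl f : mean_gap f f = 0.
Proof.
rewrite /mean_gap; have -> : gap f f = cst 0.
  by apply/funext => z; rewrite /gap !subrr normr0 !mulr0 addr0.
by rewrite /Rintegral integral0.
Qed.

Lemma mean_gap_cvg (f_ : nat -> 'rV[R]_m -> R) g : (forall k, unit_valued (f_ k)) ->
  unit_valued g -> (forall x, (fun k => f_ k x) @ \oo --> g x) ->
  (fun k => mean_gap (f_ k) g) @ \oo --> (0 : R).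
Proof.
move=> uf ug fg.
have -> : (0 : R) = \int[mu]_z (0 : R) by rewrite /Rintegral integral0.
apply: (Rintegral_dominated_cvg _ _ (integrableRD ir0 ir1) _).2 => [k|z|k z].
- exact: measurable_gap.
- have h (r : R) (y : 'rV[R]_m) : (fun k => r * `|f_ k y - g y|) @ \oo --> (0 : R).
    rewrite -(mulr0 r); apply: cvgM; first exact: cvg_cst.
    rewrite -(normr0 R); apply: cvg_norm; rewrite -(subrr (g y)).
    by apply: cvgB; [exact: fg|exact: cvg_cst].
  by rewrite -[0 in X in _ --> X](addr0 0); apply: cvgD; exact: h.
- by rewrite ger0_norm ?gap_ge0// gap_le.
Qed.

Definition smoothly_approximable (A : set 'rV[R]_m) : Prop :=
  measurable A /\ forall e, 0 < e -> exists phi : 'rV[R]_m -> R,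
    [/\ C1 phi, forall x, 0 <= phi x <= 1 & mean_gap phi (\1_A) <= e].

Lemma approximable_setU A B : smoothly_approximable A -> smoothly_approximable B ->
  smoothly_approximable (A `|` B).
Proof.
move=> [mA hA] [mB hB]; split; first exact: measurableU.
move=> e e0; have e20 : 0 < e / 2 by rewrite divr_gt0.
have [f [cf f01 fe]] := hA _ e20; have [g [cg g01 ge]] := hB _ e20.
(* This is 1 - (1 - f)(1 - g), the smooth counterpart of a union; the estimate below compares the
   products of the complements. *)
exists (fun x => f x + g x + (-1) * (f x * g x)).
have c : C1 (fun x => f x + g x + (-1) * (f x * g x) : R).
  exact: (C1_add (C1_add cf cg) (C1_mul (C1_cst _ (-1)) (C1_mul cf cg))).
have h01 x : 0 <= f x + g x + (-1) * (f x * g x) <= 1.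
  have := f01 x; have := g01 x => /andP[? ?] /andP[? ?]; apply/andP; split; nra.
split => //; rewrite (splitr e); apply: le_trans (lerD fe ge).
apply: (mean_gap_le (unit_valued_C1 c h01) (unit_valued_indic (measurableU _ _ mA mB))
  (unit_valued_C1 cf f01) (unit_valued_indic mA) (unit_valued_C1 cg g01)
  (unit_valued_indic mB)).
move=> x; have /andP[f0 f1] := f01 x; have /andP[g0 g1] := g01 x.
have aux (a b a' b' : R) : 0 <= a <= 1 -> 0 <= b <= 1 -> 0 <= a' <= 1 -> 0 <= b' <= 1 ->
    `|a * b - a' * b'| <= `|a - a'| + `|b - b'|.
  move=> /andP[a0 a1] /andP[b0 b1] /andP[a'0 a'1] /andP[b'0 b'1].
  have -> : a * b - a' * b' = (a - a') * b + a' * (b - b') by ring.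
  rewrite (le_trans (ler_normD _ _))// !normrM lerD//.
    by rewrite ler_piMr// ger0_norm.
  by rewrite ler_piMl// ger0_norm.
have i01 (C : set 'rV[R]_m) : 0 <= (1 - \1_C x : R) <= 1.
  by rewrite indicE; case: (_ \in _); rewrite ?subrr ?subr0 ?ler01 ?lexx.
have fe' : 0 <= 1 - f x <= 1 by apply/andP; split; lra.
have ge' : 0 <= 1 - g x <= 1 by apply/andP; split; lra.
have := aux _ _ _ _ fe' ge' (i01 A) (i01 B).
have -> : (1 - \1_A x) * (1 - \1_B x) = 1 - \1_(A `|` B) x :> R.
  rewrite !indicE in_setU; case: (x \in A); case: (x \in B) => /=; ring.
have -> : `|1 - f x - (1 - \1_A x)| = `|f x - \1_A x| by rewrite -normrN; congr (`|_|); ring.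
have -> : `|1 - g x - (1 - \1_B x)| = `|g x - \1_B x| by rewrite -normrN; congr (`|_|); ring.
suff -> : `|(1 - f x) * (1 - g x) - (1 - \1_(A `|` B) x)|
    = `|f x + g x + (-1) * (f x * g x) - \1_(A `|` B) x| by [].
by rewrite -normrN; congr (`|_|); ring.
Qed.

Lemma approximable_set0 : smoothly_approximable set0.
Proof.
split => // e e0; exists (fun _ => 0); split; first exact: C1_cst.
  by move=> x; rewrite lexx ler01.
have -> : (fun _ : 'rV[R]_m => 0 : R) = \1_set0 by apply/funext => x; rewrite indic0.
by rewrite mean_gap_refl ltW.
Qed.

Lemma approximable_setC A : smoothly_approximable A -> smoothly_approximable (setT `\` A).
Proof.
move=> [mA hA]; split; first exact: measurableD.
move=> e e0; have [f [cf f01 fe]] := hA _ e0.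
exists (fun x => 1 + (-1) * f x).
have c : C1 (fun x => 1 + (-1) * f x : R).
  exact: (C1_add (C1_cst _ 1) (C1_mul (C1_cst _ (-1)) cf)).
have h01 x : 0 <= 1 + (-1) * f x <= 1.
  by have := f01 x => /andP[? ?]; apply/andP; split; lra.
split => //; rewrite (le_trans _ fe)//.
rewrite -[leRHS]addr0 -(mean_gap_refl f).
have uf := unit_valued_C1 cf f01.
apply: (mean_gap_le (unit_valued_C1 c h01)
  (unit_valued_indic (measurableD measurableT mA)) uf (unit_valued_indic mA) uf uf).
move=> x; rewrite subrr normr0 addr0 -normrN le_eqVlt; apply/orP; left; apply/eqP.
by congr (`|_|); rewrite !indicE in_setD in_setT/=; case: (x \in A) => /=; ring.
Qed.

Lemma approximable_cvg (F : nat -> set 'rV[R]_m) A : measurable A ->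
  (forall k, smoothly_approximable (F k)) ->
  (forall x, (fun k => \1_(F k) x : R) @ \oo --> (\1_A x : R)) -> smoothly_approximable A.
Proof.
move=> mA hF FA; split => // e e0.
have e20 : 0 < e / 2 by rewrite divr_gt0.
have uF k : unit_valued (\1_(F k)) by apply: unit_valued_indic; exact: (hF k).1.
have := mean_gap_cvg uF (unit_valued_indic mA) FA.
move=> /cvgrPdist_le/(_ _ e20)[N _ /(_ N (leqnn N))/=].
rewrite sub0r normrN => /(le_trans (ler_norm _)) he.
have [f [cf f01 fe]] := (hF N).2 _ e20.
exists f; split => //; rewrite (splitr e); apply: le_trans (lerD fe he).
apply: (mean_gap_le (unit_valued_C1 cf f01) (unit_valued_indic mA)
  (unit_valued_C1 cf f01) (uF N) (uF N) (unit_valued_indic mA)).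
move=> x; rewrite -[X in `|X|](subrK (\1_(F N) x)).
by rewrite (le_trans _ (ler_normD _ _))// le_eqVlt; apply/orP; left; apply/eqP;
  congr (`|_|); ring.
Qed.

Lemma sigma_algebra_approximable : sigma_algebra setT smoothly_approximable.
Proof.
split; [exact: approximable_set0|exact: approximable_setC|move=> F hF].
have mU : measurable (\bigcup_k F k) by apply: bigcup_measurable => k _; exact: (hF k).1.
pose U k := \big[setU/set0]_(i < k) F i.
have hU k : smoothly_approximable (U k).
  elim: k => [|k IH]; rewrite /U ?big_ord0 ?big_ord_recr/=.
    exact: approximable_set0.
  exact: approximable_setU.
apply: (approximable_cvg mU hU) => x.
have [[i _ Fi]|nF] := pselect ((\bigcup_k F k) x).
  apply: cvg_near_cst; exists i.+1 => // k /= ik.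
  rewrite !indicE mem_set ?mem_set//; first by exists i.
  by rewrite /U -bigcup_mkord; exists i.
apply: cvg_near_cst; apply: nearW => k.
rewrite !indicE !memNset// /U -bigcup_mkord => -[i _ Fi]; apply: nF; by exists i.
Qed.

Lemma approximable_ray (j : 'I_m) (a : R) :
  smoothly_approximable [set x : 'rV[R]_m | a < x 0 j].
Proof.
have mA : measurable [set x : 'rV[R]_m | a < x 0 j].
  have -> : [set x : 'rV[R]_m | a < x 0 j] = (fun x => x 0 j) @^-1` `]a, +oo[%classic.
    by apply/seteqP; split => x; rewrite /= in_itv/= andbT.
  by rewrite -[X in measurable X]setTI; exact: measurable_coord.
split => // e e0.
pose f k (x : 'rV[R]_m) : R := gompertz (k%:R ^+ 2 * (x 0 j - a) - k%:R).
have cf k : C1 (f k).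
  apply: (@C1_comp_real _ _ (@gompertz R) (fun s => gompertz s * expR (- s))
    (fun x : 'rV[R]_m => k%:R ^+ 2 * (x 0 j - a) - k%:R)).
  - exact: is_derive_gompertz.
  - exact: continuous_gompertz'.
  - have c1 := C1_add (C1_coordinate R j) (C1_cst 'rV[R]_m (- a)).
    have c2 := C1_mul (C1_cst 'rV[R]_m (k%:R ^+ 2)) c1.
    have c3 := C1_add c2 (C1_cst 'rV[R]_m (- k%:R)).
    exact c3.
have f01 k x : 0 <= f k x <= 1 by exact: gompertz_itv.
have := @mean_gap_cvg f _ (fun k => unit_valued_C1 (cf k) (f01 k)) (unit_valued_indic mA) _.
have h x : (fun k => f k x) @ \oo --> (\1_[set x : 'rV[R]_m | a < x 0 j] x : R).
  have := @gompertz_cvg R (x 0 j - a); rewrite subr_gt0 indicE.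
  suff -> : (x \in [set x : 'rV[R]_m | a < x 0 j]) = (a < x 0 j) by [].
  by apply/idP/idP => [/set_mem//|?]; exact/mem_set.
move=> /(_ h) /cvgrPdist_le/(_ _ e0)[N _ /(_ N (leqnn N))/=].
rewrite sub0r normrN => /(le_trans (ler_norm _)) he.
by exists (f N); split.
Qed.

(** The approximable sets form a sigma-algebra containing the half-spaces on which one coordinate
    exceeds a constant, and these generate all measurable sets. *)
Lemma approximable_measurable A : measurable A -> smoothly_approximable A.
Proof.
apply: (smallest_sub sigma_algebra_approximable) => C [[i j] _ [B mB <-]].
have := sigma_algebra_image (fun x : 'rV[R]_m => x i j) sigma_algebra_approximable.
rewrite (ord1 i) => sig.
have mB' : <<s (@RGenOInfty.G R) >> B.
  suff : (@RGenOInfty.G R).-sigma.-measurable B by [].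
  by rewrite -RGenOInfty.measurableE.
have sub : <<s (@RGenOInfty.G R) >> `<=`
    image_set_system setT (fun x : 'rV[R]_m => x 0 j) smoothly_approximable.
  apply: smallest_sub => // D [a ->].
  rewrite /image_set_system/= setTI.
  have -> : (fun x : 'rV[R]_m => x 0 j) @^-1` `]a, +oo[%classic = [set x | a < x 0 j].
    by apply/seteqP; split => x; rewrite /= in_itv/= andbT.
  exact: approximable_ray.
by have := sub _ mB'; rewrite /image_set_system/= setTI.
Qed.

End smooth_approximation.

Lemma norm_weighted_sub (R : realType) (a p v a' p' v' : R) :
  `|(a * v - p * v) - (a' * v' - p' * v')| <= `|v| * `|p - a| + `|v'| * `|p' - a'|.
Proof.
rewrite -!mulrBl (le_trans (ler_normB _ _))// !normrM (distrC a) (distrC a').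
by rewrite mulrC [X in _ + X <= _]mulrC.
Qed.

(** * From smooth test functions to indicators *)

Section indicator_variation.
Context (R : realType) (n d : nat).
Local Notation B := ('rV[R]_n * 'rV[R]_d)%type.
Local Notation leb := (lebesgue_rV R d).
Variable F : B -> 'rV[R]_n.
Hypothesis hF : C2 F.

Lemma measurable_slice (b : B) : measurable_fun setT (fun z => F (b + noise_inj z)).
Proof.
apply: measurable_rV => i; apply: measurable_continuous_rV.
exact: (@continuous_slice _ _ _ (fun y => F y 0 i) b (C1_continuous (C1_coord i hF.1))).
Qed.

Variables (chi : 'rV[R]_d -> R) (r : R).
Hypotheses (cchi : C1 chi) (chi0 : forall z, ~ box r z -> chi z = 0).

(** The smooth approximant of the indicator depends on [A], on [eta] and on the error, but the
    constant of [smooth_variation] does not, so the error can be sent to zero with [C] fixed. *)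
Lemma indicator_variation (b0 : B) : exists2 C : R, 0 <= C & forall eta : B, `|eta| <= 1 ->
  forall A : set 'rV[R]_n, measurable A ->
  `| \int[leb]_z (\1_A (F (b0 + eta + noise_inj z)) * mdet F (b0 + eta + noise_inj z) * chi z)
   - \int[leb]_z (\1_A (F (b0 + noise_inj z)) * mdet F (b0 + noise_inj z) * chi z) |
  <= C * `|eta|.
Proof.
have [C C0 hC] := smooth_variation hF cchi chi0 b0; exists C => // eta e1 A mA.
pose w (b : B) z := mdet F (b + noise_inj z) * chi z.
have cw b : continuous (w b).
  exact: (continuous_mul (continuous_slice (b := b) (C1_continuous (C1_mdet hF)))
    (C1_continuous cchi)).
have w0 b z : ~ box r z -> w b z = 0 by move=> nB; rewrite /w chi0// mulr0.
have iw b := integrable_continuous_box (cw b) (w0 b).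
have iwn b : leb.-integrable setT (EFin \o (fun z => `|w b z|)) by exact: integrable_norm (iw b).
pose V (f : 'rV[R]_n -> R) b := \int[leb]_z (f (F (b + noise_inj z)) * w b z).
have VE f b : \int[leb]_z (f (F (b + noise_inj z)) * mdet F (b + noise_inj z) * chi z) = V f b.
  by apply: eq_Rintegral => z _; rewrite mulrA.
have VD f b : V f b = \int[leb]_z (f (F (b + noise_inj z)) * w b z) by [].
clearbody V.
have iV f b : unit_valued f ->
    leb.-integrable setT (EFin \o (fun z => f (F (b + noise_inj z)) * w b z)).
  move=> [mf f01]; apply: (le_integrable measurableT _ _ (iwn b)).
    apply/measurable_EFinP; apply: measurable_funM.
      exact: (measurableT_comp mf (measurable_slice b)).
    exact: measurable_continuous_rV.
  move=> z _; rewrite /= lee_fin normr_id normrM ler_piMl//.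
  by have := f01 (F (b + noise_inj z)) => /andP[f0 f1]; rewrite ger0_norm.
suff : `|V \1_A (b0 + eta) - V \1_A b0| <= C * `|eta| by rewrite -2!VE.
apply/ler_addgt0Pr => e e0.
have w_ge0 b z : 0 <= `|w b z| by [].
pose G b z := F (b + noise_inj z).
have mG b : measurable_fun setT (G b) by exact: measurable_slice.
have happ := approximable_measurable (mG (b0 + eta)) (mG b0) (iwn (b0 + eta)) (iwn b0)
    (w_ge0 (b0 + eta)) (w_ge0 b0).
have [_ /(_ e e0) [phi [cphi phi01 phie]]] := happ A mA.
have uphi := unit_valued_C1 cphi phi01.
have uA := unit_valued_indic mA.
have phi1 x : `|phi x| <= 1 by have /andP[? ?] := phi01 x; rewrite ger0_norm.
have hphi : `|V phi (b0 + eta) - V phi b0| <= C * `|eta|.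
  by rewrite -2!VE; exact: hC.
have alg (a b c d' : R) : a - b = (c - d') + ((a - c) - (b - d')) by ring.
rewrite (alg _ _ (V phi (b0 + eta)) (V phi b0)).
rewrite (le_trans (ler_normD _ _))// lerD// (le_trans _ phie)//.
have iD b := integrableRB (iV _ b uA) (iV _ b uphi).
have E b : V \1_A b - V phi b = \int[leb]_z (\1_A (F (b + noise_inj z)) * w b z
    - phi (F (b + noise_inj z)) * w b z).
  by rewrite !VD RintegralB//; exact: iV.
have iDD := integrableRB (iD (b0 + eta)) (iD b0).
have ig := integrable_gap (mG (b0 + eta)) (mG b0) (iwn (b0 + eta)) (iwn b0)
    (w_ge0 (b0 + eta)) (w_ge0 b0) uphi uA.
rewrite (E (b0 + eta)) (E b0).
rewrite -(RintegralB measurableT (iD (b0 + eta)) (iD b0)).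
apply: le_trans (le_normr_Rintegral measurableT iDD) _.
apply: (le_Rintegral measurableT (integrable_norm iDD) ig).
move=> z _ /=; rewrite /gap.
exact: (norm_weighted_sub (\1_A (G (b0 + eta) z)) (phi (G (b0 + eta) z)) (w (b0 + eta) z)
  (\1_A (G b0 z)) (phi (G b0 z)) (w b0 z)).
Qed.

End indicator_variation.

(** * Continuity in total variation *)

Section cutoff.
Context (R : realType).

Lemma is_derive_quadratic (f : R -> R) (s l : R) :
  (forall h : R, `|f (h + s) - f s - h * l| <= h ^+ 2) -> is_derive s 1 f l.
Proof.
move=> H.
have cv : h^-1 *: (f (h *: 1 + s) - f s) @[h --> 0^'] --> l.
  apply/cvgrPdist_le => e e0.
  have h0 : \forall h \near (0 : R)^', h != 0 by exact: nbhs_dnbhs_neq.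
  have h1 : \forall h \near (0 : R)^', `|h| <= e.
    exact: dnbhs0_le.
  apply: filterS2 h0 h1 => h hn he; rewrite /GRing.scale/= mulr1.
  have E (u : R) : l - h^-1 * u = - (h^-1 * (u - h * l)) by field.
  rewrite E normrN normrM normfV (le_trans _ he)// ler_pdivrMl ?normr_gt0//.
  by rewrite (le_trans (H h))// -expr2 -normrX ler_norm.
by apply: DeriveDef; [apply/cvg_ex; exists l|exact/cvg_lim].
Qed.

Definition pos_part (s : R) : R := Num.max s 0.

Lemma pos_part_ge0 s : 0 <= pos_part s.
Proof. by rewrite le_max lexx orbT. Qed.

Lemma is_derive_pos_part2 (s : R) :
  is_derive s 1 (fun s => pos_part s ^+ 2) (2 * pos_part s).
Proof.
apply: is_derive_quadratic => h; rewrite /pos_part !maxEle ler_norml.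
by case: (lerP (h + s) 0) => h1; case: (lerP s 0) => h2; apply/andP; split; nra.
Qed.

Lemma continuous_pos_part : continuous pos_part.
Proof.
move=> s; have ci : {for s, continuous (fun s : R => s)} by move=> A.
have c0 : {for s, continuous (fun _ : R => 0 : R)} by exact: cst_continuous.
exact: (continuous_max ci c0).
Qed.

Context (d : nat).

(** Squaring the positive part makes it of class C^1, which is all that the integration by parts
    asks of a cutoff. *)
Definition cutoff (r : R) (z : 'rV[R]_d) : R := \prod_j pos_part (1 - (z 0 j / r) ^+ 2) ^+ 2.

Lemma C1_cutoff r : C1 (cutoff r).
Proof.
rewrite /cutoff; apply: C1_prod => j.
have c1 := C1_mul (C1_coordinate R j) (C1_cst 'rV[R]_d (r^-1)).
have c2 := C1_add (C1_cst 'rV[R]_d 1) (C1_mul (C1_cst 'rV[R]_d (-1)) (C1_mul c1 c1)).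
have c3 : C1 (fun z : 'rV[R]_d => 1 - (z 0 j / r) ^+ 2 : R).
  have -> : (fun z : 'rV[R]_d => 1 - (z 0 j / r) ^+ 2 : R)
      = fun z => 1 + (-1) * (z 0 j * r^-1 * (z 0 j * r^-1)).
    by apply/funext => z; rewrite mulN1r expr2.
  exact c2.
have ch : continuous (fun s => 2 * pos_part s).
  by move=> s; apply: cvgM; [exact: cvg_cst|exact: continuous_pos_part].
exact: (C1_comp_real is_derive_pos_part2 ch c3).
Qed.

Lemma cutoff_itv r z : 0 <= cutoff r z <= 1.
Proof.
have h j : 0 <= pos_part (1 - (z 0 j / r) ^+ 2) ^+ 2 <= 1.
  rewrite sqr_ge0/= expr_le1 ?pos_part_ge0//.
  by rewrite /pos_part ge_max ler01 andbT gerBl sqr_ge0.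
apply: (big_ind (fun x : R => 0 <= x <= 1)) => [|x y /andP[x0 x1] /andP[y0 y1]|j _].
- by rewrite ler01 lexx.
- by rewrite mulr_ge0//= mulr_ile1.
- exact: h.
Qed.

Lemma cutoff_off_box r z : 0 < r -> ~ box r z -> cutoff r z = 0.
Proof.
move=> r0 /existsNP[j] /negP; rewrite -ltNge => rz.
rewrite /cutoff (bigD1 j)//= [pos_part _](_ : _ = 0) ?expr0n ?mul0r//.
apply/eqP; rewrite /pos_part maxEle; case: ifP => // /negbT; rewrite -ltNge subr_gt0 => h.
suff : 1 <= (z 0 j / r) ^+ 2 by rewrite leNgt h.
by rewrite -real_normK ?num_real// exprn_ege1// normf_div (gtr0_norm r0) ler_pdivlMr// mul1r ltW.
Qed.

Lemma cutoff_cvg (z : 'rV[R]_d) : (fun k => cutoff k.+1%:R z) @ \oo --> (1 : R).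
Proof.
have h (x : R) : (fun k => pos_part (1 - (x / k.+1%:R) ^+ 2) ^+ 2) @ \oo --> (1 : R).
  have c1 : (fun k => x / k.+1%:R) @ \oo --> (0 : R).
    by rewrite -(mulr0 x); apply: cvgM; [exact: cvg_cst|exact: cvg_harmonic].
  have c2 : (fun k => 1 - (x / k.+1%:R) ^+ 2) @ \oo --> (1 : R).
    rewrite -[X in _ --> X]subr0; apply: cvgB; first exact: cvg_cst.
    by rewrite -(mulr0 (0 : R)); under eq_fun do rewrite expr2; exact: cvgM.
  have c3 : (fun k => pos_part (1 - (x / k.+1%:R) ^+ 2)) @ \oo --> pos_part 1.
    exact: (cvg_comp _ _ c2 (@continuous_pos_part 1)).
  have p1 : pos_part 1 = 1 by rewrite /pos_part maxEle ler10.
  have h2 : (fun k => pos_part (1 - (x / k.+1%:R) ^+ 2) ^+ 2) @ \oo --> pos_part 1 * pos_part 1.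
    by under eq_fun do rewrite expr2; exact: cvgM.
  by move: h2; rewrite p1 mulr1.
rewrite /cutoff; elim: (index_enum 'I_d) => [|j s IH].
  under eq_fun do rewrite big_nil; exact: cvg_cst.
have h3 : (fun k => pos_part (1 - (z 0 j / k.+1%:R) ^+ 2) ^+ 2 *
    \prod_(j <- s) pos_part (1 - (z 0 j / k.+1%:R) ^+ 2) ^+ 2) @ \oo --> (1 * 1 : R).
  by apply: cvgM; [exact: h|exact: IH].
rewrite mulr1 in h3; by under eq_fun do rewrite big_cons.
Qed.

End cutoff.

Lemma telescoped_bound (R : realType) (x1 x2 x3 x4 x5 y1 y2 e : R) : y1 + y2 <= e / 4 ->
  `|x1| <= e / 4 -> `|x4| <= e / 4 -> `|x2| <= y1 -> `|x3 - x5| <= y2 ->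
  `|x1 + x2 + x3 - (x4 + x5)| <= e.
Proof.
rewrite !ler_norml => ? /andP[? ?] /andP[? ?] /andP[? ?] /andP[? ?].
by apply/andP; split; lra.
Qed.

Section total_variation_continuity.
Context (R : realType) (n d : nat).
Local Notation B := ('rV[R]_n * 'rV[R]_d)%type.
Local Notation leb := (lebesgue_rV R d).

Lemma C1_slice (u : B -> R) (b : B) : C1 u -> C1 (fun z : 'rV[R]_d => u (b + noise_inj z) : R).
Proof.
move=> cu; pose q : 'rV[R]_d -> B := cst b + (fun z => (cst 0 z, id z)).
have dq z : is_diff z q (0 + (fun z => ((0 : 'rV[R]_d -> 'rV[R]_n) z, id z))).
  exact: is_diffD.
have dqz z : differentiable q z by exact: (@ex_diff _ _ _ _ _ _ _ (dq z)).
apply: (@C1_intro _ _ _ (fun z v => 'd u (b + noise_inj z) (noise_inj v))) => [z|z v|v].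
- exact: (differentiable_comp (dqz z) (cu.1 (q z))).
- have -> : (fun z => u (b + noise_inj z)) = u \o q by [].
  by rewrite (diff_comp (dqz z) (cu.1 (q z)))/= (@diff_val _ _ _ _ _ _ _ (dq z)) add0r.
- exact: (continuous_slice (cu.2 (noise_inj v))).
Qed.

Lemma is_derive_regularized_inverse (a : R) (s : R) : 0 < a ->
  is_derive s 1 (fun s : R => (s ^+ 2 + a)^-1) (- (s ^+ 2 + a) ^- 2 * (2 * s)).
Proof.
move=> a0; have p0 : s ^+ 2 + a != 0 by rewrite gt_eqF// ltr_wpDl// sqr_ge0.
have d1 : is_derive s 1 (fun s : R => s ^+ 2 + a) (2 * s).
  by apply: is_derive_eq; rewrite /GRing.scale/=; ring.
have h := @is_deriveV R (fun s => s ^+ 2 + a) s (2 * s) 1 p0 d1.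
exact: (is_derive_eq h).
Qed.

Lemma continuous_regularized_inverse' (a : R) : 0 < a ->
  continuous (fun s : R => - (s ^+ 2 + a) ^- 2 * (2 * s)).
Proof.
move=> a0 s; have p0 : s ^+ 2 + a != 0 by rewrite gt_eqF// ltr_wpDl// sqr_ge0.
have ci : (fun s : R => s) @ s --> s by move=> A.
have c2 : (fun s : R => s ^+ 2 + a) @ s --> s ^+ 2 + a.
  by apply: cvgD; [exact: exprn_continuous|exact: cvg_cst].
apply: cvgM; last by apply: cvgM; [exact: cvg_cst|exact: ci].
have c3 : (fun s : R => (s ^+ 2 + a) ^+ 2) @ s --> (s ^+ 2 + a) ^+ 2.
  by rewrite expr2; under eq_fun do rewrite expr2; exact: cvgM.
by apply: cvgN; apply: cvgV => //; rewrite expf_neq0.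
Qed.

Variable F : B -> 'rV[R]_n.
Hypothesis hF : C2 F.
Variable g : 'rV[R]_d -> R.
Hypotheses (cg : C1 g) (g0 : forall z, 0 <= g z).
Hypothesis ig : leb.-integrable setT (EFin \o g).
Variable b0 : B.
Hypothesis D0 : {ae leb, forall z, mdet F (b0 + noise_inj z) != 0}.

Let D z : R := mdet F (b0 + noise_inj z).

Let cD : C1 D. Proof. exact: C1_slice (C1_mdet hF). Qed.

(** A compactly supported C^1 substitute for g / D: the quotient 1 / D is regularised to D / (D^2 +
    1/(k+1)), which is smooth across the zeros of D, and its product with D lies between 0 and 1. *)
Definition inverted_density (k : nat) (z : 'rV[R]_d) : R :=
  cutoff k.+1%:R z * (g z * (D z * (D z ^+ 2 + k.+1%:R^-1)^-1)).

Lemma C1_inverted_density k : C1 (inverted_density k).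
Proof.
have a0 : 0 < k.+1%:R^-1 :> R by rewrite invr_gt0.
have c1 := C1_comp_real (fun s => is_derive_regularized_inverse s a0)
  (continuous_regularized_inverse' a0) cD.
exact: (C1_mul (C1_cutoff d k.+1%:R) (C1_mul cg (C1_mul cD c1))).
Qed.

Lemma inverted_density_off_box k z : ~ box k.+1%:R z -> inverted_density k z = 0.
Proof. by move=> nB; rewrite /inverted_density cutoff_off_box// mul0r. Qed.

Let p k z := D z * inverted_density k z.

Let p_itv k z : 0 <= p k z <= g z.
Proof.
have a0 : 0 < k.+1%:R^-1 :> R by rewrite invr_gt0.
have -> : p k z = cutoff k.+1%:R z * (D z ^+ 2 / (D z ^+ 2 + k.+1%:R^-1)) * g z.
  by rewrite /p /inverted_density; ring.
have /andP[c0 c1] := cutoff_itv k.+1%:R z.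
have D2 := sqr_ge0 (D z).
have q0 : 0 < D z ^+ 2 + k.+1%:R^-1 by rewrite ltr_wpDl.
have r0 : 0 <= D z ^+ 2 / (D z ^+ 2 + k.+1%:R^-1) by rewrite divr_ge0// ltW.
have r1 : D z ^+ 2 / (D z ^+ 2 + k.+1%:R^-1) <= 1 by rewrite ler_pdivrMr// mul1r lerDl ltW.
apply/andP; split; first exact: mulr_ge0 (mulr_ge0 c0 r0) (g0 z).
by apply: ler_piMl; [exact: g0|exact: mulr_ile1].
Qed.

(** The limit of [p k z] at every point, zeros of D included; it agrees with [g] almost everywhere
    by [D0]. *)
Let f z : R := if D z == 0 then 0 else g z.

Let p_cvg z : (fun k => p k z) @ \oo --> f z.
Proof.
rewrite /f; have [Dz|Dz] := eqVneq (D z) 0.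
  have -> : (fun k => p k z) = fun _ => 0 by apply/funext => k; rewrite /p Dz mul0r.
  exact: cvg_cst.
have -> : (fun k => p k z) = fun k =>
    D z * (cutoff k.+1%:R z * (g z * (D z * (D z ^+ 2 + k.+1%:R^-1)^-1))) by [].
have e : g z = D z * (1 * (g z * (D z * (D z ^+ 2 + 0)^-1))).
  by rewrite addr0; field.
rewrite [X in _ --> X]e.
apply: cvgM; first exact: cvg_cst.
apply: cvgM; first exact: cutoff_cvg.
apply: cvgM; first exact: cvg_cst.
apply: cvgM; first exact: cvg_cst.
apply: cvgV; first by rewrite addr0 expf_neq0.
by apply: cvgD; [exact: cvg_cst|exact: cvg_harmonic].
Qed.

Let cp k : continuous (p k).
Proof. exact: (continuous_mul (C1_continuous cD) (C1_continuous (C1_inverted_density k))). Qed.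

Let mg : measurable_fun setT g.
Proof. exact: measurable_continuous_rV (C1_continuous cg). Qed.

Let ip k : leb.-integrable setT (EFin \o p k).
Proof.
apply: (le_integrable measurableT _ _ ig).
  by apply/measurable_EFinP; exact: measurable_continuous_rV (@cp k).
move=> z _ /=; have /andP[p0 pg] := p_itv k z.
by rewrite lee_fin !ger0_norm.
Qed.

Lemma inverted_density_cvg :
  (fun k => \int[leb]_z `|g z - D z * inverted_density k z|) @ \oo --> (0 : R).
Proof.
have mf : measurable_fun setT f.
  by apply: (measurable_fun_cvg (fun k => measurable_continuous_rV (@cp k))) => z _; exact: p_cvg.
have fg z : 0 <= f z <= g z by rewrite /f; case: ifP; rewrite ?lexx ?g0.
have E k : \int[leb]_z `|g z - D z * inverted_density k z| = \int[leb]_z `|f z - p k z|.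
  rewrite /Rintegral; congr fine; apply: ae_eq_integral => //.
  - apply/measurable_EFinP; apply: measurableT_comp => //; apply: measurable_funB => //.
    exact: measurable_continuous_rV (@cp k).
  - apply/measurable_EFinP; apply: measurableT_comp => //; apply: measurable_funB => //.
    exact: measurable_continuous_rV (@cp k).
  - by apply: filterS D0 => z Dz _; rewrite /f /D (negbTE Dz).
rewrite (funext E).
have -> : (0 : R) = \int[leb]_z (0 : R) by rewrite /Rintegral integral0.
apply: (Rintegral_dominated_cvg (g := g) _ _ ig _).2 => [k|z|k z].
- apply: measurableT_comp => //; apply: measurable_funB => //.
  exact: measurable_continuous_rV (@cp k).
- rewrite -(normr0 R); apply: cvg_norm; rewrite -(subrr (f z)).
  by apply: cvgB; [exact: cvg_cst|exact: p_cvg].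
- have /andP[p0 pg] := p_itv k z; have /andP[f0' fg'] := fg z.
  by rewrite normr_id ler_norml; apply/andP; split; lra.
Qed.

(** With [chi] an [inverted_density], [g] is replaced by [D * chi] in both integrals, the
    determinant being the one at [b0], where [D0] is assumed. What remains is the change of the
    determinant, of Lipschitz size, and the term of [indicator_variation]. The resulting [del] does
    not depend on [A]. *)
Lemma tv_variation (e : R) : 0 < e -> exists2 del : R, 0 < del &
  forall eta : B, `|eta| < del -> forall A : set 'rV[R]_n, measurable A ->
  `| \int[leb]_z (\1_A (F (b0 + eta + noise_inj z)) * g z)
   - \int[leb]_z (\1_A (F (b0 + noise_inj z)) * g z) | <= e.
Proof.
move=> e0; have e40 : 0 < e / 4 by rewrite divr_gt0.
have /cvgrPdist_le/(_ _ e40)[k _ /(_ k (leqnn k))/=] := inverted_density_cvg.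
rewrite sub0r normrN => /(le_trans (ler_norm _)) hk.
pose chi := inverted_density k.
have cchi : C1 chi := C1_inverted_density k.
have chi0 z : ~ box k.+1%:R z -> chi z = 0 by exact: inverted_density_off_box.
have [C C0 hC] := indicator_variation hF cchi chi0 b0.
have [M M0 hM] := lipschitz_tube b0 k.+1%:R (C1_mdet hF).
have ichi := integrable_continuous_box (C1_continuous cchi) chi0.
have iachi := integrable_norm ichi.
pose I := \int[leb]_z `|chi z|.
have I0 : 0 <= I by apply: Rintegral_ge0.
have K0 : 0 < M * I + C + 1 by rewrite ltr_wpDl// addr_ge0// mulr_ge0.
(* The bounds require |eta| <= 1. The coefficient [M * I + C] is the sum of the Lipschitz constants
   of the two last errors, and 1 is added to divide by a positive number. *)
exists (Num.min 1 (e / 4 / (M * I + C + 1))); first by rewrite lt_min ltr01 divr_gt0.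
move=> eta; rewrite lt_min => /andP[/ltW e1 he] A mA.
have hK : (M * I + C) * `|eta| <= e / 4.
  move: he; rewrite ltr_pdivlMr// => he; rewrite (le_trans _ (ltW he))//.
  by rewrite mulrC ler_wpM2l// lerDl.
pose a1 z : R := \1_A (F (b0 + eta + noise_inj z)).
pose a0 z : R := \1_A (F (b0 + noise_inj z)).
have ms b : measurable_fun setT (fun z => F (b + noise_inj z)) by exact: measurable_slice.
have ma1 : measurable_fun setT a1.
  exact: (measurableT_comp (unit_valued_indic mA).1 (ms (b0 + eta))).
have ma0 : measurable_fun setT a0.
  exact: (measurableT_comp (unit_valued_indic mA).1 (ms b0)).
have a11 z : `|a1 z| <= 1 by rewrite /a1 indicE; case: (_ \in _); rewrite ?normr1 ?normr0.
have a01 z : `|a0 z| <= 1 by rewrite /a0 indicE; case: (_ \in _); rewrite ?normr1 ?normr0.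
pose De z : R := mdet F (b0 + eta + noise_inj z).
have cDe : C1 De := C1_slice (b0 + eta) (C1_mdet hF).
have iw (a w : 'rV[R]_d -> R) : measurable_fun setT a -> (forall z, `|a z| <= 1) ->
    leb.-integrable setT (EFin \o w) -> leb.-integrable setT (EFin \o (fun z => a z * w z)).
  move=> ma a_1 iw; apply: (le_integrable measurableT _ _ iw).
    move: iw => /measurable_int/measurable_EFinP mw.
    by apply/measurable_EFinP; exact: measurable_funM.
  by move=> z _; rewrite /= lee_fin normrM ler_piMl.
have iwle (a w : 'rV[R]_d -> R) : measurable_fun setT a -> (forall z, `|a z| <= 1) ->
    leb.-integrable setT (EFin \o w) -> `|\int[leb]_z (a z * w z)| <= \int[leb]_z `|w z|.
  move=> ma a_1 iw'; have h := iw _ _ ma a_1 iw'.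
  apply: le_trans (le_normr_Rintegral measurableT h) _.
  apply: (le_Rintegral measurableT (integrable_norm h) (integrable_norm iw')) => z _.
  by rewrite /= normrM ler_piMl.
have cDchi (u : 'rV[R]_d -> R) : continuous u -> leb.-integrable setT (EFin \o (fun z => u z * chi z)).
  move=> cu; apply: (integrable_continuous_box (r := k.+1%:R)).
    exact: (continuous_mul cu (C1_continuous cchi)).
  by move=> z nB; rewrite chi0// mulr0.
have iD := cDchi _ (C1_continuous cD).
have iDe := cDchi _ (C1_continuous cDe).
have iG := integrableRB ig iD.
have iDD := integrableRB iD iDe.
have i1 := iw _ _ ma1 a11 iG; have i2 := iw _ _ ma1 a11 iDD; have i3 := iw _ _ ma1 a11 iDe.
have j1 := iw _ _ ma0 a01 iG; have j2 := iw _ _ ma0 a01 iD.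
have E1 : \int[leb]_z (a1 z * g z) = \int[leb]_z (a1 z * (g z - D z * chi z))
    + \int[leb]_z (a1 z * (D z * chi z - De z * chi z)) + \int[leb]_z (a1 z * (De z * chi z)).
  rewrite -(RintegralD measurableT i1 i2) -(RintegralD measurableT (integrableRD i1 i2) i3).
  apply: eq_Rintegral => z _ /=; move: (a1 z) (D z) (De z) (chi z) (g z) => v1 v2 v3 v4 v5.
  by ring.
have E0 : \int[leb]_z (a0 z * g z) = \int[leb]_z (a0 z * (g z - D z * chi z))
    + \int[leb]_z (a0 z * (D z * chi z)).
  rewrite -(RintegralD measurableT j1 j2).
  apply: eq_Rintegral => z _ /=; move: (a0 z) (D z) (chi z) (g z) => v1 v2 v4 v5.
  by ring.
have h1 := le_trans (iwle _ _ ma1 a11 iG) hk.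
have h0 := le_trans (iwle _ _ ma0 a01 iG) hk.
have h2 : `|\int[leb]_z (a1 z * (D z * chi z - De z * chi z))| <= M * I * `|eta|.
  apply: le_trans (iwle _ _ ma1 a11 iDD) _.
  rewrite mulrAC -(RintegralZl (M * `|eta|) measurableT iachi).
  apply: (le_Rintegral measurableT (integrable_norm iDD) (integrableRZ (M * `|eta|) iachi)) => z _.
  rewrite /= -mulrBl normrM.
  have [Bz|/chi0 ->] := pselect (box k.+1%:R z); last by rewrite normr0 !mulr0.
  by rewrite ler_wpM2r// distrC; exact: hM.
have h3 := hC eta e1 A mA.
have h3' : `|\int[leb]_z (a1 z * (De z * chi z)) - \int[leb]_z (a0 z * (D z * chi z))|
    <= C * `|eta|.
  apply: le_trans h3; rewrite le_eqVlt; apply/orP; left; apply/eqP; congr (`|_ - _|);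
    by apply: eq_Rintegral => z _; rewrite mulrA.
rewrite E1 E0; rewrite mulrDl in hK.
exact: telescoped_bound hK h1 h0 h2 h3'.
Qed.

End total_variation_continuity.

(** * Invertibility of the Malliavin matrix at fixed position *)

Lemma rV_norm_le (R : realType) m (x : 'rV[R]_m) (r : R) : 0 <= r -> box r x -> `|x| <= r.
Proof.
move=> r0 xr; have -> : `|x| = mx_norm x by [].
rewrite mx_normE -[leRHS]/(NngNum r0)%:num num_le.
apply: bigmax_le => [|[i j] _]; first by rewrite -num_le.
by rewrite -num_le/= (ord1 i).
Qed.

Section translation.
Context (R : realType).
Local Notation leb := (@lebesgue_measure R).

Lemma measurable_translation d (c : 'rV[R]_d) :
  measurable_fun setT (fun z : 'rV[R]_d => c + z).
Proof.
apply: measurable_rV => j.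
have -> : (fun z : 'rV[R]_d => (c + z) 0 j) = fun z => c 0 j + z 0 j.
  by apply/funext => z; rewrite mxE.
by apply: measurable_funD => //; exact: measurable_coord.
Qed.

Lemma ge0_integral_rV_translation d (c : 'rV[R]_d) (f : 'rV[R]_d -> \bar R) :
  measurable_fun setT f -> (forall z, 0 <= f z)%E ->
  (\int[lebesgue_rV R d]_z f (c + z)%R = \int[lebesgue_rV R d]_z f z)%E.
Proof.
elim: d c f => [|d IH] c f mf f0.
  by apply: eq_integral => z _; rewrite [c]thinmx0 add0r.
have mfc := measurableT_comp mf (measurable_translation c).
rewrite !ge0_integral_lebesgue_rVS//.
have cE (p : R * 'rV[R]_d) : c + consr p = consr (p.1 + c 0 ord0, tailr c + p.2).
  apply/rowP => j; rewrite mxE; case: (unliftP ord0 j) => [k ->|->].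
    by rewrite !consrS mxE mxE.
  by rewrite !consr0 addrC.
pose h (p : R * 'rV[R]_d) := f (consr p).
have mh : measurable_fun setT h := measurableT_comp mf (@measurable_consr R d).
have mh' : measurable_fun setT (fun p : R * 'rV[R]_d => f (c + consr p)).
  exact: (measurableT_comp mfc (@measurable_consr R d)).
rewrite !fubini_tonelli1//.
pose G a := (\int[lebesgue_rV R d]_z h (a, z))%E.
have h0 z : (0 <= h z)%E by exact: f0.
have mG : measurable_fun setT G by exact: measurable_fun_fubini_tonelli_F.
have G0 a : (0 <= G a)%E by apply: integral_ge0.
transitivity (\int[leb]_a G (a + c 0 ord0)%R)%E; last exact: ge0_integral_shift.
apply: eq_integral => a _.
have := IH (tailr c) (fun z => f (consr (a + c 0 ord0, z))).
rewrite /G /h /fubini_F => <-; [|exact: (measurableT_comp mh (measurable_pair1 _))|by move=> z].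
by apply: eq_integral => z _; rewrite cE.
Qed.

Lemma negligible_translation d (c : 'rV[R]_d) (N : set 'rV[R]_d) :
  (lebesgue_rV R d).-negligible N ->
  (lebesgue_rV R d).-negligible [set z | N (c + z)].
Proof.
move=> [A [mA A0 NA]]; exists ((fun z => c + z) @^-1` A); split.
- by rewrite -[X in measurable X]setTI; exact: measurable_translation.
- have mc := measurable_translation c.
  have mS : measurable ((fun z => c + z) @^-1` A).
    by rewrite -[X in measurable X]setTI; exact: mc.
  have lebE (S : set 'rV[R]_d) : measurable S ->
      lebesgue_rV R d S = (\int[lebesgue_rV R d]_z (\1_S z)%:E)%E.
    by move=> ?; rewrite integral_indic// setIT.
  rewrite lebE// -A0 lebE//.
  rewrite -[RHS](ge0_integral_rV_translation c)//.
  by apply/measurable_EFinP; exact: measurable_indic.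
- by move=> z /NA.
Qed.

Lemma lebesgue_rV_box_gt0 d (r : R) : 0 < r -> (0 < lebesgue_rV R d (box r))%E.
Proof.
move=> r0; elim: d => [|d IH].
  by rewrite /= diracE mem_set// => -[].
rewrite /= /pushforward.
have -> : (fun p : R * 'rV[R]_d => row_mx (p.1)%:M p.2 : 'rV[R]_(1 + d)) @^-1` @box R d.+1 r
   = `[- r, r]%classic `*` @box R d r.
  apply/seteqP; split => [p h|p [h1 h2] j].
    split; first by have := h ord0; rewrite [X in `|X|]consr0 /= in_itv/= -ler_norml.
    by move=> j; have := h (lift ord0 j); rewrite [X in `|X|]consrS.
  case: (unliftP ord0 j) => [k ->|->]; first by rewrite [X in `|X|]consrS; exact: h2.
  by move: h1; rewrite [X in `|X|]consr0 /= in_itv/= -ler_norml.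
rewrite product_measure1E//; [|exact: measurable_box].
have h : (0 < leb `[(- r)%R, r]%classic)%E.
  rewrite lebesgue_measure_itv/= lte_fin ifT; last by lra.
  by rewrite -EFinB lte_fin; lra.
exact: mule_gt0 h IH.
Qed.

End translation.

Section invertibility.
Context (R : realType) (n d : nat).
Local Notation B := ('rV[R]_n * 'rV[R]_d)%type.
Variable Phi : 'rV[R]_n -> 'rV[R]_d -> 'rV[R]_n.
Let F (y : B) := Phi y.1 y.2.
Hypothesis hF : C2 F.

Lemma malliavin_mxE x w : malliavin_mx Phi x w = mallM F (x, w).
Proof.
have xw (z : 'rV[R]_d) : (x, 0) + noise_inj z = (x, z).
  by apply/eqP; rewrite xpair_eqE/= addr0 add0r !eqxx.
have pdwE k i : pdw k (component Phi i) x w = pdF F (noise_dir k) i (x, w).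
  have h := is_derive_slice (x, 0) w k (C1_coord i hF.1).
  rewrite /pdw /component.
  have -> : (fun w => Phi x w 0 i) = fun z => F ((x, 0) + noise_inj z) 0 i.
    by apply/funext => z; rewrite xw.
  rewrite (@derive_val _ _ _ _ _ _ _ h) xw; exact: diff_F_coord.
by apply/matrixP => i j; rewrite !mxE; apply: eq_bigr => k _; rewrite !pdwE.
Qed.

Hypothesis hMunit : {ae (lebesgue_rV R n \x lebesgue_rV R d)%E,
  forall z, malliavin_mx Phi z.1 z.2 \in unitmx}.
Hypothesis hMinv : C0Gamma (fun x w => (\det (malliavin_mx Phi x w))^-1).

Let D (y : B) : R := mdet F y.

Let cD : C1 D. Proof. exact: C1_mdet. Qed.

Let GD x w : (\det (malliavin_mx Phi x w))^-1 = (D (x, w))^-1.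
Proof. by rewrite malliavin_mxE. Qed.

(** Tonelli's theorem gives invertibility for almost every position only. The following lemmas
    extend it to every position through the mean continuity of the inverse determinant. *)
Lemma ae_state_invertible : {ae lebesgue_rV R n, forall y : 'rV[R]_n,
  {ae lebesgue_rV R d, forall w, D (y, w) != 0}}.
Proof.
have [A [mA A0 NA]] := hMunit.
have h : {ae lebesgue_rV R n, forall y, lebesgue_rV R d (xsection A y) = 0%E}.
  have mx := @measurable_fun_xsection _ _ _ _ R (lebesgue_rV R d) A mA.
  have /(ae_eq_integral_abs _ measurableT mx) : (\int[lebesgue_rV R n]_y
      `| (lebesgue_rV R d \o xsection A) y| = 0)%E.
    rewrite -[RHS]A0 /product_measure1; apply: eq_integral => y _.
    by rewrite gee0_abs//= measure_ge0.
  by apply: filterS => y /(_ I).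
apply: filterS h => y hy; exists (xsection A y); split => //.
  exact: measurable_xsection.
move=> w /= Dw; rewrite /xsection/=; apply/mem_set; apply: NA => /=.
by rewrite unitmxE unitfE malliavin_mxE => h; apply: Dw; exact: h.
Qed.

Let LG (y x : 'rV[R]_n) : \bar R := (\int[lebesgue_rV R d]_w
  (`|(D (y, w))^-1 - (D (x, w))^-1| * expR (- sqnorm2 w))%:E)%E.

Lemma gaussian_L1_cvg x : (fun y => LG y x) @ x --> 0%E.
Proof.
have := hMinv.2 1 1 ltr01 (lexx _) x.
suff -> : (fun y => LGamma_norm 1 1 (fun w => (\det (malliavin_mx Phi y w))^-1
    - (\det (malliavin_mx Phi x w))^-1)) = (fun y => LG y x) by [].
apply/funext => y; rewrite /LGamma_norm invr1 poweRe1; last first.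
  by apply: integral_ge0 => w _; rewrite lee_fin mulr_ge0// ?powR_ge0// expR_ge0.
by apply: eq_integral => w _; rewrite powRr1// !GD mulN1r.
Qed.

Let mD x : measurable_fun setT (fun w => D (x, w)).
Proof.
have cs := continuous_slice (b := (x, 0)) (C1_continuous cD).
have -> : (fun w => D (x, w)) = fun z => D ((x, 0) + noise_inj z).
  by apply/funext => z; congr D; apply/eqP; rewrite xpair_eqE/= addr0 add0r !eqxx.
exact: (measurable_continuous_rV cs).
Qed.

(* On the zero set of D(x,.) the junk value 0^-1 = 0 makes the integrand of
   LG y x equal to |D(y,.)|^-1, which is large when y is close to x. *)
Lemma negligible_zero_box x (r : R) : 0 < r ->
  lebesgue_rV R d ([set w | D (x, w) = 0] `&` box r) = 0%E.
Proof.
move=> r0; set Z := _ `&` _.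
have mZ : measurable Z.
  apply: measurableI; last exact: measurable_box.
  have -> : [set w | D (x, w) = 0] = setT `&` (fun w => D (x, w)) @^-1` [set 0].
    by rewrite setTI.
  exact: mD.
have [M M0 hM] := lipschitz_tube (x, 0) r cD.
have hM' (y : 'rV[R]_n) w : box r w -> `|y - x| <= 1 -> `|D (y, w) - D (x, w)| <= M * `|y - x|.
  move=> bw yx; have e1 : `|((y - x, 0) : B)| = `|y - x|.
    by rewrite prod_normE/= normr0 max_l.
  have := hM (y - x, 0) w bw; rewrite e1 => /(_ yx).
  have -> : (x, 0) + (y - x, 0) + noise_inj w = (y, w) :> B.
    apply/eqP; rewrite xpair_eqE/=; apply/andP; split; apply/eqP.
      by rewrite addr0 addrC subrK.
    by rewrite !add0r.
  have -> : (x, 0) + noise_inj w = (x, w) :> B.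
    by apply/eqP; rewrite xpair_eqE/= addr0 add0r !eqxx.
  by [].
pose c := expR (- (d%:R * r ^+ 2)).
have c0 : 0 < c by exact: expR_gt0.
have hc (w : 'rV[R]_d) : box r w -> c <= expR (- sqnorm2 w).
  move=> bw; rewrite ler_expR lerN2 /sqnorm2.
  apply: (@le_trans _ _ (\sum_(j < d) r ^+ 2)); last first.
    by rewrite sumr_const card_ord mulr_natl.
  by apply: ler_sum => j _; rewrite -real_normK ?num_real// lerXn2r// ?nnegrE ?(ltW r0).
(* For a [y] within [e] of [x], |D(y, w)| <= M e on [Z], hence its inverse is at least 1/(M e)
   there, whereas [LG y x] is at most 1. The constant [c] bounds the Gaussian weight from below on
   the box. *)
have key (e : R) : 0 < e -> e <= 1 -> (c%:E * lebesgue_rV R d Z <= (M * e)%:E)%E.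
  move=> e0 e1.
  have [y [ye yL yD]] : exists y, [/\ `|y - x| <= e, (LG y x <= 1)%E &
      {ae lebesgue_rV R d, forall w, D (y, w) != 0}].
    have h1 : \forall y \near x, (LG y x <= 1)%E.
      have : nbhs 0%E [set z : \bar R | (z <= 1)%E].
        have := @nbhs_open_ereal_lt R 0 1 ltr01.
        apply: filterS => z /ltW//.
      exact: gaussian_L1_cvg.
    have /nbhs_ballP[t /= t0 ht] := h1.
    have m0 : 0 < Num.min (t / 2) e by rewrite lt_min e0 divr_gt0.
    (* Otherwise a small box around [x] would consist of positions where invertibility fails, and
       would be negligible in spite of its positive measure. *)
    apply: contrapT => nex.
    have := negligible_translation x ae_state_invertible.
    have mB := @measurable_box R n (Num.min (t / 2) e).
    suff sub : box (Num.min (t / 2) e) `<=`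
        [set z | (~` [set y | {ae lebesgue_rV R d, forall w, D (y, w) != 0}]) (x + z)].
      move/(negligibleS sub)/(negligibleP _ mB) => b0.
      by have := @lebesgue_rV_box_gt0 R n _ m0; rewrite b0 ltxx.
    move=> z bz yD; apply: nex; exists (x + z); split => //.
      rewrite addrC addKr.
      by rewrite (le_trans (rV_norm_le (ltW m0) bz))// ge_min lexx orbT.
    apply: ht; rewrite -ball_normE /ball_/= opprD addNKr normrN.
    rewrite (le_lt_trans (rV_norm_le (ltW m0) bz))// gt_min; apply/orP; left; lra.
  have le1 w : Z w -> D (y, w) != 0 -> c <= M * e * (`|(D (y, w))^-1 - (D (x, w))^-1| * expR (- sqnorm2 w)).
    move=> [/= Dx bw] Dy; rewrite Dx invr0 subr0.
    have := hM' y w bw (le_trans ye e1); rewrite Dx subr0 => Dle.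
    have D1 : 1 <= M * e * `|(D (y, w))^-1|.
      rewrite normfV ler_pdivlMr ?normr_gt0// mul1r (le_trans Dle)//.
      by rewrite ler_wpM2l.
    rewrite mulrA (le_trans (hc w bw))// ler_peMl// expR_ge0.
  have mLG : measurable_fun setT (fun w => `|(D (y, w))^-1 - (D (x, w))^-1| * expR (- sqnorm2 w)).
    apply: measurable_funM.
      apply: measurableT_comp => //; apply: measurable_funB.
        have := (hMinv.1 y).1; congr (measurable_fun _ _); apply/funext => w; exact: GD.
      have := (hMinv.1 x).1; congr (measurable_fun _ _); apply/funext => w; exact: GD.
    apply: measurableT_comp => //; apply: measurableT_comp => //.
    by apply: measurable_sum => j; apply: measurable_funX; exact: measurable_coord.
  rewrite -[Z]setIT -integral_indic// -ge0_integralZl//; last 2 first.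
    by apply/measurable_EFinP; exact: measurable_indic.
    by rewrite lee_fin ltW.
  apply: (@le_trans _ _ ((M * e)%:E * LG y x)%E); last first.
    by rewrite -[leRHS]mule1 lee_wpmul2l// lee_fin mulr_ge0// ltW.
  have nn (w : 'rV[R]_d) : setT w -> (0 <= (`|(D (y, w))^-1 - (D (x, w))^-1|
      * expR (- sqnorm2 w))%:E)%E.
    by move=> _; rewrite lee_fin mulr_ge0// expR_ge0.
  have k0 : (0 <= (M * e)%:E)%E by rewrite lee_fin mulr_ge0// ltW.
  have mLG' := (measurable_EFinP _ _).2 mLG.
  rewrite /LG -(ge0_integralZl _ measurableT mLG' nn k0).
  apply: ae_ge0_le_integral => //.
  - by move=> w _; rewrite mule_ge0// lee_fin// ltW.
  - apply/measurable_EFinP; apply: measurable_funM => //; exact: measurable_indic.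
  - by move=> w _; rewrite -EFinM lee_fin !mulr_ge0// ?expR_ge0// ltW.
  - by apply/measurable_EFinP; exact: measurable_funM.
  apply: filterS yD => w Dy _; rewrite -!EFinM lee_fin indicE.
  have [Zw|nZ] := pselect (Z w); first by rewrite mem_set// mulr1 le1.
  by rewrite memNset// mulr0 !mulr_ge0// ?expR_ge0// ltW.
have fin : lebesgue_rV R d Z \is a fin_num.
  rewrite ge0_fin_numE//; apply: le_lt_trans (@lebesgue_rV_box R d r).
  by apply: le_measure; rewrite ?inE//; [exact: measurable_box|exact: subIsetr].
apply/eqP; rewrite eq_le measure_ge0 andbT.
rewrite -(fineK fin) lee_fin; apply/ler_addgt0Pr => e e0; rewrite add0r.
(* [M + 1] is positive even when the Lipschitz constant [M] is zero. *)
pose e' := Num.min 1 (e * c / (M + 1)).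
have M1 : 0 < M + 1 by rewrite ltr_wpDl.
have e'0 : 0 < e' by rewrite lt_min ltr01 divr_gt0// mulr_gt0.
have e'1 : e' <= 1 by rewrite ge_min lexx.
have := key e' e'0 e'1.
rewrite -(fineK fin) -EFinM lee_fin => h.
have h2 : (M + 1) * e' <= e * c.
  by rewrite mulrC -ler_pdivlMr// /e' ge_min lexx orbT.
rewrite -(ler_pM2l c0) (le_trans h)// (le_trans _ (_ : e * c <= c * e)) ?(mulrC c)//.
by rewrite (le_trans _ h2)// mulrDl mul1r lerDl ltW.
Qed.

Lemma ae_invertible (b0 : B) :
  {ae lebesgue_rV R d, forall z, mdet F (b0 + noise_inj z) != 0}.
Proof.
have bE z : b0 + noise_inj z = (b0.1, b0.2 + z).
  by apply/eqP; rewrite xpair_eqE/= addr0 !eqxx.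
have h : (lebesgue_rV R d).-negligible [set w | D (b0.1, w) = 0].
  have -> : [set w | D (b0.1, w) = 0]
      = \bigcup_k ([set w | D (b0.1, w) = 0] `&` box k.+1%:R).
    apply/seteqP; split => [w Dw|w [k _ []]//].
    exists (Num.truncn `|w|) => //; split => // j.
    by rewrite (le_trans (rV_coord_le _ _))// ltW// truncnS_gt.
  apply: negligible_bigcup => k; apply/negligibleP; last exact: negligible_zero_box.
  apply: measurableI; last exact: measurable_box.
  have -> : [set w | D (b0.1, w) = 0] = setT `&` (fun w => D (b0.1, w)) @^-1` [set 0].
    by rewrite setTI.
  exact: mD.
apply: negligibleS (negligible_translation b0.2 h) => z /=.
by rewrite bE => /negP; rewrite negbK => /eqP.
Qed.

End invertibility.

(** * Square integrable variables *)

Section real_sequences.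
Context (R : realType).

Lemma cvg_dominated (u v : nat -> R) (l : R) : (forall k, `|u k - l| <= v k) ->
  v @ \oo --> (0 : R) -> u @ \oo --> l.
Proof.
move=> uv v0; apply/cvgrPdist_le => e e0.
have /cvgrPdist_le/(_ e e0) := v0; apply: filterS => k; rewrite sub0r normrN => vk.
by rewrite distrC (le_trans (uv k))// (le_trans (ler_norm _)).
Qed.

Lemma cvg_sqr_dominated (u v : nat -> R) : (forall k, u k ^+ 2 <= v k) ->
  v @ \oo --> (0 : R) -> u @ \oo --> (0 : R).
Proof.
move=> uv v0; apply/cvgrPdist_le => e e0.
have e20 : 0 < e ^+ 2 by rewrite exprn_gt0.
have /cvgrPdist_le/(_ _ e20) := v0; apply: filterS => k.
rewrite !sub0r !normrN => vk.
have : `|u k| ^+ 2 <= e ^+ 2.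
  by rewrite real_normK ?num_real// (le_trans (uv k))// (le_trans (ler_norm _)).
by rewrite ler_pXn2r ?nnegrE// ltW.
Qed.

Lemma cvg_geometric_decay (c z : R) : 0 <= z < 1 -> (fun k => c * z ^+ k) @ \oo --> (0 : R).
Proof.
by move=> /andP[z0 z1]; have := @cvg_geometric R c z; rewrite ger0_norm//; exact.
Qed.

(** Subtracting 2 s 2^-k from [u k], and likewise from [- u k], gives two nondecreasing sequences:
    their monotone limits yield both the convergence and the two-sided bound. *)
Lemma geometric_cauchy (u : nat -> R) (s : R) : 0 <= s ->
  (forall k, `|u k.+1 - u k| <= s * 2^-1 ^+ k) ->
  exists2 l, u @ \oo --> l & forall k, `|l - u k| <= 2 * s * 2^-1 ^+ k.
Proof.
move=> s0 us; pose h k : R := 2^-1 ^+ k.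
have hS k : h k.+1 = h k / 2 by rewrite /h exprSr.
have h0 k : 0 <= h k by rewrite exprn_ge0// invr_ge0.
have tele (w : nat -> R) : (forall k, `|w k.+1 - w k| <= s * h k) ->
    nondecreasing_seq (fun k => w k - 2 * s * h k).
  move=> ws; apply/nondecreasing_seqP => k; rewrite hS.
  by have := ws k; rewrite ler_norml => /andP[? _]; lra.
have nu k : `|(- u k.+1) - (- u k)| <= s * h k by rewrite -opprD normrN; exact: us.
have mono := tele _ us; have monoN := tele _ nu.
have ub k : u k - 2 * s * h k <= u 0%N + 2 * s.
  have := monoN _ _ (leq0n k); rewrite /h expr0 mulr1 => ?.
  have : 0 <= 2 * s * h k by rewrite !mulr_ge0.
  rewrite /h; lra.
have cvgv : cvgn (fun k => u k - 2 * s * h k).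
  by apply: nondecreasing_is_cvgn => //; exists (u 0%N + 2 * s) => _ [k _ <-]; exact: ub.
have ch : (fun k => 2 * s * h k) @ \oo --> (0 : R).
  by apply: cvg_geometric_decay; apply/andP; split; [rewrite invr_ge0|rewrite invf_lt1// ltr1n].
set l := limn (fun k => u k - 2 * s * h k).
have ul : u @ \oo --> l.
  have -> : u = fun k => (u k - 2 * s * h k) + 2 * s * h k by apply/funext => k; rewrite subrK.
  by rewrite -[l]addr0; apply: cvgD.
exists l => // k.
have lo : u k - 2 * s * h k <= l by exact: nondecreasing_cvgn_le.
have clN : (fun k => - u k - 2 * s * h k) @ \oo --> - l.
  by rewrite -[X in _ --> X]subr0; apply: cvgB => //; exact: cvgN.
have hi : - u k - 2 * s * h k <= - l.
  rewrite -(cvg_lim _ clN)//; apply: nondecreasing_cvgn_le => //.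
  by apply/cvg_ex; exists (- l).
by rewrite ler_norml; apply/andP; split; rewrite -/(h k); lra.
Qed.

(** A limit that is defined for every sequence and depends measurably on parameters, with no
    condition of convergence: it agrees with the limit whenever there is one. *)
Definition lims (u : nat -> R) : R := fine (limn_esup (EFin \o u)).

Lemma cvg_lims (u : nat -> R) (l : R) : u @ \oo --> l -> lims u = l.
Proof.
move=> ul; have cE : (EFin \o u) @ \oo --> l%:E by apply: cvg_EFin => //; exact: nearW.
by rewrite /lims is_cvg_limn_esupE; [rewrite (cvg_lim _ cE)|apply/cvg_ex; exists l%:E].
Qed.

Lemma measurable_lims d (T : measurableType d) (U : nat -> T -> R) :
  (forall k, measurable_fun setT (U k)) -> measurable_fun setT (fun x => lims (U ^~ x)).
Proof.
move=> mU; apply: (@measurableT_comp _ _ _ _ _ _ fine) => //.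
by apply: (measurable_fun_limn_esup (f := fun k x => (U k x)%:E)) => k; exact/measurable_EFinP.
Qed.

Lemma trig_lipschitz (f f' : R -> R) (a b : R) : (forall x : R, is_derive x 1 f (f' x)) ->
  (forall x, `|f' x| <= 1) -> `|f a - f b| <= `|a - b|.
Proof.
move=> df f1; wlog ab : a b / b <= a.
  by move=> H; have [|/ltW] := leP b a; [exact: H|rewrite distrC (distrC a); exact: H].
have [|c _] := @MVT_segment R f f' b a ab (fun x _ => df x).
  by apply: derivable_within_continuous => x _; case: (df x).
by move=> ->; rewrite normrM ler_piMl.
Qed.

Lemma cos_lipschitz (a b : R) : `|cos a - cos b| <= `|a - b|.
Proof.
apply: (@trig_lipschitz cos (fun x => - sin x)) => x.
by rewrite normrN norm_sin_le1.
Qed.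

Lemma sin_lipschitz (a b : R) : `|sin a - sin b| <= `|a - b|.
Proof.
apply: (@trig_lipschitz sin cos) => x.
exact: norm_cos_le1.
Qed.

End real_sequences.

Section square_integrable.
Context (R : realType) dT (T : measurableType dT) (P : probability T R).

Implicit Types f g h : T -> R.

Definition sqint (f : T -> R) : Prop :=
  measurable_fun setT f /\ P.-integrable setT (EFin \o (fun x => f x ^+ 2)).

Definition ip (f g : T -> R) : R := \int[P]_x (f x * g x).
Definition msq (f : T -> R) : R := ip f f.

Lemma sqint_mul f g : sqint f -> sqint g -> P.-integrable setT (EFin \o (fun x => f x * g x)).
Proof.
move=> [mf if_] [mg ig]; apply: (le_integrable measurableT _ _ (integrableRD if_ ig)).
  by apply/measurable_EFinP; exact: measurable_funM.
move=> x _ /=; rewrite lee_fin [X in _ <= X]ger0_norm ?addr_ge0 ?sqr_ge0// ler_norml.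
have := sqr_ge0 (f x + g x); have := sqr_ge0 (f x - g x).
by rewrite sqrrB sqrrD => ? ?; apply/andP; split; nra.
Qed.

Lemma sqint_le f g (a : R) : sqint g -> measurable_fun setT f ->
  (forall x, f x ^+ 2 <= a * g x ^+ 2) -> sqint f.
Proof.
move=> [mg ig] mf fg; split => //.
apply: (le_integrable measurableT _ _ (integrableRZ a ig)).
  by apply/measurable_EFinP; exact: measurable_funX.
by move=> x _ /=; rewrite lee_fin ger0_norm ?sqr_ge0// (le_trans (fg x))// ler_norm.
Qed.

Lemma sqintZ (a : R) f : sqint f -> sqint (fun x => a * f x).
Proof.
move=> hf; apply: (@sqint_le _ f (a ^+ 2) hf).
  by apply: measurable_funM => //; exact: hf.1.
by move=> x; rewrite exprMn.
Qed.

Lemma sqintD f g : sqint f -> sqint g -> sqint (fun x => f x + g x).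
Proof.
move=> hf hg; split; first exact: measurable_funD hf.1 hg.1.
have := integrableRD (integrableRD hf.2 (integrableRZ 2 (sqint_mul hf hg))) hg.2.
by apply: eq_integrable => // x _ /=; congr EFin; ring.
Qed.

Lemma sqintB f g : sqint f -> sqint g -> sqint (fun x => f x - g x).
Proof.
move=> hf hg; have := sqintD hf (sqintZ (-1) hg).
by have -> : (fun x => f x + -1 * g x) = (fun x => f x - g x) by apply/funext => x; rewrite mulN1r.
Qed.

Lemma sqint_cst (a : R) : sqint (fun _ => a).
Proof.
split => //; apply: (@integrable_le_cst _ _ _ _ _ (a ^+ 2)) => //.
by move=> x; rewrite ger0_norm ?sqr_ge0.
Qed.

Lemma sqint_integrable f : sqint f -> P.-integrable setT (EFin \o f).
Proof.
move=> hf; have := sqint_mul hf (sqint_cst 1).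
by apply: eq_integrable => // x _ /=; rewrite mulr1.
Qed.

Lemma ipC f g : ip f g = ip g f.
Proof. by apply: eq_Rintegral => x _; rewrite mulrC. Qed.

Lemma ipDl f g h : sqint f -> sqint g -> sqint h ->
  ip (fun x => f x + g x) h = ip f h + ip g h.
Proof.
move=> hf hg hh; rewrite /ip -(RintegralD measurableT (sqint_mul hf hh) (sqint_mul hg hh)).
by apply: eq_Rintegral => x _; rewrite mulrDl.
Qed.

Lemma ipZl (a : R) f h : sqint f -> sqint h -> ip (fun x => a * f x) h = a * ip f h.
Proof.
move=> hf hh; rewrite /ip -(RintegralZl a measurableT (sqint_mul hf hh)).
by apply: eq_Rintegral => x _; rewrite mulrA.
Qed.

Lemma ipDr f g h : sqint f -> sqint g -> sqint h ->
  ip h (fun x => f x + g x) = ip h f + ip h g.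
Proof. by move=> hf hg hh; rewrite ipC ipDl// !(ipC h). Qed.

Lemma ipZr (a : R) f h : sqint f -> sqint h -> ip h (fun x => a * f x) = a * ip h f.
Proof. by move=> hf hh; rewrite ipC ipZl// ipC. Qed.

Lemma ipBl f g h : sqint f -> sqint g -> sqint h ->
  ip (fun x => f x - g x) h = ip f h - ip g h.
Proof.
move=> hf hg hh; rewrite -mulN1r -ipZl// -ipDl//; last exact: sqintZ.
by apply: eq_Rintegral => x _; rewrite mulN1r.
Qed.

Lemma ipBr f g h : sqint f -> sqint g -> sqint h ->
  ip h (fun x => f x - g x) = ip h f - ip h g.
Proof. by move=> hf hg hh; rewrite ipC ipBl// !(ipC h). Qed.

Lemma ip0l f : ip (fun _ => 0) f = 0.
Proof. by rewrite /ip; under eq_Rintegral do rewrite mul0r; rewrite /Rintegral integral0. Qed.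

Lemma ip_suml (I : Type) (s : seq I) (F : I -> T -> R) h :
  (forall i, sqint (F i)) -> sqint h ->
  sqint (fun x => \sum_(i <- s) F i x) /\
  ip (fun x => \sum_(i <- s) F i x) h = \sum_(i <- s) ip (F i) h.
Proof.
move=> hF hh; elim: s => [|i s [IH1 IH2]].
  have -> : (fun x => \sum_(i <- [::]) F i x) = fun _ => 0 by apply/funext => x; rewrite big_nil.
  by rewrite big_nil ip0l; split => //; exact: sqint_cst.
have -> : (fun x => \sum_(j <- i :: s) F j x) = fun x => F i x + \sum_(j <- s) F j x.
  by apply/funext => x; rewrite big_cons.
by split; [exact: sqintD|rewrite ipDl// IH2 big_cons].
Qed.

Lemma msq_ge0 f : 0 <= msq f.
Proof. by apply: Rintegral_ge0 => x _; rewrite -expr2 sqr_ge0. Qed.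

Lemma msqZ (a : R) f : sqint f -> msq (fun x => a * f x) = a ^+ 2 * msq f.
Proof. by move=> hf; have ha := sqintZ a hf; rewrite /msq ipZl// ipZr// mulrA expr2. Qed.

Lemma msqD f g : sqint f -> sqint g ->
  msq (fun x => f x + g x) = msq f + 2 * ip f g + msq g.
Proof.
move=> hf hg; have hfg := sqintD hf hg.
by rewrite /msq ipDl// !ipDr// (ipC g f); ring.
Qed.

Lemma msqB f g : sqint f -> sqint g ->
  msq (fun x => f x - g x) = msq f - 2 * ip f g + msq g.
Proof.
move=> hf hg; have hfg := sqintB hf hg.
by rewrite /msq ipBl// !ipBr// (ipC g f); ring.
Qed.

Lemma cauchy_schwarz f g : sqint f -> sqint g -> ip f g ^+ 2 <= msq f * msq g.
Proof.
move=> hf hg.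
have H t : 0 <= msq f - 2 * t * ip f g + t ^+ 2 * msq g.
  have := msq_ge0 (fun x => f x - t * g x).
  by rewrite msqB//; [rewrite ipZr// msqZ// mulrA|exact: sqintZ].
have [g0|gn0] := eqVneq (msq g) 0.
  rewrite g0 mulr0; have [->|ipn0] := eqVneq (ip f g) 0; first by rewrite expr0n.
  (* When [g] has zero norm, the quadratic polynomial in t is affine; this t would give it the value
     -1. *)
  have := H ((msq f + 1) / (2 * ip f g)); rewrite g0 mulr0 addr0.
  have -> : 2 * ((msq f + 1) / (2 * ip f g)) * ip f g = msq f + 1 by field.
  lra.
have gp : 0 < msq g by rewrite lt_def gn0 msq_ge0.
have := H (ip f g / msq g).
have -> : msq f - 2 * (ip f g / msq g) * ip f g + (ip f g / msq g) ^+ 2 * msq g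
    = (msq f * msq g - ip f g ^+ 2) / msq g by field.
by rewrite pmulr_lge0 ?invr_gt0// subr_ge0.
Qed.

Lemma msqD_le f g : sqint f -> sqint g ->
  msq (fun x => f x + g x) <= 2 * msq f + 2 * msq g.
Proof.
move=> hf hg; have := msq_ge0 (fun x => f x - g x).
by rewrite msqB// msqD//; lra.
Qed.

Definition l2cvg (U : nat -> T -> R) (V : T -> R) : Prop :=
  (fun k => msq (fun x => U k x - V x)) @ \oo --> (0 : R).

Lemma ip_cvg (U U' : nat -> T -> R) (V V' : T -> R) :
  (forall k, sqint (U k)) -> (forall k, sqint (U' k)) -> sqint V -> sqint V' ->
  l2cvg U V -> l2cvg U' V' -> (fun k => ip (U k) (U' k)) @ \oo --> ip V V'.
Proof.
move=> hU hU' hV hV' c c'.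
have D k := sqintB (hU k) hV; have D' k := sqintB (hU' k) hV'.
have E k : ip (U k) (U' k) = ip (fun x => U k x - V x) (fun x => U' k x - V' x)
    + ip (fun x => U k x - V x) V' + ip V (fun x => U' k x - V' x) + ip V V'.
  by rewrite ipBr// !ipBl// ipBr//; ring.
have c1 : (fun k => ip (fun x => U k x - V x) (fun x => U' k x - V' x)) @ \oo --> (0 : R).
  apply: (cvg_sqr_dominated (fun k => cauchy_schwarz (D k) (D' k))).
  by rewrite -(mulr0 (0 : R)); exact: cvgM.
have c2 : (fun k => ip (fun x => U k x - V x) V') @ \oo --> (0 : R).
  apply: (cvg_sqr_dominated (fun k => cauchy_schwarz (D k) hV')).
  by rewrite -(mul0r (msq V')); apply: cvgM => //; exact: cvg_cst.
have c3 : (fun k => ip V (fun x => U' k x - V' x)) @ \oo --> (0 : R).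
  apply: (cvg_sqr_dominated (fun k => cauchy_schwarz hV (D' k))).
  by rewrite -(mulr0 (msq V)); apply: cvgM => //; exact: cvg_cst.
rewrite (funext E) -[X in _ --> X]add0r.
apply: cvgD; last exact: cvg_cst.
rewrite -[0]addr0; apply: cvgD => //.
by rewrite -[0]addr0; apply: cvgD.
Qed.

Lemma l2cvgD (U U' : nat -> T -> R) (V V' : T -> R) :
  (forall k, sqint (U k)) -> (forall k, sqint (U' k)) -> sqint V -> sqint V' ->
  l2cvg U V -> l2cvg U' V' -> l2cvg (fun k x => U k x + U' k x) (fun x => V x + V' x).
Proof.
move=> hU hU' hV hV' c c'.
have c2 : (fun k => 2 * msq (fun x => U k x - V x) + 2 * msq (fun x => U' k x - V' x))
    @ \oo --> (0 : R).
  rewrite -[0]addr0 -{1 2}(mulr0 (2 : R)).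
  by apply: cvgD; apply: cvgM => //; exact: cvg_cst.
apply: (cvg_dominated _ c2) => k; rewrite subr0 ger0_norm ?msq_ge0//.
have := msqD_le (sqintB (hU k) hV) (sqintB (hU' k) hV').
by congr (_ <= _); apply: eq_Rintegral => x _; ring.
Qed.

Lemma l2cvgZ (a : R) (U : nat -> T -> R) (V : T -> R) :
  (forall k, sqint (U k)) -> sqint V ->
  l2cvg U V -> l2cvg (fun k x => a * U k x) (fun x => a * V x).
Proof.
move=> hU hV c; rewrite /l2cvg.
have -> : (fun k => msq (fun x => a * U k x - a * V x))
    = fun k => a ^+ 2 * msq (fun x => U k x - V x).
  apply/funext => k; rewrite -msqZ; last exact: sqintB.
  by apply: eq_Rintegral => x _; rewrite -mulrBr.
by rewrite -(mulr0 (a ^+ 2)); apply: cvgM => //; exact: cvg_cst.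
Qed.

Lemma l2cvg_cst V : l2cvg (fun _ => V) V.
Proof.
rewrite /l2cvg; have -> : (fun k : nat => msq (fun x => V x - V x)) = fun _ => 0.
  by apply/funext => k; rewrite /msq /ip; under eq_Rintegral do rewrite subrr mul0r;
    rewrite /Rintegral integral0.
exact: cvg_cst.
Qed.

Lemma Rintegral_lipschitz_cvg (h : R -> R) (U : nat -> T -> R) (V : T -> R) :
  measurable_fun setT h -> (forall a, `|h a| <= 1) ->
  (forall a b, `|h a - h b| <= `|a - b|) ->
  (forall k, sqint (U k)) -> sqint V -> l2cvg U V ->
  (fun k => \int[P]_x h (U k x)) @ \oo --> \int[P]_x h (V x).
Proof.
move=> mh h1 hlip hU hV c.
have ih f : measurable_fun setT f -> P.-integrable setT (EFin \o (fun x => h (f x))).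
  by move=> mf; apply: (@integrable_le_cst _ _ _ _ _ 1) => //; exact: (measurableT_comp mh mf).
pose v k : R := \int[P]_x `|U k x - V x|.
have D k := sqintB (hU k) hV.
have iD k := integrable_norm (sqint_integrable (D k)).
have sD k : sqint (fun x => `|U k x - V x|).
  apply: (@sqint_le _ _ 1 (D k)); first exact: (measurableT_comp _ (D k).1).
  by move=> x; rewrite mul1r real_normK ?num_real.
apply: (@cvg_dominated _ _ v).
  move=> k; rewrite -(RintegralB measurableT (ih _ (hU k).1) (ih _ hV.1)).
  have i2 := integrableRB (ih _ (hU k).1) (ih _ hV.1).
  apply: le_trans (le_normr_Rintegral measurableT i2) _.
  apply: (le_Rintegral measurableT (integrable_norm i2) (iD k)) => x _ /=; exact: hlip.
apply: (@cvg_sqr_dominated _ _ (fun k => msq (fun x => U k x - V x))) => // k.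
have := cauchy_schwarz (sD k) (sqint_cst 1).
have -> : ip (fun x => `|U k x - V x|) (fun _ => 1) = v k.
  by apply: eq_Rintegral => x _; rewrite mulr1.
have -> : msq (fun _ => 1) = 1.
  rewrite /msq /ip /Rintegral; under eq_integral do rewrite mulr1.
  rewrite integral_cst// mul1e; exact: (congr1 fine (probability_setT P)).
rewrite mulr1; suff -> : msq (fun x => `|U k x - V x|) = msq (fun x => U k x - V x) by [].
by apply: eq_Rintegral => x _; rewrite -normrM ger0_norm// -expr2 sqr_ge0.
Qed.

Lemma sqint_bound f (M : R) : measurable_fun setT f ->
  (\int[P]_x (f x ^+ 2)%:E <= M%:E)%E -> sqint f /\ msq f <= M.
Proof.
move=> mf fM; have i2 : P.-integrable setT (EFin \o (fun x => f x ^+ 2)).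
  apply/integrableP; split; first by apply/measurable_EFinP; exact: measurable_funX.
  apply: le_lt_trans (ltry M); apply: le_trans fM; rewrite le_eqVlt.
  by apply/orP; left; apply/eqP; apply: eq_integral => x _ /=; rewrite ger0_norm// sqr_ge0.
have E : (\int[P]_x (f x * f x)%:E = \int[P]_x (f x ^+ 2)%:E)%E.
  by apply: eq_integral => x _; rewrite expr2.
split => //; rewrite -lee_fin /msq /ip /Rintegral E fineK//.
exact: (integrable_fin_num measurableT i2).
Qed.

Lemma sum_half_le (N : nat) : \sum_(k < N) 2^-1 ^+ k <= 2 :> R.
Proof.
suff : \sum_(k < N) 2^-1 ^+ k = 2 - 2 * 2^-1 ^+ N :> R.
  by move=> ->; rewrite gerBl mulr_ge0// exprn_ge0// invr_ge0.
elim: N => [|N IH]; first by rewrite big_ord0 expr0 mulr1 subrr.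
by rewrite big_ord_recr/= IH exprS; field.
Qed.

(* The weights 4^k leave room for both the pointwise and the mean square
   convergence: with A = sum_k 4^k (U_(k+1) - U_k)^2 one has |V - U_k|^2 <= 4 A / 4^k. *)
Lemma fast_limit (U : nat -> T -> R) (C : R) : (forall k, sqint (U k)) -> 0 <= C ->
  (forall k, msq (fun x => U k.+1 x - U k x) <= C * 8^-1 ^+ k) ->
  [/\ sqint (fun x => lims (U ^~ x)), l2cvg U (fun x => lims (U ^~ x)) &
      {ae P, forall x, U ^~ x @ \oo --> lims (U ^~ x)}].
Proof.
move=> hU C0 hC; pose V x := lims (U ^~ x).
have mV : measurable_fun setT V by apply: measurable_lims => k; exact: (hU k).1.
pose D k x : R := 4 ^+ k * (U k.+1 x - U k x) ^+ 2.
have D0 k x : 0 <= D k x by rewrite mulr_ge0 ?sqr_ge0// exprn_ge0.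
have hD k := sqintB (hU k.+1) (hU k).
have mD k : measurable_fun setT (fun x => (D k x)%:E).
  by apply/measurable_EFinP; apply: measurable_funM => //; apply: measurable_funX; exact: (hD k).1.
pose A x : \bar R := (\sum_(k <oo) (D k x)%:E)%E.
have DE0 k x : [set: T] x -> (0 <= (D k x)%:E)%E by move=> _; rewrite lee_fin.
have mA : measurable_fun setT A by apply: ge0_emeasurable_sum => // k x _ _; exact: DE0.
have A0 x : (0 <= A x)%E by apply: nneseries_ge0 => k _ _; rewrite lee_fin.
have intD k : (\int[P]_x (D k x)%:E = (4 ^+ k * msq (fun x => U k.+1 x - U k x)%R)%:E)%E.
  have i1 := integrableRZ (4 ^+ k) (hD k).2.
  rewrite -[LHS](fineK (integrable_fin_num measurableT i1)); congr EFin.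
  rewrite -/(Rintegral _ _ _) RintegralZl//; last exact: (hD k).2.
have intA : (\int[P]_x A x <= (2 * C)%:E)%E.
  rewrite integral_nneseries//.
  apply: lime_le; first by apply: is_cvg_nneseries => k _ _; apply: integral_ge0 => x; exact: DE0.
  apply: nearW => N; rewrite big_mkord.
  under eq_bigr do rewrite intD.
  rewrite sumEFin lee_fin (le_trans (_ : _ <= \sum_(k < N) C * 2^-1 ^+ k))//.
    apply: ler_sum => k _; rewrite (le_trans (ler_wpM2l _ (hC k))) ?exprn_ge0//.
    rewrite mulrCA -exprMn; have -> : 4 / 8 = 2^-1 :> R by lra.
    by [].
  by rewrite -mulr_sumr mulrC ler_wpM2r// sum_half_le.
have iA : P.-integrable setT A.
  apply/integrableP; split => //; under eq_integral do rewrite gee0_abs//.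
  by apply: le_lt_trans intA _; rewrite ltry.
have aeA : {ae P, forall x, A x \is a fin_num}.
  by have := integrable_ae measurableT iA; apply: filterS => x; exact.
have key x : A x \is a fin_num -> U ^~ x @ \oo --> V x /\
    forall k, (V x - U k x) ^+ 2 <= 4 * 4^-1 ^+ k * fine (A x).
  move=> Afin; pose s := Num.sqrt (fine (A x)).
  have a0 : 0 <= fine (A x) by rewrite fine_ge0.
  have Us k : `|U k.+1 x - U k x| <= s * 2^-1 ^+ k.
    have Dk : D k x <= fine (A x).
      rewrite -lee_fin fineK//; have := @nneseries_lim_ge R (fun k => (D k x)%:E) xpredT 0%N k.+1.
      rewrite big_nat_recr//= => h; apply: le_trans (h _); last by move=> *; rewrite lee_fin.
      rewrite leeDr// sume_ge0// => i _; by rewrite lee_fin.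
    have h2 : 2^-1 ^+ k = (2 ^+ k)^-1 :> R by rewrite exprVn.
    rewrite h2 ler_pdivlMr ?exprn_gt0// mulrC -ler_sqr ?nnegrE ?mulr_ge0 ?exprn_ge0 ?sqrtr_ge0//.
    rewrite sqr_sqrtr// exprMn real_normK ?num_real// (le_trans _ Dk)// /D.
    by rewrite -exprM mulnC exprM; have -> : 2 ^+ 2 = 4 :> R by rewrite expr2; lra.
  have [l Ul hl] := geometric_cauchy (sqrtr_ge0 _) Us.
  rewrite /V (cvg_lims Ul); split => // k.
  rewrite -real_normK ?num_real//.
  apply: (@le_trans _ _ ((2 * s * 2^-1 ^+ k) ^+ 2)).
    by rewrite ler_sqr ?nnegrE ?mulr_ge0 ?exprn_ge0 ?sqrtr_ge0 ?invr_ge0.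
  rewrite !exprMn sqr_sqrtr// -exprM mulnC exprM.
  have -> : 2^-1 ^+ 2 = 4^-1 :> R by rewrite expr2; lra.
  by rewrite le_eqVlt; apply/orP; left; apply/eqP; rewrite -mulrA (mulrC (fine _)) mulrA expr2; congr (_ * _ * _); lra.
have main k : sqint (fun x => U k x - V x) /\
    msq (fun x => U k x - V x) <= 8 * C * 4^-1 ^+ k.
  apply: sqint_bound; first exact: measurable_funB (hU k).1 mV.
  have c0 : (0 <= (4 * 4^-1 ^+ k : R)%:E)%E.
    by rewrite lee_fin mulr_ge0// exprn_ge0// invr_ge0.
  apply: (@le_trans _ _ (\int[P]_x ((4 * 4^-1 ^+ k)%:E * A x))%E).
    apply: ae_ge0_le_integral => //.
    - by move=> x _; rewrite lee_fin sqr_ge0.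
    - by apply/measurable_EFinP; apply: measurable_funX; exact: measurable_funB (hU k).1 mV.
    - by move=> x _; rewrite mule_ge0.
    - exact: measurable_funeM.
    apply: filterS aeA => x Afin _; rewrite -(fineK Afin) -EFinM lee_fin.
    by rewrite -sqrrN opprB; exact: (key x Afin).2.
  rewrite ge0_integralZl//.
  apply: le_trans (lee_wpmul2l c0 intA) _; rewrite -EFinM lee_fin.
  by rewrite le_eqVlt; apply/orP; left; apply/eqP; ring.
split.
- have := sqintB (hU 0%N) (main 0%N).1.
  by congr sqint; apply/funext => x; rewrite opprB addrC subrK.
- apply: (@cvg_dominated _ _ (fun k => 8 * C * 4^-1 ^+ k)) => [k|].
    by rewrite subr0 ger0_norm ?msq_ge0//; exact: (main k).2.
  by apply: cvg_geometric_decay; apply/andP; split; [rewrite invr_ge0|rewrite invf_lt1// ltr1n].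
- by apply: filterS aeA => x Afin; exact: (key x Afin).1.
Qed.

End square_integrable.

(** * Gaussian spaces *)

Section law.
Context (R : realType) d1 d2 (T : measurableType d1) (T' : measurableType d2).

Definition mfun_of (h : T -> T') (mh : measurable_fun setT h) : {mfun T >-> T'} :=
  HB.pack h (isMeasurableFun.Build _ _ _ _ h mh).

Definition law (P : probability T R) (h : T -> T') (mh : measurable_fun setT h) :
  probability T' R := distribution P (mfun_of mh).

Lemma lawE P h (mh : measurable_fun setT h) A : law P mh A = P (h @^-1` A).
Proof. by []. Qed.

Lemma ge0_integral_law P h (mh : measurable_fun setT h) (f : T' -> \bar R) :
  measurable_fun setT f -> (forall y, 0 <= f y)%E ->
  (\int[law P mh]_y f y = \int[P]_x f (h x))%E.
Proof. by move=> mf f0; rewrite ge0_integral_pushforward//= ?preimage_setT//; exact: mh. Qed.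

Lemma Rintegral_law P h (mh : measurable_fun setT h) (f : T' -> R) (M : R) :
  measurable_fun setT f -> (forall y, `|f y| <= M) ->
  \int[law P mh]_y f y = \int[P]_x f (h x).
Proof.
move=> mf fM; rewrite /Rintegral integral_distribution//; first exact/measurable_EFinP.
by apply: (@integrable_le_cst _ _ _ P _ M) => //; exact: (measurableT_comp mf mh).
Qed.

End law.

Lemma Rintegral_prod (R : realType) d1 d2 (T1 : measurableType d1) (T2 : measurableType d2)
    (P1 : probability T1 R) (P2 : probability T2 R) (f : T1 * T2 -> R) (M : R) :
  measurable_fun setT f -> (forall z, `|f z| <= M) ->
  \int[(P1 \x P2)%E]_z f z = \int[P1]_x \int[P2]_y f (x, y).
Proof.
move=> mf fM.
pose PP : probability (T1 * T2)%type R := (P1 \x P2)%E.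
have intf := @integrable_le_cst _ _ _ PP f M mf fM.
rewrite {1}/Rintegral -(integral12_prod_meas1 intf) {1}/Rintegral; congr fine.
apply: eq_integral => x _; rewrite /fubini_F /Rintegral fineK//.
apply: integrable_fin_num => //.
apply: (@integrable_le_cst _ _ _ P2 _ M) => //.
exact: (measurableT_comp mf (measurable_pair1 x)).
Qed.

Section trigonometric_products.
Context (R : realType) d1 d2 (T1 : measurableType d1) (T2 : measurableType d2).
Variables (P1 : probability T1 R) (P2 : probability T2 R).
Variables (a : T1 -> R) (b : T2 -> R).
Hypotheses (ma : measurable_fun setT a) (mb : measurable_fun setT b).

Let mf (h : R -> R) : measurable_fun setT h ->
  measurable_fun setT (fun z : T1 * T2 => h (a z.1 + b z.2)).
Proof.
move=> mh; apply: (measurableT_comp mh); apply: measurable_funD.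
  exact: measurableT_comp.
exact: measurableT_comp.
Qed.

Let ib d (T : measurableType d) (P : probability T R) (h : R -> R) (u : T -> R) :
  measurable_fun setT h -> (forall x, `|h x| <= 1) -> measurable_fun setT u ->
  P.-integrable setT (EFin \o (fun x => h (u x))).
Proof. by move=> mh h1 mu; apply: (@integrable_le_cst _ _ _ P _ 1) => //; exact: measurableT_comp. Qed.

Let split_lin d (T : measurableType d) (P : probability T R) (f g : T -> R) (x y : R) :
  P.-integrable setT (EFin \o f) -> P.-integrable setT (EFin \o g) ->
  \int[P]_t (x * f t + y * g t) = x * \int[P]_t f t + y * \int[P]_t g t.
Proof.
move=> if_ ig; rewrite (RintegralD measurableT (integrableRZ x if_) (integrableRZ y ig)).
by rewrite (RintegralZl x measurableT if_) (RintegralZl y measurableT ig).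
Qed.

Lemma Rintegral_prod_cos : \int[(P1 \x P2)%E]_z cos (a z.1 + b z.2) =
  \int[P1]_x cos (a x) * \int[P2]_y cos (b y) - \int[P1]_x sin (a x) * \int[P2]_y sin (b y).
Proof.
rewrite (@Rintegral_prod _ _ _ _ _ _ _ _ 1); [|exact: mf (@measurable_cos R)|by move=> z; exact: norm_cos_le1].
have icb := ib P2 (@measurable_cos R) (@norm_cos_le1 R) mb.
have isb := ib P2 (@measurable_sin R) (@norm_sin_le1 R) mb.
have ica := ib P1 (@measurable_cos R) (@norm_cos_le1 R) ma.
have isa := ib P1 (@measurable_sin R) (@norm_sin_le1 R) ma.
transitivity (\int[P1]_x (\int[P2]_y cos (b y) * cos (a x) + (- \int[P2]_y sin (b y)) * sin (a x))).
  apply: eq_Rintegral => x _; rewrite mulrC mulNr -mulrN (mulrC _ (- sin _)) -split_lin//.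
  by apply: eq_Rintegral => y _ /=; rewrite cosD mulNr.
by rewrite split_lin//; ring.
Qed.

Lemma Rintegral_prod_sin : \int[(P1 \x P2)%E]_z sin (a z.1 + b z.2) =
  \int[P1]_x sin (a x) * \int[P2]_y cos (b y) + \int[P1]_x cos (a x) * \int[P2]_y sin (b y).
Proof.
rewrite (@Rintegral_prod _ _ _ _ _ _ _ _ 1); [|exact: mf (@measurable_sin R)|by move=> z; exact: norm_sin_le1].
have icb := ib P2 (@measurable_cos R) (@norm_cos_le1 R) mb.
have isb := ib P2 (@measurable_sin R) (@norm_sin_le1 R) mb.
have ica := ib P1 (@measurable_cos R) (@norm_cos_le1 R) ma.
have isa := ib P1 (@measurable_sin R) (@norm_sin_le1 R) ma.
transitivity (\int[P1]_x (\int[P2]_y cos (b y) * sin (a x) + \int[P2]_y sin (b y) * cos (a x))).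
  apply: eq_Rintegral => x _; rewrite mulrC (mulrC _ (cos (a x))) -split_lin//.
  by apply: eq_Rintegral => y _ /=; rewrite sinD.
by rewrite split_lin//; ring.
Qed.

End trigonometric_products.

Section gaussian_spaces.
Context (R : realType) dT (T : measurableType dT) (P : probability T R).
Implicit Types f g : T -> R.

(** Centred Gaussian variables, degenerate ones included. Only the characteristic function at
    frequency 1 is recorded: other frequencies are reached by scaling inside a class [V] closed
    under linear combinations, that is, a Gaussian space. *)
Definition gauss f : Prop := [/\ sqint P f,
  \int[P]_x cos (f x) = expR (- msq P f / 2) & \int[P]_x sin (f x) = 0].

Lemma gauss_l2cvg (U : nat -> T -> R) (V : T -> R) : (forall k, gauss (U k)) ->
  sqint P V -> l2cvg P U V -> gauss V.
Proof.
move=> gU hV c; have hU k : sqint P (U k) by case: (gU k).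
have cm := ip_cvg hU hU hV hV c c.
have cc := Rintegral_lipschitz_cvg (@measurable_cos R) (@norm_cos_le1 R) (@cos_lipschitz R) hU hV c.
have cs := Rintegral_lipschitz_cvg (@measurable_sin R) (@norm_sin_le1 R) (@sin_lipschitz R) hU hV c.
split => //.
  have e k : \int[P]_x cos (U k x) = expR (- msq P (U k) / 2) by case: (gU k).
  move: cc; rewrite (funext e) => cc.
  rewrite -(cvg_lim _ cc)//; apply: (@cvg_lim _ _ _ _ _ (fun k => expR (- msq P (U k) / 2))) => //.
  apply: (@continuous_cvg _ _ _ _ _ _ expR); first exact: continuous_expR.
  by apply: cvgM; [exact: cvgN|exact: cvg_cst].
have e k : \int[P]_x sin (U k x) = 0 by case: (gU k).
move: cs; rewrite (funext e) => cs.
by rewrite -(cvg_lim _ cs)//; apply: (@cvg_lim _ _ _ _ _ (fun=> 0)) => //; exact: cvg_cst.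
Qed.

Variable V : (T -> R) -> Prop.
Hypotheses (V0 : V (fun _ => 0)) (VG : forall f, V f -> gauss f).
Hypotheses (VD : forall f g, V f -> V g -> V (fun x => f x + g x)).
Hypotheses (VZ : forall (a : R) f, V f -> V (fun x => a * f x)).

Let VS f : V f -> sqint P f. Proof. by move=> /VG[]. Qed.

Lemma combo_class d1 (T1 : measurableType d1) I (X : I -> T1 -> R) (Y : T -> T1)
    (l : seq (I * R)) : (forall i, V (fun x => X i (Y x))) -> V (fun x => combo X l (Y x)).
Proof.
move=> VX; rewrite /combo; elim: l => [|p l IH].
  by have -> : (fun x => \sum_(p <- [::]) p.2 * X p.1 (Y x)) = fun _ => 0
    by apply/funext => x; rewrite big_nil.
have -> : (fun x => \sum_(q <- p :: l) q.2 * X q.1 (Y x))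
    = fun x => p.2 * X p.1 (Y x) + \sum_(q <- l) q.2 * X q.1 (Y x).
  by apply/funext => x; rewrite big_cons.
by apply: VD => //; exact: VZ.
Qed.

Lemma ip_combo d1 (T1 : measurableType d1) I (X : I -> T1 -> R) (Y : T -> T1)
    (l : seq (I * R)) h : (forall i, V (fun x => X i (Y x))) -> V h ->
  ip P (fun x => combo X l (Y x)) h = \sum_(p <- l) p.2 * ip P (fun x => X p.1 (Y x)) h.
Proof.
move=> VX Vh; have hF (p : I * R) : sqint P (fun x => p.2 * X p.1 (Y x)).
  by apply: sqintZ; exact: VS.
rewrite (ip_suml l hF (VS Vh)).2; apply: eq_bigr => p _.
by rewrite ipZl//; exact: VS.
Qed.

Section independence.
Context d1 d2 (T1 : measurableType d1) (T2 : measurableType d2) (I1 I2 : Type).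
Variables (X1 : I1 -> T1 -> R) (X2 : I2 -> T2 -> R).
Hypotheses (g1 : generating X1) (g2 : generating X2).
Variables (Y : T -> T1) (Z : T -> T2).
Hypotheses (VY : forall i, V (fun x => X1 i (Y x))) (VZ' : forall i, V (fun x => X2 i (Z x))).

Lemma class_measurable d (T' : measurableType d) I (X : I -> T' -> R) (h : T -> T') :
  generating X -> (forall i, V (fun x => X i (h x))) -> measurable_fun setT h.
Proof. by move=> gX VX; apply: (generating_measurable gX) => i; exact: (VS (VX i)).1. Qed.

Let mY : measurable_fun setT Y. Proof. exact: class_measurable g1 VY. Qed.
Let mZ : measurable_fun setT Z. Proof. exact: class_measurable g2 VZ'. Qed.

Hypothesis unc : forall i j, ip P (fun x => X1 i (Y x)) (fun x => X2 j (Z x)) = 0.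

Lemma combo_sum (l : seq ((I1 + I2) * R)) : exists l1 l2, forall z : T1 * T2,
  combo (fun (i : I1 + I2) (z : T1 * T2) =>
    match i with inl i1 => X1 i1 z.1 | inr i2 => X2 i2 z.2 end) l z
  = combo X1 l1 z.1 + combo X2 l2 z.2.
Proof.
rewrite /combo; elim: l => [|[[i|i] t] l [l1 [l2 IH]]].
- by exists [::], [::] => z; rewrite !big_nil addr0.
- by exists ((i, t) :: l1), l2 => z; rewrite !big_cons/= IH addrA.
- by exists l1, ((i, t) :: l2) => z; rewrite !big_cons/= IH addrCA.
Qed.

(** In a Gaussian space uncorrelated families are independent: the variance of the sum of two
    combinations is the sum of the variances, so the joint characteristic function factorises as the
    one of a product measure. *)
Lemma gauss_independence (A : set (T1 * T2)) : measurable A ->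
  P ((fun x => (Y x, Z x)) @^-1` A) = (law P mY \x law P mZ)%E A.
Proof.
have mYZ : measurable_fun setT (fun x => (Y x, Z x)) by exact: measurable_fun_pair.
move=> mA; rewrite -(lawE P mYZ).
apply: (eq_law (generating_prod g1 g2)) mA => l; have [l1 [l2 lE]] := combo_sum l.
- have Va := combo_class l1 VY; have Vb := combo_class l2 VZ'.
  have m1 := measurable_combo g1 l1; have m2 := measurable_combo g2 l2.
  have mc : measurable_fun setT (fun z : T1 * T2 => cos (combo X1 l1 z.1 + combo X2 l2 z.2)).
    apply: (measurableT_comp (@measurable_cos R)); apply: measurable_funD; exact: measurableT_comp.
  under eq_Rintegral do rewrite lE; under [RHS]eq_Rintegral do rewrite lE.
  rewrite (Rintegral_law P mYZ mc (M := 1)); last by move=> ?; exact: norm_cos_le1.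
  rewrite Rintegral_prod_cos//.
  have mcl1 := measurableT_comp (@measurable_cos R) m1; have mcl2 := measurableT_comp (@measurable_cos R) m2.
  have msl1 := measurableT_comp (@measurable_sin R) m1.
  rewrite (Rintegral_law P mY mcl1 (M := 1)); last by move=> ?; exact: norm_cos_le1.
  rewrite (Rintegral_law P mZ mcl2 (M := 1)); last by move=> ?; exact: norm_cos_le1.
  rewrite (Rintegral_law P mY msl1 (M := 1)); last by move=> ?; exact: norm_sin_le1.
  have [_ cab _] := VG (VD Va Vb); have [_ ca sa] := VG Va; have [_ cb _] := VG Vb.
  rewrite [LHS]cab [X in _ = X * _ - _]ca [X in _ = _ * X - _]cb.
  rewrite [X in _ - X * _]sa mul0r subr0 -expRD; congr expR.
  rewrite msqD; [|exact: VS|exact: VS].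
  have -> : ip P (fun x => combo X1 l1 (Y x)) (fun x => combo X2 l2 (Z x)) = 0.
    rewrite ip_combo// big1// => p _; rewrite ipC ip_combo// big1 ?mulr0// => q _.
    by rewrite ipC unc mulr0.
  by field.
- have Va := combo_class l1 VY; have Vb := combo_class l2 VZ'.
  have m1 := measurable_combo g1 l1; have m2 := measurable_combo g2 l2.
  have mc : measurable_fun setT (fun z : T1 * T2 => sin (combo X1 l1 z.1 + combo X2 l2 z.2)).
    apply: (measurableT_comp (@measurable_sin R)); apply: measurable_funD; exact: measurableT_comp.
  under eq_Rintegral do rewrite lE; under [RHS]eq_Rintegral do rewrite lE.
  rewrite (Rintegral_law P mYZ mc (M := 1)); last by move=> ?; exact: norm_sin_le1.
  rewrite Rintegral_prod_sin//.
  have msl1 := measurableT_comp (@measurable_sin R) m1; have msl2 := measurableT_comp (@measurable_sin R) m2.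
  rewrite (Rintegral_law P mY msl1 (M := 1)); last by move=> ?; exact: norm_sin_le1.
  rewrite (Rintegral_law P mZ msl2 (M := 1)); last by move=> ?; exact: norm_sin_le1.
  have [_ _ sab] := VG (VD Va Vb); have [_ _ sa] := VG Va; have [_ _ sb] := VG Vb.
  by rewrite [LHS]sab [X in _ = X * _ + _]sa [X in _ = _ + _ * X]sb mul0r mulr0 addr0.
Qed.

End independence.

(** In a Gaussian space the variances of all combinations, hence the characteristic functions and
    the law, depend only on the covariances of the coordinates. *)
Lemma gauss_same_law d1 (T1 : measurableType d1) I (X : I -> T1 -> R) (Y Z : T -> T1) :
  generating X -> (forall i, V (fun x => X i (Y x))) -> (forall i, V (fun x => X i (Z x))) ->
  (forall i j, ip P (fun x => X i (Y x)) (fun x => X j (Y x))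
             = ip P (fun x => X i (Z x)) (fun x => X j (Z x))) ->
  forall A, measurable A -> P (Y @^-1` A) = P (Z @^-1` A).
Proof.
move=> gX VY VZ' cov A mA.
have mY := class_measurable gX VY; have mZ := class_measurable gX VZ'.
rewrite -(lawE P mY) -(lawE P mZ); apply: (eq_law gX) mA => l.
- have mc := measurableT_comp (@measurable_cos R) (measurable_combo gX l).
  rewrite (Rintegral_law P mY mc (M := 1)); last by move=> ?; exact: norm_cos_le1.
  rewrite (Rintegral_law P mZ mc (M := 1)); last by move=> ?; exact: norm_cos_le1.
  have Va := combo_class l VY; have Vb := combo_class l VZ'.
  have [_ ca _] := VG Va; have [_ cb _] := VG Vb.
  rewrite [LHS]ca [RHS]cb; congr (expR (- _ / 2)).
  rewrite /msq ip_combo// ip_combo//; apply: eq_bigr => p _; congr (_ * _).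
  by rewrite ipC ip_combo// [RHS]ipC ip_combo//; apply: eq_bigr => q _; rewrite cov.
- have ms := measurableT_comp (@measurable_sin R) (measurable_combo gX l).
  rewrite (Rintegral_law P mY ms (M := 1)); last by move=> ?; exact: norm_sin_le1.
  rewrite (Rintegral_law P mZ ms (M := 1)); last by move=> ?; exact: norm_sin_le1.
  have [_ _ sa] := VG (combo_class l VY); have [_ _ sb] := VG (combo_class l VZ').
  by rewrite [LHS]sa [RHS]sb.
Qed.

End gaussian_spaces.

(** * Linear functionals of the noise *)

Section density_real.
Context (R : realType).
Local Notation leb := (@lebesgue_measure R).

Definition retype (x : R) : measurableTypeR R := x.

Lemma measurable_retype : measurable_fun setT retype.
Proof. by move=> _ A mA; rewrite setTI. Qed.

Lemma ge0_integral_retype (nu : {measure set R -> \bar R}) (h : R -> \bar R) :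
  measurable_fun setT h -> (forall x, 0 <= h x)%E ->
  (\int[pushforward nu retype]_x h x = \int[nu]_x h x)%E.
Proof.
move=> mh h0; rewrite ge0_integral_pushforward//=; exact: measurable_retype.
Qed.

(* The Lebesgue measure and the measures on R live on two displays of the same
   sigma-algebra, whence the push-forward under the identity. *)
Lemma ge0_integral_density_real (nu rho : {measure set R -> \bar R}) (g : R -> R)
    (h : R -> \bar R) : measurable_fun setT g -> (forall x, 0 <= g x) ->
  (forall A, measurable A -> nu A = (\int[leb]_(x in A) (g x)%:E + rho A)%E) ->
  measurable_fun setT h -> (forall x, 0 <= h x)%E ->
  (\int[nu]_x h x = \int[leb]_x (h x * (g x)%:E) + \int[rho]_x h x)%E.
Proof.
move=> mg g0 nuE mh h0.
rewrite -(ge0_integral_retype nu mh h0) -(ge0_integral_retype rho mh h0).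
have mr := measurable_retype.
pose N := mfun_of mr.
by apply: (@ge0_integral_density _ _ R leb (pushforward nu N) (pushforward rho N) g mg g0).
Qed.
End density_real.

Section normal_law.
Context (R : realType).
Local Notation leb := (@lebesgue_measure R).

Section normal_expectation.
Variables (s : R) (Q : probability R R).
Hypotheses (s0 : s != 0) (hQ : forall A, measurable A -> Q A = normal_prob 0 s A).

Lemma ge0_integral_normal_prob (h : R -> \bar R) :
  measurable_fun setT h -> (forall x, 0 <= h x)%E ->
  (\int[Q]_x h x = \int[leb]_x (h x * (normal_pdf 0 s x)%:E))%E.
Proof.
move=> mh h0.
have hQ' A : measurable A -> Q A = (\int[leb]_(x in A) (normal_pdf 0 s x)%:E + mzero A)%E.
  by move=> mA; rewrite /mzero adde0; exact: hQ.
rewrite (ge0_integral_density_real (measurable_normal_pdf 0 s) (normal_pdf_ge0 0 s) hQ' mh h0).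
by rewrite integral_measure_zero adde0.
Qed.

Lemma Rintegral_normal_prob (h : R -> R) :
  measurable_fun setT h -> (forall x, `|h x| <= 1) ->
  \int[Q]_x h x = \int[leb]_x (h x * normal_pdf 0 s x).
Proof.
move=> mh h1.
have m1 : measurable_fun setT (fun x => h x + 1) by exact: measurable_funD.
have h10 x : 0 <= h x + 1 by have := h1 x; rewrite ler_norml => /andP[? _]; lra.
have i1 := @integrable_le_cst _ _ _ Q h 1 mh h1.
have n1 (x : R) : `|cst (1 : R) x| <= 1 by rewrite /= normr1.
have ic := @integrable_le_cst _ _ _ Q _ 1 (measurable_cst (1 : R)) n1.
have j1 := integrable_bounded_normal s0 mh h1.
have jc : leb.-integrable setT (fun x => (1 * normal_pdf 0 s x)%:E) :=
  integrable_bounded_normal s0 (measurable_cst (1 : R)) n1.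
have E : \int[Q]_x (h x + 1) = \int[leb]_x (h x * normal_pdf 0 s x + 1 * normal_pdf 0 s x).
  have mE := (measurable_EFinP _ _).2 m1.
  rewrite /Rintegral ge0_integral_normal_prob//.
  by congr fine; apply: eq_integral => x _; rewrite -mulrDl EFinM.
move: E; rewrite (RintegralD measurableT i1 ic) (RintegralD measurableT j1 jc).
have -> : \int[Q]_x cst (1 : R) x = 1.
  transitivity (fine (\int[Q]_x (1%:E : \bar R))%E) => //.
  by rewrite integral_cst// mul1e; exact: (congr1 fine (probability_setT _)).
have -> : \int[leb]_x (1 * normal_pdf 0 s x) = 1.
  by rewrite /Rintegral; under eq_integral do rewrite mul1r; rewrite integral_normal_pdf.
by move/addIr.
Qed.

End normal_expectation.

Lemma gauss_of_law dT (T : measurableType dT) (P : probability T R) (S : T -> R) (s : R) :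
  measurable_fun setT S ->
  (forall A, measurable A -> pushforward P S A = centred_normal s A) -> gauss P S.
Proof.
move=> mS hS.
have lawS A : measurable A -> law P mS A = centred_normal s A by exact: hS.
have tr (h : R -> R) : measurable_fun setT h -> (forall x, `|h x| <= 1) ->
    \int[P]_x h (S x) = \int[law P mS]_x h x.
  by move=> mh h1; rewrite (Rintegral_law P mS mh h1).
have trs : (\int[P]_x (S x ^+ 2)%:E = \int[law P mS]_x (x ^+ 2)%:E)%E.
  rewrite (ge0_integral_law P mS (f := fun x => (x ^+ 2)%:E))//.
    by apply/measurable_EFinP; exact: measurable_funX.
  by move=> x; rewrite lee_fin sqr_ge0.
have msqE (v : R) : (\int[P]_x (S x ^+ 2)%:E = v%:E)%E -> sqint P S /\ msq P S = v.
  move=> e; have [|h _] := @sqint_bound _ _ _ P S v mS; first by rewrite e.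
  split => //; rewrite /msq /ip /Rintegral.
  have -> : (\int[P]_x (S x * S x)%:E = v%:E)%E by rewrite -e; apply: eq_integral => x _; rewrite expr2.
  by [].
have [s0|sn0] := eqVneq s 0.
  have intE (h : R -> \bar R) : measurable_fun setT h -> (\int[law P mS]_x h x = h 0%R)%E.
    move=> mh; transitivity (\int[dirac (0%R : R)]_x h x)%E.
      apply: eq_measure_integral => A mA _.
      by have := lawS _ mA; rewrite /centred_normal s0 eqxx.
    by rewrite integral_dirac// diracT mul1e.
  have [hS2 m0] : sqint P S /\ msq P S = 0.
    apply: msqE; rewrite trs intE ?expr0n//.
    by apply/measurable_EFinP; exact: measurable_funX.
  split => //.
    rewrite (tr _ (@measurable_cos R) (@norm_cos_le1 R)).
    rewrite /Rintegral (intE _ ((measurable_EFinP _ _).2 (@measurable_cos R)))/=.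
    by rewrite cos0 m0 oppr0 mul0r expR0.
  rewrite (tr _ (@measurable_sin R) (@norm_sin_le1 R)).
  by rewrite /Rintegral (intE _ ((measurable_EFinP _ _).2 (@measurable_sin R)))/= sin0.
have hQ A : measurable A -> law P mS A = normal_prob 0 s A.
  by move=> mA; have := lawS _ mA; rewrite /centred_normal (negbTE sn0).
have [hS2 m0] : sqint P S /\ msq P S = s ^+ 2.
  apply: msqE; rewrite trs (ge0_integral_normal_prob hQ)//; last 2 first.
  - by apply/measurable_EFinP; exact: measurable_funX.
  - by move=> x; rewrite lee_fin sqr_ge0.
  rewrite -(normal_variance_pdf sn0) /Rintegral fineK; first by apply: eq_integral => x _; rewrite EFinM.
  apply: (integrable_fin_num measurableT).
  by apply: integrable_le_normal_moment => // x; rewrite ger0_norm ?sqr_ge0// lerDr.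
split => //.
  rewrite (tr _ (@measurable_cos R) (@norm_cos_le1 R)).
  rewrite (Rintegral_normal_prob sn0 hQ (@measurable_cos R) (@norm_cos_le1 R)).
  have := normal_cosE sn0 1; rewrite /normal_cos expr1n mulr1 m0 => <-.
  by apply: eq_Rintegral => x _; rewrite mul1r.
rewrite (tr _ (@measurable_sin R) (@norm_sin_le1 R)).
rewrite (Rintegral_normal_prob sn0 hQ (@measurable_sin R) (@norm_sin_le1 R)).
by rewrite -[RHS](normal_sin_eq0 sn0 1); apply: eq_Rintegral => x _; rewrite mul1r.
Qed.

End normal_law.

Lemma ipZZ (R : realType) dT (T : measurableType dT) (P : probability T R) (a b : R) (f g : T -> R) :
  sqint P f -> sqint P g ->
  ip P (fun x => a * f x) (fun x => b * g x) = a * (b * ip P f g).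
Proof. by move=> hf hg; rewrite ipZl ?ipZr//; exact: sqintZ. Qed.

Section linear_functionals.
Context (R : realType) (d : nat).
Local Notation W := (seqs 'rV[R]_d).

Implicit Types (p q r : {poly R}) (j l : 'I_d) (w : W).

(** A polynomial encodes a finitely supported sequence of coefficients: multiplication by 'X is the
    shift to the past, and dropping the lowest coefficient describes the effect of [append]. *)
Definition lin (p : {poly R}) (j : 'I_d) (w : W) : R := \sum_(k < size p) p`_k * w k 0 j.

Lemma lin_widen N p j w : (size p <= N)%N -> lin p j w = \sum_(k < N) p`_k * w k 0 j.
Proof.
move=> pN; rewrite /lin (big_ord_widen N (fun k => p`_k * w k 0 j))//.
rewrite big_mkcond; apply: eq_bigr => k _; case: ifP => // /negbT; rewrite -leqNgt => h.
by rewrite nth_default// mul0r.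
Qed.

Lemma linD p q j w : lin (p + q) j w = lin p j w + lin q j w.
Proof.
pose N := maxn (size p) (size q).
rewrite !(@lin_widen N) ?leq_maxl ?leq_maxr//; last exact: size_polyD.
by rewrite -big_split; apply: eq_bigr => k _; rewrite coefD mulrDl.
Qed.

Lemma linZ (a : R) p j w : lin (a *: p) j w = a * lin p j w.
Proof.
rewrite (@lin_widen (size p)) ?size_scale_leq// /lin mulr_sumr.
by apply: eq_bigr => k _; rewrite coefZ mulrA.
Qed.

Lemma linB p q j w : lin (p - q) j w = lin p j w - lin q j w.
Proof. by rewrite linD -scaleN1r linZ mulN1r. Qed.

Lemma lin_mulX p j w : lin ('X * p) j w = lin p j (past w).
Proof.
rewrite (@lin_widen (size p).+1); last first.
  by rewrite (leq_trans (size_polyMleq _ _))// size_polyX.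
rewrite big_ord_recl/= coefXM eqxx mul0r add0r /lin.
by apply: eq_bigr => k _; rewrite coefXM.
Qed.

Lemma linXn n j w : lin 'X^n j w = w n 0 j.
Proof.
rewrite (@lin_widen n.+1) ?size_polyXn// big_ord_recr/= coefXn eqxx mul1r.
by rewrite big1 ?add0r// => k _; rewrite coefXn (ltn_eqF (ltn_ord k)) mul0r.
Qed.

Lemma lin_append p j w v : lin p j (append w v) = p`_0 * v 0 j + lin (drop_poly 1 p) j w.
Proof.
rewrite (@lin_widen (size p).+1)// big_ord_recl/=; congr (_ + _).
rewrite (@lin_widen (size p)); last by rewrite size_drop_poly leq_subr.
by apply: eq_bigr => k _; rewrite coef_drop_poly addn1.
Qed.

Lemma measurable_coordinate k (j : 'I_d) : measurable_fun setT (fun w : W => w k 0 j).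
Proof. exact: (measurableT_comp (measurable_coord j) (measurable_proj k)). Qed.

Lemma measurable_lin p j : measurable_fun setT (lin p j).
Proof.
apply: measurable_sum => k; apply: measurable_funM => //; exact: measurable_coordinate.
Qed.

Definition vlin (pp : 'I_d -> {poly R}) (w : W) : R := \sum_j lin (pp j) j w.

Variable P : probability W R.
Hypothesis hP : centred_gaussian P.

Lemma gauss_vlin pp : gauss P (vlin pp).
Proof.
pose N := \max_j size (pp j).
have [s hs] := hP (fun k : 'I_N => \row_j (pp j)`_k).
have E : vlin pp = fun w : W => \sum_(k < N) \sum_j (\row_j (pp j)`_k) 0 j * w k 0 j.
  apply/funext => w; rewrite /vlin exchange_big/=; apply: eq_bigr => j _.
  rewrite (@lin_widen N); last exact: leq_bigmax.
  by apply: eq_bigr => k _; rewrite mxE.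
apply: (@gauss_of_law _ _ _ _ _ s); last by rewrite E.
by apply: measurable_sum => j; exact: measurable_lin.
Qed.

Lemma lin_vlin p j : lin p j = vlin (fun l => if l == j then p else 0).
Proof.
apply/funext => w; rewrite /vlin (bigD1 j)//= eqxx big1 ?addr0// => l lj.
by rewrite (negbTE lj) /lin size_poly0 big_ord0.
Qed.

Lemma gauss_lin p j : gauss P (lin p j).
Proof. by rewrite lin_vlin; exact: gauss_vlin. Qed.

Lemma sqint_lin p j : sqint P (lin p j).
Proof. by case: (gauss_lin p j). Qed.

Variable mu : 'I_d -> {finite_measure set R -> \bar R}.
Hypothesis hmu : has_spectral_measures P mu.

Lemma covariance_coordinate j l a b :
  ip P (fun w => w a 0 j) (fun w => w b 0 l)
  = (j == l)%:R / (2 * pi) * \int[mu j]_(x in `[- pi, pi]) cos ((a%:R - b%:R) * x).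
Proof.
have [+ _] := hmu j l a b; rewrite mul0r subr0 /ip => ->.
congr (_ * _); apply: eq_Rintegral => x _ /=.
by rewrite intrD mulrNz -!pmulrn.
Qed.

Lemma sqint_coordinate k j : sqint P (fun w : W => w k 0 j).
Proof.
have -> : (fun w : W => w k 0 j) = lin 'X^k j by apply/funext => w; rewrite linXn.
exact: sqint_lin.
Qed.

Lemma covariance_lin p q j l : ip P (lin p j) (lin q l) = \sum_(a < size p) \sum_(b < size q)
  p`_a * (q`_b * ip P (fun w => w a 0 j) (fun w => w b 0 l)).
Proof.
have h r i k : sqint P (fun w : W => r`_k * w k 0 i) by apply: sqintZ; exact: sqint_coordinate.
rewrite (ip_suml (index_enum _) (fun a : 'I_(size p) => h p j a) (sqint_lin q l)).2.
apply: eq_bigr => a _.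
rewrite ipC (ip_suml (index_enum _) (fun b : 'I_(size q) => h q l b) (h p j a)).2.
apply: eq_bigr => b _.
rewrite ipZZ; [|exact: sqint_coordinate|exact: sqint_coordinate].
by rewrite mulrCA ipC.
Qed.

Lemma covariance_cross p q j l : j != l -> ip P (lin p j) (lin q l) = 0.
Proof.
move=> jl; rewrite covariance_lin big1// => a _; rewrite big1// => b _.
by rewrite covariance_coordinate (negbTE jl) !mul0r !mulr0.
Qed.

(** Stationarity: the spectral formula for the covariance of two coordinates depends only on the
    difference of their indices. *)
Lemma covariance_shift p q j : ip P (lin ('X * p) j) (lin ('X * q) j) = ip P (lin p j) (lin q j).
Proof.
have e r : lin ('X * r) j = fun w => \sum_(k < size r) r`_k * w k.+1 0 j.
  by apply/funext => w; rewrite lin_mulX.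
have h r k : sqint P (fun w : W => r`_k * w k.+1 0 j) by apply: sqintZ; exact: sqint_coordinate.
rewrite !e [RHS]covariance_lin.
have hs r : sqint P (fun w : W => \sum_(k < size r) r`_k * w k.+1 0 j).
  by rewrite -e; exact: sqint_lin.
rewrite (ip_suml (index_enum _) (fun a : 'I_(size p) => h p a) (hs q)).2.
apply: eq_bigr => a _.
rewrite ipC (ip_suml (index_enum _) (fun b : 'I_(size q) => h q b) (h p a)).2.
apply: eq_bigr => b _.
rewrite ipZZ; [|exact: sqint_coordinate|exact: sqint_coordinate].
rewrite mulrCA ipC !covariance_coordinate; congr (_ * (_ * (_ * _))).
by apply: eq_Rintegral => x _; congr (cos (_ * _)); rewrite -!natr1; ring.
Qed.

End linear_functionals.

(** * The spectral bound on coefficients *)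

Section trigonometric_integrals.
Context (R : realType).
Local Notation leb := (@lebesgue_measure R).
Local Notation I := (`[- (pi : R), pi]%classic).

Lemma Rintegral_sum d (T : measurableType d) (mu : {measure set T -> \bar R}) (D : set T)
    (J : Type) (s : seq J) (F : J -> T -> R) : measurable D ->
  (forall i, mu.-integrable D (EFin \o F i)) ->
  mu.-integrable D (EFin \o (fun x => \sum_(i <- s) F i x)) /\
  \int[mu]_(x in D) (\sum_(i <- s) F i x) = \sum_(i <- s) \int[mu]_(x in D) F i x.
Proof.
move=> mD iF; elim: s => [|i s [IH1 IH2]].
  have -> : (fun x => \sum_(i <- [::]) F i x) = cst 0 by apply/funext => x; rewrite big_nil.
  rewrite big_nil; split; first exact: integrable0.
  by rewrite /Rintegral integral0.
have -> : (fun x => \sum_(j <- i :: s) F j x) = fun x => F i x + \sum_(j <- s) F j x.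
  by apply/funext => x; rewrite big_cons.
have h : mu.-integrable D (EFin \o (fun x => F i x + \sum_(j <- s) F j x)).
  by have := integrableD mD (iF i) IH1; apply: eq_integrable.
by split => //; rewrite RintegralD// IH2 big_cons.
Qed.

Lemma sin_natpi (n : nat) : sin (n%:R * pi) = 0 :> R.
Proof.
elim: n => [|n IH]; first by rewrite mul0r sin0.
by rewrite -natr1 mulrDl mul1r sinDpi IH oppr0.
Qed.

Lemma integral_cos_shift (a i : nat) :
  \int[leb]_(x in I) cos ((a%:R - i%:R) * x) = (a == i)%:R * (2 * pi).
Proof.
have pi0 := @pi_gt0 R.
have lt : - pi < pi :> R by lra.
have [->|ai] := eqVneq a i.
  rewrite subrr; under eq_Rintegral do rewrite mul0r cos0.
  have lI : leb I = (2 * pi)%:E.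
    by rewrite lebesgue_measure_itv/= lte_fin lt -EFinD; congr EFin; ring.
  by rewrite mul1r Rintegral_cst// mul1r; exact: (congr1 fine lI).
set m : R := a%:R - i%:R.
have m0 : m != 0 by rewrite subr_eq0 eqr_nat.
have dF (x : R) : is_derive x 1 (fun x => sin (m * x) / m) (cos (m * x)).
  have dm : is_derive x 1 (fun x => m * x) m.
    by apply: is_derive_eq; rewrite /GRing.scale/=; ring.
  have ds := @is_derive1_comp R sin (fun x => m * x) x _ _ (is_derive_sin (m * x)) dm.
  have h := is_deriveM ds (is_derive_cst (m^-1 : R) x 1).
  by apply: (is_derive_eq h); rewrite /GRing.scale/=; field.
have cF (x : R) : {for x, continuous (fun x => sin (m * x) / m)}.
  by apply: differentiable_continuous; apply/derivable1_diffP; case: (dF x).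
rewrite mul0r /Rintegral (@continuous_FTC2 R _ (fun x => sin (m * x) / m))//.
- rewrite -EFinB/= mulrN sinN mulNr opprK.
  rewrite /m mulrBl sinB !sin_natpi mul0r mulr0 subrr mul0r addr0//.
- by apply: continuous_subspaceT; exact: continuous_cos_lin.
- split.
  + by move=> x _; case: (dF x).
  + by apply: cvg_at_right_filter; exact: cF.
  + by apply: cvg_at_left_filter; exact: cF.
- by move=> x _; rewrite derive1E; exact: (@derive_val _ _ _ _ _ _ _ (dF x)).
Qed.

Lemma integral_indicator_domain d (T : measurableType d) (nu : {measure set T -> \bar R})
    (D : set T) (g : T -> R) :
  (\int[nu]_(x in D) (g x)%:E = \int[nu]_x (g x * \1_D x)%:E)%E.
Proof.
rewrite integral_mkcond; apply: eq_integral => x _; rewrite patchE indicE.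
by case: (x \in D); rewrite ?mulr1 ?mulr0.
Qed.

End trigonometric_integrals.

Lemma weighted_am_gm (R : realType) (c v e : R) : 0 < c -> v ^+ 2 <= e ->
  2 * v <= c * e + c^-1.
Proof.
move=> c0 ve; have h2 : 0 <= c^-1 * (c * v - 1) ^+ 2.
  by rewrite mulr_ge0 ?sqr_ge0// invr_ge0 ltW.
have h3 : c^-1 * (c * v - 1) ^+ 2 = c * v ^+ 2 - 2 * v + c^-1 by field; rewrite gt_eqF.
have h4 : c * v ^+ 2 <= c * e by rewrite ler_wpM2l// ltW.
by rewrite h3 in h2; lra.
Qed.

(** The choice t = (J + 1) / (w v) makes the second term at most w v, half of the left-hand side.
    Using J + 1 rather than J keeps t positive when J = 0. *)
Lemma optimized_bound (R : realType) (w v q J : R) : 0 < w -> 0 < v -> 0 <= J -> 0 <= q ->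
  (forall t, 0 < t -> 2 * w * v <= t * (w * q) + t^-1 * J) -> v ^+ 2 <= (J + 1) / w * q.
Proof.
move=> w0 v0 J0 q0 H; have J1 : 0 < J + 1 by rewrite ltr_wpDl.
have wn0 : w != 0 by rewrite gt_eqF.
have vn0 : v != 0 by rewrite gt_eqF.
have Jn0 : J + 1 != 0 by rewrite gt_eqF.
have := H ((J + 1) / (w * v)) (divr_gt0 J1 (mulr_gt0 w0 v0)).
have -> : (J + 1) / (w * v) * (w * q) = (J + 1) * q / v by field; rewrite ?wn0 ?vn0.
have -> : ((J + 1) / (w * v))^-1 * J = w * v * (J / (J + 1)) by field; rewrite ?wn0 ?vn0 ?Jn0.
have hJ : J / (J + 1) <= 1 by rewrite ler_pdivrMr ?mul1r ?lerDl.
have h2 : w * v * (J / (J + 1)) <= w * v by rewrite ler_piMr// mulr_ge0// ltW.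
move=> h; have : w * v <= (J + 1) * q / v by lra.
rewrite ler_pdivlMr// => h3; rewrite mulrAC ler_pdivlMr//.
by have -> : v ^+ 2 * w = w * v * v by ring.
Qed.

Section coefficient_bound.
Context (R : realType) (d : nat).
Local Notation leb := (@lebesgue_measure R).
Local Notation W := (seqs 'rV[R]_d).
Local Notation I := (`[- (pi : R), pi]%classic).
Variable P : probability W R.
Hypothesis hP : centred_gaussian P.
Variable mu : 'I_d -> {finite_measure set R -> \bar R}.
Hypothesis hmu : has_spectral_measures P mu.
Variable f : 'I_d -> R -> R.
Hypothesis hf : forall j, ac_density (mu j) (f j).
Hypothesis hf_pos : forall j, {ae leb, forall x, I x -> 0 < f j x}.
Hypothesis hf_int : forall j, (\int[leb]_(x in I) ((f j x)^-1)%:E < +oo)%E.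

Let mI : measurable I. Proof. exact: measurable_itv. Qed.

Let mIl : measurable (I : set (measurableTypeR R)). Proof. exact: measurable_itv. Qed.

Implicit Types (p : {poly R}) (j : 'I_d).

(** [cos_poly] and [sin_poly] are the real and imaginary parts of p(e^(i x)), and [energy] is its
    squared modulus. *)
Definition cos_poly (p : {poly R}) (x : R) : R := \sum_(a < size p) p`_a * cos (a%:R * x).
Definition sin_poly (p : {poly R}) (x : R) : R := \sum_(a < size p) p`_a * sin (a%:R * x).
Definition energy p x : R := cos_poly p x ^+ 2 + sin_poly p x ^+ 2.

Lemma energyE p x : energy p x =
  \sum_(a < size p) \sum_(b < size p) p`_a * (p`_b * cos ((a%:R - b%:R) * x)).
Proof.
rewrite /energy !expr2 /cos_poly /sin_poly !mulr_suml -big_split; apply: eq_bigr => a _.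
rewrite /= !mulr_sumr -big_split; apply: eq_bigr => b _ /=.
by rewrite mulrBl cosB; ring.
Qed.

Lemma energy_ge0 p x : 0 <= energy p x.
Proof. by rewrite addr_ge0// sqr_ge0. Qed.

Let mcl (c : R) : measurable_fun setT (fun x : R => cos (c * x)).
Proof. by apply: continuous_measurable_fun; exact: continuous_cos_lin. Qed.

Let msl (c : R) : measurable_fun setT (fun x : R => sin (c * x)).
Proof. by apply: continuous_measurable_fun; exact: continuous_sin_lin. Qed.

Lemma measurable_energy p : measurable_fun setT (energy p).
Proof.
apply: measurable_funD; apply: measurable_funX; apply: measurable_sum => a;
  apply: measurable_funM => //.
Qed.

Lemma msq_spectral p j : msq P (lin p j) = (2 * pi)^-1 * \int[mu j]_(x in I) energy p x.
Proof.
have ic c : (mu j).-integrable I (EFin \o (fun x => cos (c * x))).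
  apply: (integrableS measurableT) => //.
  by apply: (@integrable_le_cst _ _ _ (mu j) _ 1) => // x; exact: norm_cos_le1.
have icc (u v c : R) : (mu j).-integrable I (EFin \o (fun x => u * (v * cos (c * x)))).
  have := integrableZl mI u (integrableZl mI v (ic c)); exact: eq_integrable.
have e a := Rintegral_sum (index_enum 'I_(size p)) mI
  (fun b : 'I_(size p) => icc p`_a p`_b ((a : nat)%:R - (b : nat)%:R)).
have -> : \int[mu j]_(x in I) energy p x = \int[mu j]_(x in I)
    \sum_(a < size p) \sum_(b < size p) p`_a * (p`_b * cos ((a%:R - b%:R) * x)).
  by apply: eq_Rintegral => x _; exact: energyE.
rewrite (Rintegral_sum (index_enum 'I_(size p)) mI (fun a : 'I_(size p) => (e a).1)).2.
rewrite /msq (covariance_lin hP) mulr_sumr; apply: eq_bigr => a _.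
rewrite (e a).2 mulr_sumr; apply: eq_bigr => b _.
have iz : (mu j).-integrable I (EFin \o (fun x => p`_b * cos (((a : nat)%:R - (b : nat)%:R) * x))).
  have := integrableZl mI p`_b (ic ((a : nat)%:R - (b : nat)%:R)); exact: eq_integrable.
rewrite (RintegralZl p`_a mI iz) (RintegralZl p`_b mI (ic _)).
rewrite (covariance_coordinate hmu) eqxx div1r; ring.
Qed.

(** The singular part of the spectral measure contributes a nonnegative amount and is dropped. *)
Lemma energy_density_le p j :
  (\int[leb]_(x in I) (energy p x * f j x)%:E <= \int[mu j]_(x in I) (energy p x)%:E)%E.
Proof.
have [mf f0 [nu [_ nuE]]] := hf j.
have m1 : measurable_fun setT (fun x : R => energy p x * \1_I x).
  by apply: measurable_funM; [exact: measurable_energy|exact: measurable_indic].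
have h0 x : (0 <= (energy p x * \1_I x)%:E)%E.
  by rewrite lee_fin mulr_ge0 ?energy_ge0// indicE.
rewrite [leRHS]integral_indicator_domain.
rewrite (ge0_integral_density_real mf f0 nuE ((measurable_EFinP _ _).2 m1) h0).
rewrite [leLHS]integral_indicator_domain.
apply: (@le_trans _ _ (\int[leb]_x ((energy p x * \1_I x)%:E * (f j x)%:E))%E).
  by rewrite le_eqVlt; apply/orP; left; apply/eqP; apply: eq_integral => x _; rewrite -EFinM mulrAC.
by rewrite leeDl//; apply: integral_ge0 => x _; exact: h0.
Qed.

(** The constant that [optimized_bound] returns for the width 2 pi of the interval and the integral
    of the inverse density. *)
Definition spectral_const (j : 'I_d) : R :=
  (fine (\int[leb]_(x in I) ((f j x)^-1)%:E) + 1) / (2 * pi).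

(** The integrand is the real part of p(e^(i x)) times the conjugate of the i-th exponential, so the
    integral isolates a Fourier coefficient. *)
Lemma coefficient_integral p (i : nat) :
  \int[leb]_(x in I) (cos_poly p x * cos (i%:R * x) + sin_poly p x * sin (i%:R * x))
  = 2 * pi * p`_i.
Proof.
have ic c : leb.-integrable I (EFin \o (fun x : R => cos (c * x))).
  apply: continuous_compact_integrable; first exact: segment_compact.
  by apply: continuous_subspaceT; exact: continuous_cos_lin.
have icc (u c : R) : leb.-integrable I (EFin \o (fun x => u * cos (c * x))).
  have := integrableZl mIl u (ic c); exact: eq_integrable.
transitivity (\int[leb]_(x in I) \sum_(a < size p) p`_a * cos ((a%:R - i%:R) * x)).
  apply: eq_Rintegral => x _; rewrite !mulr_suml -big_split; apply: eq_bigr => a _ /=.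
  by rewrite mulrBl cosB; ring.
rewrite (Rintegral_sum (index_enum 'I_(size p)) mIl
  (fun a : 'I_(size p) => icc p`_a ((a : nat)%:R - i%:R))).2.
under eq_bigr do rewrite (RintegralZl _ mIl (ic _)) integral_cos_shift.
have [ip|ip] := ltnP i (size p).
  rewrite (bigD1 (Ordinal ip))//= eqxx mul1r big1 ?addr0 1?mulrC// => a ai.
  have -> : ((a : nat) == i) = false by apply/negP => /eqP e; case/negP: ai; apply/eqP/val_inj.
  by rewrite mul0r mulr0.
rewrite nth_default// mulr0 big1// => a _.
have -> : ((a : nat) == i) = false.
  by apply/negP => /eqP e; have := ltn_ord a; rewrite e ltnNge ip.
by rewrite mul0r mulr0.
Qed.

(** A Cauchy-Schwarz inequality between the weights f and 1/f in additive form: the integrand [y] of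
    [coefficient_integral] satisfies 2 |y| <= t f |p(e^(i x))|^2 + 1/(t f) wherever f > 0. The
    additive form turns into inequalities between integrals of nonnegative functions; t is optimised
    afterwards. *)
Lemma coefficient_bound_aux p j (i : nat) (t : R) : 0 < t ->
  4 * pi * `|p`_i| <= t * (2 * pi * msq P (lin p j))
    + t^-1 * fine (\int[leb]_(x in I) ((f j x)^-1)%:E).
Proof.
move=> t0; have pi0 := @pi_gt0 R.
have [mf f0 _] := hf j.
pose y x : R := cos_poly p x * cos (i%:R * x) + sin_poly p x * sin (i%:R * x).
have my : measurable_fun setT y.
  apply: measurable_funD; apply: measurable_funM => //; apply: measurable_sum => a;
    exact: measurable_funM.
have y2 x : y x ^+ 2 <= energy p x.
  have := cos2Dsin2 (i%:R * x); rewrite /y /energy.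
  move: (cos_poly p x) (sin_poly p x) (cos _) (sin _) => u v c s cs.
  (* Lagrange's identity: [y] is the scalar product of (u, v) with the unit vector (c, s). *)
  have : 0 <= (u * s - v * c) ^+ 2 by exact: sqr_ge0.
  have -> : (u * c + v * s) ^+ 2 = (u ^+ 2 + v ^+ 2) * (c ^+ 2 + s ^+ 2) - (u * s - v * c) ^+ 2 by ring.
  by rewrite cs mulr1; lra.
have mF : measurable_fun I (f j) by exact: measurable_funTS.
have mV : measurable_fun setT (fun x => (f j x)^-1).
  have -> : (fun x => (f j x)^-1) = fun x => f j x `^ (-1).
    by apply/funext => x; rewrite powR_inv1.
  apply: (@measurableT_comp _ _ _ _ _ _ (fun y : R => y `^ (-1))) => //.
have mk (h : R -> R) : measurable_fun setT h ->
    measurable_fun (I : set (measurableTypeR R)) (fun x : measurableTypeR R => (h x)%:E).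
  by move=> mh; apply/(@measurable_EFinP _ (measurableTypeR R)); exact: measurable_funTS mh.
have key : (\int[leb]_(x in I) (2 * `|y x|)%:E <= t%:E * \int[leb]_(x in I) (energy p x * f j x)%:E
    + t^-1%:E * \int[leb]_(x in I) ((f j x)^-1)%:E)%E.
  have mEf : measurable_fun setT (fun x => energy p x * f j x).
    by apply: measurable_funM => //; exact: measurable_energy.
  have e0 x : 0 <= energy p x * f j x by rewrite mulr_ge0// energy_ge0.
  have v0 x : 0 <= (f j x)^-1 by rewrite invr_ge0.
  have t'0 : 0 <= t^-1 by rewrite invr_ge0 ltW.
  have ee (h : R -> R) (u : R) : measurable_fun setT h -> (forall x, 0 <= h x) -> 0 <= u ->
      (u%:E * \int[leb]_(x in I) (h x)%:E = \int[leb]_(x in I) (u * h x)%:E)%E.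
    move=> mh h0 u0; under [RHS]eq_integral do rewrite EFinM.
    have hn (x : measurableTypeR R) : I x -> (0 <= (h x)%:E)%E by rewrite lee_fin.
    have un : (0 <= u%:E)%E by rewrite lee_fin.
    by rewrite (ge0_integralZl _ mIl (mk _ mh) hn un).
  rewrite (ee _ _ mEf e0 (ltW t0)) (ee _ _ mV v0 t'0).
  have m1 : measurable_fun setT (fun x => t * (energy p x * f j x)) by exact: measurable_funM.
  have m2 : measurable_fun setT (fun x => t^-1 * (f j x)^-1) by exact: measurable_funM.
  have m3 : measurable_fun setT (fun x => 2 * `|y x|).
    by apply: measurable_funM => //; exact: measurableT_comp.
  have q1 x : 0 <= t * (energy p x * f j x) by rewrite mulr_ge0// ltW.
  have q2 x : 0 <= t^-1 * (f j x)^-1 by rewrite mulr_ge0.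
  have q1' (x : measurableTypeR R) : I x -> (0 <= (t * (energy p x * f j x))%:E)%E.
    by rewrite lee_fin.
  have q2' (x : measurableTypeR R) : I x -> (0 <= (t^-1 * (f j x)^-1)%:E)%E by rewrite lee_fin.
  rewrite -(ge0_integralD _ mIl q1' (mk _ m1) q2' (mk _ m2)).
  apply: ae_ge0_le_integral => //.
  - exact: (mk _ m3).
  - by move=> x _; rewrite -EFinD lee_fin addr_ge0.
  - exact: (mk _ (measurable_funD m1 m2)).
  apply: negligibleS (hf_pos j) => x nQ fx; apply: nQ => Ix; have {}fx := fx Ix.
  rewrite -EFinD lee_fin.
  have tf : 0 < t * f j x by rewrite mulr_gt0.
  have -> : t^-1 / f j x = (t * f j x)^-1 by rewrite invfM.
  have h : t * (energy p x * f j x) = (t * f j x) * energy p x by ring.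
  rewrite h; have := y2 x; rewrite -(real_normK (num_real (y x))).
  exact: weighted_am_gm.
have iy : leb.-integrable I (EFin \o y).
  have cc (c : R) : continuous (fun x : R => cos (c * x)) by exact: continuous_cos_lin.
  have cs (c : R) : continuous (fun x : R => sin (c * x)) by exact: continuous_sin_lin.
  apply: continuous_compact_integrable; first exact: segment_compact.
  apply: continuous_subspaceT => x.
  have csum (g : nat -> R -> R) : (forall c, continuous (g c)) ->
      {for x, continuous (fun x => \sum_(a < size p) p`_a * g a x)}.
    move=> cg; apply: (@continuous_at_sum R R^o) => a.
    by apply: cvgM; [exact: cvg_cst|exact: cg].
  apply: cvgD; apply: cvgM; try exact: cc; try exact: cs.
    exact: (csum (fun a x => cos (a%:R * x))).
  exact: (csum (fun a x => sin (a%:R * x))).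
have fJ : (\int[leb]_(x in I) ((f j x)^-1)%:E)%E \is a fin_num.
  have n0 : (0 <= \int[leb]_(x in I) ((f j x)^-1)%:E)%E.
    by apply: integral_ge0 => x _; rewrite lee_fin invr_ge0.
  by rewrite (ge0_fin_numE n0); exact: hf_int.
have iE : (mu j).-integrable I (EFin \o energy p).
  apply: (integrableS measurableT) => //.
  apply: (@integrable_le_cst _ _ _ (mu j) _ (\sum_(a < size p) \sum_(b < size p) `|p`_a| * `|p`_b|)).
    exact: measurable_energy.
  move=> x; rewrite energyE (le_trans (ler_norm_sum _ _ _))// ler_sum// => a _.
  rewrite (le_trans (ler_norm_sum _ _ _))// ler_sum// => b _.
  by rewrite !normrM ler_wpM2l// ler_piMr// norm_cos_le1.
have fE := integrable_fin_num mI iE.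
have M2 : 2 * pi * msq P (lin p j) = fine (\int[mu j]_(x in I) (energy p x)%:E).
  by rewrite msq_spectral mulrA divff ?mul1r// gt_eqF// mulr_gt0.
have lhs : 4 * pi * `|p`_i| <= fine (\int[leb]_(x in I) (2 * `|y x|)%:E).
  have -> : 4 * pi * `|p`_i| = 2 * `|\int[leb]_(x in I) y x|.
    have pp : `|2 * pi : R| = 2 * pi by rewrite ger0_norm// mulr_ge0// ltW.
    by rewrite coefficient_integral normrM pp; ring.
  have iny := integrable_norm iy.
  have -> : fine (\int[leb]_(x in I) (2 * `|y x|)%:E) = 2 * \int[leb]_(x in I) `|y x|.
    by rewrite -(RintegralZl 2 mIl iny).
  by rewrite ler_wpM2l//; exact: (le_normr_Rintegral mIl iy).
apply: (le_trans lhs); rewrite M2 -lee_fin EFinD !EFinM !fineK//.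
  rewrite (le_trans key)// leeD2r// lee_wpmul2l// ?lee_fin ?(ltW t0)//.
  exact: energy_density_le.
apply: integrable_fin_num => //.
have := integrableZl mIl 2 (integrable_norm iy); exact: eq_integrable.
Qed.

Lemma coefficient_bound p j (i : nat) : p`_i ^+ 2 <= spectral_const j * msq P (lin p j).
Proof.
have pi0 := @pi_gt0 R.
pose J := fine (\int[leb]_(x in I) ((f j x)^-1)%:E).
have J0 : 0 <= J.
  apply: fine_ge0; apply: integral_ge0 => x _; rewrite lee_fin invr_ge0.
  by case: (hf j) => _ f0 _.
have q0 := msq_ge0 P (lin p j); set q := msq P (lin p j) in q0 *.
rewrite /spectral_const -/J -(real_normK (num_real p`_i)).
have [->|pn0] := eqVneq p`_i 0.
  by rewrite normr0 expr0n/= mulr_ge0// divr_ge0// ?addr_ge0// mulr_ge0// ltW.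
have v0 : 0 < `|p`_i| by rewrite normr_gt0.
apply: optimized_bound => // [|t t0]; first by rewrite mulr_gt0.
have := coefficient_bound_aux p j i t0; rewrite -/q -/J.
suff -> : 2 * (2 * pi) * `|p`_i| = 4 * pi * `|p`_i| by [].
by ring.
Qed.

End coefficient_bound.

(** * One-step prediction *)

Lemma l2cvgB (R : realType) dT (T : measurableType dT) (P : probability T R)
    (U U' : nat -> T -> R) (V V' : T -> R) :
  (forall k, sqint P (U k)) -> (forall k, sqint P (U' k)) -> sqint P V -> sqint P V' ->
  l2cvg P U V -> l2cvg P U' V' -> l2cvg P (fun k x => U k x - U' k x) (fun x => V x - V' x).
Proof.
move=> hU hU' hV hV' c c'.
have := l2cvgD hU (fun k => sqintZ (-1) (hU' k)) hV (sqintZ (-1) hV') c (l2cvgZ (-1) hU' hV' c').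
have -> : (fun k x => U k x + -1 * U' k x) = (fun k x => U k x - U' k x).
  by apply/funext => k; apply/funext => x; rewrite mulN1r.
by have -> : (fun x => V x + -1 * V' x) = (fun x => V x - V' x)
  by apply/funext => x; rewrite mulN1r.
Qed.

Section prediction.
Context (R : realType) (d : nat).
Local Notation W := (seqs 'rV[R]_d).
Variable P : probability W R.
Hypothesis hP : centred_gaussian P.
Variable mu : 'I_d -> {finite_measure set R -> \bar R}.
Hypothesis hmu : has_spectral_measures P mu.
Variables (j : 'I_d) (K : R).
Implicit Types (r : {poly R}) (w : W).
Local Notation L r := (lin r j).
Local Notation q r := (msq P (L r)).
Hypothesis hK : forall r i, r`_i ^+ 2 <= K * q r.

Let hL r : sqint P (L r). Proof. exact: sqint_lin. Qed.

Let LD r1 r2 : L (r1 + r2) = fun w => L r1 w + L r2 w.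
Proof. by apply/funext => w; rewrite linD. Qed.
Let LB r1 r2 : L (r1 - r2) = fun w => L r1 w - L r2 w.
Proof. by apply/funext => w; rewrite linB. Qed.
Let LZ (a : R) r : L (a *: r) = fun w => a * L r w.
Proof. by apply/funext => w; rewrite linZ. Qed.

Let ipX r1 r2 : ip P (L ('X * r1)) (L ('X * r2)) = ip P (L r1) (L r2).
Proof. exact: covariance_shift hmu _ _ _. Qed.

Let ipXn n r1 r2 : ip P (L ('X^n * r1)) (L ('X^n * r2)) = ip P (L r1) (L r2).
Proof.
elim: n r1 r2 => [|n IH] r1 r2; first by rewrite !expr0 !mul1r.
by rewrite !exprS -!mulrA ipX IH.
Qed.

Lemma K_gt0 : 0 < K.
Proof.
rewrite ltNge; apply/negP => K0; have := hK 1 0%N.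
rewrite coef1 expr1n => h; have := mulr_le0_ge0 K0 (msq_ge0 P (L 1)).
by move=> /(le_trans h); rewrite ler10.
Qed.

(** Near-minimisers of the prediction error rather than a minimiser, which need not be a polynomial.
    The rate 8^-k is the one that [fast_limit] requires. *)
Lemma prediction_minimizers : exists (s2 : R) (p : nat -> {poly R}),
  (forall r, s2 <= q (1 - 'X * r)) /\ (forall k, q (1 - 'X * p k) <= s2 + 8^-1 ^+ k).
Proof.
pose E := [set q (1 - 'X * r) | r in [set: {poly R}]].
have hE : has_inf E.
  split; first by exists (q (1 - 'X * 0)), 0.
  by exists 0 => _ [r _ <-]; exact: msq_ge0.
have h k : exists r, q (1 - 'X * r) <= inf E + 8^-1 ^+ k.
  have e0 : 0 < 8^-1 ^+ k :> R by rewrite exprn_gt0// invr_gt0.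
  by have [_ [r _ <-] /ltW] := inf_adherent e0 hE; exists r.
have [p hp] := choice h; exists (inf E), p; split => // r.
by apply: ge_inf; [exact: hE.2|exists r].
Qed.

(** Forgetting the coefficient of the most recent coordinate is a bounded operation, because [hK]
    controls that coefficient. The predictors thus still converge after the coordinates have been
    shifted by [append]. *)
Lemma msq_drop1 r : q (drop_poly 1 r) <= (2 + 2 * K * q 1) * q r.
Proof.
have e : 'X * drop_poly 1 r = r + (- r`_0) *: 1.
  apply/polyP => i; rewrite coefXM coefD coefZ coef1 coef_drop_poly.
  by case: i => [|i] /=; rewrite ?mulr1 ?subrr// mulr0 addr0 addn1.
have -> : q (drop_poly 1 r) = q ('X * drop_poly 1 r) by rewrite /msq ipX.
rewrite e LD LZ; apply: le_trans (msqD_le (hL r) (sqintZ _ (hL 1))) _.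
rewrite msqZ// sqrrN; have := ler_wpM2r (msq_ge0 P (L 1)) (hK r 0).
by move: (q r) (q 1) (r`_0 ^+ 2) => a b c ?; lra.
Qed.

Lemma msq_drop i r : q (drop_poly i r) <= (2 + 2 * K * q 1) ^+ i * q r.
Proof.
have c0 : 0 <= 2 + 2 * K * q 1 by rewrite addr_ge0// !mulr_ge0 ?msq_ge0// ltW// K_gt0.
elim: i r => [|i IH] r; first by rewrite drop_poly0l expr0 mul1r.
have -> : drop_poly i.+1 r = drop_poly 1 (drop_poly i r).
  by apply/polyP => k; rewrite !coef_drop_poly addn1 addSnnS addnC addnC.
by apply: le_trans (msq_drop1 _) _; rewrite [in leRHS]exprS -[leRHS]mulrA; apply: ler_wpM2l.
Qed.

Variables (s2 : R) (p : nat -> {poly R}).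
Hypothesis hmin : forall r, s2 <= q (1 - 'X * r).
Hypothesis hp : forall k, q (1 - 'X * p k) <= s2 + 8^-1 ^+ k.

Let rho k := 1 - 'X * p k.

(** Parallelogram law, as for projections in a Hilbert space: the mean of two near-minimisers is
    again of the form 1 - 'X * r, so the error of their sum is at least 4 times [s2]. *)
Lemma msq_increment k : q (p k.+1 - p k) <= 4 * 8^-1 ^+ k.
Proof.
have -> : q (p k.+1 - p k) = q (rho k - rho k.+1).
  have -> : rho k - rho k.+1 = 'X * (p k.+1 - p k) by rewrite /rho; ring.
  by rewrite /msq ipX.
have mid : rho k + rho k.+1 = 2 *: (1 - 'X * (2^-1 *: (p k + p k.+1))).
  rewrite scalerBr -scalerAr scalerA divff// scale1r /rho scaler_nat.
  by ring.
have h1 : 4 * s2 <= q (rho k + rho k.+1).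
  rewrite mid LZ msqZ//; have -> : 2 ^+ 2 = 4 :> R by rewrite expr2; lra.
  by rewrite ler_wpM2l.
rewrite (LD (rho k) (rho k.+1)) (msqD (hL _) (hL _)) in h1.
rewrite (LB (rho k) (rho k.+1)) (msqB (hL _) (hL _)); move: h1.
have := hp k; have := hp k.+1; rewrite -/(rho k) -/(rho k.+1) exprS.
have : 0 <= 8^-1 ^+ k :> R by rewrite exprn_ge0// invr_ge0.
by lra.
Qed.

Definition pcoef (i : nat) : R := lims (fun k => (p k)`_i).

Lemma pcoef_cvg i : (fun k => (p k)`_i) @ \oo --> pcoef i.
Proof.
have s0 : 0 <= Num.sqrt (4 * K) by exact: sqrtr_ge0.
have K0 := K_gt0.
have h k : `|(p k.+1)`_i - (p k)`_i| <= Num.sqrt (4 * K) * 2^-1 ^+ k.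
  have h0 : 0 <= Num.sqrt (4 * K) * 2^-1 ^+ k.
    by rewrite mulr_ge0// exprn_ge0// invr_ge0.
  rewrite -ler_sqr ?nnegrE// real_normK ?num_real// exprMn sqr_sqrtr; last first.
    by rewrite mulr_ge0// ltW.
  rewrite -coefB (le_trans (hK _ i))// -exprM mulnC exprM.
  have -> : 2^-1 ^+ 2 = 4^-1 :> R by rewrite expr2; lra.
  rewrite mulrAC mulrC ler_wpM2r ?(ltW K0)//.
  apply: le_trans (msq_increment k) _; rewrite ler_wpM2l// lerXn2r ?nnegrE ?invr_ge0//.
  by rewrite lef_pV2 ?posrE// ler_nat.
by have [l cl _] := geometric_cauchy s0 h; rewrite /pcoef (cvg_lims cl).
Qed.

Definition predictor (w : W) : R := lims (fun k => L (p k) w).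

Lemma drop_fast i : [/\ sqint P (fun w => lims (fun k => L (drop_poly i (p k)) w)),
  l2cvg P (fun k => L (drop_poly i (p k))) (fun w => lims (fun k => L (drop_poly i (p k)) w)) &
  {ae P, forall w, (fun k => L (drop_poly i (p k)) w) @ \oo
                     --> lims (fun k => L (drop_poly i (p k)) w)}].
Proof.
have c0 : 0 <= 2 + 2 * K * q 1 by rewrite addr_ge0// !mulr_ge0 ?msq_ge0// ltW// K_gt0.
apply: (@fast_limit _ _ _ P (fun k => L (drop_poly i (p k))) ((2 + 2 * K * q 1) ^+ i * 4)).
- by move=> k.
- by rewrite mulr_ge0// exprn_ge0.
- move=> k; rewrite -LB.
  have -> : drop_poly i (p k.+1) - drop_poly i (p k) = drop_poly i (p k.+1 - p k).
    by apply/polyP => a; rewrite coefB !coef_drop_poly coefB.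
  apply: le_trans (msq_drop _ _) _; rewrite -[leRHS]mulrA.
  by apply: ler_wpM2l; [exact: exprn_ge0|exact: msq_increment].
Qed.

Definition innovation (n : nat) (w : W) : R := w n 0 j - predictor (iter n.+1 (@past R d) w).

Lemma lin_mulXn n r w : L ('X^n * r) w = L r (iter n (@past R d) w).
Proof.
elim: n w => [|n IH] w; first by rewrite expr0 mul1r.
by rewrite exprS -mulrA lin_mulX IH -iterSr.
Qed.

Lemma innovation_limit n : sqint P (innovation n) /\
  l2cvg P (fun k => L ('X^n * rho k)) (innovation n).
Proof.
have [h1 h2 _] : [/\ sqint P (fun w => lims (fun k => L ('X^(n.+1) * p k) w)),
  l2cvg P (fun k => L ('X^(n.+1) * p k)) (fun w => lims (fun k => L ('X^(n.+1) * p k) w)) &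
  {ae P, forall w, (fun k => L ('X^(n.+1) * p k) w) @ \oo --> lims (fun k => L ('X^(n.+1) * p k) w)}].
  apply: (@fast_limit _ _ _ P (fun k => L ('X^(n.+1) * p k)) 4) => // k.
  by rewrite -(LB ('X^(n.+1) * p k.+1)) -mulrBr /msq ipXn; exact: msq_increment.
have e : (fun w => lims (fun k => L ('X^(n.+1) * p k) w))
    = fun w => predictor (iter n.+1 (@past R d) w).
  by apply/funext => w; congr lims; apply/funext => k; rewrite lin_mulXn.
have eI : innovation n = fun w => L 'X^n w - lims (fun k => L ('X^(n.+1) * p k) w).
  by apply/funext => w; rewrite linXn /innovation -[predictor _]/((fun w => predictor (iter n.+1 (@past R d) w)) w) -e.
rewrite eI; split; first exact: sqintB.
have -> : (fun k => L ('X^n * rho k)) = fun k w => L 'X^n w - L ('X^(n.+1) * p k) w.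
  apply/funext => k; rewrite -LB; congr (lin _ j).
  by rewrite /rho mulrBr mulr1 mulrA -exprSr.
exact: (l2cvgB (fun=> hL _) (fun k => hL _) (hL _) h1 (@l2cvg_cst _ _ _ P _) h2).
Qed.

Let hI n : sqint P (innovation n). Proof. exact: (innovation_limit n).1. Qed.
Let cI n : l2cvg P (fun k => L ('X^n * rho k)) (innovation n). Proof. exact: (innovation_limit n).2. Qed.

(** Larger indices are earlier times: a prediction error is orthogonal to the coordinates used for
    the prediction. For the near-minimisers, adding a multiple of such a coordinate cannot lower the
    error below [s2], which bounds the square of the inner product by a multiple of 8^-k. *)
Lemma innovation_future n a : (n < a)%N -> ip P (innovation n) (L 'X^a) = 0.
Proof.
(* A positive upper bound for the variance [q 1] of a coordinate, by which it is safe to divide. *)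
move=> na; set v := q 1 + 1.
have v0 : 0 < v by rewrite ltr_wpDl// msq_ge0.
have aE : a = (n + (a - n.+1).+1)%N by rewrite addnS -addSn subnKC.
set b := (a - n.+1)%N in aE.
have eqE k : ip P (L ('X^n * rho k)) (L 'X^a) = ip P (L (rho k)) (L ('X * 'X^b)).
  by rewrite aE exprD ipXn exprS.
have bound k : ip P (L (rho k)) (L ('X * 'X^b)) ^+ 2 <= v * 8^-1 ^+ k.
  set E := ip _ _ _.
  have qX : q ('X * 'X^b) = q 1 by rewrite /msq ipX -[X in L X]mulr1 ipXn.
  have := hmin (p k + (E / v) *: 'X^b).
  have -> : 1 - 'X * (p k + (E / v) *: 'X^b) = rho k - (E / v) *: ('X * 'X^b).
    by rewrite /rho mulrDr opprD addrA -scalerAr.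
  rewrite LB LZ (msqB (hL _) (sqintZ _ (hL _))) (ipZr _ (hL _) (hL _)) (msqZ _ (hL _)) qX -/E.
  have := hp k; rewrite -/(rho k) => h1 h2.
  have h3 : 2 * (E / v * E) <= 8^-1 ^+ k + (E / v) ^+ 2 * q 1 by lra.
  have h4 : (E / v) ^+ 2 * q 1 <= (E / v) ^+ 2 * v by rewrite ler_wpM2l ?sqr_ge0// /v lerDl.
  have vn0 : v != 0 by rewrite gt_eqF.
  have e1 : E / v * E = E ^+ 2 / v by field.
  have e2 : (E / v) ^+ 2 * v = E ^+ 2 / v by field.
  rewrite e1 in h3; rewrite e2 in h4.
  have : E ^+ 2 / v <= 8^-1 ^+ k by lra.
  by rewrite ler_pdivrMr// mulrC.
have c1 := ip_cvg (fun k => hL ('X^n * rho k)) (fun=> hL 'X^a) (hI n) (hL 'X^a) (cI n) (@l2cvg_cst _ _ _ P _).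
have c2 : (fun k => ip P (L ('X^n * rho k)) (L 'X^a)) @ \oo --> (0 : R).
  rewrite (funext eqE); apply: (cvg_sqr_dominated bound).
  by apply: cvg_geometric_decay; apply/andP; split; [rewrite invr_ge0|rewrite invf_lt1// ltr1n].
exact: (cvg_unique _ c1 c2).
Qed.

Lemma innovation_future_poly n a r : (n < a)%N -> ip P (innovation n) (L ('X^a * r)) = 0.
Proof.
move=> na; have hF (i : nat) : sqint P (fun w => r`_i * L ('X^(a + i)) w) by exact: sqintZ.
have -> : L ('X^a * r) = fun w => \sum_(i < size r) r`_i * L ('X^(a + i)) w.
  have iterE a' w b : iter a' (@past R d) w b = w (a' + b)%N.
    by elim: a' w b => [//|a' IH] w b; rewrite iterSr IH addSn.
  apply/funext => w; rewrite lin_mulXn [LHS]/lin; apply: eq_bigr => i _.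
  by rewrite linXn iterE.
rewrite ipC (ip_suml (index_enum _) (fun i : 'I_(size r) => hF i) (hI n)).2 big1// => i _.
by rewrite ipZl// ipC innovation_future ?mulr0// (leq_trans na)// leq_addr.
Qed.

(** For n < m the second innovation is a limit of functionals of coordinates with indices at least
    m, all orthogonal to the first one. The variances agree by stationarity, and equal the limit
    [s2] of the minimised errors. *)
Lemma innovation_white n m : ip P (innovation n) (innovation m) = (n == m)%:R * s2.
Proof.
have lt_case a b : (a < b)%N -> ip P (innovation a) (innovation b) = 0.
  move=> ab.
  have c1 := ip_cvg (fun=> hI a) (fun k => hL ('X^b * rho k)) (hI a) (hI b) (@l2cvg_cst _ _ _ P _) (cI b).
  have e k : ip P (innovation a) (L ('X^b * rho k)) = 0 by exact: innovation_future_poly.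
  move: c1; rewrite (funext e) => c1.
  exact: (cvg_unique _ c1 (cvg_cst (0 : R))).
have [nm|mn|<-] := ltngtP n m; first by rewrite lt_case// mul0r.
  by rewrite ipC lt_case// mul0r.
rewrite mul1r.
have c1 := ip_cvg (fun k => hL ('X^n * rho k)) (fun k => hL ('X^n * rho k)) (hI n) (hI n) (cI n) (cI n).
have c2 : (fun k => ip P (L ('X^n * rho k)) (L ('X^n * rho k))) @ \oo --> s2.
  apply: (@cvg_dominated _ _ (fun k => 1 * 8^-1 ^+ k)) => [k|].
    have h1 : ip P (L (rho k)) (L (rho k)) <= s2 + 8^-1 ^+ k := hp k.
    have h2 : s2 <= ip P (L (rho k)) (L (rho k)) := hmin (p k).
    have h3 : 0 <= 8^-1 ^+ k :> R by rewrite exprn_ge0// invr_ge0.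
    by rewrite ipXn mul1r ler_distl; apply/andP; split; lra.
  by apply: cvg_geometric_decay; apply/andP; split; [rewrite invr_ge0|rewrite invf_lt1// ltr1n].
exact: (cvg_unique _ c1 c2).
Qed.

(** In 1 - 'X * p k the most recent coordinate has coefficient 1, so [hK] bounds every prediction
    error from below by 1/K. *)
Lemma innovation_variance_gt0 : 0 < s2.
Proof.
have h k : 1 <= K * (s2 + 8^-1 ^+ k).
  have := hK (rho k) 0; rewrite /rho coefB coef1 coefXM eqxx subr0 expr1n => /le_trans.
  by apply; rewrite ler_wpM2l ?(ltW K_gt0).
have c : (fun k => K * (s2 + 8^-1 ^+ k)) @ \oo --> K * (s2 + 0).
  apply: cvgM; first exact: cvg_cst.
  apply: cvgD; first exact: cvg_cst.
  have := @cvg_geometric_decay R 1 8^-1.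
  under eq_fun do rewrite mul1r.
  by apply; apply/andP; split; [rewrite invr_ge0|rewrite invf_lt1// ltr1n].
have : 1 <= K * (s2 + 0).
  rewrite -(cvg_lim _ c)//; apply: limr_ge; last exact: nearW.
  by apply/cvg_ex; eexists; exact: c.
rewrite addr0 => h1; have := lt_le_trans ltr01 h1.
by rewrite pmulr_rgt0// K_gt0.
Qed.

(** The coefficients of the limit of 1 - 'X * p k, which express the innovation through the
    coordinates. *)
Definition bcoef (i : nat) : R := if i is i'.+1 then - pcoef i' else 1.

Lemma bcoef_cvg i : (fun k => (rho k)`_i) @ \oo --> bcoef i.
Proof.
case: i => [|i] /=.
  have -> : (fun k => (rho k)`_0) = fun _ => 1.
    by apply/funext => k; rewrite /rho coefB coef1 coefXM eqxx subr0.
  exact: cvg_cst.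
have -> : (fun k => (rho k)`_i.+1) = fun k => - (p k)`_i.
  by apply/funext => k; rewrite /rho coefB coef1 coefXM/= sub0r.
by apply: cvgN; exact: pcoef_cvg.
Qed.

Definition bsum (n : nat) : R := \sum_(i < n) bcoef i ^+ 2.

Lemma bsum_nondecreasing : nondecreasing_seq bsum.
Proof.
by apply/nondecreasing_seqP => n; rewrite /bsum big_ord_recr/= lerDl sqr_ge0.
Qed.

Lemma cvg_sum_seq (I : Type) (s : seq I) (F : I -> nat -> R) (l : I -> R) :
  (forall i, F i @ \oo --> l i) -> (fun k => \sum_(i <- s) F i k) @ \oo --> \sum_(i <- s) l i.
Proof.
move=> h; elim: s => [|i s IH].
  by under eq_fun do rewrite big_nil; rewrite big_nil; exact: cvg_cst.
under eq_fun do rewrite big_cons.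
by rewrite big_cons; apply: cvgD; [exact: h|exact: IH].
Qed.

(* The coefficient of w_n in sum_(i <= n) b_(n - i) eps_i is bsum n.+1, and the mean
   square of this variable is s2 * bsum n.+1. *)
Lemma bsum_le n : bsum n.+1 <= K * s2.
Proof.
pose Y k := \sum_(i < n.+1) bcoef (n - i) *: ('X^i * rho k).
have LY k : L (Y k) = fun w => \sum_(i < n.+1) bcoef (n - i) * L ('X^i * rho k) w.
  apply/funext => w; rewrite /Y; elim: (index_enum _) => [|i s IH].
    by rewrite !big_nil /lin size_poly0 big_ord0.
  by rewrite !big_cons linD linZ IH.
have bE : bsum n.+1 = \sum_(i < n.+1) bcoef (n - i) * bcoef (n - i).
  by rewrite /bsum (reindex_inj rev_ord_inj)/=; apply: eq_bigr => i _; rewrite subSS expr2.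
have cY : (fun k => (Y k)`_n) @ \oo --> bsum n.+1.
  have -> : (fun k => (Y k)`_n) = fun k => \sum_(i < n.+1) bcoef (n - i) * (rho k)`_(n - i).
    apply/funext => k; rewrite /Y coef_sum; apply: eq_bigr => i _.
    by rewrite coefZ coefXnM ltnNge -ltnS ltn_ord.
  rewrite bE; apply: cvg_sum_seq => i; apply: cvgM; first exact: cvg_cst.
  exact: bcoef_cvg.
pose V w := \sum_(i < n.+1) bcoef (n - i) * innovation i w.
have cq : (fun k => q (Y k)) @ \oo --> s2 * bsum n.+1.
  have e k : q (Y k) = \sum_(i < n.+1) \sum_(l < n.+1)
      bcoef (n - i) * (bcoef (n - l) * ip P (L ('X^i * rho k)) (L ('X^l * rho k))).
    have hF (i : 'I_n.+1) : sqint P (fun w => bcoef (n - i) * L ('X^i * rho k) w) by exact: sqintZ.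
    rewrite /msq LY; have hs := (ip_suml (index_enum _) hF (hL 0)).1.
    rewrite (ip_suml (index_enum _) hF hs).2; apply: eq_bigr => i _.
    rewrite ipC (ip_suml (index_enum _) hF (hF i)).2; apply: eq_bigr => l _.
    by rewrite ipZZ// mulrCA ipC.
  rewrite (funext e) bE mulr_sumr.
  have -> : \sum_(i < n.+1) s2 * (bcoef (n - i) * bcoef (n - i)) = \sum_(i < n.+1) \sum_(l < n.+1)
      bcoef (n - i) * (bcoef (n - l) * ip P (innovation i) (innovation l)).
    apply: eq_bigr => i _; rewrite (bigD1 i)//= big1 ?addr0.
      by rewrite innovation_white eqxx mul1r; ring.
    move=> l li; rewrite innovation_white.
    have -> : ((i : nat) == l) = false.
      by apply/negP => /eqP il; case/negP: li; apply/eqP/val_inj.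
    by rewrite mul0r !mulr0.
  apply: cvg_sum_seq => i; apply: cvg_sum_seq => l.
  apply: cvgM; first exact: cvg_cst.
  apply: cvgM; first exact: cvg_cst.
  exact: (ip_cvg (fun k => hL _) (fun k => hL _) (hI i) (hI l) (cI i) (cI l)).
have b1 : 1 <= bsum n.+1.
  by rewrite /bsum big_ord_recl/= expr1n lerDl sumr_ge0// => i _; rewrite sqr_ge0.
have : bsum n.+1 ^+ 2 <= K * (s2 * bsum n.+1).
  have c1 : (fun k => (Y k)`_n ^+ 2) @ \oo --> bsum n.+1 ^+ 2.
    by rewrite expr2; under eq_fun do rewrite expr2; exact: cvgM.
  have c2 : (fun k => K * q (Y k)) @ \oo --> K * (s2 * bsum n.+1).
    by apply: cvgM => //; exact: cvg_cst.
  rewrite -(cvg_lim _ c1)// -(cvg_lim _ c2)//; apply: ler_lim.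
  - by apply/cvg_ex; eexists; exact: c1.
  - by apply/cvg_ex; eexists; exact: c2.
  - by apply: nearW => k; exact: hK.
by rewrite mulrA expr2 ler_pM2r// (lt_le_trans ltr01 b1).
Qed.

Definition binf : R := limn bsum.

Lemma bsum_cvg : bsum @ \oo --> binf.
Proof.
apply: nondecreasing_is_cvgn; first exact: bsum_nondecreasing.
exists (K * s2) => _ [n _ <-].
by apply: le_trans (bsum_le n); exact: bsum_nondecreasing.
Qed.

Lemma binf_gt0 : 0 < binf.
Proof.
have h : bsum 1 <= binf.
  apply: nondecreasing_cvgn_le; first exact: bsum_nondecreasing.
  by apply/cvg_ex; exists binf; exact: bsum_cvg.
apply: lt_le_trans h; by rewrite /bsum big_ord1/= expr1n.
Qed.

(** The variable is the sum of the series of (b_i / binf) eps_i. This normalisation makes its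
    covariance with each innovation equal to b_i times its own variance, so that subtracting b_i Z
    from the i-th innovation leaves something uncorrelated with Z. *)
Lemma smoothing_variable : exists Z : W -> R, [/\ sqint P Z,
  forall n, ip P Z (innovation n) = s2 / binf * bcoef n,
  msq P Z = s2 / binf &
  exists (U : nat -> W -> R) (N : nat -> nat), l2cvg P U Z /\
    forall k, U k = fun w => \sum_(i < N k) (bcoef i / binf) * innovation i w].
Proof.
have B0 := binf_gt0; have s20 := innovation_variance_gt0.
(* Partial sums along a subsequence, fast enough for [fast_limit]; the condition k <= n ensures that
   every fixed innovation is eventually included. *)
have h k : exists n, (k <= n)%N /\ `|binf - bsum n| <= 8^-1 ^+ k.
  have e0 : 0 < 8^-1 ^+ k :> R by rewrite exprn_gt0// invr_gt0.
  have /cvgrPdist_le/(_ _ e0)[n _ hn] := bsum_cvg.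
  by exists (maxn k n); split; [exact: leq_maxl|apply: hn; exact: leq_maxr].
have [N /all_and2[Nk hN]] := choice h.
pose a i := bcoef i / binf.
pose S n w := \sum_(i < n) a i * innovation i w.
have hS n : sqint P (S n).
  exact: (ip_suml (index_enum _) (fun i : 'I_n => sqintZ (a i) (hI i)) (hI 0)).1.
have ipS n i : ip P (S n) (innovation i) = if (i < n)%N then a i * s2 else 0.
  rewrite (ip_suml (index_enum _) (fun i : 'I_n => sqintZ (a i) (hI i)) (hI i)).2.
  under eq_bigr do rewrite (ipZl _ (hI _) (hI _)) innovation_white.
  case: ifPn => [lt|].
    rewrite (bigD1 (Ordinal lt))//= eqxx mul1r big1 ?addr0// => l li.
    have -> : ((l : nat) == i) = false by apply/negP => /eqP e; case/negP: li; apply/eqP/val_inj.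
    by rewrite mul0r mulr0.
  rewrite -leqNgt => ni; rewrite big1// => l _.
  have -> : ((l : nat) == i) = false by apply/negP => /eqP e; have := ltn_ord l; rewrite e ltnNge ni.
  by rewrite mul0r mulr0.
have ipSS n m : (n <= m)%N -> ip P (S n) (S m) = s2 / binf ^+ 2 * bsum n.
  move=> nm; rewrite (ip_suml (index_enum _) (fun i : 'I_n => sqintZ (a i) (hI i)) (hS m)).2.
  rewrite /bsum mulr_sumr; apply: eq_bigr => i _.
  rewrite (ipZl _ (hI _) (hS _)) ipC ipS (leq_trans (ltn_ord i) nm) /a.
  by field; rewrite gt_eqF.
have dS n m : (n <= m)%N -> msq P (fun w => S m w - S n w) = s2 / binf ^+ 2 * (bsum m - bsum n).
  move=> nm; rewrite (msqB (hS m) (hS n)) /msq (ipC P (S m) (S n)) !ipSS//; ring.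
have c0 : 0 <= s2 / binf ^+ 2 by rewrite divr_ge0 ?ltW// exprn_gt0.
have dS' n m : msq P (fun w => S m w - S n w) = s2 / binf ^+ 2 * `|bsum m - bsum n|.
  have [nm|/ltnW mn] := leqP n m.
    by rewrite dS// ger0_norm// subr_ge0 bsum_nondecreasing.
  rewrite distrC ger0_norm ?subr_ge0 ?bsum_nondecreasing// -dS//.
  by apply: eq_Rintegral => w _; rewrite -mulrNN !opprB.
have [hZ lZ _] : [/\ sqint P (fun w => lims (fun k => S (N k) w)),
    l2cvg P (fun k => S (N k)) (fun w => lims (fun k => S (N k) w)) &
    {ae P, forall w, (fun k => S (N k) w) @ \oo --> lims (fun k => S (N k) w)}].
  apply: (@fast_limit _ _ _ P (fun k => S (N k)) (s2 / binf ^+ 2 * 2)).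
  - by move=> k; exact: hS.
  - by rewrite mulr_ge0.
  - move=> k; rewrite (dS' (N k) (N k.+1)) -[leRHS]mulrA; apply: ler_wpM2l => //.
    have := hN k; have := hN k.+1; rewrite exprS.
    have : 0 <= 8^-1 ^+ k :> R by rewrite exprn_ge0// invr_ge0.
    move: (8^-1 ^+ k) => z z0; rewrite !ler_norml => /andP[? ?] /andP[? ?].
    by apply/andP; split; lra.
exists (fun w => lims (fun k => S (N k) w)); split => //.
- move=> n; have c1 := ip_cvg (fun k => hS (N k)) (fun=> hI n) hZ (hI n) lZ (@l2cvg_cst _ _ _ P _).
  have c2 : (fun k => ip P (S (N k)) (innovation n)) @ \oo --> a n * s2.
    apply: cvg_near_cst; exists n.+1 => // k /= nk.
    by rewrite ipS (leq_trans nk).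
  have -> : s2 / binf * bcoef n = a n * s2 by rewrite /a mulrC mulrA mulrAC.
  exact: (cvg_unique _ c1 c2).
- have c1 := ip_cvg (fun k => hS (N k)) (fun k => hS (N k)) hZ hZ lZ lZ.
  have c2 : (fun k => ip P (S (N k)) (S (N k))) @ \oo --> s2 / binf ^+ 2 * binf.
    have -> : (fun k => ip P (S (N k)) (S (N k))) = fun k => s2 / binf ^+ 2 * bsum (N k).
      by apply/funext => k; rewrite ipSS.
    apply: cvgM; first exact: cvg_cst.
    apply: (@cvg_dominated _ _ (fun k => 1 * 8^-1 ^+ k)) => [k|].
      by rewrite mul1r distrC; exact: hN.
    by apply: cvg_geometric_decay; apply/andP; split; [rewrite invr_ge0|rewrite invf_lt1// ltr1n].
  have -> : s2 / binf = s2 / binf ^+ 2 * binf by field; rewrite gt_eqF.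
  exact: (cvg_unique _ c1 c2).
- by exists (fun k => S (N k)), N.
Qed.

End prediction.

(** * Gaussian vectors *)

Section gaussian_expectations.
Context (R : realType) dT (T : measurableType dT) (P : probability T R).
Variable V : (T -> R) -> Prop.
Hypotheses (V0 : V (fun _ => 0)) (VG : forall f, V f -> gauss P f).
Hypotheses (VD : forall f g, V f -> V g -> V (fun x => f x + g x)).
Hypotheses (VZ : forall (a : R) f, V f -> V (fun x => a * f x)).

Lemma gauss_independence_integral d1 d2 (T1 : measurableType d1) (T2 : measurableType d2)
    (I1 I2 : Type) (X1 : I1 -> T1 -> R) (X2 : I2 -> T2 -> R) (Y : T -> T1) (Z : T -> T2) :
  generating X1 -> generating X2 ->
  (forall i, V (fun x => X1 i (Y x))) -> (forall i, V (fun x => X2 i (Z x))) ->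
  (forall i j, ip P (fun x => X1 i (Y x)) (fun x => X2 j (Z x)) = 0) ->
  forall f : T1 * T2 -> \bar R, measurable_fun setT f -> (forall z, 0 <= f z)%E ->
  (\int[P]_x f (Y x, Z x) = \int[P]_x \int[P]_y f (Y x, Z y))%E.
Proof.
move=> g1 g2 VY VZ' unc f mf f0.
have mY := class_measurable VG g1 VY; have mZ := class_measurable VG g2 VZ'.
have mYZ : measurable_fun setT (fun x => (Y x, Z x)) by exact: measurable_fun_pair.
rewrite -(ge0_integral_law P mYZ mf f0).
transitivity (\int[law P mY \x law P mZ]_z f z)%E.
  apply: eq_measure_integral => A mA _.
  exact: (gauss_independence V0 VG VD VZ g1 g2 VY VZ' unc mA).
rewrite (@fubini_tonelli1 _ _ _ _ _ (law P mY) (law P mZ) f mf f0).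
have mF := @measurable_fun_fubini_tonelli_F _ _ _ _ _ (law P mZ) f mf f0.
rewrite (ge0_integral_law P mY mF); last by move=> x; apply: integral_ge0 => y _; exact: f0.
apply: eq_integral => x _; rewrite /fubini_F ge0_integral_law//.
by apply: (measurableT_comp mf); exact: measurable_fun_pair.
Qed.

Lemma gauss_same_law_integral d1 (T1 : measurableType d1) I (X : I -> T1 -> R) (Y Z : T -> T1) :
  generating X -> (forall i, V (fun x => X i (Y x))) -> (forall i, V (fun x => X i (Z x))) ->
  (forall i j, ip P (fun x => X i (Y x)) (fun x => X j (Y x))
             = ip P (fun x => X i (Z x)) (fun x => X j (Z x))) ->
  forall f : T1 -> \bar R, measurable_fun setT f -> (forall z, 0 <= f z)%E ->
  (\int[P]_x f (Y x) = \int[P]_x f (Z x))%E.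
Proof.
move=> gX VY VZ' cov f mf f0.
have mY := class_measurable VG gX VY; have mZ := class_measurable VG gX VZ'.
rewrite -(ge0_integral_law P mY mf f0) -(ge0_integral_law P mZ mf f0).
apply: eq_measure_integral => A mA _.
exact: (gauss_same_law V0 VG VD VZ gX VY VZ' cov mA).
Qed.

Lemma combo_real (l : seq (unit * R)) :
  combo (fun (_ : unit) (x : R) => x) l = fun x => (\sum_(p <- l) p.2) * x.
Proof. by apply/funext => x; rewrite /combo mulr_suml. Qed.

Lemma gauss_normal_law (h : T -> R) (v : R) (mh : measurable_fun setT h) : V h -> msq P h = v -> 0 < v ->
  forall A, measurable A -> law P mh A = normal_prob 0 (Num.sqrt v) A.
Proof.
move=> Vh hv v0 A mA; set s := Num.sqrt v.
have s0 : s != 0 by rewrite gt_eqF// sqrtr_gt0.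
have mid : measurable_fun setT (fun x : measurableTypeR R => (x : R)) by move=> _ B mB; rewrite setTI.
pose N : probability R R := law (normal_prob 0 s) mid.
have hN B : measurable B -> N B = normal_prob 0 s B by [].
rewrite -(hN A mA); apply: (eq_law (@generating_id R)) mA => l; rewrite combo_real.
- set t := \sum_(p <- l) p.2.
  have mc : measurable_fun setT (fun x : R => cos (t * x)).
    by apply: (measurableT_comp (@measurable_cos R)); exact: measurable_funM.
  rewrite (Rintegral_law P mh mc (M := 1)); last by move=> ?; exact: norm_cos_le1.
  rewrite (Rintegral_normal_prob s0 hN mc); last by move=> ?; exact: norm_cos_le1.
  have [_ c _] := VG (VZ t Vh); rewrite [LHS]c msqZ; last by case: (VG Vh).
  rewrite hv; have := normal_cosE s0 t; rewrite /normal_cos => ->.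
  by congr (expR (- _ / 2)); rewrite mulrC; congr (_ * _); rewrite /s [RHS]sqr_sqrtr// ltW.
- set t := \sum_(p <- l) p.2.
  have mc : measurable_fun setT (fun x : R => sin (t * x)).
    by apply: (measurableT_comp (@measurable_sin R)); exact: measurable_funM.
  rewrite (Rintegral_law P mh mc (M := 1)); last by move=> ?; exact: norm_sin_le1.
  rewrite (Rintegral_normal_prob s0 hN mc); last by move=> ?; exact: norm_sin_le1.
  have [_ _ c] := VG (VZ t Vh); rewrite [LHS]c.
  by rewrite -[LHS](normal_sin_eq0 s0 t).
Qed.

Definition normal_density d (v : 'I_d -> R) (z : 'rV[R]_d) : R :=
  \prod_j normal_pdf 0 (Num.sqrt (v j)) (z 0 j).

Lemma normal_density_ge0 d (v : 'I_d -> R) z : 0 <= normal_density v z.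
Proof. by apply: prodr_ge0 => j _; exact: normal_pdf_ge0. Qed.

Lemma C1_normal_density d (v : 'I_d -> R) : (forall j, 0 < v j) -> C1 (normal_density v).
Proof.
move=> v0; apply: C1_prod => j.
have s0 : Num.sqrt (v j) != 0 by rewrite gt_eqF// sqrtr_gt0.
set s := Num.sqrt (v j) in s0 *.
pose h' (x : R) := normal_peak s * (expR (- x ^+ 2 / (s ^+ 2 *+ 2)) * (- (2 * x) / (s ^+ 2 *+ 2))).
have dh (x : R) : is_derive x 1 (normal_pdf 0 s) (h' x).
  have -> : normal_pdf 0 s = fun x : R => normal_peak s * expR (- x ^+ 2 / (s ^+ 2 *+ 2)).
    by apply/funext => y; rewrite normal_pdfE// /normal_fun subr0.
  apply: is_derive_eq.
  by rewrite /h' /GRing.scale/=; ring.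
have ch : continuous h'.
  move=> x; apply: cvgM; first exact: cvg_cst.
  have h1 : continuous (fun x : R => - x ^+ 2 / (s ^+ 2 *+ 2)).
    by move=> y; apply: cvgM; [apply: cvgN; exact: exprn_continuous|exact: cvg_cst].
  apply: cvgM; first exact: cvg_comp (h1 x) (@continuous_expR R _).
  by apply: cvgM; [apply: cvgN; apply: cvgM; [exact: cvg_cst|exact: cvg_id]|exact: cvg_cst].
exact: (C1_comp_real dh ch (@C1_coordinate R d j)).
Qed.

(** Induction on the dimension: the first coordinate is uncorrelated with the others, hence
    independent of them, and Lebesgue measure on row vectors is built by the same splitting. *)
Lemma gauss_normal_density d (h : T -> 'rV[R]_d) (v : 'I_d -> R) :
  (forall j, V (fun x => h x 0 j)) ->
  (forall i j, ip P (fun x => h x 0 i) (fun x => h x 0 j) = (i == j)%:R * v j) ->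
  (forall j, 0 < v j) ->
  forall f : 'rV[R]_d -> \bar R, measurable_fun setT f -> (forall z, 0 <= f z)%E ->
  (\int[P]_x f (h x) = \int[lebesgue_rV R d]_z (f z * (normal_density v z)%:E))%E.
Proof.
elim: d h v => [|d IH] h v Vh cov v0 f mf f0.
  rewrite (_ : (fun x => f (h x)) = cst (f 0%R)); last first.
    by apply/funext => x; rewrite (thinmx0 (h x)).
  rewrite integral_cst//.
  rewrite [X in (_ * X)%E](@probability_setT _ _ _ P) mule1.
  rewrite (_ : lebesgue_rV R 0 = dirac (0 : 'rV[R]_0))//.
  under eq_integral do rewrite /normal_density big_ord0 mule1.
  by rewrite integral_dirac// diracT mul1e.
have vS := v0 ord0.
have V1 : V (fun x => h x 0 ord0) := Vh ord0.
have m1 : msq P (fun x => h x 0 ord0) = v ord0 by rewrite /msq cov eqxx mul1r.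
have mh0 : measurable_fun setT (fun x => h x 0 ord0) by case: (VG V1) => -[].
have s0 : Num.sqrt (v ord0) != 0 by rewrite gt_eqF// sqrtr_gt0.
pose v' j := v (lift ord0 j).
have Vt j : V (fun x => tailr (h x) 0 j).
  by have -> : (fun x => tailr (h x) 0 j) = fun x => h x 0 (lift ord0 j)
    by apply/funext => x; rewrite mxE.
have E := IH (fun x => tailr (h x)) v' Vt.
have mfc : measurable_fun setT (fun p : R * 'rV[R]_d => f (consr p)).
  by apply: (measurableT_comp mf); exact: measurable_consr.
have -> : (\int[P]_x f (h x) = \int[P]_x f (consr (h x 0%R ord0, tailr (h x))))%E.
  by apply: eq_integral => x _; rewrite tailrK.
have unc (i : unit) (j : 'I_d) :
    ip P (fun x => h x 0 ord0) (fun x => tailr (h x) 0 j) = 0.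
  rewrite (_ : (fun x => tailr (h x) 0 j) = fun x => h x 0 (lift ord0 j)); last first.
    by apply/funext => x; rewrite mxE.
  by rewrite cov mul0r.
rewrite (gauss_independence_integral (@generating_id R) (@generating_rV R d)
  (Y := fun x => h x 0 ord0) (Z := fun x => tailr (h x)) (fun=> V1) Vt unc mfc (fun p => f0 _)).
have mnd : measurable_fun setT (normal_density v').
  by apply: measurable_continuous_rV; apply: C1_continuous; apply: C1_normal_density => j; exact: v0.
pose F (p : R * 'rV[R]_d) := (f (consr p) * (normal_density v' p.2)%:E)%E.
have mF : measurable_fun setT F.
  apply: emeasurable_funM => //; apply/measurable_EFinP.
  by apply: (measurableT_comp mnd).
have F0 p : (0 <= F p)%E by rewrite mule_ge0// lee_fin normal_density_ge0.
pose G (a : R) : \bar R := (\int[lebesgue_rV R d]_z F (a, z))%E.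
have G0 a : (0 <= G a)%E by apply: integral_ge0 => z _; exact: F0.
have mG : measurable_fun setT G := @measurable_fun_fubini_tonelli_F _ _ _ _ _ (lebesgue_rV R d) F mF F0.
have cov' i j : ip P (fun x => tailr (h x) 0 i) (fun x => tailr (h x) 0 j) = (i == j)%:R * v' j.
  have tE k : (fun x => tailr (h x) 0 k) = fun x => h x 0 (lift ord0 k).
    by apply/funext => x; rewrite mxE.
  by rewrite !tE cov (inj_eq lift_inj).
transitivity (\int[P]_x G (h x 0%R ord0))%E.
  apply: eq_integral => x _.
  apply: (E cov' (fun j => v0 _) (fun z => f (consr (h x 0 ord0, z)))).
    by apply: (measurableT_comp mfc); exact: measurable_fun_pair.
  by move=> z; exact: f0.
rewrite -(ge0_integral_law P mh0 mG G0).
rewrite (ge0_integral_normal_prob (gauss_normal_law mh0 V1 m1 vS) mG G0).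
have mndv : measurable_fun setT (normal_density v).
  by apply: measurable_continuous_rV; apply: C1_continuous; exact: C1_normal_density.
have mH : measurable_fun setT (fun z => f z * (normal_density v z)%:E)%E.
  by apply: emeasurable_funM => //; exact/measurable_EFinP.
have H0 z : (0 <= f z * (normal_density v z)%:E)%E by rewrite mule_ge0// lee_fin normal_density_ge0.
rewrite (ge0_integral_lebesgue_rVS mH H0).
have mHc : measurable_fun setT (fun p : measurableTypeR R * 'rV[R]_d =>
    (f (consr p) * (normal_density v (consr p))%:E)%E).
  by apply: (measurableT_comp mH); exact: measurable_consr.
rewrite (@fubini_tonelli1 _ _ _ _ _ (@lebesgue_measure R) (lebesgue_rV R d) _ mHc (fun p => H0 _)).
apply: eq_integral => a _; rewrite /fubini_F /=.
have mFa : measurable_fun setT (fun z => F (a, z)) by apply: (measurableT_comp mF); exact: measurable_fun_pair.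
rewrite muleC /G -(ge0_integralZl _ measurableT mFa (fun z _ => F0 (a, z))); last first.
  by rewrite lee_fin normal_pdf_ge0.
apply: eq_integral => z _; rewrite /F /normal_density big_ord_recl consr0 EFinM /=.
rewrite muleCA; congr (_ * (_ * _%:E))%E.
by apply: eq_bigr => j _; rewrite consrS.
Qed.

End gaussian_expectations.

(** * Mean-square closures of classes of variables *)

Section l2_closure.
Context (R : realType) dT (T : measurableType dT) (P : probability T R).
Implicit Types (f g h : T -> R) (A B : (T -> R) -> Prop).

(** Predictors, innovations and the smoothing variable are only limits of linear functionals; the
    closure keeps the algebra, the Gaussian property and the orthogonality relations of the original
    class. *)
Definition l2closure A f : Prop :=
  sqint P f /\ forall e : R, 0 < e -> exists h, A h /\ msq P (fun x => f x - h x) < e.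

Lemma msq_sym f g : msq P (fun x => f x - g x) = msq P (fun x => g x - f x).
Proof. by apply: eq_Rintegral => x _; rewrite -mulrNN !opprB. Qed.

Section one_class.
Variable A : (T -> R) -> Prop.
Hypothesis hA : forall f, A f -> sqint P f.

Lemma l2closure_sub f : A f -> l2closure A f.
Proof.
move=> Af; split => [|e e0]; first exact: hA.
exists f; split => //; rewrite (_ : (fun x => f x - f x) = fun _ => 0); last first.
  by apply/funext => x; rewrite subrr.
by rewrite /msq ip0l.
Qed.

Lemma l2closure_seq f : l2closure A f ->
  exists U : nat -> T -> R, (forall k, A (U k)) /\ l2cvg P U f.
Proof.
move=> [sf hf]; have e0 (k : nat) : 0 < 2^-1 ^+ k :> R by rewrite exprn_gt0// invr_gt0.
have [U hU] := choice (fun k => hf _ (e0 k)).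
exists U; split => [k|]; first by have [] := hU k.
apply: (@cvg_dominated _ _ (fun k => 1 * 2^-1 ^+ k)) => [k|].
  rewrite subr0 mul1r ger0_norm ?msq_ge0// msq_sym; by have [_ /ltW] := hU k.
by apply: cvg_geometric_decay; apply/andP; split; [rewrite invr_ge0|rewrite invf_lt1// ltr1n].
Qed.

Lemma l2closure_lim (U : nat -> T -> R) f : sqint P f -> (forall k, l2closure A (U k)) ->
  l2cvg P U f -> l2closure A f.
Proof.
move=> sf hU c; split => // e e0; have e4 : 0 < e / 4 by rewrite divr_gt0.
have /cvgrPdist_lt/(_ _ e4)[n _ /(_ n (leqnn n))] := c.
rewrite sub0r normrN ger0_norm ?msq_ge0// => hn.
have [h [Ah hh]] := (hU n).2 _ e4; exists h; split => //.
have := msqD_le (sqintB sf (hU n).1) (sqintB (hU n).1 (hA Ah)).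
rewrite (_ : (fun x => f x - U n x + (U n x - h x)) = fun x => f x - h x); last first.
  by apply/funext => x; rewrite addrA subrK.
rewrite (msq_sym f (U n)); move: hn hh; move: (msq _ _) (msq _ _) (msq _ _) => a b c' ? ? ?; lra.
Qed.

Lemma l2closureD f g : (forall f g, A f -> A g -> A (fun x => f x + g x)) ->
  l2closure A f -> l2closure A g -> l2closure A (fun x => f x + g x).
Proof.
move=> AD cf cg; have [U [AU cU]] := l2closure_seq cf; have [U' [AU' cU']] := l2closure_seq cg.
apply: (@l2closure_lim (fun k x => U k x + U' k x)).
- exact: sqintD cf.1 cg.1.
- by move=> k; apply: l2closure_sub; exact: AD.
- exact: (l2cvgD (fun k => hA (AU k)) (fun k => hA (AU' k)) cf.1 cg.1 cU cU').
Qed.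

Lemma l2closureZ (a : R) f : (forall f, A f -> A (fun x => a * f x)) ->
  l2closure A f -> l2closure A (fun x => a * f x).
Proof.
move=> AZ cf; have [U [AU cU]] := l2closure_seq cf.
apply: (@l2closure_lim (fun k x => a * U k x)).
- exact: sqintZ cf.1.
- by move=> k; apply: l2closure_sub; exact: AZ.
- exact: (l2cvgZ a (fun k => hA (AU k)) cf.1 cU).
Qed.

Lemma l2closure_gauss f : (forall f, A f -> gauss P f) -> l2closure A f -> gauss P f.
Proof.
move=> AG cf; have [U [AU cU]] := l2closure_seq cf.
exact: (gauss_l2cvg (fun k => AG _ (AU k)) cf.1 cU).
Qed.

End one_class.

Lemma l2closure_mono A B f : (forall f, A f -> B f) -> l2closure A f -> l2closure B f.
Proof. by move=> AB [sf hf]; split => // e /hf[h [/AB Bh ?]]; exists h. Qed.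

Lemma l2closure_orth A B f g : (forall f, A f -> sqint P f) -> (forall f, B f -> sqint P f) ->
  (forall f g, A f -> B g -> ip P f g = 0) -> l2closure A f -> l2closure B g -> ip P f g = 0.
Proof.
move=> hA hB AB cf cg; have [U [AU cU]] := l2closure_seq cf; have [U' [AU' cU']] := l2closure_seq cg.
have := ip_cvg (fun k => hA _ (AU k)) (fun k => hB _ (AU' k)) cf.1 cg.1 cU cU'.
rewrite (_ : (fun k => ip P (U k) (U' k)) = fun _ => 0); last by apply/funext => k; exact: AB.
by move=> c; exact: (cvg_unique _ c (cvg_cst (0 : R))).
Qed.

End l2_closure.

(** * The noise as a predicted Gaussian sequence *)

Lemma measurable_cvg_lims (R : realType) d (T : measurableType d) (U : nat -> T -> R) :
  (forall k, measurable_fun setT (U k)) ->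
  measurable [set x | (fun k => U k x) @ \oo --> lims (fun k => U k x)].
Proof.
move=> mU; have ml : measurable_fun setT (fun x => lims (fun k => U k x)) by exact: measurable_lims.
have -> : [set x | (fun k => U k x) @ \oo --> lims (fun k => U k x)] =
    \bigcap_(m in [set: nat]) \bigcup_(N in [set: nat]) \bigcap_(k in [set: nat])
      [set x | (N <= k)%N -> `|lims (fun k => U k x) - U k x| <= m.+1%:R^-1].
  apply/seteqP; split => [x /= /cvgrPdist_le h m _|x /= h].
    have e0 : 0 < m.+1%:R^-1 :> R by rewrite invr_gt0.
    by have [N _ hN] := h _ e0; exists N => // k _ /= Nk; exact: hN.
  apply/cvgrPdist_le => e e0; have [m hm] : exists m : nat, m.+1%:R^-1 < e.
    by have [m _ hm] := near_infty_natSinv_lt (PosNum e0); exists m; apply: hm => /=.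
  have [N _ hN] := h m Logic.I; exists N => // k /= Nk.
  by apply: le_trans (ltW hm); exact: (hN k Logic.I Nk).
apply: bigcapT_measurable => m; apply: bigcupT_measurable => N; apply: bigcapT_measurable => k.
have [Nk|/negbTE Nk] := boolP (N <= k)%N; last first.
  by rewrite (_ : [set _ | _] = setT)//; apply/seteqP; split.
have mh : measurable_fun setT (fun x => `|lims (fun k => U k x) - U k x|).
  by apply: measurableT_comp => //; exact: measurable_funB.
rewrite (_ : [set _ | _] = setT `&` (fun x => `|lims (fun k => U k x) - U k x|) @^-1` `]-oo, m.+1%:R^-1]).
  by apply: mh => //; exact: measurable_itv.
by apply/seteqP; split => x /=; rewrite in_itv/=; [move=> h; split => //; exact: h|move=> [_ h] _].
Qed.

Section noise_model.
Context (R : realType) (d : nat).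
Local Notation W := (seqs 'rV[R]_d).

Definition had (a v : 'rV[R]_d) : 'rV[R]_d := \row_j (a 0 j * v 0 j).

Lemma hadE a v j : had a v 0 j = a 0 j * v 0 j.
Proof. by rewrite mxE. Qed.

Definition perturb (k : nat) (v : 'rV[R]_d) (w : W) : W := fun i => w i + (if i == k then v else 0).

Definition innov (m : W -> 'rV[R]_d) (k : nat) (w : W) : 'rV[R]_d :=
  w k - m (iter k.+1 (@past R d) w).

(** The first k innovations, padded with zeros to remain in the space of sequences. *)
Definition innov_before (m : W -> 'rV[R]_d) (k : nat) (w : W) : W :=
  fun i => if (i < k)%N then innov m i w else 0.

(* If Z perturbs the noise xi_i by [inverse_coef c i * Z] for every i, the increments
   c_k * Z that the perturbed w_1 causes in later predictions are compensated. *)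
Definition inverse_coef (c : nat -> 'rV[R]_d) (i : nat) : 'rV[R]_d :=
  if i is i'.+1 then - c i' else const_mx 1.

Definition residual (m : W -> 'rV[R]_d) (c : nat -> 'rV[R]_d) (Z : W -> 'rV[R]_d) (w : W) : W :=
  fun i => innov m i w - had (inverse_coef c i) (Z w).

(** All that the Markov process and the coupling use of the noise. [nm_past] yields the conditional
    law, [nm_before] the Markov property, and [nm_residual] says that the residual noise is
    independent of [Z], which has density [g]; [nm_perturb] makes the predictor exactly affine in
    each coordinate on [G]. *)
Record noise_model (P : probability W R) (m : W -> 'rV[R]_d) (G : set W) (c : nat -> 'rV[R]_d)
    (Z : W -> 'rV[R]_d) (g : 'rV[R]_d -> R) : Prop := NoiseModel {
  nm_pred : measurable_fun setT m;
  nm_smoothing : measurable_fun setT Z;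
  nm_good : measurable G;
  nm_good_ae : {ae P, forall w, G w};
  nm_good_append : forall w u, G w -> G (append w u);
  nm_perturb : forall k v w, G w -> m (perturb k v w) = m w + had (c k) v;
  nm_past : forall f : W * 'rV[R]_d -> \bar R, measurable_fun setT f -> (forall z, 0 <= f z)%E ->
    (\int[P]_w f (past w, innov m 0 w) = \int[P]_w \int[P]_w' f (past w, innov m 0 w'))%E;
  nm_before : forall k (f : W * 'rV[R]_d -> \bar R), measurable_fun setT f ->
    (forall z, 0 <= f z)%E ->
    (\int[P]_w f (innov_before m k w, innov m k w)
     = \int[P]_w \int[P]_w' f (innov_before m k w, innov m 0 w'))%E;
  nm_residual : forall f : W * 'rV[R]_d -> \bar R, measurable_fun setT f ->
    (forall z, 0 <= f z)%E ->
    (\int[P]_w f (residual m c Z w, Z w)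
     = \int[P]_w \int[lebesgue_rV R d]_z (f (residual m c Z w, z) * (g z)%:E))%E;
  nm_density_C1 : C1 g;
  nm_density_ge0 : forall z, 0 <= g z;
  nm_density_integrable : (lebesgue_rV R d).-integrable setT (EFin \o g) }.

Lemma measurable_past : measurable_fun setT (@past R d).
Proof. by apply: measurable_seqs => k; exact: measurable_proj. Qed.

Lemma measurable_iter_past k : measurable_fun setT (iter k (@past R d)).
Proof.
elim: k => [|k IH]; first exact: measurable_id.
exact: (measurableT_comp measurable_past IH).
Qed.

Lemma lin_perturb p j k v w : lin p j (perturb k v w) = lin p j w + p`_k * v 0 j.
Proof.
have pN : (size p <= maxn (size p) k.+1)%N by rewrite leq_maxl.
rewrite !(lin_widen _ _ pN).
under eq_bigr do rewrite /perturb mxE mulrDr.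
rewrite big_split/=; congr (_ + _).
have kN : (k < maxn (size p) k.+1)%N by rewrite leq_maxr.
rewrite (bigD1 (Ordinal kN))//= eqxx big1 ?addr0// => i ik.
have -> : ((i : nat) == k) = false by apply/negP => /eqP e; case/negP: ik; apply/eqP/val_inj.
by rewrite mxE mulr0.
Qed.

Lemma measurable_innov (m : W -> 'rV[R]_d) k :
  measurable_fun setT m -> measurable_fun setT (innov m k).
Proof.
move=> mm; apply: measurable_rV => j.
rewrite (_ : (fun w => innov m k w 0 j) = fun w => w k 0 j - m (iter k.+1 (@past R d) w) 0 j).
  apply: measurable_funB; first exact: measurable_coordinate.
  apply: (measurableT_comp (measurable_coord j)).
  exact: (measurableT_comp mm (measurable_iter_past k.+1)).
by apply/funext => w; rewrite /innov !mxE.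
Qed.

Section construction.
Variable P : probability W R.
Hypothesis hP : centred_gaussian P.
Variable mu : 'I_d -> {finite_measure set R -> \bar R}.
Hypothesis hmu : has_spectral_measures P mu.
Variable K : 'I_d -> R.
Hypothesis hK : forall j (r : {poly R}) i, r`_i ^+ 2 <= K j * msq P (lin r j).
Variables (s2 : 'I_d -> R) (p : 'I_d -> nat -> {poly R}).
Hypothesis hmin : forall j r, s2 j <= msq P (lin (1 - 'X * r) j).
Hypothesis hp : forall j k, msq P (lin (1 - 'X * p j k) j) <= s2 j + 8^-1 ^+ k.

Definition mean (w : W) : 'rV[R]_d := \row_j predictor j (p j) w.
Definition coef (k : nat) : 'rV[R]_d := \row_j pcoef (p j) k.
(** Convergence for every number i of dropped coefficients, and not only for the predictors
    themselves (i = 0): appending a coordinate turns the condition for i into the one for i + 1, so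
    the whole family is stable under [append]. *)
Definition good : set W := \bigcap_(i in [set: nat]) \bigcap_(j in [set: 'I_d])
  [set w | (fun k => lin (drop_poly i (p j k)) j w) @ \oo --> lims (fun k => lin (drop_poly i (p j k)) j w)].

Lemma measurable_mean : measurable_fun setT mean.
Proof.
apply: measurable_rV => j; under eq_fun do rewrite mxE.
by apply: measurable_lims => k; exact: measurable_lin.
Qed.

Lemma measurable_good : measurable good.
Proof.
apply: bigcapT_measurable => i.
apply: fin_bigcap_measurable => // j _.
by apply: measurable_cvg_lims => k; exact: measurable_lin.
Qed.

Lemma good_ae : {ae P, forall w, good w}.
Proof.
have h i j := let: And3 _ _ h := drop_fast hP hmu (hK j) (hmin j) (hp j) i in h.
have : {ae P, forall w, forall i : nat, forall j : 'I_d,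
    (fun k => lin (drop_poly i (p j k)) j w) @ \oo --> lims (fun k => lin (drop_poly i (p j k)) j w)}.
  apply: ae_foralln => i.
  by apply: filter_forall => j; exact: h.
by apply: filterS => w hw i _ j _; exact: hw.
Qed.

Lemma good_append w u : good w -> good (append w u).
Proof.
move=> Gw i _ j _ /=.
have -> : (fun k => lin (drop_poly i (p j k)) j (append w u)) =
    fun k => (p j k)`_i * u 0 j + lin (drop_poly i.+1 (p j k)) j w.
  apply/funext => k; rewrite lin_append coef_drop_poly add0n; congr (_ + lin _ _ _).
  by apply/polyP => a; rewrite !coef_drop_poly addn1 addSnnS.
have c : (fun k => (p j k)`_i * u 0 j + lin (drop_poly i.+1 (p j k)) j w) @ \oo -->
    pcoef (p j) i * u 0 j + lims (fun k => lin (drop_poly i.+1 (p j k)) j w).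
  apply: cvgD; last exact: (Gw i.+1 Logic.I j Logic.I).
  by apply: cvgM; [exact: (pcoef_cvg hP hmu (hK j) (hmin j) (hp j))|exact: cvg_cst].
by rewrite (cvg_lims c).
Qed.

Lemma mean_perturb k v w : good w -> mean (perturb k v w) = mean w + had (coef k) v.
Proof.
move=> Gw; apply/rowP => j; rewrite !mxE /predictor.
have d0 r : drop_poly 0 r = r :> {poly R} by apply/polyP => a; rewrite coef_drop_poly addn0.
have c0 := Gw 0%N Logic.I j Logic.I; rewrite /= in c0.
have dE : (fun k0 => lin (drop_poly 0 (p j k0)) j w) = fun k0 => lin (p j k0) j w.
  by apply/funext => k0; rewrite d0.
rewrite dE in c0; apply: cvg_lims.
under eq_fun do rewrite lin_perturb.
apply: cvgD; first exact: c0.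
by apply: cvgM; [exact: (pcoef_cvg hP hmu (hK j) (hmin j) (hp j))|exact: cvg_cst].
Qed.

(** The closure of [A] is the Gaussian space of the whole noise. [Aj j] keeps track of a single
    component, since distinct components are orthogonal. *)
Let A (f : W -> R) := exists pp, f = vlin pp.
Let Aj (j : 'I_d) (f : W -> R) := exists r, f = lin r j.
Let V := l2closure P A.

Let sA f : A f -> sqint P f. Proof. by move=> [pp ->]; case: (gauss_vlin hP pp). Qed.
Let sAj j f : Aj j f -> sqint P f. Proof. by move=> [r ->]; exact: sqint_lin. Qed.
Let AjA j f : Aj j f -> A f. Proof. by move=> [r ->]; eexists; exact: lin_vlin. Qed.

Let AD f g : A f -> A g -> A (fun x => f x + g x).
Proof.
move=> [pp ->] [qq ->]; exists (fun j => pp j + qq j); apply/funext => w.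
by rewrite /vlin -big_split/=; apply: eq_bigr => j _; rewrite linD.
Qed.

Let AZ (a : R) f : A f -> A (fun x => a * f x).
Proof.
move=> [pp ->]; exists (fun j => a *: pp j); apply/funext => w.
by rewrite /vlin mulr_sumr; apply: eq_bigr => j _; rewrite linZ.
Qed.

Let AjZ j (a : R) f : Aj j f -> Aj j (fun x => a * f x).
Proof. by move=> [r ->]; exists (a *: r); apply/funext => w; rewrite linZ. Qed.

Let AjD j f g : Aj j f -> Aj j g -> Aj j (fun x => f x + g x).
Proof. by move=> [r ->] [r' ->]; exists (r + r'); apply/funext => w; rewrite linD. Qed.

Let VG f : V f -> gauss P f.
Proof. by apply: l2closure_gauss => // g [pp ->]; exact: gauss_vlin. Qed.
Let VD f g : V f -> V g -> V (fun x => f x + g x).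
Proof. by move=> cf cg; apply: l2closureD. Qed.
Let VZ (a : R) f : V f -> V (fun x => a * f x).
Proof. by move=> cf; apply: l2closureZ => // g; exact: AZ. Qed.
Let V0 : V (fun _ => 0).
Proof.
apply: l2closure_sub => //; exists (fun _ => 0); apply/funext => w.
by rewrite /vlin big1// => j _; rewrite /lin size_poly0 big_ord0.
Qed.
Let VjV j f : l2closure P (Aj j) f -> V f.
Proof. by apply: l2closure_mono => g; exact: AjA. Qed.

Let orth i j f g : i != j -> l2closure P (Aj i) f -> l2closure P (Aj j) g -> ip P f g = 0.
Proof.
move=> ij; apply: l2closure_orth => [u|u|u v [r ->] [r' ->]].
- exact: sAj.
- exact: sAj.
- exact: (covariance_cross hP hmu).
Qed.

Let Vcoord k j : l2closure P (Aj j) (fun w => w k 0 j).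
Proof.
by apply: l2closure_sub => [f|]; [exact: sAj|exists 'X^k; apply/funext => w; rewrite linXn].
Qed.

Let Vinn k j : l2closure P (Aj j) (innovation j (p j) k).
Proof.
have [h1 h2] := innovation_limit hP hmu (hmin j) (hp j) k.
apply: (l2closure_lim (@sAj j) h1 _ h2) => i.
by apply: l2closure_sub => [f|]; [exact: sAj|eexists].
Qed.

Lemma innovE k w j : innov mean k w 0 j = innovation j (p j) k w.
Proof. by rewrite !mxE. Qed.

Let inn_cov k l i j : ip P (fun w => innov mean k w 0 i) (fun w => innov mean l w 0 j)
  = (i == j)%:R * ((k == l)%:R * s2 i).
Proof.
under [X in ip P X _]eq_fun do rewrite innovE.
under [X in ip P _ X]eq_fun do rewrite innovE.
have [<-|ij] := eqVneq i j.
  by rewrite mul1r (innovation_white hP hmu (hmin i) (hp i)).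
by rewrite mul0r; exact: orth ij (Vinn _ _) (Vinn _ _).
Qed.

Lemma noise_construction : exists (Z : W -> 'rV[R]_d) (g : 'rV[R]_d -> R),
  noise_model P mean good coef Z g.
Proof.
have B0 j : 0 < binf (p j) by exact: (binf_gt0 hP hmu (hK j) (hmin j) (hp j)).
have s20 j : 0 < s2 j by exact: (innovation_variance_gt0 (hK j) (hp j)).
have [Zc hZc] := choice (fun j => smoothing_variable hP hmu (hK j) (hmin j) (hp j)).
have VZc j : l2closure P (Aj j) (Zc j).
  have [h1 _ _ [U [N [h2 h3]]]] := hZc j.
  apply: (l2closure_lim (@sAj j) h1 _ h2) => k; rewrite h3.
  elim: (index_enum _) => [|i s IH].
    under eq_fun do rewrite big_nil; apply: l2closure_sub => [f|]; first exact: sAj.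
    by exists 0; apply/funext => w; rewrite /lin size_poly0 big_ord0.
  under eq_fun do rewrite big_cons.
  apply: (l2closureD (@sAj j) (@AjD j) _ IH).
  by apply: (l2closureZ (@sAj j)) => [g|]; [exact: AjZ|exact: Vinn].
pose v j := s2 j / binf (p j).
have v0 j : 0 < v j by rewrite divr_gt0.
pose Z w : 'rV[R]_d := \row_j Zc j w.
have ZE j : (fun w => Z w 0 j) = Zc j by apply/funext => w; rewrite mxE.
have VZj j : V (fun w => Z w 0 j) by rewrite ZE; exact: VjV (VZc j).
have iE k j : (fun w => innov mean k w 0 j) = innovation j (p j) k by apply/funext => w; exact: innovE.
have bE i j : inverse_coef coef i 0 j = bcoef (p j) i by case: i => [|i]; rewrite /= !mxE.
have rE i j : (fun w => residual mean coef Z w i 0 j)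
    = fun w => innovation j (p j) i w + (- bcoef (p j) i) * Zc j w.
  have mB (u1 u2 : 'rV[R]_d) : (u1 - u2) 0 j = u1 0 j - u2 0 j by rewrite !mxE.
  by apply/funext => w; rewrite /residual mB innovE hadE bE -ZE mulNr.
have Vres i j : l2closure P (Aj j) (fun w => residual mean coef Z w i 0 j).
  rewrite rE; apply: (l2closureD (@sAj j) (@AjD j) (Vinn _ _)).
  by apply: (l2closureZ (@sAj j)) => [g|]; [exact: AjZ|exact: VZc].
exists Z, (normal_density v).
have covZ i j : ip P (fun w => Z w 0 i) (fun w => Z w 0 j) = (i == j)%:R * v j.
  rewrite !ZE; have [<-|ij] := eqVneq i j.
    by rewrite mul1r; have [_ _ h _] := hZc i.
  by rewrite mul0r; exact: orth ij (VZc _) (VZc _).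
have mZ : measurable_fun setT Z by apply: (class_measurable VG (@generating_rV R d)).
have Vi k j : V (fun w => innov mean k w 0 j) by rewrite iE; exact: VjV (Vinn k j).
have gs := generating_seqs (@generating_rV R d).
split.
- exact: measurable_mean.
- exact: mZ.
- exact: measurable_good.
- exact: good_ae.
- exact: good_append.
- exact: mean_perturb.
- apply: (gauss_independence_integral V0 VG VD VZ gs (@generating_rV R d)).
  + by move=> [k j]/=; exact: VjV (Vcoord k.+1 j).
  + by move=> j; exact: Vi.
  + move=> [k i] j /=; rewrite iE; have [<-|ij] := eqVneq i j.
      rewrite ipC (_ : (fun w : W => past w k 0 i) = lin 'X^(k.+1) i); last first.
        by apply/funext => w; rewrite linXn.
      exact: (innovation_future hP hmu (hmin i) (hp i)).
    exact: orth ij (Vcoord k.+1 i) (Vinn _ _).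
- move=> k f mf f0.
  have Vb (i : nat * 'I_d) : V (fun w => innov_before mean k w i.1 0 i.2).
    rewrite /innov_before; case: (i.1 < k)%N; first exact: Vi.
    by under eq_fun do rewrite mxE.
  rewrite (gauss_independence_integral V0 VG VD VZ gs (@generating_rV R d) Vb (Vi k) _ mf f0).
    (* Innovations have the same covariances at all indices, so the k-th one may be replaced by the
       zeroth in the inner integral. *)
    apply: eq_integral => w _.
    apply: (gauss_same_law_integral V0 VG VD VZ (@generating_rV R d) (Vi k) (Vi 0%N) _ (f := fun z => f (_, z))).
    + by move=> i j; rewrite !inn_cov !eqxx.
    + by apply: (measurableT_comp mf); exact: measurable_fun_pair.
    + by move=> z; exact: f0.
  move=> [i l] j /=; rewrite /innov_before; have [ik|ik] := boolP (i < k)%N.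
    by rewrite inn_cov (ltn_eqF ik) mul0r mulr0.
  under [X in ip P X _]eq_fun do rewrite mxE.
  exact: ip0l.
- move=> f mf f0.
  have Vr (i : nat * 'I_d) : V (fun w => residual mean coef Z w i.1 0 i.2) by exact: VjV (Vres _ _).
  rewrite (gauss_independence_integral V0 VG VD VZ gs (@generating_rV R d) Vr VZj _ mf f0).
    apply: eq_integral => w _.
    apply: (gauss_normal_density V0 VG VD VZ VZj covZ v0 (f := fun z => f (_, z))).
    + by apply: (measurableT_comp mf); exact: measurable_fun_pair.
    + by move=> z; exact: f0.
  move=> [i l] j /=; rewrite ZE; have [<-|ij] := eqVneq l j; last first.
    exact: orth ij (Vres i l) (VZc j).
  have [hz hzi hzz _] := hZc l.
  (* The covariance of an innovation with Z is b_i times the variance of Z, which cancels the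
     subtracted term. *)
  rewrite rE (ipDl (Vinn i l).1 (sqintZ _ hz) hz) (ipZl _ hz hz) ipC hzi.
  by rewrite -/(msq P (Zc l)) hzz mulrC mulNr subrr.
- exact: C1_normal_density.
- exact: normal_density_ge0.
- have mg : measurable_fun setT (normal_density v).
    by apply: measurable_continuous_rV; apply: C1_continuous; exact: C1_normal_density.
  apply/integrableP; split; first exact/measurable_EFinP.
  (* The identity for the constant function 1 gives the total mass of the density. *)
  have := gauss_normal_density V0 VG VD VZ VZj covZ v0 (@measurable_cst _ _ _ _ setT 1%E) (fun _ => lee01).
  under [X in _ = X -> _]eq_integral do rewrite mul1e.
  rewrite integral_cst// mul1e [X in X = _](@probability_setT _ _ _ P) => h.
  under eq_integral do rewrite /= ger0_norm ?normal_density_ge0//.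
  by rewrite -h ltry.
Qed.

End construction.

Lemma gaussian_noise_model (P : probability W R) (mu : 'I_d -> {finite_measure set R -> \bar R})
    (f : 'I_d -> R -> R) : centred_gaussian P -> has_spectral_measures P mu ->
  (forall j, ac_density (mu j) (f j)) ->
  (forall j, {ae @lebesgue_measure R, forall x, `[- pi, pi]%classic x -> 0 < f j x}) ->
  (forall j, (\int[@lebesgue_measure R]_(x in `[(- pi)%R, pi]) ((f j x)^-1)%:E < +oo)%E) ->
  exists m G c Z g, noise_model P m G c Z g.
Proof.
move=> hP hmu hf hf_pos hf_int.
have hK j r i := coefficient_bound hP hmu hf hf_pos hf_int r j i.
have [s2 hs2] := choice (fun j => prediction_minimizers P j).
have [p hp] := choice hs2.
have [Z [g h]] := noise_construction hP hmu hK (fun j => (hp j).1) (fun j => (hp j).2).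
by exists (mean p), (good p), (coef p), Z, g.
Qed.
End noise_model.

(** * The Markov process driven by the noise *)

Lemma measurable_indic_comp (R : realType) d1 d2 (T1 : measurableType d1) (T2 : measurableType d2)
    (A : set T2) (h : T1 -> T2) : measurable A -> measurable_fun setT h ->
  measurable_fun setT (fun x => \1_A (h x) : R).
Proof. by move=> mA mh; apply: (measurableT_comp _ mh); exact: measurable_indic. Qed.

Lemma integral_indic_comp (R : realType) d1 d2 (T1 : measurableType d1) (T2 : measurableType d2)
    (P : {measure set T1 -> \bar R}) (A : set T2) (h : T1 -> T2) :
  measurable A -> measurable_fun setT h ->
  (\int[P]_x (\1_A (h x))%:E = P (h @^-1` A))%E.
Proof.
move=> mA mh; have mhA : measurable (h @^-1` A) by rewrite -[_ @^-1` _]setTI; exact: mh.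
by rewrite -[in RHS](setIT (h @^-1` A)) -integral_indic.
Qed.

Lemma measurable_comp2 d0 d1 d2 d3 (T : measurableType d0) (T1 : measurableType d1)
    (T2 : measurableType d2) (T3 : measurableType d3) (F : T1 -> T2 -> T3) (f : T -> T1) (g : T -> T2) :
  measurable_fun setT (fun z : T1 * T2 => F z.1 z.2) ->
  measurable_fun setT f -> measurable_fun setT g -> measurable_fun setT (fun x => F (f x) (g x)).
Proof. by move=> mF mf mg; have := measurableT_comp mF (measurable_fun_pair mf mg). Qed.

Section transition_kernel.
Context (R : realType) (d : nat).
Local Notation W := (seqs 'rV[R]_d).
Variables (P : probability W R) (m : W -> 'rV[R]_d).
Hypothesis mm : measurable_fun setT m.

Lemma measurable_addr_rV dT (T : measurableType dT) (f g : T -> 'rV[R]_d) :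
  measurable_fun setT f -> measurable_fun setT g -> measurable_fun setT (fun x => f x + g x).
Proof.
move=> mf mg; apply: measurable_rV => j; under eq_fun do rewrite mxE.
by apply: measurable_funD; apply: (measurableT_comp (measurable_coord j)).
Qed.

Let me0 := measurable_innov 0 mm.

Let mshift w : measurable_fun setT (fun w' => m w + innov m 0 w').
Proof. by apply: measurable_addr_rV. Qed.

(** A version of the conditional law defined at every [w]: the predicted value plus an independent
    copy of the innovation. *)
Definition transition (w : W) : {measure set 'rV[R]_d -> \bar R} := law P (mshift w).

Lemma transitionE w (h : 'rV[R]_d -> \bar R) : measurable_fun setT h -> (forall z, 0 <= h z)%E ->
  (\int[transition w]_z h z = \int[P]_w' h (m w + innov m 0 w')%R)%E.
Proof. by move=> mh h0; rewrite -(ge0_integral_law P (mshift w) mh h0). Qed.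

Let mpair : measurable_fun setT (fun z : W * W => m z.1 + innov m 0 z.2).
Proof.
apply: measurable_addr_rV; first exact: (measurableT_comp mm).
exact: (measurableT_comp me0).
Qed.

Let transition_measurable (U : set 'rV[R]_d) : measurable U -> measurable_fun setT (transition ^~ U).
Proof.
move=> mU.
pose F (z : W * W) : \bar R := (\1_U (m z.1 + innov m 0 z.2))%:E.
have mF : measurable_fun setT F.
  by apply/measurable_EFinP; exact: measurable_indic_comp mU mpair.
have F0 z : (0 <= F z)%E by rewrite lee_fin.
have -> : transition ^~ U = fun w => (\int[P]_w' F (w, w'))%E.
  by apply/funext => w; exact: (esym (integral_indic_comp P mU (mshift w))).
exact: (@measurable_fun_fubini_tonelli_F _ _ _ _ _ P F mF F0).
Qed.

Let transition_setT w : transition w setT = 1%E.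
Proof. exact: (@probability_setT _ _ _ (law P (mshift w))). Qed.

HB.instance Definition _ := isKernel.Build _ _ _ _ _ transition transition_measurable.
HB.instance Definition _ := Kernel_isProbability.Build _ _ _ _ _ transition transition_setT.

Definition transition_kernel : R.-pker W ~> 'rV[R]_d := transition.

Lemma transition_conditional_law : (forall f : W * 'rV[R]_d -> \bar R, measurable_fun setT f ->
    (forall z, 0 <= f z)%E ->
    (\int[P]_w f (past w, innov m 0 w) = \int[P]_w \int[P]_w' f (past w, innov m 0 w'))%E) ->
  is_conditional_law P transition_kernel.
Proof.
move=> indep A B mA mB.
pose f (z : W * 'rV[R]_d) : \bar R := (\1_A z.1 * \1_B (m z.1 + z.2))%:E.
have mf : measurable_fun setT f.
  apply/measurable_EFinP; apply: measurable_funM.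
    exact: measurable_indic_comp.
  apply: measurable_indic_comp => //; apply: measurable_addr_rV => //.
  exact: (measurableT_comp mm).
have f0 z : (0 <= f z)%E by rewrite lee_fin mulr_ge0.
have mpw : measurable_fun setT (fun w : W => (past w, w 0%N)).
  by apply: measurable_fun_pair; [exact: measurable_past|exact: measurable_proj].
have -> : [set w : W | A (past w) /\ B (w 0%N)] = (fun w : W => (past w, w 0%N)) @^-1` (A `*` B) by [].
rewrite -(integral_indic_comp _ (measurableX mA mB) mpw).
transitivity (\int[P]_w f (past w, innov m 0 w))%E.
  apply: eq_integral => w _; rewrite /f /innov /= addrC subrK !indicE.
  by rewrite in_setX -natrM mulnb.
rewrite (indep f mf f0) [RHS]integral_mkcond; apply: eq_integral => w _.
rewrite patchE; have [Aw|Aw] := pselect (A (past w)).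
  rewrite mem_set// -[transition_kernel _ B]/(P (_ @^-1` B)) -(integral_indic_comp P mB (mshift _)).
  by apply: eq_integral => w' _; rewrite /f /= indicE mem_set// mul1r.
rewrite memNset// (_ : (fun w' => f (past w, innov m 0 w')) = cst 0%E) ?integral0//.
by apply/funext => w'; rewrite /f /= indicE memNset// mul0r.
Qed.

End transition_kernel.

(** * Trajectories as functions of a sequence of independent noises *)

Section trajectories.
Context (R : realType) (n d : nat).
Local Notation X := 'rV[R]_n.
Local Notation W0 := 'rV[R]_d.
Local Notation W := (seqs 'rV[R]_d).
Variables (P : probability W R) (m : W -> W0) (Phi : X -> W0 -> X).
Hypothesis mm : measurable_fun setT m.
Hypothesis mPhi : measurable_fun setT (fun z : X * W0 => Phi z.1 z.2).
Hypothesis indep : forall k (f : W * W0 -> \bar R), measurable_fun setT f ->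
  (forall z, 0 <= f z)%E ->
  (\int[P]_w f (innov_before m k w, innov m k w)
   = \int[P]_w \int[P]_w' f (innov_before m k w, innov m 0 w'))%E.

Definition step (z : X * W) (u : W0) : X * W :=
  (Phi z.1 (m z.2 + u), append z.2 (m z.2 + u)).

Fixpoint state (z : X * W) (xi : W) (i : nat) : X * W :=
  if i is i'.+1 then step (state z xi i') (xi i') else z.

(** The innovations of one sample, read from the most recent one backwards, serve as the successive
    fresh noises of the process forwards in time. This realises the process for every starting point
    on the given probability space, where the smoothing variable lives too. *)
Definition noise (w : W) : W := fun i => innov m i w.

Lemma measurable_noise : measurable_fun setT noise.
Proof. by apply: measurable_seqs => k; exact: measurable_innov. Qed.

Lemma measurable_innov_before k : measurable_fun setT (innov_before m k).
Proof.
apply: measurable_seqs => i; rewrite /innov_before.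
by case: (i < k)%N => //; exact: measurable_innov.
Qed.

Lemma measurable_append dT (T : measurableType dT) (f : T -> W) (g : T -> W0) :
  measurable_fun setT f -> measurable_fun setT g -> measurable_fun setT (fun x => append (f x) (g x)).
Proof.
move=> mf mg; apply: measurable_seqs => -[|k] //=.
exact: (measurableT_comp (measurable_proj k) mf).
Qed.

Lemma measurable_step : measurable_fun setT (fun z : (X * W) * W0 => step z.1 z.2).
Proof.
have m2 : measurable_fun setT (fun z : (X * W) * W0 => z.1.2).
  by apply: (measurableT_comp measurable_snd).
have mu : measurable_fun setT (fun z : (X * W) * W0 => m z.1.2 + z.2).
  by apply: measurable_addr_rV => //; exact: (measurableT_comp mm m2).
apply: measurable_fun_pair; last exact: measurable_append.
apply: (measurable_comp2 mPhi) => //.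
by apply: (measurableT_comp measurable_fst).
Qed.

Lemma measurable_state z i : measurable_fun setT (fun xi => state z xi i).
Proof.
elim: i => [|i IH] /=; first exact: measurable_cst.
apply: (measurable_comp2 measurable_step) => //.
exact: measurable_proj.
Qed.

Lemma state_before z k w i : (i <= k)%N -> state z (noise w) i = state z (innov_before m k w) i.
Proof.
elim: i => [//|i IH] ik /=; rewrite IH ?(ltnW ik)//; congr step.
by rewrite /innov_before ik.
Qed.

Let mpath z : measurable_fun setT (fun w => state z (noise w) : seqs (X * W)%type).
Proof.
apply: measurable_seqs => k.
exact: (measurableT_comp (measurable_state z k) measurable_noise).
Qed.

Definition path_law z : probability (seqs (X * W)%type) R := law P (mpath z).

Let msolution z : measurable_fun setT (fun w => (fun k => (state z (noise w) k.+1).1) : seqs X).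
Proof.
apply: measurable_seqs => k; apply: (measurableT_comp measurable_fst).
exact: (measurableT_comp (measurable_state z k.+1) measurable_noise).
Qed.

Definition solution (x : X) (w : W) : probability (seqs X) R := law P (msolution (x, w)).

Lemma solutionE x w A : solution x w A = P [set w' | A (fun k => (state (x, w) (noise w') k.+1).1)].
Proof. by []. Qed.

Lemma skew_operator_indic (B : set (X * W)) z : measurable B ->
  skew_operator (skew_kernel (transition_kernel P mm)) Phi (fun z => (\1_B z)%:E) z
  = (\int[P]_w (\1_B (step z (innov m 0 w)))%:E)%E.
Proof.
move=> mB; rewrite /skew_operator /skew_kernel.
have mfst : measurable_fun setT (fun w : W => (Phi z.1 (w 0%N), w)).
  apply: measurable_fun_pair => //; apply: (measurable_comp2 mPhi) => //; exact: measurable_proj.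
rewrite ge0_integral_pushforward//; last 2 first.
- exact: measurable_append.
- by apply/measurable_EFinP; exact: measurable_indic_comp mB mfst.
have mh : measurable_fun setT (fun v : W0 => (\1_B (Phi z.1 v, append z.2 v))%:E : \bar R).
  apply/measurable_EFinP; apply: (measurable_indic_comp mB).
  by apply: (measurableT_comp mfst (measurable_append (measurable_cst z.2) (@measurable_id _ _ setT))).
by rewrite preimage_setT (transitionE P mm z.2 mh) => // v; rewrite lee_fin.
Qed.

(** The states up to time k depend only on the first k noises, and by [indep] the next noise is
    independent of these and distributed as the zeroth innovation; integrating it out is one
    application of the transition operator. *)
Lemma path_markov z : markov_law (skew_operator (skew_kernel (transition_kernel P mm)) Phi) z (path_law z).
Proof.
split=> [A mA|k A B mA mB past_in].
  rewrite /path_law lawE /= diracE.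
  have [Az|Az] := pselect (A z).
    rewrite mem_set// (_ : _ @^-1` _ = setT) ?probability_setT//.
    by apply/seteqP; split.
  rewrite memNset// (_ : _ @^-1` _ = set0) ?measure0//.
  by apply/seteqP; split.
pose Hs : set W := [set xi | forall i, (i <= k)%N -> A i (state z xi i)].
have mHs : measurable Hs.
  have -> : Hs = \bigcap_(i in [set: nat]) [set xi | (i <= k)%N -> A i (state z xi i)].
    by apply/seteqP; split => [xi h i _|xi h i]; [exact: h|exact: (h i Logic.I)].
  apply: bigcapT_measurable => i; have [ik|ik] := boolP (i <= k)%N; last first.
    by rewrite (_ : [set _ | _] = setT)//; apply/seteqP; split.
  rewrite (_ : [set _ | _] = setT `&` (fun xi => state z xi i) @^-1` A i).
    exact: measurable_state.
  by apply/seteqP; split => xi /=; [move=> h; split => //; exact: h|move=> [_ h] _].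
pose C : set (W * W0) := [set p | Hs p.1 /\ B (step (state z p.1 k) p.2)].
have mstate2 : measurable_fun setT (fun p : W * W0 => step (state z p.1 k) p.2).
  apply: (measurable_comp2 measurable_step) => //.
  by apply: (measurableT_comp (measurable_state z k)).
have mC : measurable C.
  have -> : C = (fst @^-1` Hs) `&` ((fun p : W * W0 => step (state z p.1 k) p.2) @^-1` B) by [].
  apply: measurableI; first by rewrite -[_ @^-1` _]setTI; exact: measurable_fst.
  by rewrite -[_ @^-1` _]setTI; exact: mstate2.
have HsE w : Hs (noise w) = Hs (innov_before m k w).
  apply/propext; split => h i ik; first by rewrite -state_before//; exact: h.
  by rewrite (state_before z w ik); exact: h.
have mpair : measurable_fun setT (fun w : W => (innov_before m k w, innov m k w)).
  by apply: measurable_fun_pair; [exact: measurable_innov_before|exact: measurable_innov].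
have mC1 : measurable_fun setT (fun p : W * W0 => (\1_C p)%:E : \bar R).
  by apply/measurable_EFinP; exact: measurable_indic.
transitivity (P ((fun w : W => (innov_before m k w, innov m k w)) @^-1` C)).
  rewrite /path_law lawE; congr (P _); apply/seteqP; split => w /=.
    by move=> [h1 h2]; split => /=; [rewrite -HsE|rewrite -state_before].
  by move=> [h1 h2]; split; [move: h1; rewrite -HsE|rewrite (state_before z w (leqnn k))].
rewrite -(integral_indic_comp P mC mpair) (indep k mC1); last by move=> p; rewrite lee_fin.
pose Q (z' : X * W) := (\int[P]_w (\1_B (step z' (innov m 0 w)))%:E)%E.
have mQ : measurable_fun setT Q.
  pose F (p : (X * W) * W) : \bar R := (\1_B (step p.1 (innov m 0 p.2)))%:E.
  have mF : measurable_fun setT F.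
    apply/measurable_EFinP; apply: (measurable_indic_comp mB).
    apply: (measurable_comp2 measurable_step) => //.
    by apply: (measurableT_comp (measurable_innov 0 mm)).
  have F0 p : (0 <= F p)%E by rewrite lee_fin.
  exact: (@measurable_fun_fubini_tonelli_F _ _ _ _ _ P F mF F0).
have Q0 z' : (0 <= Q z')%E by apply: integral_ge0 => w _; rewrite lee_fin.
have mpast : measurable past_in.
  have -> : past_in = \bigcap_(i in [set: nat]) [set u : seqs (X * W)%type | (i <= k)%N -> A i (u i)].
    by apply/seteqP; split => [xi h i _|xi h i]; [exact: h|exact: (h i Logic.I)].
  apply: bigcapT_measurable => i; have [ik|ik] := boolP (i <= k)%N; last first.
    by rewrite (_ : [set _ | _] = setT)//; apply/seteqP; split.
  rewrite (_ : [set _ | _] = setT `&` (fun u : seqs (X * W)%type => u i) @^-1` A i).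
    exact: measurable_proj.
  by apply/seteqP; split => xi /=; [move=> h; split => //; exact: h|move=> [_ h] _].
transitivity (\int[path_law z]_(u in past_in) Q (u k))%E; last first.
  by apply: eq_integral => u _; rewrite skew_operator_indic.
rewrite [RHS]integral_mkcond.
have mQk : measurable_fun setT ((fun u : seqs (X * W)%type => Q (u k)) \_ past_in).
  apply/(measurable_restrictT _ mpast); apply: measurable_funTS.
  exact: (measurableT_comp mQ (measurable_proj k)).
have Qk0 u : (0 <= ((fun u : seqs (X * W)%type => Q (u k)) \_ past_in) u)%E.
  by rewrite patchE; case: ifP.
rewrite (ge0_integral_law P (mpath z) mQk Qk0); apply: eq_integral => w _.
rewrite patchE; have [h|h] := pselect (Hs (noise w)).
  rewrite mem_set// /Q (state_before z w (leqnn k)); apply: eq_integral => w' _; rewrite !indicE.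
  congr (_%:R%:E); congr nat_of_bool; apply/idP/idP; rewrite !inE.
    by case.
  by move=> hB; split => //=; rewrite -HsE.
rewrite memNset//; rewrite (_ : (fun w' => _) = cst 0%E) ?integral0//.
apply/funext => w'; rewrite indicE memNset//= => -[]; by rewrite -HsE.
Qed.

End trajectories.

(** * The distance between one-step laws *)

(** Dominated convergence concerns sequences, so a failure of continuity is first turned into a
    sequence b_k within 1/(k+1) of [b0] along which the integrals stay away from the limit. *)
Lemma continuous_Rintegral (R : realType) d (T : measurableType d) (P : probability T R)
    (B : normedModType R) (F : B -> T -> R) (b0 : B) :
  (forall b, measurable_fun setT (F b)) -> (forall b t, `|F b t| <= 1) ->
  (forall t, {for b0, continuous (fun b => F b t)}) ->
  {for b0, continuous (fun b => \int[P]_t F b t)}.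
Proof.
move=> mF F1 cF; apply/cvgrPdist_le => e e0.
apply: contrapT => nF.
have h (k : nat) : exists b, `|b0 - b| < k.+1%:R^-1 /\ e < `|\int[P]_t F b0 t - \int[P]_t F b t|.
  apply: contrapT => hk; apply: nF.
  have k0 : 0 < k.+1%:R^-1 :> R by rewrite invr_gt0.
  apply/nbhs_ballP; exists k.+1%:R^-1 => //= b; rewrite -ball_normE/= => hb.
  by rewrite leNgt; apply/negP => he; apply: hk; exists b.
have [b /all_and2[hb he]] := choice h.
have cb : b @ \oo --> b0.
  apply/cvgrPdist_le => e' e'0; have [N _ hN] := near_infty_natSinv_lt (PosNum e'0).
  by exists N => // k /= Nk; exact: le_trans (ltW (hb k)) (ltW (hN k Nk)).
have ione : P.-integrable setT (EFin \o (fun _ => 1 : R)).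
  by apply: (@integrable_le_cst _ _ _ _ _ 1) => // t; rewrite normr1.
have ct t : (fun k => F (b k) t) @ \oo --> F b0 t by exact: cvg_comp cb (cF t).
have [_ c] := Rintegral_dominated_cvg (fun k => mF (b k)) ct ione (fun k t => F1 (b k) t).
move/cvgrPdist_le : c => /(_ _ e0)[N _ /(_ N (leqnn N))/=].
by rewrite leNgt he.
Qed.

Lemma quadrilateral (R : realType) (u v a b c c' e : R) : u <= a + c -> c <= v + b ->
  v <= a + c' -> c' <= u + b -> a <= e / 2 -> b <= e / 2 -> `|v - u| <= e.
Proof. by move=> *; rewrite ler_norml; apply/andP; split; lra. Qed.

Section total_variation_function.
Context (R : realType) (n d : nat).
Local Notation X := 'rV[R]_n.
Local Notation W0 := 'rV[R]_d.
Local Notation leb := (lebesgue_rV R d).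
Variable Phi : X -> W0 -> X.
Hypothesis hPhi : C2 (fun z : X * W0 => Phi z.1 z.2).
Hypothesis hMunit : {ae (lebesgue_rV R n \x leb)%E, forall z, malliavin_mx Phi z.1 z.2 \in unitmx}.
Hypothesis hMinv : C0Gamma (fun x w => (\det (malliavin_mx Phi x w))^-1).
Variable g : W0 -> R.
Hypotheses (cg : C1 g) (g0 : forall z, 0 <= g z).
Hypotheses (ig : leb.-integrable setT (EFin \o g)) (g1 : \int[leb]_z g z = 1).

Lemma measurable_Phi : measurable_fun setT (fun z : X * W0 => Phi z.1 z.2).
Proof.
apply: measurable_rV => j; apply: measurable_continuous_prod.
exact: (C1_continuous (C1_coord j hPhi.1)).
Qed.

(** The probability that the next position lies in [A], for a pair [b] of a current position and a
    mean of the noise, the fluctuation having density [g]. *)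
Definition hit (A : set X) (b : X * W0) : R := \int[leb]_z (\1_A (Phi b.1 (b.2 + z)) * g z).

Lemma measurable_hit_integrand A x : measurable A ->
  measurable_fun setT (fun z : W0 * W0 => \1_A (Phi x (z.1 + z.2)) * g z.2 : R).
Proof.
move=> mA; apply: measurable_funM.
  apply: (measurable_indic_comp mA); apply: (measurable_comp2 measurable_Phi) => //.
  exact: measurable_addr_rV.
by apply: (measurableT_comp (measurable_continuous_rV (C1_continuous cg))).
Qed.

Lemma integrable_hit A b : measurable A ->
  leb.-integrable setT (EFin \o (fun z => \1_A (Phi b.1 (b.2 + z)) * g z)).
Proof.
move=> mA; apply: (le_integrable measurableT _ _ ig).
  apply/measurable_EFinP.
  have := measurableT_comp (measurable_hit_integrand b.1 mA)
    (measurable_fun_pair (measurable_cst b.2) (@measurable_id _ _ setT)).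
  exact.
by move=> z _; rewrite lee_fin normrM ler_piMl// ger0_norm// indicE lern1 leq_b1.
Qed.

Lemma hit_ge0 A b : 0 <= hit A b.
Proof. by apply: Rintegral_ge0 => z _; rewrite mulr_ge0. Qed.

Lemma hit_le1 A b : measurable A -> hit A b <= 1.
Proof.
move=> mA; rewrite -g1; apply: le_Rintegral => //; first exact: integrable_hit.
by move=> z _; rewrite ler_piMl// indicE lern1 leq_b1.
Qed.

Lemma hit_dist_le1 A b b' : measurable A -> `|hit A b - hit A b'| <= 1.
Proof.
move=> mA; have := hit_ge0 A b; have := hit_ge0 A b'; have := hit_le1 b mA; have := hit_le1 b' mA.
by rewrite ler_norml => ? ? ? ?; apply/andP; split; lra.
Qed.

(** The total variation distance between two one-step laws, as a real number; the bound by 1 makes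
    the supremum meaningful. *)
Definition dtv (b b' : X * W0) : R := sup [set `|hit A b - hit A b'| | A in measurable].

Lemma dtv_ge A b b' : measurable A -> `|hit A b - hit A b'| <= dtv b b'.
Proof.
move=> mA; apply: ub_le_sup; last by exists A.
by exists 1 => _ [C mC <-]; exact: hit_dist_le1.
Qed.

Lemma dtv_le b b' (M : R) : (forall A, measurable A -> `|hit A b - hit A b'| <= M) -> dtv b b' <= M.
Proof.
move=> h; apply: ge_sup; first by exists (`|hit set0 b - hit set0 b'|), set0.
by move=> _ [A mA <-]; exact: h.
Qed.

Lemma dtv_ge0 b b' : 0 <= dtv b b'.
Proof. exact: le_trans (normr_ge0 _) (dtv_ge b b' (@measurable0 _ X)). Qed.

Lemma dtv_le1 b b' : dtv b b' <= 1.
Proof. by apply: dtv_le => A mA; exact: hit_dist_le1. Qed.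

Lemma dtv_refl b : dtv b b = 0.
Proof.
apply/eqP; rewrite eq_le dtv_ge0 andbT; apply: dtv_le => A mA.
by rewrite subrr normr0.
Qed.

Lemma dtv_sym b b' : dtv b b' = dtv b' b.
Proof.
by apply/eqP; rewrite eq_le; apply/andP; split; apply: dtv_le => A mA; rewrite distrC; exact: dtv_ge.
Qed.

Lemma dtv_trans b b' b'' : dtv b b'' <= dtv b b' + dtv b' b''.
Proof.
apply: dtv_le => A mA; apply: le_trans (ler_distD (hit A b') _ _) _.
by apply: lerD; exact: dtv_ge.
Qed.

(** The radius in [tv_variation] is the same for all [A], so the estimate passes to the supremum. *)
Lemma dtv_near b0 (e : R) : 0 < e -> \forall b \near b0, dtv b b0 <= e.
Proof.
move=> e0.
have [del del0 hdel] := tv_variation hPhi cg g0 ig (ae_invertible hPhi hMunit hMinv b0) e0.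
have hitE A b : hit A b = \int[leb]_z (\1_A ((fun z : X * W0 => Phi z.1 z.2) (b + noise_inj z)) * g z).
  by apply: eq_Rintegral => z _ /=; rewrite addr0.
apply/nbhs_ballP; exists del => //= b; rewrite -ball_normE/= => hb.
apply: dtv_le => A mA; rewrite !hitE.
have := hdel (b - b0) _ A mA; rewrite subrKC; apply.
by rewrite distrC.
Qed.

Definition spread (z : W0 * (X * X)) : R := dtv (z.2.1, z.1) (z.2.2, z.1).

Lemma continuous_spread : continuous spread.
Proof.
move=> z0; apply/cvgrPdist_le => e e0; have e20 : 0 < e / 2 by rewrite divr_gt0.
pose f1 (z : W0 * (X * X)) : X * W0 := (z.2.1, z.1).
pose f2 (z : W0 * (X * X)) : X * W0 := (z.2.2, z.1).
have c1 : {for z0, continuous f1}.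
  apply: (@cvg_pair _ _ _ _ (nbhs z0.2.1) (nbhs z0.1)); last exact: cvg_fst.
  by apply: (cvg_comp _ _ (@cvg_snd _ _ (nbhs z0.1) (nbhs z0.2) _)); exact: cvg_fst.
have c2 : {for z0, continuous f2}.
  apply: (@cvg_pair _ _ _ _ (nbhs z0.2.2) (nbhs z0.1)); last exact: cvg_fst.
  by apply: (cvg_comp _ _ (@cvg_snd _ _ (nbhs z0.1) (nbhs z0.2) _)); exact: cvg_snd.
have n1 : \forall z \near z0, dtv (f1 z) (f1 z0) <= e / 2 by exact: (c1 _ (dtv_near (f1 z0) e20)).
have n2 : \forall z \near z0, dtv (f2 z) (f2 z0) <= e / 2 by exact: (c2 _ (dtv_near (f2 z0) e20)).
apply: filterS2 n1 n2 => z; rewrite /spread -/(f1 z0) -/(f2 z0) -/(f1 z) -/(f2 z) => h1 h2.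
have t1 := dtv_trans (f1 z) (f1 z0) (f2 z); have t2 := dtv_trans (f1 z0) (f2 z0) (f2 z).
have t3 := dtv_trans (f1 z0) (f1 z) (f2 z0); have t4 := dtv_trans (f1 z) (f2 z) (f2 z0).
rewrite (dtv_sym (f2 z0) (f2 z)) in t2; rewrite (dtv_sym (f1 z0) (f1 z)) in t3.
exact: quadrilateral t1 t2 t3 t4 h1 h2.
Qed.

End total_variation_function.

(** * Coupling through the smoothing variable *)

Lemma dist_le_EFin (R : realType) (a b : \bar R) (e : R) : a \is a fin_num -> b \is a fin_num ->
  (a <= b + e%:E)%E -> (b <= a + e%:E)%E -> (`|a - b| <= e%:E)%E.
Proof.
move: a b => [a| |] [b| |]//= _ _; rewrite -!EFinD !lee_fin => h1 h2.
by rewrite ler_norml; apply/andP; split; lra.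
Qed.

Section coupling.
Context (R : realType) (n d : nat).
Local Notation X := 'rV[R]_n.
Local Notation W0 := 'rV[R]_d.
Local Notation W := (seqs 'rV[R]_d).
Variables (P : probability W R) (m : W -> W0) (G : set W) (c : nat -> W0) (Z : W -> W0) (g : W0 -> R).
Hypothesis nm : noise_model P m G c Z g.
Variable Phi : X -> W0 -> X.
Hypothesis hPhi : C2 (fun z : X * W0 => Phi z.1 z.2).

Let mm := nm_pred nm.
Let mPhi := measurable_Phi hPhi.

Fixpoint traj (w : W) (xi : W) (i : nat) : W :=
  if i is i'.+1 then append (traj w xi i') (m (traj w xi i') + xi i') else w.

Lemma state_traj z xi i : (state m Phi z xi i).2 = traj z.2 xi i.
Proof. by elim: i => //= i ->. Qed.

Lemma good_traj w xi i : G w -> G (traj w xi i).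
Proof. by move=> Gw; elim: i => //= i; exact: (nm_good_append nm). Qed.

Definition shifted (zeta : W) (z : W0) : W := fun i => zeta i + had (inverse_coef c i) z.

Lemma had1 (z : W0) : had (const_mx 1) z = z.
Proof. by apply/rowP => j; rewrite hadE mxE mul1r. Qed.

Lemma hadN (a z : W0) : had (- a) z = - had a z.
Proof. by apply/rowP => j; rewrite hadE !mxE mulNr. Qed.

Lemma continuous_had (a : W0) : continuous (had a).
Proof.
move=> u; have FF : Filter (nbhs (u : W0)) by exact: nbhs_filter.
apply/(@cvgrPdist_le _ _ _ _ FF) => e e0.
have a0 : 0 < `|a| + 1 by rewrite ltr_wpDl.
apply/nbhs_ballP; exists (e / (`|a| + 1)) => /=; first by rewrite divr_gt0.
move=> v; rewrite -ball_normE/= ltr_pdivlMr// => h.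
have -> : had a u - had a v = had a (u - v) by apply/rowP => j; rewrite !mxE mulrBr.
apply: le_trans (ltW h); apply: rV_norm_le => [|j]; first by rewrite mulr_ge0// ltW.
rewrite hadE normrM mulrC; apply: ler_pM => //; first exact: rV_coord_le.
by apply: le_trans (rV_coord_le _ _) _; rewrite lerDl.
Qed.

(** The first step changes the newest coordinate by [z]. At later steps this coordinate has moved to
    index i and shifts the prediction by c_i z, which is exactly what the next perturbation - c_i z
    takes away; no other coordinate ever changes. *)
Lemma traj_shift w zeta z i : G w ->
  traj w (shifted zeta z) i.+1 = perturb i z (traj w zeta i.+1).
Proof.
move=> Gw; elim: i => [|i IH].
  apply/funext => -[|k] /=; rewrite /perturb /shifted/= ?addr0//.
  by rewrite had1 addrA.
rewrite [LHS]/= -/(traj w (shifted zeta z) i.+1) IH [in RHS]/= -/(traj w zeta i.+1).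
apply/funext => -[|k]; last by rewrite /perturb/= eqSS.
rewrite /= [RHS]/perturb /= addr0 -/(traj w zeta i.+1) (nm_perturb nm i z (good_traj zeta i.+1 Gw)).
by rewrite /shifted /= hadN addrACA subrr addr0.
Qed.

Lemma fresh_shift w zeta z i : G w ->
  m (traj w (shifted zeta z) i.+1) + shifted zeta z i.+1 = m (traj w zeta i.+1) + zeta i.+1.
Proof.
move=> Gw; rewrite traj_shift// (nm_perturb nm i z (good_traj zeta i.+1 Gw)).
by rewrite /shifted [inverse_coef _ _]/= hadN addrACA subrr addr0.
Qed.

(** The positions from X_1 = [x] on, driven by the unperturbed coordinates: by [fresh_shift] these
    do not see [z], so the smoothing variable enters the path through X_1 alone. *)
Fixpoint later (w zeta : W) (x : X) (k : nat) : X :=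
  if k is k'.+1 then Phi (later w zeta x k') (m (traj w zeta k) + zeta k) else x.

Lemma state_shift x w zeta z k : G w ->
  (state m Phi (x, w) (shifted zeta z) k.+1).1 = later w zeta (Phi x (m w + zeta 0%N + z)) k.
Proof.
move=> Gw; elim: k => [|k IH]; first by rewrite /= /shifted/= had1 addrA.
rewrite -[LHS]/(Phi (state m Phi (x, w) (shifted zeta z) k.+1).1
  (m (state m Phi (x, w) (shifted zeta z) k.+1).2 + shifted zeta z k.+1)).
by rewrite IH state_traj fresh_shift.
Qed.

Let zeta w : W := residual m c Z w.

Lemma noise_residual w : noise m w = shifted (zeta w) (Z w).
Proof. by apply/funext => i; rewrite /noise /shifted /zeta /residual subrK. Qed.

Lemma measurable_traj w i : measurable_fun setT (fun xi => traj w xi i).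
Proof.
elim: i => [|i IH] /=; first exact: measurable_cst.
apply: measurable_append => //; apply: measurable_addr_rV.
  exact: (measurableT_comp mm IH).
exact: measurable_proj.
Qed.

Lemma measurable_later w : measurable_fun setT (fun p : W * X => later w p.1 p.2 : seqs X).
Proof.
apply: measurable_seqs; elim => [|k IH] /=; first exact: measurable_snd.
apply: (measurable_comp2 mPhi) => //; apply: measurable_addr_rV.
  apply: (measurableT_comp mm).
  exact: (measurableT_comp (measurable_traj w k.+1)).
by apply: (measurableT_comp (measurable_proj k.+1)).
Qed.

Lemma measurable_residual : measurable_fun setT zeta.
Proof.
apply: measurable_seqs => i; apply: measurable_rV => j.
rewrite (_ : (fun w => zeta w i 0 j) = fun w => innov m i w 0 j - inverse_coef c i 0 j * Z w 0 j).
  apply: measurable_funB; first exact: (measurableT_comp (measurable_coord j) (measurable_innov i mm)).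
  apply: measurable_funM => //.
  exact: (measurableT_comp (measurable_coord j) (nm_smoothing nm)).
by apply/funext => w; rewrite /zeta /residual !mxE.
Qed.

Lemma density_integral1 : \int[lebesgue_rV R d]_z g z = 1.
Proof.
have := nm_residual nm (@measurable_cst _ _ _ _ setT 1%E) (fun _ => lee01).
rewrite integral_cst// mul1e [X in X = _](@probability_setT _ _ _ P).
under [X in _ = X -> _]eq_integral do under eq_integral do rewrite mul1e.
rewrite integral_cst// [X in _ = (_ * X)%E -> _](@probability_setT _ _ _ P) mule1 => h.
exact: (congr1 fine (esym h)).
Qed.

Let cg := nm_density_C1 nm.
Let g0 := nm_density_ge0 nm.
Let ig := nm_density_integrable nm.
Let g1 := density_integral1.

(* Given the residual noise, X_1 determines all later positions, so the laws of the whole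
   path are no further apart than the conditional laws of X_1. *)
Lemma solution_hit x w (A : set (seqs X)) : G w -> measurable A ->
  solution P mm mPhi x w A
  = (\int[P]_w' (hit Phi g [set x1 | A (later w (zeta w') x1)] (x, m w + zeta w' 0%N))%:E)%E.
Proof.
move=> Gw mA.
pose C : set (W * W0) := [set p | A (later w p.1 (Phi x (m w + p.1 0%N + p.2)))].
have mfst0 : measurable_fun setT (fun p : W * W0 => p.1 0%N).
  by apply: (measurableT_comp (measurable_proj 0%N)).
have mu : measurable_fun setT (fun p : W * W0 => m w + p.1 0%N + p.2).
  by apply: measurable_addr_rV => //; apply: measurable_addr_rV.
have mC0 : measurable_fun setT (fun p : W * W0 => later w p.1 (Phi x (m w + p.1 0%N + p.2)) : seqs X).
  have mx := measurable_comp2 mPhi (measurable_cst x) mu.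
  exact: (measurableT_comp (measurable_later w) (measurable_fun_pair measurable_fst mx)).
have mC : measurable C by rewrite -[C]setTI; exact: mC0.
have mZ := nm_smoothing nm.
have mp : measurable_fun setT (fun w' => (zeta w', Z w')) by exact: measurable_fun_pair measurable_residual mZ.
have -> : solution P mm mPhi x w A = P ((fun w' => (zeta w', Z w')) @^-1` C).
  have pathE w' : (fun k => (state m Phi (x, w) (noise m w') k.+1).1)
      = later w (zeta w') (Phi x (m w + zeta w' 0%N + Z w')).
    by apply/funext => k; rewrite noise_residual state_shift.
  by rewrite solutionE; congr (P _); apply/funext => w'; rewrite /mkset pathE.
rewrite -(integral_indic_comp P mC mp).
have mC1 : measurable_fun setT (fun p : W * W0 => (\1_C p)%:E : \bar R).
  by apply/measurable_EFinP; exact: measurable_indic.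
rewrite (nm_residual nm mC1); last by move=> p; rewrite lee_fin.
apply: eq_integral => w' _; rewrite /hit /Rintegral fineK; first by apply: eq_integral.
apply: (integrable_fin_num measurableT).
apply: (integrable_hit hPhi cg ig).
rewrite -[[set _ | _]]setTI.
exact: (measurableT_comp (measurable_later w) (measurable_fun_pair (measurable_cst (zeta w')) (@measurable_id _ _ setT))).
Qed.

Hypothesis hMunit : {ae (lebesgue_rV R n \x lebesgue_rV R d)%E,
  forall z, malliavin_mx Phi z.1 z.2 \in unitmx}.
Hypothesis hMinv : C0Gamma (fun x w => (\det (malliavin_mx Phi x w))^-1).

Let T := spread Phi g.
Let T0 z : 0 <= T z. Proof. exact: dtv_ge0. Qed.
Let T1 z : T z <= 1. Proof. exact: dtv_le1. Qed.
Let cT : continuous T. Proof. exact: continuous_spread. Qed.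
Let mT : measurable_fun setT T. Proof. exact: measurable_continuous_prod3 cT. Qed.

Let mzeta0 : measurable_fun setT (fun w => zeta w 0%N).
Proof. exact: (measurableT_comp (measurable_proj 0%N) measurable_residual). Qed.

Definition mean_spread (z : W * (X * X)) : R := \int[P]_w' T (m z.1 + zeta w' 0%N, z.2).

Let mTz (z : W * (X * X)) : measurable_fun setT (fun w' => T (m z.1 + zeta w' 0%N, z.2)).
Proof.
apply: (measurableT_comp mT); apply: measurable_fun_pair => //.
exact: measurable_addr_rV.
Qed.

Let iT (z : W * (X * X)) : P.-integrable setT (EFin \o (fun w' => T (m z.1 + zeta w' 0%N, z.2))).
Proof.
apply: (@integrable_le_cst _ _ _ _ _ 1); first exact: mTz.
by move=> w'; rewrite ger0_norm.
Qed.

Lemma mean_spread_ge0 z : 0 <= mean_spread z.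
Proof. by apply: Rintegral_ge0 => w' _; exact: T0. Qed.

Lemma mean_spreadE z : (\int[P]_w' (T (m z.1 + zeta w' 0%N, z.2))%:E = (mean_spread z)%:E)%E.
Proof. by rewrite /mean_spread /Rintegral fineK//; exact: (integrable_fin_num measurableT (iT z)). Qed.

Lemma mean_spread_le1 z : mean_spread z <= 1.
Proof.
rewrite -lee_fin -mean_spreadE.
apply: le_trans (_ : (\int[P]_w' (1%:E : \bar R) <= 1)%E); last first.
  by rewrite integral_cst// mul1e [leLHS](@probability_setT _ _ _ P).
apply: ge0_le_integral => //.
- by move=> w' _; rewrite lee_fin; exact: T0.
- by apply/measurable_EFinP; exact: mTz.
- by move=> w' _; rewrite lee_fin; exact: T1.
Qed.

Lemma measurable_mean_spread : measurable_fun setT mean_spread.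
Proof.
pose F (p : (W * (X * X)) * W) : \bar R := (T (m p.1.1 + zeta p.2 0%N, p.1.2))%:E.
have mF : measurable_fun setT F.
  apply/measurable_EFinP; apply: (measurableT_comp mT); apply: measurable_fun_pair.
    apply: measurable_addr_rV.
      by apply: (measurableT_comp mm); apply: (measurableT_comp measurable_fst).
    by apply: (measurableT_comp mzeta0).
  by apply: (measurableT_comp measurable_snd).
have F0 p : (0 <= F p)%E by rewrite lee_fin; exact: T0.
have := @measurable_fun_fubini_tonelli_F _ _ _ _ _ P F mF F0.
rewrite (_ : fubini_F P F = EFin \o mean_spread); first by move/measurable_EFinP.
by apply/funext => z; rewrite /fubini_F /F /= mean_spreadE.
Qed.

Lemma solution_le x y w (A : set (seqs X)) : G w -> measurable A ->
  (solution P mm mPhi x w A <= solution P mm mPhi y w A + (mean_spread (w, (x, y)))%:E)%E.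
Proof.
move=> Gw mA; rewrite !solution_hit// -mean_spreadE.
pose B w' : set X := [set x1 | A (later w (zeta w') x1)].
have mB w' : measurable (B w').
  rewrite -[B w']setTI.
  exact: (measurableT_comp (measurable_later w) (measurable_fun_pair (measurable_cst (zeta w')) (@measurable_id _ _ setT))).
have mh (x0 : X) : measurable_fun setT (fun w' => (hit Phi g (B w') (x0, m w + zeta w' 0%N))%:E).
  pose F (p : W * W0) : \bar R := (\1_A (later w p.1 (Phi x0 (m w + p.1 0%N + p.2))) * g p.2)%:E.
  have mF : measurable_fun setT F.
    apply/measurable_EFinP; apply: measurable_funM; last first.
      by apply: (measurableT_comp (measurable_continuous_rV (C1_continuous cg))).
    apply: (measurable_indic_comp mA).
    have mu : measurable_fun setT (fun p : W * W0 => m w + p.1 0%N + p.2).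
      apply: measurable_addr_rV => //; apply: measurable_addr_rV => //.
      by apply: (measurableT_comp (measurable_proj 0%N)).
    have mx := measurable_comp2 mPhi (measurable_cst x0) mu.
    exact: (measurableT_comp (measurable_later w) (measurable_fun_pair measurable_fst mx)).
  have F0 p : (0 <= F p)%E by rewrite lee_fin mulr_ge0.
  have mFF := @measurable_fun_fubini_tonelli_F _ _ _ _ _ (lebesgue_rV R d) F mF F0.
  have := measurableT_comp mFF measurable_residual.
  rewrite (_ : _ \o _ = fun w' => (hit Phi g (B w') (x0, m w + zeta w' 0%N))%:E)//.
  apply/funext => w'; rewrite /hit /Rintegral fineK; first by apply: eq_integral.
  by apply: (integrable_fin_num measurableT); exact: (integrable_hit hPhi cg ig).
have h0 (x0 : X) w' : (0 <= (hit Phi g (B w') (x0, m w + zeta w' 0%N))%:E)%E.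
  by rewrite lee_fin; exact: hit_ge0.
have <- : (\int[P]_w' ((hit Phi g (B w') (y, m w + zeta w' 0%N))%:E
      + (T (m w + zeta w' 0%N, (x, y)))%:E)
    = \int[P]_w' (hit Phi g (B w') (y, m w + zeta w' 0%N))%:E
      + \int[P]_w' (T (m w + zeta w' 0%N, (x, y)))%:E)%E.
  apply: ge0_integralD => //; solve [by move=> *; exact: h0 | exact: mh |
    by move=> *; rewrite lee_fin; exact: T0 | by apply/measurable_EFinP; exact: (mTz (w, (x, y)))].
apply: ge0_le_integral => //.
- by move=> w' _; exact: h0.
- apply: emeasurable_funD; first exact: mh.
  by apply/measurable_EFinP; exact: (mTz (w, (x, y))).
move=> w' _; rewrite -EFinD lee_fin -lerBlDl; apply: le_trans (ler_norm _) _.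
exact: (dtv_ge hPhi cg g0 ig g1 (x, m w + zeta w' 0%N) (y, m w + zeta w' 0%N) (mB w')).
Qed.

(** The value 1 off [G] makes the bound trivial there. It does no harm to continuity, since
    [append w w'] lies in [G] for every [w'] as soon as [w] does. *)
Definition ell (z : W * (X * X)) : R := \1_G z.1 * mean_spread z + (1 - \1_G z.1).

Lemma ell_good w xy : G w -> ell (w, xy) = mean_spread (w, xy).
Proof. by move=> Gw; rewrite /ell /= indicE mem_set// mul1r subrr addr0. Qed.

Lemma coupling_strong_feller : strong_feller P (skew_kernel (transition_kernel P mm)) Phi.
Proof.
exists (solution P mm mPhi).
  move=> x w; exists (path_law P mm mPhi (x, w)); last by [].
  exact: (path_markov mm mPhi (nm_before nm)).
exists ell; split.
- split.
    have mG : measurable_fun setT (fun z : W * (X * X) => \1_G z.1 : R).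
      exact: (measurable_indic_comp (nm_good nm) measurable_fst).
    apply: measurable_funD; first by apply: measurable_funM => //; exact: measurable_mean_spread.
    exact: measurable_funB.
  move=> [w xy]; have [Gw|Gw] := pselect (G w).
    by rewrite ell_good// mean_spread_ge0 mean_spread_le1.
  by rewrite /ell /= indicE memNset// mul0r add0r subr0 ler01 lexx.
- apply: negligibleS (nm_good_ae nm) => w nQ Gw; apply: nQ => x.
  rewrite ell_good//; transitivity (\int[P]_w' (0 : R)); last by rewrite /Rintegral integral0.
  by apply: eq_Rintegral => w' _; exact: (dtv_refl hPhi cg g0 ig g1).
- move=> w x y; apply: ge_ereal_sup => _ [A mA <-].
  have f1 := fin_num_measure (solution P mm mPhi x w) A mA.
  have f2 := fin_num_measure (solution P mm mPhi y w) A mA.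
  have [Gw|Gw] := pselect (G w).
    rewrite ell_good//; apply: dist_le_EFin => //; first exact: solution_le.
    have -> : mean_spread (w, (x, y)) = mean_spread (w, (y, x)).
      by apply: eq_Rintegral => w' _; exact: dtv_sym.
    exact: solution_le.
  rewrite /ell /= indicE memNset// mul0r add0r subr0; apply: dist_le_EFin => //.
    by apply: le_trans (probability_le1 _ mA) _; rewrite leeDr.
  by apply: le_trans (probability_le1 _ mA) _; rewrite leeDr.
- apply: negligibleS (nm_good_ae nm) => w nQ Gw; apply: nQ; rewrite /mkset.
  (* By [nm_perturb] at index 0 the predictor is affine, hence continuous, in the newest coordinate,
     although it is only measurable in the whole past. *)
  have mE u : m (append w u) = m (append w 0) + had (c 0%N) u.
    rewrite -(nm_perturb nm 0%N u (nm_good_append nm 0 Gw)); congr m.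
    by apply/funext => -[|k]; rewrite /perturb/= ?add0r ?addr0.
  have -> : (fun z : W0 * (X * X) => ell (append w z.1, z.2)) =
      fun z => \int[P]_w' T (m (append w 0) + had (c 0%N) z.1 + zeta w' 0%N, z.2).
    apply/funext => z; rewrite (ell_good z.2 (nm_good_append nm z.1 Gw)).
    by rewrite /mean_spread /= mE.
  pose F (z : W0 * (X * X)) (w' : W) : R := T (m (append w 0) + had (c 0%N) z.1 + zeta w' 0%N, z.2).
  have mF z : measurable_fun setT (F z).
    apply: (measurableT_comp mT); apply: measurable_fun_pair => //.
    exact: measurable_addr_rV.
  have F1 z w' : `|F z w'| <= 1 by rewrite ger0_norm ?T0// T1.
  have cF z0 w' : {for z0, continuous (fun z => F z w')}.
    pose h (z : W0 * (X * X)) := (m (append w 0) + had (c 0%N) z.1 + zeta w' 0%N, z.2).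
    have ch : {for z0, continuous h}.
      apply: (@cvg_pair _ _ _ _ (nbhs (m (append w 0) + had (c 0%N) z0.1 + zeta w' 0%N)) (nbhs z0.2));
        last exact: cvg_snd.
      apply: cvgD; last exact: cvg_cst.
      apply: cvgD; first exact: cvg_cst.
      by apply: (cvg_comp _ _ cvg_fst); exact: continuous_had.
    by move=> A hA; exact: (ch (T @^-1` A) (cT hA)).
  move=> z0.
  have h0 := @continuous_Rintegral R _ _ P ('rV[R]_d * ('rV[R]_n * 'rV[R]_n))%type F z0 mF F1.
  exact: (h0 (cF z0)).
Qed.

End coupling.

Theorem theorem1p5p9 (R : realType) (n d : nat)
  (Phi : 'rV[R]_n -> 'rV[R]_d -> 'rV[R]_n)
  (hPhi : C2 (fun z : 'rV[R]_n * 'rV[R]_d => Phi z.1 z.2))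
  (hDw : forall (i : 'I_n) (k : 'I_d), C0Gamma (pdw k (component Phi i)))
  (hDwDx : forall (i l : 'I_n) (k : 'I_d),
     C0Gamma (pdw k (pdx l (component Phi i))))
  (hDw2 : forall (i : 'I_n) (k k' : 'I_d),
     C0Gamma (pdw k (pdw k' (component Phi i))))
  (hMunit : {ae (lebesgue_rV R n \x lebesgue_rV R d)%E,
     forall z, malliavin_mx Phi z.1 z.2 \in unitmx})
  (hMinv : C0Gamma (fun x w => (\det (malliavin_mx Phi x w))^-1))
  (P : probability (seqs 'rV[R]_d) R)
  (hP : centred_gaussian P)
  (mu : 'I_d -> {finite_measure set R -> \bar R})
  (hmu_supp : forall j, mu j (~` `[- pi, pi]) = 0%E)
  (hmu_atom : forall j (x : R), mu j [set x] = 0%E)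
  (hmu : has_spectral_measures P mu)
  (f : 'I_d -> R -> R)
  (hf : forall j, ac_density (mu j) (f j))
  (hf_pos : forall j, {ae @lebesgue_measure R, forall x, `[- pi, pi]%classic x -> 0 < f j x})
  (hf_int : forall j,
     (\int[@lebesgue_measure R]_(x in `[(- pi)%R, pi]) ((f j x)^-1)%:E < +oo)%E) :
  exists2 Pbar : R.-pker (seqs 'rV[R]_d) ~> 'rV[R]_d,
    is_conditional_law P Pbar & strong_feller P (skew_kernel Pbar) Phi.
Proof.
have [m [G [c [Z [g nm]]]]] := gaussian_noise_model hP hmu hf hf_pos hf_int.
exists (transition_kernel P (nm_pred nm)).
  exact: (transition_conditional_law (nm_pred nm) (nm_past nm)).
exact: coupling_strong_feller.
Qed.
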